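(* For $t\in\mathbb{C}$ near $0$ let $f_t:(\mathbb{C}^4,0)\to(\mathbb{C},0)$ be $$f_t(x_1,x_2,x_3,x_4)=x_3^5+t\,x_2^6x_3+x_2^7x_1+x_1^{15}+x_4^2.$$ Then the family $f_t^2$ is topologically right-equivalent trivial, but the Lê numbers at $0$ of $f_t^2$ are not constant in $t$ (i.e. it is not the case that all $\lambda^i(f_t^2)$, $0\le i\le 3$, are independent of $t$ for $t$ near $0$).
   Context: Topologically right-equivalent trivial. A family $g_t:(\mathbb{C}^n,0)\to(\mathbb{C},0)$ is topologically right-equivalent trivial if, for $t$ near $0$, there are positive $\epsilon,\delta$ and a continuous family of homeomorphisms $h_t:B_\epsilon\cap g_0^{-1}(D_\delta)\to B_\epsilon\cap g_t^{-1}(D_\delta)$ such that $g_t\circ h_t=g_0$, where $B_\epsilon$ is the ball of radius $\epsilon$ about $0\in\mathbb{C}^n$ and $D_\delta$ the disc of radius $\delta$ about $0\in\mathbb{C}$. Lê numbers. For a holomorphic germ $g:(\mathbb{C}^n,0)\to(\mathbb{C},0)$ (not necessarily square-free), let $J(g)$ be the ideal generated by the partial derivatives of $g$, let $B_{J(g)}(\mathbb{C}^n)\subset\mathbb{C}^n\times\mathbb{P}^{n-1}$ be the blowup of $(\mathbb{C}^n,0)$ along $J(g)$, with projection $\pi$ to $\mathbb{C}^n$, and let $[E]$ be the cycle of its exceptional divisor (the Cartier divisor defined by the pullback of $J(g)$, counted with multiplicities). Let $[H]^r$ denote the class of an intersection of $r$ general hyperplanes $\mathbb{C}^n\times H$,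 $H\subset\mathbb{P}^{n-1}$ a hyperplane. For $0\le k\le n-1$ the Lê cycle of dimension $k$ is $\Lambda^k(g,0)=\pi_*([E]\cdot[H]^{n-k-1})$. If the components of the underlying set of $\Lambda^k(g,0)$ have multiplicities $m_1,m_2,\dots$ at $0$ and occur in the cycle with coefficients $e_1,e_2,\dots$, the $k$-th Lê number is $\lambda^k(g)=\sum_l m_le_l$. *)

(* Defs.v *)
From HB Require Import structures.
From mathcomp Require Import all_boot all_order all_algebra complex.
From mathcomp Require Import boolp classical_sets functions fsbigop reals.
From mathcomp Require Import topology normedtype.
From mathcomp Require Import -(notations) mpoly.

Set Implicit Arguments.
Unset Strict Implicit.
Unset Printing Implicit Defensive.

Import Order.TTheory GRing.Theory Num.Theory numFieldNormedType.Exports.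

Local Open Scope classical_set_scope.
Local Open Scope ring_scope.

(* The notations of multinomials clash with those of mathcomp-analysis. *)
Notation "{ 'mpoly' T [ n ] }" := (mpoly n T)
  (at level 0, T, n at level 2, format "{ 'mpoly'  T [ n ] }") : type_scope.

(* The numClosedFieldType structure has to be made explicit for the topology
   that mathcomp-analysis puts on every numClosedFieldType to be found. *)
Definition Cplx (R : realType) : numClosedFieldType := R[i].

Section TopologicalTriviality.
Variables (C : numClosedFieldType) (n : nat).
Implicit Types (g : 'rV[C]_n -> C) (X Y : set 'rV[C]_n).

(* The balls are Euclidean; the norm that mathcomp-analysis puts on matrices is
   the sup norm. Balls and discs are closed. Over C an inequality [0 < eps]
   forces [eps] to be real. *)
Definition tube g (eps delta : C) : set 'rV[C]_n :=
  [set x : 'rV[C]_n | \sum_i `|x ord0 i| ^+ 2 <= eps ^+ 2 /\ `|g x| <= delta].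

Definition homeomorphism_on X Y (h : 'rV[C]_n -> 'rV[C]_n) : Prop :=
  [/\ set_bij X Y h, {within X, continuous h} &
      exists2 k : 'rV[C]_n -> 'rV[C]_n, {within Y, continuous k} &
        forall x, X x -> k (h x) = x].

Definition top_right_trivial (g : C -> 'rV[C]_n -> C) : Prop :=
  exists tau eps delta : C, [/\ 0 < tau, 0 < eps, 0 < delta &
  exists h : C -> 'rV[C]_n -> 'rV[C]_n,
    {within [set p : C * 'rV[C]_n | `|p.1| < tau /\ tube (g 0) eps delta p.2],
      continuous (fun p : C * 'rV[C]_n => h p.1 p.2)} /\
    forall t, `|t| < tau ->
      homeomorphism_on (tube (g 0) eps delta) (tube (g t) eps delta) (h t) /\
      forall x, tube (g 0) eps delta x -> g t (h t x) = g 0 x].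

End TopologicalTriviality.

Section ConvergentSeries.
Variables (C : numFieldType) (n : nat).
Local Notation mnm := (multinom n).
Implicit Types (a b c : mnm -> C) (m : mnm).

(* Absolute convergence on the polydisc of radius 1/r; by Cauchy's estimates
   the Taylor coefficients of every holomorphic germ satisfy this. *)
Definition convergent a : Prop :=
  exists M r : C, 0 < r /\ forall m, `|a m| <= M * r ^+ mdeg m.

Definition cauchy_prod a b : mnm -> C := fun m =>
  \sum_(k : bmultinom n (mdeg m).+1 * bmultinom n (mdeg m).+1
         | m == mnm_add k.1 k.2) a k.1 * b k.2.

(* A germ at 0 of a holomorphic function on C^n is identified with its Taylor
   series. *)
Record holo_germ := HoloGerm {
  coef :> mnm -> C;
  coef_convergent : convergent coef }.

HB.instance Definition _ := gen_eqMixin holo_germ.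
HB.instance Definition _ := gen_choiceMixin holo_germ.

Implicit Types f g h : holo_germ.

Lemma holo_germP f g : (forall m, f m = g m) -> f = g.
Proof.
case: f g => [a ca] [b cb] /= /funext eab; rewrite -{}eab in cb *.
by congr HoloGerm; exact: Prop_irrelevance.
Qed.

Lemma convergent_ge0 a M (r : C) :
  (forall m, `|a m| <= M * r ^+ mdeg m) -> 0 <= M.
Proof.
by move=> /(_ (@mnm0 n)); rewrite mdeg0 expr0 mulr1; exact: le_trans.
Qed.

Lemma convergent_add a b :
  convergent a -> convergent b -> convergent (fun m => a m + b m).
Proof.
move=> [M [r [r0 Ha]]] [N [s [s0 Hb]]].
have M0 := convergent_ge0 Ha; have N0 := convergent_ge0 Hb.
exists (M + N), (r + s); split=> [|m]; first exact: addr_gt0.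
apply: le_trans (ler_normD _ _) _; rewrite mulrDl; apply: lerD.
  apply: le_trans (Ha m) _; apply: ler_wpM2l => //.
  by rewrite lerXn2r ?nnegrE ?addr_ge0 ?lerDl// ltW.
apply: le_trans (Hb m) _; apply: ler_wpM2l => //.
by rewrite lerXn2r ?nnegrE ?addr_ge0 ?lerDr// ltW.
Qed.

Lemma convergent_opp a : convergent a -> convergent (fun m => - a m).
Proof.
by move=> [M [r [r0 Ha]]]; exists M, r; split=> // m; rewrite normrN.
Qed.

Lemma card_bmultinom d : (#|{: bmultinom n d}| <= d ^ n)%N.
Proof.
pose F (m : bmultinom n d) : {ffun 'I_n -> 'I_d} :=
  [ffun i => insubd (Ordinal (leq_ltn_trans (leq0n _) (bmdeg m))) (bmnm m i)].
have lt_d (m : bmultinom n d) i : (bmnm m i < d)%N.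
  by apply: leq_ltn_trans (bmdeg m); rewrite mdegE (bigD1 i) //= leq_addr.
have /leq_card : injective F.
  move=> m1 m2 /ffunP eF; apply/val_inj/mnmP => i /=.
  by have := eF i; rewrite !ffunE => /(congr1 val) /=; rewrite !insubdK ?unfold_in.
by rewrite card_ffun !card_ord.
Qed.

Lemma convergent_mul a b :
  convergent a -> convergent b -> convergent (cauchy_prod a b).
Proof.
move=> [M [r [r0 Ha]]] [N [s [s0 Hb]]].
have M0 := convergent_ge0 Ha; have N0 := convergent_ge0 Hb.
exists (M * N), ((r + s) * (2 ^ (n + n))%:R).
split=> [|m].
  by rewrite mulr_gt0 ?addr_gt0// ltr0n expn_gt0.
set d := mdeg m.
have bnd (k : bmultinom n d.+1 * bmultinom n d.+1) : m == mnm_add k.1 k.2 ->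
    `|a k.1 * b k.2| <= M * N * (r + s) ^+ d.
  move=> /eqP em; rewrite normrM.
  apply: le_trans (ler_pM (normr_ge0 _) (normr_ge0 _) (Ha _) (Hb _)) _.
  rewrite mulrACA; apply: ler_wpM2l; first exact: mulr_ge0.
  have ed : (r + s) ^+ d = (r + s) ^+ mdeg k.1 * (r + s) ^+ mdeg k.2.
    by rewrite -exprD -mdegD -em.
  rewrite {}ed.
  apply: ler_pM; rewrite ?exprn_ge0 ?(ltW r0) ?(ltW s0)//.
    by rewrite lerXn2r ?nnegrE ?addr_ge0 ?lerDl// ltW.
  by rewrite lerXn2r ?nnegrE ?addr_ge0 ?lerDr// ltW.
apply: le_trans (ler_norm_sum _ _ _) _; apply: le_trans (ler_sum _ bnd) _.
rewrite sumr_const exprMn -natrX mulrA -[X in X <= _]mulr_natr.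
apply: ler_wpM2l.
  by rewrite mulr_ge0 ?mulr_ge0 ?exprn_ge0 ?addr_ge0// ltW.
rewrite ler_nat; apply: leq_trans (max_card _) _.
rewrite card_prod -expnM mulnDl expnD.
have le2 : (#|{: bmultinom n d.+1}| <= 2 ^ (n * d))%N.
  apply: leq_trans (card_bmultinom _) _.
  rewrite mulnC expnM; elim: (n) => // e IHe.
  by rewrite !expnS leq_mul // ltn_expl.
exact: leq_mul.
Qed.


Lemma convergent_mpoly (p : {mpoly C[n]}) : convergent (fun m => mcoeff m p).
Proof.
exists (\sum_(m <- msupp p) `|mcoeff m p|), 1; split=> // m.
rewrite expr1n mulr1; have [mp|/memN_msupp_eq0 ->] := boolP (m \in msupp p).
  by rewrite (big_rem m mp) /= lerDl sumr_ge0.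
by rewrite normr0 sumr_ge0.
Qed.

Lemma convergent_deriv (i : 'I_n) a : convergent a ->
  convergent (fun m => a (mnm_add m (mnm1 i)) *+ (m i).+1).
Proof.
move=> [M [r [r0 Ha]]]; have M0 := convergent_ge0 Ha.
exists (M * r), (r * 2%:R); split=> [|m]; first by rewrite mulr_gt0 ?ltr0n.
rewrite normrMn -[X in X <= _]mulr_natr exprMn [X in _ <= X]mulrA.
apply: ler_pM; rewrite ?ler0n//.
- apply: le_trans (Ha _) _.
  by rewrite mdegD mdeg1 addn1 exprS mulrA.
- rewrite -natrX ler_nat; apply: leq_ltn_trans (_ : mdeg m < _)%N.
    by rewrite mdegE (bigD1 i) //= leq_addr.
  exact: ltn_expl.
Qed.

Definition germ_of_mpoly (p : {mpoly C[n]}) := HoloGerm (convergent_mpoly p).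
Definition germ_deriv (i : 'I_n) f :=
  HoloGerm (convergent_deriv i (coef_convergent f)).
Definition germC (c : C) := germ_of_mpoly (mpolyC n c).

Definition germ_add f g :=
  HoloGerm (convergent_add (coef_convergent f) (coef_convergent g)).
Definition germ_opp f := HoloGerm (convergent_opp (coef_convergent f)).
Definition germ_mul f g :=
  HoloGerm (convergent_mul (coef_convergent f) (coef_convergent g)).

Lemma germ_addA : associative germ_add.
Proof. by move=> f g h; apply: holo_germP => m /=; rewrite addrA. Qed.
Lemma germ_addC : commutative germ_add.
Proof. by move=> f g; apply: holo_germP => m /=; rewrite addrC. Qed.
Lemma germ_add0 : left_id (germC 0) germ_add.
Proof.
by move=> f; apply: holo_germP => m /=; rewrite mcoeffC mul0r add0r.
Qed.
Lemma germ_addN : left_inverse (germC 0) germ_opp germ_add.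
Proof.
by move=> f; apply: holo_germP => m /=; rewrite mcoeffC mul0r addNr.
Qed.

HB.instance Definition _ := GRing.isZmodule.Build holo_germ
  germ_addA germ_addC germ_add0 germ_addN.

(* The ring axioms are inherited from polynomials by truncation. *)
Let trunc d a : {mpoly C[n]} := \sum_(k : bmultinom n d) a k *: mpolyX C k.

Let mcoeff_trunc d a m : (mdeg m < d)%N -> mcoeff m (trunc d a) = a m.
Proof.
move=> md; rewrite /trunc raddf_sum /= (bigD1 (BMultinom md)) //=.
rewrite mcoeffZ mcoeffX eqxx mulr1 big1 ?addr0// => k kNm.
rewrite mcoeffZ mcoeffX; case: eqP => [e|]; last by rewrite mulr0.
by case/eqP: kNm; apply/val_inj.
Qed.

Let cauchy_prodE (p q : {mpoly C[n]}) a b m :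
  (forall m', (mdeg m' <= mdeg m)%N -> mcoeff m' p = a m') ->
  (forall m', (mdeg m' <= mdeg m)%N -> mcoeff m' q = b m') ->
  cauchy_prod a b m = mcoeff m (p * q).
Proof.
move=> pa qb; rewrite mcoeffM; apply: eq_bigr => k _.
by rewrite pa ?qb// -ltnS bmdeg.
Qed.

Let mcoeff_truncS d a m : (mdeg m <= d)%N -> mcoeff m (trunc d.+1 a) = a m.
Proof. by move=> md; exact: mcoeff_trunc. Qed.

Let mcoeff_truncM d a b m : (mdeg m <= d)%N ->
  mcoeff m (trunc d.+1 a * trunc d.+1 b) = cauchy_prod a b m.
Proof.
by move=> md; symmetry; apply: cauchy_prodE => m' m'm;
  apply: mcoeff_truncS; apply: leq_trans md.
Qed.

Lemma germ_mulC : commutative germ_mul.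
Proof.
move=> f g; apply: holo_germP => m /=.
by rewrite -!(mcoeff_truncM _ _ (leqnn _)) mulrC.
Qed.

Lemma germ_mulA : associative germ_mul.
Proof.
move=> f g h; apply: holo_germP => m /=; pose T := trunc (mdeg m).+1.
rewrite (@cauchy_prodE (T f) (T g * T h)); first last.
- by move=> m' ?; exact: mcoeff_truncM.
- by move=> m' ?; exact: mcoeff_truncS.
rewrite (@cauchy_prodE (T f * T g) (T h)) ?mulrA//.
- by move=> m' ?; exact: mcoeff_truncM.
- by move=> m' ?; exact: mcoeff_truncS.
Qed.

Lemma germ_mul1 : left_id (germC 1) germ_mul.
Proof.
move=> f; apply: holo_germP => m /=; pose T := trunc (mdeg m).+1.
rewrite (@cauchy_prodE (mpolyC n 1) (T f)) //.
  by rewrite mpolyC1 mul1r mcoeff_truncS.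
by move=> m' ?; exact: mcoeff_truncS.
Qed.

Lemma germ_mulDl : left_distributive germ_mul germ_add.
Proof.
move=> f g h; apply: holo_germP => m /=; pose T := trunc (mdeg m).+1.
rewrite (@cauchy_prodE (T f + T g) (T h)); first last.
- by move=> m' ?; exact: mcoeff_truncS.
- by move=> m' ?; rewrite mcoeffD !mcoeff_truncS.
by rewrite mulrDl mcoeffD !mcoeff_truncM.
Qed.

Lemma germ_1_neq0 : germC 1 != germC 0.
Proof.
apply/eqP => /(congr1 (fun f : holo_germ => f (@mnm0 n))) /=.
by rewrite !mcoeffC eqxx !mulr1 => /eqP; rewrite oner_eq0.
Qed.

HB.instance Definition _ := GRing.Zmodule_isComNzRing.Build holo_germ
  germ_mulA germ_mulC germ_mul1 germ_mulDl germ_1_neq0.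

Definition germ_maximal_ideal : set holo_germ := [set f | f (@mnm0 n) = 0].

End ConvergentSeries.

(* The largest element of E, and 0 if E is empty or unbounded. *)
Definition max_or0 (E : set nat) : nat :=
  xget 0%N [set k | E k /\ forall j, E j -> (j <= k)%N].

Section CommutativeAlgebra.
Variable A : comNzRingType.
Implicit Types I J P : set A.

Definition is_ideal I : Prop :=
  [/\ I 0, forall x y, I x -> I y -> I (x + y) & forall a x, I x -> I (a * x)].

Definition is_prime P : Prop :=
  [/\ is_ideal P, ~ P 1 & forall x y, P (x * y) -> P x \/ P y].

Definition ideal_gen (G : set A) : set A := smallest is_ideal G.

Fixpoint ideal_exp I (s : nat) : set A :=
  if s is s'.+1 then
    ideal_gen [set z | exists x y, [/\ I x, ideal_exp I s' y & z = x * y]]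
  else setT.

(* I is the contraction of an ideal of the localization of A at P. *)
Definition contracted P I : Prop := forall s x, ~ P s -> I (s * x) -> I x.

(* The length of the local ring (A/I)_P: the ideals of the localization of A/I
   at P are in bijection with the contracted ideals of A which contain I. *)
Definition local_length P I : nat := max_or0 [set k | exists L : nat -> set A,
  (forall i, (i <= k)%N -> [/\ is_ideal (L i), I `<=` L i & contracted P (L i)])
  /\ forall i, (i < k)%N -> L i `<` L i.+1].

(* The Hilbert-Samuel multiplicity of the local ring (A/I)_m. *)
Definition hs_multiplicity (m I : set A) : nat := xget 0%N [set e |
  exists (h : {poly rat}) (N : nat),
    (forall s, (N <= s)%N ->
       h.[s%:R] = (local_length m (ideal_gen (I `|` ideal_exp m s)))%:R) /\
    e%:R = lead_coef h * ((size h).-1)`!%:R].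

End CommutativeAlgebra.

Section ProjectiveCycles.
Variables (A : comNzRingType) (n : nat).
Local Notation S := {mpoly A[n]}.
Implicit Types P Q : set S.

Definition homogeneous_ideal P : Prop :=
  forall p d, P p -> P (pihomog mdeg d p).

(* The irreducible closed subschemes of P^{n-1} over A. *)
Definition proj_point P : Prop :=
  [/\ is_prime P, homogeneous_ideal P & exists i : 'I_n, ~ P (mpolyX A (mnm1 i))].

Definition proj_component (I P : set S) : Prop :=
  [/\ proj_point P, I `<=` P &
      forall Q, proj_point Q -> I `<=` Q -> Q `<=` P -> Q = P].

Definition cycle := set S -> nat.

(* The cycle of the subscheme defined by the homogeneous ideal I: irreducible
   components with multiplicities. The local ring of the affine cone at P has
   the same length as the local ring of the projective scheme at P, because some
   variable is invertible in it. *)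
Definition scheme_cycle (I : set S) : cycle :=
  fun P => if `[< proj_component I P >] then local_length P I else 0%N.

(* Intersection with the hyperplane l = 0, for l vanishing on no component. *)
Definition hyperplane_cap (l : S) (Z : cycle) : cycle := fun Q =>
  (\sum_(P \in [set: set S]) Z P * scheme_cycle (ideal_gen (P `|` [set l])) Q)%N.

Definition contraction Q : set A := [set c | Q (mpolyC n c)].

(* The degree of the function field of V(Q) over that of its image; elements of
   the former are fractions of forms of the same degree modulo Q. The value is 0
   for an infinite extension, that is, if the dimension of the image drops. *)
Definition proj_degree Q : nat := max_or0 [set d |
  exists e (u : 'I_d -> S), (forall i, u i \is ishomog1 e mdeg) /\
    forall c : 'I_d -> A,
      Q (\sum_i c i *: u i) -> forall i, contraction Q (c i)].

Definition pushforward (Z : cycle) : set A -> nat := fun q =>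
  (\sum_(Q \in [set Q | contraction Q = q]) Z Q * proj_degree Q)%N.

(* The blowup of the ideal generated by the a_i is Proj of the Rees algebra, i.e.,
   of the image of y_i |-> a_i T. For A the ring of holomorphic germs, germs along
   {0} x P^{n-1} of closed analytic subspaces of C^n x P^{n-1} correspond to closed
   subschemes of the projective space over A. *)
Definition blowup_ideal (a : 'I_n -> A) : set S :=
  [set p | mmap (@polyC A) (fun i => (a i)%:P * 'X) p = 0].

Definition exceptional_cycle (a : 'I_n -> A) : cycle :=
  scheme_cycle (ideal_gen (blowup_ideal a `|` range (fun i => mpolyC n (a i)))).

End ProjectiveCycles.

Section LeNumbers.
Variables (C : numFieldType) (n : nat).
Implicit Types (g : holo_germ C n) (k : nat).

Definition linear_form (v : 'rV[C]_n) : {mpoly (holo_germ C n)[n]} :=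
  \sum_j germC n (v ord0 j) *: mpolyX _ (mnm1 j).

(* The rows of L are the equations of the hyperplanes. *)
Definition Le_cycle g k (L : 'M[C]_((n - k - 1)%N, n)) :
    set (holo_germ C n) -> nat :=
  pushforward
    (foldr (fun i => hyperplane_cap (linear_form (row i L)))
       (exceptional_cycle (fun i => germ_deriv i g)) (enum 'I_(n - k - 1)%N)).

Definition Le_multiplicity g k (L : 'M[C]_((n - k - 1)%N, n)) : nat :=
  (\sum_(q \in [set: set (holo_germ C n)])
     hs_multiplicity (@germ_maximal_ideal C n) q * Le_cycle g L q)%N.

(* "General" means outside a proper Zariski closed set of hyperplanes. *)
Definition Le_number g k : nat := xget 0%N [set l |
  exists2 F : {mpoly C[((n - k - 1) * n)%N]}, F != 0 &
    forall L : 'M[C]_((n - k - 1)%N, n),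
      meval (fun i => mxvec L ord0 i) F != 0 -> Le_multiplicity g L = l].

End LeNumbers.

Definition f_family (C : comNzRingType) (t : C) : {mpoly C[4]} :=
  let x1 : {mpoly C[4]} := mpolyX C (mnm1 (inord 0)) in
  let x2 : {mpoly C[4]} := mpolyX C (mnm1 (inord 1)) in
  let x3 : {mpoly C[4]} := mpolyX C (mnm1 (inord 2)) in
  let x4 : {mpoly C[4]} := mpolyX C (mnm1 (inord 3)) in
  x3 ^+ 5 + t *: (x2 ^+ 6 * x3) + x2 ^+ 7 * x1 + x1 ^+ 15 + x4 ^+ 2.

(* Main.v *)
Require Import Defs.
From HB Require Import structures.
From mathcomp Require Import all_boot all_order all_algebra complex.
From mathcomp Require Import boolp classical_sets functions fsbigop reals.
From mathcomp Require Import topology normedtype.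
From mathcomp Require Import -(notations) mpoly.
From mathcomp Require Import fingroup perm separable.
From mathcomp Require Import ring lra zify.

(** Both halves rest on the homogeneity of f_t: it has degree 30 for the weights
2, 4, 6, 15 of the variables, whatever t is.

Triviality. On the unit sphere the gradient of f_0 is bounded below
([gsq_bound]), so that f_0 (x + u * dir x) is f_0 x + u to first order, where
[dir] is the conjugate gradient over its squared norm. Hence for small t the
equation f_t (x + u * dir x) = f_0 x * g ^ 30 has one small solution u, found by a
contraction ([step_small], [solution_exists]); here g depends on x and u. The map
x |-> g ^ -1 . (x + u * dir x) on the sphere extends by homogeneity to a map [hh]
with f_t o hh = f_0 ([hh_f]); a second contraction gives its inverse ([kkK],
[hhK]), and homogeneity reduces the continuity of both to a Lipschitz estimate on
an annulus ([cone]). The factor g is there for the ball: where f_0 is small on the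
sphere it is the size of x + u * dir x, which makes hh preserve the size of a
point; elsewhere g only has to be bounded, because the points of the tube in these
directions are far inside the ball ([tube_hh]).

Le numbers. The first Le number of the square is 32 for t = 0 and 30 for some
arbitrarily small t <> 0 ([Le_number_special], [Le_number_generic]). The partial
derivatives of f ^ 2 are 2 f times those of f, so the exceptional divisor consists
of the strict transform of the hypersurface f = 0 ([pf_prime]) and of the fibre
over the origin, which is a full projective space. One general hyperplane cuts the
transform in that of a polar surface ([p1_prime]) and in parts of the fibre; a
second one leaves the transforms of finitely many curves and points of the fibre,
and the points do not contribute ([two_hyperplanes], [slice_multiplicity]). So the
Le number is the multiplicity of the polar curve lying on f = 0. For t <> 0 this
curve consists of 30 smooth branches (s, s^2 Y, s^3 Z), one for each solution of
5 Z^4 + t Y^6 = 0 and Z^5 + t Y^6 Z + Y^7 + 1 = 0; for t = 0 it consists of 8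
branches of multiplicity 4. The branches come from the implicit function theorem;
that there are no others, and that they are reduced, follows by counting standard
monomials ([arc_components], [arc_reduced]). The components inside the fibre are
controlled by relations among the derivatives ([relation_generic],
[relation_special]) and by limits of tangent hyperplanes along arcs
([transform_sub_linear]). *)

Set Implicit Arguments.
Unset Strict Implicit.
Unset Printing Implicit Defensive.

Import Order.TTheory GRing.Theory Num.Theory numFieldNormedType.Exports.

Local Open Scope classical_set_scope.
Local Open Scope ring_scope.

(** * The ring of convergent power series *)

Module Ga.
Section GermRing.
Variables (C : numFieldType) (n : nat).
Local Notation mnm := (multinom n).
Local Notation A := (holo_germ C n).
Implicit Types (a b c g : A) (m : mnm).

Lemma gcoefD a b m : (a + b) m = a m + b m. Proof. by []. Qed.
Lemma gcoefN a m : (- a) m = - a m. Proof. by []. Qed.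
Lemma gcoef0 m : (0 : A) m = 0. Proof. by rewrite /= mcoeffC mul0r. Qed.
Lemma gcoefB a b m : (a - b) m = a m - b m. Proof. by []. Qed.
Lemma gcoef1 m : (1 : A) m = (m == mnm0)%:R.
Proof. by rewrite /= mcoeffC mul1r. Qed.
Lemma gcoefC (x : C) m : germC n x m = x * (m == mnm0)%:R.
Proof. by rewrite /= mcoeffC. Qed.
Lemma coef_mpoly (p : {mpoly C[n]}) m : germ_of_mpoly p m = mcoeff m p.
Proof. by []. Qed.
Lemma gcoef_sum I (r : seq I) (P : pred I) (F : I -> A) m :
 (\sum_(i <- r | P i) F i) m = \sum_(i <- r | P i) F i m.
Proof. by elim/big_rec2: _ => [|i y x _ <-]; rewrite ?gcoef0. Qed.

Definition jet d a : {mpoly C[n]} :=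
 \sum_(k : bmultinom n d) a k *: mpolyX C k.

Lemma mcoeff_jet d a m : (mdeg m < d)%N -> mcoeff m (jet d a) = a m.
Proof. exact: mcoeff_mpoly. Qed.
Lemma eq_lem1 m m1 m2 : m = mnm_add m1 m2 -> lem m1 m.
Proof. by move->; apply: lem_addr. Qed.
Lemma eq_lem2 m m1 m2 : m = mnm_add m1 m2 -> lem m2 m.
Proof. by move->; apply: lem_addl. Qed.
Lemma coefM_mpoly (p q : {mpoly C[n]}) a b m :
 (forall m', lem m' m -> mcoeff m' p = a m') ->
 (forall m', lem m' m -> mcoeff m' q = b m') ->
 (a * b) m = mcoeff m (p * q).
Proof.
move=> pa qb; rewrite mcoeffM; apply: eq_bigr => k /eqP em.
by rewrite pa ?qb ?(eq_lem1 em) ?(eq_lem2 em).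
Qed.
Lemma lem_mdeg m1 m2 : lem m1 m2 -> (mdeg m1 <= mdeg m2)%N.
Proof. by move=> /lem_leo/lemc_mdeg. Qed.
Lemma coefM_jet d a b m : (mdeg m < d)%N ->
 (a * b) m = mcoeff m (jet d a * jet d b).
Proof.
by move=> md; apply: coefM_mpoly => m' /lem_mdeg m'm; apply: mcoeff_jet;
 apply: leq_ltn_trans md.
Qed.
Lemma gcoefM d a b m : (mdeg m < d)%N ->
 (a * b) m = \sum_(k : bmultinom n d * bmultinom n d | m == mnm_add k.1 k.2)
 a k.1 * b k.2.
Proof.
move=> md; rewrite (coefM_jet a b md) (mcoeff_poly_mul _ _ md).
by apply: eq_bigr => k _; rewrite !mcoeff_jet ?bmdeg.
Qed.
Lemma coefM_neq0 a b m : (a * b) m != 0 ->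
 exists m1 m2, [/\ m = mnm_add m1 m2, a m1 != 0 & b m2 != 0].
Proof.
rewrite (gcoefM a b (ltnSn _)) => ab0.
have [k /andP[/eqP em nz]|none] := pickP [pred k : bmultinom n (mdeg m).+1
 * bmultinom n (mdeg m).+1 | (m == mnm_add k.1 k.2) && (a k.1 * b k.2 != 0)].
 by exists k.1, k.2; split=> //; apply: contraNneq nz => ->;
 rewrite ?mul0r ?mulr0.
case/eqP: ab0; apply: big1 => k em; have := none k.
by rewrite /= em => /negbFE/eqP.
Qed.
Lemma eq_coefM a a' b b' m : (forall m', lem m' m -> a m' = a' m') ->
 (forall m', lem m' m -> b m' = b' m') -> (a * b) m = (a' * b') m.
Proof.
move=> ea eb; rewrite !(gcoefM _ _ (ltnSn _)); apply: eq_bigr => k /eqP em.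
by rewrite ea ?eb ?(eq_lem1 em) ?(eq_lem2 em).
Qed.
Lemma germ_of_mpoly_is_zmod : zmod_morphism (@germ_of_mpoly C n).
Proof. by move=> p q; apply: holo_germP => m; exact: mcoeffB. Qed.
Lemma germ_of_mpoly_is_monoid : monoid_morphism (@germ_of_mpoly C n).
Proof.
split=> [|p q]; apply: holo_germP => m; first by [].
by symmetry; apply: coefM_mpoly.
Qed.
HB.instance Definition _ := GRing.isZmodMorphism.Build {mpoly C[n]} A
 (@germ_of_mpoly C n) germ_of_mpoly_is_zmod.
HB.instance Definition _ := GRing.isMonoidMorphism.Build {mpoly C[n]} A
 (@germ_of_mpoly C n) germ_of_mpoly_is_monoid.

Lemma germC_is_zmod : zmod_morphism (@germC C n).
Proof. by move=> p q; rewrite /germC mpolyCB rmorphB. Qed.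
Lemma germC_is_monoid : monoid_morphism (@germC C n).
Proof. by split=> [|p q]; rewrite /germC ?mpolyC1 ?mpolyCM ?rmorph1 ?rmorphM. Qed.
HB.instance Definition _ := GRing.isZmodMorphism.Build C A
 (@germC C n) germC_is_zmod.
HB.instance Definition _ := GRing.isMonoidMorphism.Build C A
 (@germC C n) germC_is_monoid.

Lemma gcoefCM (x : C) a m : (germC n x * a) m = x * a m.
Proof.
rewrite (coefM_jet _ _ (ltnSn (mdeg m))).
rewrite (_ : jet _ (germC n x) = mpolyC n x) ?mcoeffCM ?mcoeff_jet//.
apply/mpolyP => m'; have [lt|ge] := ltnP (mdeg m') (mdeg m).+1.
 by rewrite mcoeff_jet.
rewrite /jet raddf_sum mcoeffC big1 => [|k _] /=; last first.
 rewrite mcoeffZ mcoeffX; case: eqP => [e|]; last by rewrite mulr0.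
 by have := bmdeg k; rewrite e ltnNge ge.
by have [e|_] := eqVneq m' mnm0; [rewrite e mdeg0 in ge | rewrite mulr0].
Qed.

Definition gX m : A := germ_of_mpoly (mpolyX C m).

Lemma coef_gX m m' : gX m m' = (m == m')%:R.
Proof. by rewrite coef_mpoly mcoeffX. Qed.
Lemma gcoefMX a m m' :
 (a * gX m) m' = if lem m m' then a (mnm_sub m' m) else 0.
Proof.
case: ifP => lm; last first.
 apply/eqP/negPn/negP => /coefM_neq0[m1 [m2 [e _]]]; rewrite coef_gX.
 have [e2 _|] := eqVneq m m2; last by rewrite eqxx.
 by rewrite e2 (eq_lem2 e) in lm.
rewrite (gcoefM _ _ (ltnSn (mdeg m'))).
have d1 : (mdeg (mnm_sub m' m) < (mdeg m').+1)%N by rewrite ltnS mdegB.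
have d2 : (mdeg m < (mdeg m').+1)%N by rewrite ltnS lem_mdeg.
rewrite (bigD1 (BMultinom d1, BMultinom d2)) ?submK//=.
rewrite !mcoeffX eqxx mulr1 big1 ?addr0// => -[k1 k2] /= /andP[/eqP em ne].
rewrite mcoeffX; case: eqP => [e2|]; last by rewrite mulr0.
case/eqP: ne; congr pair; apply/val_inj => //=.
by rewrite -[val k1](addmK m) {1}e2 -em.
Qed.
Lemma cst_is_zmod : zmod_morphism (fun a : A => a mnm0).
Proof. by []. Qed.
Lemma cst_is_monoid : monoid_morphism (fun a : A => a mnm0).
Proof.
split=> [|a b]; first by rewrite gcoef1 eqxx.
rewrite (gcoefM _ _ (_ : mdeg (@mnm0 n) < 1)%N) ?mdeg0//.
rewrite (bigD1 (@bm0 n 0, @bm0 n 0)) /= ?addm0// big1 ?addr0// => -[k1 k2] /=.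
rewrite eq_sym mnmD_eq0 => /andP[/andP[/eqP e1 /eqP e2]] /eqP[].
by congr pair; apply/val_inj.
Qed.
Definition cst a : C := a mnm0.
HB.instance Definition _ := GRing.isZmodMorphism.Build A C cst cst_is_zmod.
HB.instance Definition _ := GRing.isMonoidMorphism.Build A C cst cst_is_monoid.

Lemma cstD a b : cst (a + b) = cst a + cst b. Proof. exact: rmorphD. Qed.
Lemma cstM a b : cst (a * b) = cst a * cst b. Proof. exact: rmorphM. Qed.
Lemma cstN a : cst (- a) = - cst a. Proof. exact: rmorphN. Qed.
Lemma cstB a b : cst (a - b) = cst a - cst b. Proof. exact: rmorphB. Qed.
Lemma cstX a k : cst (a ^+ k) = cst a ^+ k. Proof. exact: rmorphXn. Qed.
Lemma cst0 : cst 0 = 0. Proof. exact: rmorph0. Qed.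
Lemma cst1 : cst 1 = 1. Proof. exact: rmorph1. Qed.
Lemma cstC x : cst (germC n x) = x.
Proof. by rewrite /cst gcoefC eqxx mulr1. Qed.
Lemma cst_gX m : cst (gX m) = (m == mnm0)%:R.
Proof. by rewrite /cst coef_gX. Qed.
Lemma cst_sum I (r : seq I) (P : pred I) (F : I -> A) :
 cst (\sum_(i <- r | P i) F i) = \sum_(i <- r | P i) cst (F i).
Proof. exact: rmorph_sum. Qed.

(** The finite sums of the absolute values of the terms at radii s. *)
Definition normle (s : 'I_n -> C) (a : mnm -> C) (x : C) :=
 forall l, uniq l -> \sum_(m <- l) `|a m| * mmap1 s m <= x.

Lemma mmap1_ge0 (s : 'I_n -> C) m : (forall i, 0 <= s i) -> 0 <= mmap1 s m.
Proof. by move=> s0; rewrite /mmap1 prodr_ge0// => i _; rewrite exprn_ge0. Qed.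
Lemma mmap1D (R : comNzRingType) (s : 'I_n -> R) m1 m2 :
 mmap1 s (mnm_add m1 m2) = mmap1 s m1 * mmap1 s m2.
Proof.
by rewrite /mmap1 -big_split; apply: eq_bigr => i _; rewrite mnmDE exprD.
Qed.
Lemma normle_ge0 s (a : mnm -> C) x : normle s a x -> 0 <= x.
Proof. by move=> /(_ [::] isT); rewrite big_nil. Qed.
Lemma normle_coef s (a : mnm -> C) x m : normle s a x -> `|a m| * mmap1 s m <= x.
Proof. by move=> /(_ [:: m] isT); rewrite big_seq1. Qed.
Lemma normleD s (a b : mnm -> C) x y : normle s a x -> normle s b y ->
 (forall i, 0 <= s i) -> normle s (fun m => a m + b m) (x + y).
Proof.
move=> na nb s0 l ul; apply: le_trans (lerD (na l ul) (nb l ul)).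
rewrite -big_split /=; apply: ler_sum => m _; rewrite -mulrDl.
by apply: ler_wpM2r; rewrite ?mmap1_ge0 ?ler_normD.
Qed.
Lemma normle_sum (I : Type) (r : seq I) (s : 'I_n -> C) (F : I -> mnm -> C)
 (x : I -> C) :
 (forall i, 0 <= s i) -> (forall i, normle s (F i) (x i)) ->
 normle s (fun m => \sum_(i <- r) F i m) (\sum_(i <- r) x i).
Proof.
move=> s0 H; elim: r => [|i r IH].
 by move=> l ul; rewrite big_nil big1// => m _; rewrite big_nil normr0 mul0r.
rewrite big_cons.
rewrite (_ : (fun m => _) = fun m => F i m + \sum_(j <- r) F j m).
 exact: normleD.
by apply/funext => m; rewrite big_cons.
Qed.
Lemma normle_le s (a b : mnm -> C) x : (forall i, 0 <= s i) ->
 (forall m, `|b m| <= `|a m|) -> normle s a x -> normle s b x.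
Proof.
move=> s0 ba na l ul; apply: le_trans (na l ul); apply: ler_sum => m _.
by apply: ler_wpM2r; rewrite ?mmap1_ge0.
Qed.
Lemma ler_sum_uniq (I : eqType) (l l' : seq I) (F : I -> C) :
 uniq l -> {subset l <= l'} -> (forall i, 0 <= F i) ->
 \sum_(i <- l) F i <= \sum_(i <- l') F i.
Proof.
move=> ul ll' F0; elim: l ul l' ll' => [|i l IH] /=.
 by move=> _ l' _; rewrite big_nil sumr_ge0.
move=> /andP[il ul] l' ll'.
rewrite big_cons [leRHS](big_rem i) /= ?ll' ?mem_head//.
rewrite lerD2l; apply: IH => // j jl.
have := ll' j; rewrite inE jl orbT => /(_ isT) jl'.
have : j \in i :: rem i l' by rewrite -(perm_mem (perm_to_rem (ll' i (mem_head _ _)))).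
by rewrite inE; case: eqP => [e|//]; rewrite -e jl in il.
Qed.
Lemma normleM s a b x y : normle s a x -> normle s b y ->
 (forall i, 0 <= s i) -> normle s (a * b) (x * y).
Proof.
move=> na nb s0 l ul; pose d := (\max_(m <- l) mdeg m).+1.
have ld m : m \in l -> (mdeg m < d)%N.
 by move=> ml; rewrite ltnS (big_rem m ml) /= leq_maxl.
pose E := enum {: bmultinom n d}.
have uE : uniq [seq val k | k <- E] by rewrite map_inj_uniq ?enum_uniq//; apply: val_inj.
have ba : \sum_(k : bmultinom n d) `|a k| * mmap1 s k <= x.
 by have := na _ uE; rewrite big_map big_enum.
have bb : \sum_(k : bmultinom n d) `|b k| * mmap1 s k <= y.
 by have := nb _ uE; rewrite big_map big_enum.
pose G (k : bmultinom n d * bmultinom n d) :=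
 `|a k.1| * mmap1 s k.1 * (`|b k.2| * mmap1 s k.2).
have G0 k : 0 <= G k by rewrite /G !mulr_ge0 ?mmap1_ge0.
have le_xy : \sum_k G k <= x * y.
 rewrite -(pair_bigA _ (fun k1 k2 => G (k1, k2))) /=.
 apply: le_trans (_ : _ <= x * \sum_(k : bmultinom n d) `|b k| * mmap1 s k) _.
 rewrite /G /=; under eq_bigr do rewrite -mulr_sumr.
 rewrite -mulr_suml; apply: ler_wpM2r => //.
 by apply: sumr_ge0 => k _; rewrite mulr_ge0 ?mmap1_ge0.
 by apply: ler_wpM2l => //; exact: normle_ge0 na.
apply: le_trans le_xy.
apply: le_trans (_ : _ <= \sum_(m <- l) \sum_(k | m == mnm_add (val k.1) (val k.2)) G k) _.
 rewrite big_seq [leRHS]big_seq; apply: ler_sum => m ml.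
 rewrite (gcoefM a b (ld _ ml)).
 apply: le_trans (_ : _ <= (\sum_(k : bmultinom n d * bmultinom n d |
 m == mnm_add k.1 k.2) `|a k.1 * b k.2|) * mmap1 s m) _.
 by apply: ler_wpM2r; rewrite ?mmap1_ge0 ?ler_norm_sum.
 rewrite mulr_suml; apply: ler_sum => k /eqP ->.
 by rewrite normrM mmap1D mulrACA.
rewrite (exchange_big_dep predT) //=; apply: ler_sum => k _.
rewrite -big_filter.
apply: le_trans (_ : _ <= \sum_(i <- [:: mnm_add (val k.1) (val k.2)]) G k) _.
 apply: ler_sum_uniq => //; first exact: filter_uniq.
 by move=> m; rewrite mem_filter inE => /andP[].
by rewrite big_seq1.
Qed.
Lemma normle_convergent s (a : mnm -> C) x : (forall i, 0 < s i) ->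
 normle s a x -> convergent a.
Proof.
move=> s0 na; pose r : C := 1 + \sum_i (s i)^-1.
have sv0 i : 0 <= (s i)^-1 by rewrite invr_ge0 ltW.
exists x, r; split=> [|m]; first by rewrite ltr_pwDl ?sumr_ge0.
have m0 : 0 < mmap1 s m by rewrite /mmap1 prodr_gt0// => i _; rewrite exprn_gt0.
have := normle_coef m na; rewrite -ler_pdivlMr// => H; apply: le_trans H _.
apply: ler_wpM2l; first exact: normle_ge0 na.
rewrite /mmap1 -prodfV mdegE -prodrXr.
apply: ler_prod => i _; rewrite invr_ge0 exprn_ge0 ?(ltW (s0 i))//= -exprVn.
apply: lerXn2r; rewrite ?nnegrE ?sv0//.
- by rewrite addr_ge0 ?sumr_ge0.
- by rewrite /r (bigD1 i)//= addrCA lerDl addr_ge0 ?sumr_ge0.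
Qed.
Lemma sum_half k : \sum_(i < k) (2%:R^-1 : C) ^+ i <= 2%:R.
Proof.
have -> : \sum_(i < k) (2%:R^-1 : C) ^+ i = 2%:R - 2%:R * (2%:R^-1) ^+ k.
 elim: k => [|k IH]; first by rewrite big_ord0 expr0 mulr1 subrr.
 by rewrite big_ord_recr /= IH exprS mulrA mulfV ?pnatr_eq0// mul1r; ring.
by rewrite gerBl mulr_ge0 ?exprn_ge0 ?invr_ge0 ?ler0n.
Qed.
Lemma convergent_normle (a : mnm -> C) : convergent a ->
 exists s0 x, 0 < s0 /\ forall s, (forall i, 0 <= s i <= s0) -> normle s a x.
Proof.
move=> [M [r [r0 Ha]]]; have M0 := convergent_ge0 Ha.
exists (r^-1 / 2%:R), (M * 2%:R ^+ n); split=> [|s s0 l ul].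
 by rewrite divr_gt0 ?invr_gt0 ?ltr0n.
pose B := (\max_(m <- l) mdeg m).+1.
have lB m i : m \in l -> (m i < B)%N.
 move=> ml; rewrite ltnS (big_rem m ml) /= leq_max; apply/orP; left.
 by rewrite mdegE (bigD1 i) //= leq_addr.
pose mf (f : {ffun 'I_n -> 'I_B}) : mnm := Multinom [tuple val (f i) | i < n].
have mfE f i : mf f i = f i by rewrite mnmE.
have inj_mf : injective mf.
 move=> f g /mnmP e; apply/ffunP => i; apply/val_inj.
 by have := e i; rewrite !mfE.
have lel : {subset l <= [seq mf f | f <- enum {: {ffun 'I_n -> 'I_B}}]}.
 move=> m ml; apply/mapP; exists [ffun i => inord (m i)].
 by rewrite mem_enum.
 by apply/mnmP => i; rewrite mfE ffunE inordK// lB.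
apply: le_trans (_ : _ <= \sum_(m <- l) M * \prod_(i < n) (2%:R^-1) ^+ m i) _.
 apply: ler_sum => m _.
 apply: le_trans (ler_wpM2r _ (Ha m)) _.
 by rewrite mmap1_ge0// => i; have /andP[] := s0 i.
 rewrite -mulrA; apply: ler_wpM2l => //.
 rewrite /mmap1 mdegE -prodrXr -big_split /=.
 apply: ler_prod => i _; have /andP[si0 sis] := s0 i.
 rewrite -exprMn exprn_ge0 ?mulr_ge0 ?(ltW r0)//=.
 apply: lerXn2r; rewrite ?nnegrE ?mulr_ge0 ?invr_ge0 ?ler0n ?(ltW r0)//.
 apply: le_trans (ler_wpM2l (ltW r0) sis) _.
 by rewrite mulrA mulfV ?gt_eqF// mul1r.
apply: le_trans (ler_sum_uniq ul lel _) _.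
 by move=> m; rewrite mulr_ge0 ?prodr_ge0// => i _; rewrite exprn_ge0 ?invr_ge0 ?ler0n.
rewrite big_map big_enum -mulr_sumr; apply: ler_wpM2l => //.
under eq_bigr do under eq_bigr do rewrite mfE.
rewrite -(bigA_distr_bigA (fun (i : 'I_n) (j : 'I_B) => (2%:R^-1 : C) ^+ j)).
rewrite -[X in _ <= _ ^+ X]card_ord -prodr_const; apply: ler_prod => i _.
by rewrite sum_half sumr_ge0// => j _; rewrite exprn_ge0 ?invr_ge0 ?ler0n.
Qed.

End GermRing.

Arguments cst : simpl never.
Arguments gX : simpl never.

End Ga.
Import Ga.

(** * Division of germs by several germs *)

Module Gb.
Section Division.
Variables (C : numFieldType) (n : nat) (w : 'I_n -> nat).
Local Notation mnm := (multinom n).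
Local Notation A := (holo_germ C n).
Implicit Types (a b c g : A) (m : mnm).

Definition wdeg m : nat := \sum_(i < n) w i * m i.

Lemma wdegD m1 m2 : wdeg (mnm_add m1 m2) = (wdeg m1 + wdeg m2)%N.
Proof.
by rewrite /wdeg -big_split; apply: eq_bigr => i _; rewrite mnmDE mulnDr.
Qed.
Lemma wdeg0 : wdeg mnm0 = 0%N.
Proof. by rewrite /wdeg big1// => i _; rewrite mnm0E muln0. Qed.
Lemma wdegB m1 m2 : lem m2 m1 -> (wdeg (mnm_sub m1 m2) + wdeg m2 = wdeg m1)%N.
Proof. by move=> le; rewrite -wdegD submK. Qed.

Definition wge d a := forall m, a m != 0 -> (d <= wdeg m)%N.

Lemma wgeM d e a b : wge d a -> wge e b -> wge (d + e) (a * b).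
Proof.
move=> da eb m /coefM_neq0[m1 [m2 [-> /da d1 /eb d2]]].
by rewrite wdegD leq_add.
Qed.
Lemma wgeW d e a : (e <= d)%N -> wge d a -> wge e a.
Proof. by move=> ed da m /da; apply: leq_trans. Qed.
Lemma wge_sum d I (r : seq I) (F : I -> A) :
 (forall i, wge d (F i)) -> wge d (\sum_(i <- r) F i).
Proof.
move=> dF m; rewrite gcoef_sum; elim: r => [|i r IH]; first by rewrite big_nil eqxx.
rewrite big_cons; have [->|/dF//] := eqVneq (F i m) 0.
by rewrite add0r.
Qed.
Lemma wge0 a : wge 0 a. Proof. by []. Qed.

Hypothesis w_gt0 : forall i, (0 < w i)%N.
Variables (k : nat) (g : 'I_k -> A) (al : 'I_k -> mnm).
Hypothesis g_lead : forall i, g i (al i) = 1.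
Hypothesis g_tail : forall i m, g i m != 0 -> m != al i ->
 (wdeg (al i) < wdeg m)%N.

Let e i : A := g i - gX C (al i).

Let e_neq0 i m : e i m != 0 -> (wdeg (al i) < wdeg m)%N.
Proof.
rewrite /e gcoefB coef_gX; have [<-|ne] := eqVneq (al i) m.
 by rewrite g_lead subrr eqxx.
by rewrite subr0 => nz; apply: g_tail => //; rewrite eq_sym.
Qed.

Let sel m : option 'I_k := [pick i | lem (al i) m].

Let selP m i : sel m = Some i -> lem (al i) m.
Proof. by rewrite /sel; case: pickP => // j ? [<-]. Qed.

Let q_fun i a := fun m : mnm =>
 if sel (mnm_add m (al i)) == Some i then a (mnm_add m (al i)) else 0.
Let r_fun a := fun m : mnm => if sel m == None then a m else 0.

Let rad (t : C) := fun i : 'I_n => t ^+ w i.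

Let radE t m : mmap1 (rad t) m = t ^+ wdeg m.
Proof.
by rewrite /mmap1 /wdeg -prodrXr; apply: eq_bigr => i _; rewrite exprM.
Qed.

Let rad_ge0 t : 0 < t -> forall i, 0 <= rad t i.
Proof. by move=> t0 i; rewrite exprn_ge0// ltW. Qed.
Let rad_gt0 t : 0 < t -> forall i, 0 < rad t i.
Proof. by move=> t0 i; rewrite exprn_gt0. Qed.

Let normle_q (t x : C) (a : A) i : 0 < t -> normle (rad t) a x ->
 normle (rad t) (q_fun i a) (x * (t ^+ wdeg (al i))^-1).
Proof.
move=> t0 na l ul; rewrite ler_pdivlMr ?exprn_gt0//.
have uL : uniq [seq mnm_add m (al i) | m <- l] by rewrite map_inj_uniq//; apply: addIm.
apply: le_trans (na _ uL); rewrite big_map mulr_suml; apply: ler_sum => m _.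
rewrite !radE wdegD exprD mulrA; rewrite !ler_wpM2r ?exprn_ge0 ?(ltW t0)//.
by rewrite /q_fun; case: ifP => // _; rewrite normr0.
Qed.

Let small (a : A) : exists2 t0, 0 < t0 &
 exists x, forall t, 0 < t <= t0 -> normle (rad t) a x.
Proof.
have [s0 [x [s0_gt0 nx]]] := convergent_normle (coef_convergent a).
have p : 0 < s0^-1 + 1 by rewrite addr_gt0 ?invr_gt0.
exists (s0^-1 + 1)^-1; first by rewrite invr_gt0.
exists x => t /andP[t0 le_t]; apply: nx => i; rewrite rad_ge0//=.
have t1 : t <= 1.
 by apply: le_trans le_t _; rewrite invf_le1// lerDr ltW ?invr_gt0.
have ts : t <= s0.
 apply: le_trans le_t _; rewrite -[leRHS]invrK lef_pV2 ?posrE ?invr_gt0//.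
 by rewrite lerDl.
apply: le_trans ts; rewrite /rad -[leRHS]expr1.
by rewrite ler_wiXn2l// ltW.
Qed.

Let common (K : nat) (P : 'I_K -> C -> Prop) :
 (forall i, exists2 t0, 0 < t0 & forall t, 0 < t <= t0 -> P i t) ->
 exists2 t0, 0 < t0 & forall t, 0 < t <= t0 -> forall i, P i t.
Proof.
move=> H; have {}H i : exists t0, 0 < t0 /\ forall t, 0 < t <= t0 -> P i t.
 by have [t0] := H i; exists t0.
have [T HT] := choice H.
have inv_ge0 i : 0 <= (T i)^-1 by rewrite invr_ge0 ltW//; have [] := HT i.
have p : 0 < 1 + \sum_i (T i)^-1 by rewrite ltr_pwDl// sumr_ge0.
exists (1 + \sum_i (T i)^-1)^-1; first by rewrite invr_gt0.
move=> t /andP[t0 le_t] i; have [Ti0 HP] := HT i; apply: HP; rewrite t0/=.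
apply: le_trans le_t _; rewrite -[leRHS]invrK lef_pV2 ?posrE ?invr_gt0//.
by rewrite (bigD1 i)//= addrCA lerDl addr_ge0 ?sumr_ge0.
Qed.

Let small_e i : exists2 t0, 0 < t0 & forall t, 0 < t <= t0 ->
 normle (rad t) (e i) (t ^+ wdeg (al i) / (2 * k.+1)%:R).
Proof.
have [t0 t0_gt0 [x nx]] := small (e i).
have x0 : 0 <= x by apply: normle_ge0 (nx t0 _); rewrite t0_gt0 lexx.
have x1 : 0 < x + 1 by rewrite ltr_wpDl.
have k0 : 0 < (2 * k.+1)%:R :> C by rewrite ltr0n.
pose y := t0 ^+ (wdeg (al i)).+1 / (2 * k.+1)%:R / (x + 1).
have y0 : 0 < y by rewrite !divr_gt0 ?exprn_gt0.
exists (y^-1 + t0^-1)^-1; first by rewrite invr_gt0 addr_gt0 ?invr_gt0.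
move=> t /andP[t_gt0 le_t].
have ty : t <= y.
 apply: le_trans le_t _; rewrite -[leRHS]invrK lef_pV2 ?posrE ?addr_gt0 ?invr_gt0//.
 by rewrite lerDl ltW ?invr_gt0.
have tt : t <= t0.
 apply: le_trans le_t _; rewrite -[leRHS]invrK lef_pV2 ?posrE ?addr_gt0 ?invr_gt0//.
 by rewrite lerDr ltW ?invr_gt0.
move=> l ul; pose z := t / t0.
have z0 : 0 <= z by rewrite divr_ge0 ?ltW.
have z1 : z <= 1 by rewrite ler_pdivrMr ?mul1r.
apply: le_trans (_ : _ <= z ^+ (wdeg (al i)).+1 * x) _.
 have := nx t0 _ l ul; rewrite t0_gt0 lexx => /(_ isT) /(ler_wpM2l (exprn_ge0 (wdeg (al i)).+1 z0)).
 apply: le_trans; rewrite mulr_sumr; apply: ler_sum => m _.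
 rewrite !radE; have [->|/e_neq0 lt] := eqVneq (e i m) 0.
 by rewrite normr0 !mul0r mulr0.
 have -> : t = z * t0 by rewrite mulfVK ?gt_eqF.
 rewrite exprMn mulrCA ler_wpM2r ?mulr_ge0 ?exprn_ge0 ?(ltW t0_gt0)//.
 by rewrite ler_wiXn2l.
rewrite exprS expr_div_n -mulrA ler_pdivlMr//.
have -> : z * (t ^+ wdeg (al i) / t0 ^+ wdeg (al i) * x) * (2 * k.+1)%:R =
 t ^+ wdeg (al i) * (t * (x * ((2 * k.+1)%:R / t0 ^+ (wdeg (al i)).+1))).
 by rewrite /z exprS invfM; ring.
rewrite ler_piMr ?exprn_ge0 ?(ltW t_gt0)//.
apply: le_trans (ler_wpM2r _ ty) _.
 by rewrite !mulr_ge0 ?invr_ge0 ?exprn_ge0 ?ler0n ?(ltW t0_gt0).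
have tk0 : t0 ^+ (wdeg (al i)).+1 != 0 by rewrite gt_eqF ?exprn_gt0.
have E (T K X : C) : T != 0 -> K != 0 -> X + 1 != 0 ->
 T / K / (X + 1) * (X * (K / T)) = X / (X + 1) by move=> *; field; apply/and3P.
rewrite /y E ?gt_eqF ?exprn_gt0//.
by rewrite ler_pdivrMr// mul1r lerDl.
Qed.

Let conv_q i a : convergent (q_fun i a).
Proof.
have [t t0 [x nx]] := small a.
by apply: normle_convergent (rad_gt0 t0) (normle_q i t0 (nx t _)); rewrite t0 lexx.
Qed.

Let normle_r t x (a : A) : 0 < t -> normle (rad t) a x -> normle (rad t) (r_fun a) x.
Proof.
move=> t0; apply: normle_le; first exact: rad_ge0.
by move=> m; rewrite /r_fun; case: ifP => // _; rewrite normr0.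
Qed.

Let conv_r a : convergent (r_fun a).
Proof.
have [t t0 [x nx]] := small a.
by apply: normle_convergent (rad_gt0 t0) (normle_r t0 (nx t _)); rewrite t0 lexx.
Qed.

Let Q i a : A := HoloGerm (conv_q i a).
Let R a : A := HoloGerm (conv_r a).
Let nxt a : A := - \sum_i Q i a * e i.

Let nxtE a : a = \sum_i Q i a * g i + R a + nxt a.
Proof.
have -> : \sum_i Q i a * g i = \sum_i Q i a * gX C (al i) + \sum_i Q i a * e i.
 by rewrite -big_split; apply: eq_bigr => i _ /=; rewrite -mulrDr [gX _ _ + _]addrC subrK.
rewrite /nxt [_ + R a - _]addrAC addrK.
apply: holo_germP => m; rewrite gcoefD gcoef_sum.
have QX i : (Q i a * gX C (al i)) m = if sel m == Some i then a m else 0.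
 rewrite gcoefMX; case: ifP => le.
 by rewrite /= /q_fun submK.
 by case: eqP => // /selP; rewrite le.
under eq_bigr do rewrite QX.
rewrite /= /r_fun; case: (sel m) => [i|]; last first.
 by rewrite eqxx big1 ?add0r// => i _; case: eqP.
rewrite (bigD1 i)//= eqxx big1 ?addr0// => j ji.
by case: eqP => // -[ij]; rewrite ij eqxx in ji.
Qed.

Let wge_nxt d a : wge d a -> wge d.+1 (nxt a).
Proof.
move=> da m nz.
have: (\sum_i Q i a * e i) m != 0 by rewrite -oppr_eq0 -gcoefN.
apply: wge_sum => i m' /coefM_neq0[m1 [m2 [-> nz1 /e_neq0 lt]]].
rewrite wdegD; move: nz1; rewrite /= /q_fun; case: ifP => [_ /da|]; last by rewrite eqxx.
by rewrite wdegD => le; apply: leq_trans (_ : (wdeg m1 + wdeg (al i)).+1 <= _)%N;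
 rewrite ?ltnS// -addnS leq_add2l.
Qed.

Let normle_nxt t x a : 0 < t ->
 (forall i, normle (rad t) (e i) (t ^+ wdeg (al i) / (2 * k.+1)%:R)) ->
 normle (rad t) a x -> normle (rad t) (nxt a) (x / 2%:R).
Proof.
move=> t0 ne na.
have x0 := normle_ge0 na.
have : normle (rad t) (fun m => \sum_i (Q i a * e i) m)
 (\sum_(i < k) x * (t ^+ wdeg (al i))^-1 * (t ^+ wdeg (al i) / (2 * k.+1)%:R)).
 apply: normle_sum; first exact: rad_ge0.
 by move=> i; apply: normleM; rewrite ?ne//; [exact: normle_q|exact: rad_ge0].
have -> : \sum_(i < k) x * (t ^+ wdeg (al i))^-1 * (t ^+ wdeg (al i) / (2 * k.+1)%:R)
 = (x / (2 * k.+1)%:R) *+ k.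
 rewrite (eq_bigr (fun=> x / (2 * k.+1)%:R)) ?sumr_const ?card_ord// => i _.
 by rewrite mulrA mulfVK ?gt_eqF ?exprn_gt0.
move=> H l ul; apply: le_trans (_ : _ <= (x / (2 * k.+1)%:R) *+ k) _.
 apply: le_trans (H l ul); apply: ler_sum => m _.
 by rewrite /nxt gcoefN normrN gcoef_sum.
rewrite -[leLHS]mulr_natr -mulrA ler_wpM2l// natrM invfM -mulrA ler_piMr ?invr_ge0 ?ler0n//.
by rewrite mulrC ler_pdivrMr ?ltr0n// mul1r ler_nat.
Qed.

Let conv_series t y (b : nat -> A) (N : mnm -> nat) : 0 < t ->
 (forall j, normle (rad t) (b j) (y * (2%:R^-1) ^+ j)) ->
 convergent (fun m => \sum_(j < N m) b j m).
Proof.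
move=> t0 nb; apply: (@normle_convergent _ _ (rad t) _ (y * 2%:R)); first exact: rad_gt0.
move=> l ul; pose M := \max_(m <- l) N m.
have y0 : 0 <= y by have := normle_ge0 (nb 0%N); rewrite expr0 mulr1.
apply: le_trans (_ : _ <= \sum_(j < M) y * (2%:R^-1) ^+ j) _; last first.
 by rewrite -mulr_sumr ler_wpM2l// sum_half.
apply: le_trans (ler_sum _ (fun (j : 'I_M) _ => nb j l ul)).
rewrite exchange_big /= big_seq [leRHS]big_seq; apply: ler_sum => m ml.
rewrite -mulr_suml ler_wpM2r ?mmap1_ge0//; first exact: rad_ge0.
have NM : (N m <= M)%N by rewrite /M (big_rem m ml) /= leq_maxl.
apply: le_trans (ler_norm_sum _ _ _) _.
rewrite (big_ord_widen _ (fun j => `|b j m|) NM) big_mkcond /=.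
by apply: ler_sum => j _; case: ifP.
Qed.

(** Grauert's division theorem, when the leading monomials are those of strictly
 smallest weight: the tails of the divisors are small compared with their
 leading monomials on a small polydisc with radii t^w, so the step which
 replaces each multiple of a leading monomial by the corresponding tail halves
 the norm; it raises the weight, so the coefficients of the limit are finite
 sums. *)
Theorem germ_division a : exists (c : 'I_k -> A) (r : A),
 a = \sum_i c i * g i + r /\
 forall m, r m != 0 -> forall i, ~~ lem (al i) m.
Proof.
have [t1 t1_gt0 [x nx]] := small a.
have [t2 t2_gt0 ne] := common small_e.
pose t := (t1^-1 + t2^-1)^-1.
have t_gt0 : 0 < t by rewrite invr_gt0 addr_gt0 ?invr_gt0.
have tt1 : t <= t1.
 rewrite -[leRHS]invrK lef_pV2 ?posrE ?addr_gt0 ?invr_gt0//.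
 by rewrite lerDl ltW ?invr_gt0.
have tt2 : t <= t2.
 rewrite -[leRHS]invrK lef_pV2 ?posrE ?addr_gt0 ?invr_gt0//.
 by rewrite lerDr ltW ?invr_gt0.
have {}ne : forall i, normle (rad t) (e i) (t ^+ wdeg (al i) / (2 * k.+1)%:R).
 by apply: ne; rewrite t_gt0.
have {}nx : normle (rad t) a x by apply: nx; rewrite t_gt0.
pose b j := iter j nxt a.
have nb j : normle (rad t) (b j) (x * (2%:R^-1) ^+ j).
 elim: j => [|j IH]; first by rewrite expr0 mulr1.
 by rewrite exprSr mulrA; apply: normle_nxt.
have wb j : wge j (b j).
 by elim: j => [|j IH]; [exact: wge0 | exact: wge_nxt].
have conv_c i : convergent (fun m =>
 \sum_(j < (wdeg m + wdeg (al i)).+1) Q i (b j) m).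
 apply: (@conv_series t (x * (t ^+ wdeg (al i))^-1)
 (fun j => Q i (b j)) (fun m => (wdeg m + wdeg (al i)).+1)) => // j.
 by rewrite mulrAC; apply: normle_q.
have conv_r' : convergent (fun m => \sum_(j < (wdeg m).+1) R (b j) m).
 apply: (@conv_series t x (fun j => R (b j)) (fun m => (wdeg m).+1)) => // j.
 exact: normle_r.
exists (fun i => HoloGerm (conv_c i)), (HoloGerm conv_r'); split; last first.
 move=> m nz i; apply: contra nz => le; rewrite /= big1// => j _.
 rewrite /r_fun /sel; case: pickP => // /(_ i); by rewrite le.
apply: holo_germP => m; pose N := (wdeg m + \max_i wdeg (al i)).+1.
have sumE K : a = \sum_(j < K) (\sum_i Q i (b j) * g i + R (b j)) + b K.
 elim: K => [|K IH]; first by rewrite big_ord0 add0r.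
 by rewrite big_ord_recr -addrA -[b K.+1]/(nxt (b K)) -nxtE.
rewrite {1}(sumE N) !gcoefD.
have -> : b N m = 0.
 by apply: contraTeq (leq_addr (\max_i wdeg (al i)) (wdeg m)) => /wb; rewrite ltnNge.
rewrite addr0 gcoef_sum; under eq_bigr do rewrite gcoefD.
rewrite big_split /=; congr (_ + _); last first.
 rewrite /r_fun.
 have NM : ((wdeg m).+1 <= N)%N by rewrite ltnS leq_addr.
 rewrite (big_ord_widen _ (fun j => if sel m == None then b j m else 0) NM).
 rewrite [RHS]big_mkcond; apply: eq_bigr => j _; case: (ltnP j _) => // mj.
 case: ifP => // _; by apply: contraTeq mj => /wb; rewrite ltnNge negbK.
under eq_bigr do rewrite gcoef_sum.
rewrite exchange_big gcoef_sum; apply: eq_bigr => i _.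
rewrite -gcoef_sum -mulr_suml; apply: eq_coefM => // m' le; rewrite gcoef_sum /= /q_fun.
have NM : ((wdeg m' + wdeg (al i)).+1 <= N)%N.
 rewrite ltnS leq_add//; last exact: (leq_bigmax i).
 by rewrite -(wdegB le) leq_addl.
rewrite [RHS](big_ord_widen _ (fun j => if sel (mnm_add m' (al i)) == Some i
 then b j (mnm_add m' (al i)) else 0) NM).
rewrite [RHS]big_mkcond; apply: eq_bigr => j _; case: (ltnP j _) => // mj.
case: ifP => // _; apply: contraTeq mj => /wb; by rewrite wdegD ltnNge negbK.
Qed.

(** The remainder of a division by one germ is unique. *)
Lemma germ_division_uniq i c r : r = c * g i ->
 (forall m, r m != 0 -> ~~ lem (al i) m) -> c = 0.
Proof.
move=> rE std; apply: holo_germP => m; rewrite gcoef0.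
move: {2}(wdeg m).+1 (ltnSn (wdeg m)) => d; elim: d m => // d IH m.
rewrite ltnS => lt; have [//|nz] := eqVneq (c m) 0.
have : (c * g i) (mnm_add m (al i)) = c m.
 transitivity ((c * gX C (al i)) (mnm_add m (al i)) + (c * e i) (mnm_add m (al i))).
 by rewrite -gcoefD -mulrDr [gX _ _ + _]addrC subrK.
 rewrite gcoefMX lem_addl addmK.
 rewrite (_ : (c * e i) _ = 0) ?addr0//; apply/eqP/negPn/negP.
 move=> /coefM_neq0[m1 [m2 [em nz1 /e_neq0 lt2]]]; case/eqP: nz1; apply: IH.
 have /(congr1 wdeg) := em; rewrite !wdegD => ed.
 by apply: leq_trans lt; move: ed lt2; lia.
rewrite -rE => ce; move: (std (mnm_add m (al i))).
by rewrite ce nz lem_addl => /(_ isT).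
Qed.

End Division.

End Gb.
Import Gb.

(** * Units, leading monomials and substitution *)

Module Gc.
Section Units.
Variables (C : numFieldType) (n : nat).
Local Notation A := (holo_germ C n).

Lemma wdeg1 m : wdeg (fun _ : 'I_n => 1%N) m = mdeg m.
Proof. by rewrite /wdeg mdegE; apply: eq_bigr => i _; rewrite mul1n. Qed.
Lemma germ_unit (a : A) : cst a != 0 -> exists b, a * b = 1.
Proof.
move=> a0; pose g (i : 'I_1) : A := germC n (cst a)^-1 * a.
have [||c [r [e r0]]] := @germ_division C n (fun=> 1%N) (fun=> isT) 1 g
 (fun=> mnm0) _ _ (1 : A).
- by move=> i; rewrite /g gcoefCM mulVf.
- move=> i m _ m0; rewrite !wdeg1 mdeg0 lt0n mdeg_eq0//.
exists (c ord0 * germC n (cst a)^-1); rewrite e big_ord1.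
suff -> : r = 0 by rewrite addr0 /g; ring.
apply: holo_germP => m; rewrite gcoef0; apply/eqP/negPn/negP => /r0 /(_ ord0)/negP.
by apply; apply/mnm_lepP => i; rewrite mnm0E.
Qed.

End Units.

Section Lead.
Variables (C : numFieldType) (n : nat) (w : 'I_n -> nat).
Local Notation A := (holo_germ C n).
Local Notation mnm := (multinom n).

(** The monomial of a nonzero germ which comes first for a total monomial order
 refining the weight; it is multiplicative. *)
Definition lead (a : A) (m : mnm) := a m != 0 /\
 forall m', a m' != 0 -> (wdeg w m < wdeg w m')%N \/
 wdeg w m' = wdeg w m /\ (m <= m')%O.

Lemma lead_exists (a : A) : a != 0 -> exists m, lead a m.
Proof.
move=> a0.
have [m0 am0] : exists m, a m != 0.
 apply: contrapT => /forallNP H; case/eqP: a0; apply: holo_germP => m.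
 by rewrite gcoef0; apply/eqP/negPn/negP => /H.
have exP : exists d, `[< exists2 m, a m != 0 & wdeg w m = d >].
 by exists (wdeg w m0); apply/asboolP; exists m0.
case: (ex_minnP exP) => d /asboolP[m1 am1 dm1] dmin.
have : exists2 m, a m != 0 /\ wdeg w m = d &
 forall m', a m' != 0 -> wdeg w m' = d -> (m <= m')%O.
 move: am1 dm1; elim/(@ltmwf n): m1 => m IH am dm.
 have [[m' [am' dm' lt]]|none] := pselect (exists m', [/\ a m' != 0,
 wdeg w m' = d & (m' < m)%O]); first exact: (IH m').
 exists m => // m' am' dm'; rewrite leNgt; apply/negP => lt.
 by apply: none; exists m'.
move=> [m [am dm] mmin]; exists m; split=> // m' am'.
have : (d <= wdeg w m')%N by apply: dmin; apply/asboolP; exists m'.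
rewrite dm leq_eqVlt => /orP[/eqP e|]; [right|by left].
by split=> //; apply: mmin.
Qed.
Lemma leadM (a b : A) m1 m2 : lead a m1 -> lead b m2 ->
 (a * b) (mnm_add m1 m2) = a m1 * b m2 /\ lead (a * b) (mnm_add m1 m2).
Proof.
move=> [a1 la] [b2 lb].
have aux (p q r s : nat) : (p + q = r + s)%N -> (p < r)%N -> (q <= s)%N -> False by lia.
have cE : (a * b) (mnm_add m1 m2) = a m1 * b m2.
 set M := mnm_add m1 m2; rewrite (gcoefM _ _ (ltnSn (mdeg M))).
 have d1 : (mdeg m1 < (mdeg M).+1)%N by rewrite ltnS lem_mdeg// lem_addr.
 have d2 : (mdeg m2 < (mdeg M).+1)%N by rewrite ltnS lem_mdeg// lem_addl.
 rewrite (bigD1 (BMultinom d1, BMultinom d2)) //= big1 ?addr0// => -[k1 k2] /=.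
 move=> /andP[/eqP em ne].
 have [->|nz1] := eqVneq (a k1) 0; first by rewrite mul0r.
 have [->|nz2] := eqVneq (b k2) 0; first by rewrite mulr0.
 have := congr1 (wdeg w) em; rewrite /M !wdegD => ed.
 have [lt1|[e1 le1]] := la _ nz1.
 have le2 : (wdeg w m2 <= wdeg w k2)%N by case: (lb _ nz2) => [/ltnW|[->]].
 by case: (aux _ _ _ _ ed lt1 le2).
 have [lt2|[e2 le2]] := lb _ nz2; first by
 move: ed; rewrite e1 => /addnI e2; rewrite e2 ltnn in lt2.
 case/eqP: ne; move: le1; rewrite le_eqVlt => /orP[/eqP m1k|lt1].
 have m2k : m2 = k2 by apply: (@addmI n m1); rewrite [RHS]/= {2}m1k.
 by congr pair; apply/val_inj.
 by have := ltmc_le_add lt1 le2; rewrite -em /M ltxx.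
split=> //; split=> [|m']; first by rewrite cE mulf_neq0.
move=> /coefM_neq0[k1 [k2 [-> /la h1 /lb h2]]]; rewrite !wdegD.
case: h1 => [lt1|[e1 le1]].
 left; case: h2 => [/ltnW le2|[-> _]]; first by rewrite -addSn leq_add.
 by rewrite ltn_add2r.
case: h2 => [lt2|[e2 le2]]; first by left; rewrite e1 ltn_add2l.
by right; rewrite e1 e2; split=> //; apply: lem_add.
Qed.

End Lead.

Lemma germ_integral (C : numFieldType) n (a b : holo_germ C n) :
 a * b = 0 -> a = 0 \/ b = 0.
Proof.
move=> ab; have [->|/(lead_exists (fun=> 1%N))[m1 l1]] := eqVneq a 0; first by left.
have [->|/(lead_exists (fun=> 1%N))[m2 l2]] := eqVneq b 0; first by right.
have [cE _] := leadM l1 l2; case: l1 l2 => a1 _ [b2 _].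
by have := mulf_neq0 a1 b2; rewrite -cE ab gcoef0 eqxx.
Qed.

Section Substitution.
Variables (C : numFieldType) (n n' : nat).
Local Notation A := (holo_germ C n).
Local Notation B := (holo_germ C n').
Local Notation one := (fun _ => 1%N).
Implicit Types (a b : A).

Lemma wge_prod (s : 'I_n -> B) (m : multinom n) : (forall i, cst (s i) = 0) ->
 wge one (mdeg m) (mmap1 s m).
Proof.
move=> s0; have s1 i : wge one 1 (s i).
 move=> k; have [->|k0] := eqVneq k mnm0; first by rewrite [s i _]s0 eqxx.
 by rewrite wdeg1 lt0n mdeg_eq0.
have sX i j : wge one j (s i ^+ j).
 by elim: j => [|j IH]; [exact: wge0|rewrite exprS; exact: (@wgeM _ _ _ 1 j)].
rewrite /mmap1 mdegE; apply: (big_ind2 (fun d (x : B) => wge one d x)).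
- exact: wge0.
- by move=> d1 x1 d2 x2; apply: wgeM.
- by move=> i _.
Qed.

Variable s : 'I_n -> B.
Hypothesis s0 : forall i, cst (s i) = 0.

Let ev (p : {mpoly C[n]}) : B := mmap (@germC C n') s p.

Let wge_ev d p : (forall m, (mdeg m < d)%N -> mcoeff m p = 0) -> wge one d (ev p).
Proof.
move=> pd; rewrite /ev /mmap big_seq_cond; under eq_bigr => m do over.
rewrite -big_seq_cond; have H m : m \in msupp p -> (d <= mdeg m)%N.
 by rewrite mcoeff_msupp leqNgt; apply: contraNN => /pd ->.
elim: (msupp p) H => [|m r IH] H; first by rewrite big_nil => k; rewrite gcoef0 eqxx.
rewrite big_cons => k; have [z|/coefM_neq0[k1 [k2 [-> _ nz]]]] :=
 eqVneq ((germC n' (mcoeff m p) * mmap1 s m) k) 0; last first.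
 move=> _; rewrite wdegD; apply: leq_trans (leq_addl _ _).
 by apply: leq_trans (wge_prod s0 nz); apply: H; rewrite mem_head.
rewrite gcoefD z add0r; apply: IH => m' m'r; apply: H.
by rewrite inE m'r orbT.
Qed.

Let ev_jet d d' a k : (mdeg k < d)%N -> (mdeg k < d')%N ->
 ev (jet d a) k = ev (jet d' a) k.
Proof.
move=> kd kd'; apply/eqP; rewrite -subr_eq0; apply/negPn/negP => nz.
have : wge one (mdeg k).+1 (ev (jet d a - jet d' a)).
 apply: wge_ev => m md; rewrite mcoeffB !mcoeff_jet ?subrr//.
 exact: leq_trans kd'.
 exact: leq_trans kd.
by rewrite /ev rmorphB => /(_ k nz); rewrite wdeg1 ltnn.
Qed.

Let sub_fun a (k : multinom n') : C := ev (jet (mdeg k).+1 a) k.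

Let ev_jetE d a k : (mdeg k < d)%N -> sub_fun a k = ev (jet d a) k.
Proof. by move=> kd; apply: ev_jet. Qed.

Let evE d a : ev (jet d a) = \sum_(m : bmultinom n d) germC n' (a m) * mmap1 s m.
Proof.
rewrite /ev /jet raddf_sum; apply: eq_bigr => m _.
by rewrite /= mmapZ mmapX.
Qed.
Lemma normle_mmap1 (t x : C) m : 0 <= t -> (forall i, normle (fun=> t) (s i) x) ->
 normle (fun=> t) (mmap1 s m) (x ^+ mdeg m).
Proof.
move=> t0 ns; have t0' : forall i : 'I_n', 0 <= t by [].
have n1 : normle (fun=> t) (1 : B) 1.
 move=> l ul; apply: le_trans (_ : _ <= \sum_(m <- l) (m == mnm0)%:R) _.
 apply: ler_sum => k _; rewrite gcoef1; case: eqP => [->|]; last by rewrite normr0 mul0r.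
 by rewrite normr1 mul1r mmap11.
 elim: l ul => [|k l IH] /=; first by rewrite big_nil.
 move=> /andP[kl ul]; rewrite big_cons; have [k0|_] := eqVneq k mnm0; last first.
 by rewrite add0r IH.
 rewrite big_seq big1 ?addr0// => k' k'l; case: eqP => // e.
 by rewrite k0 -e k'l in kl.
have nX i j : normle (fun=> t) (s i ^+ j) (x ^+ j).
 by elim: j => [|j IH]; rewrite ?expr0// !exprS; apply: normleM.
rewrite /mmap1 mdegE -prodrXr.
apply: (big_ind2 (fun (y : B) (z : C) => normle (fun=> t) y z)) => //.
by move=> y1 z1 y2 z2 ? ?; apply: normleM.
Qed.

Let small_s x : 0 < x -> exists2 t, 0 < t & forall i, normle (fun=> t) (s i) x.
Proof.
move=> x0.
have H i : exists t0, 0 < t0 /\ forall t, 0 < t <= t0 -> normle (fun=> t) (s i) x.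
 have [t0 [y [t0_gt0 ny]]] := convergent_normle (coef_convergent (s i)).
 have {}ny : normle (fun=> t0) (s i) y by apply: ny => j; rewrite lexx ltW.
 have y0 := normle_ge0 ny; have y1 : 0 < y + 1 by rewrite ltr_wpDl.
 have z0 : 0 < x / (y + 1) * t0 by rewrite mulr_gt0 ?divr_gt0.
 exists ((x / (y + 1) * t0)^-1 + t0^-1)^-1; split.
 by rewrite invr_gt0 addr_gt0 ?invr_gt0.
 move=> t /andP[t_gt0 le_t].
 have ty : t <= x / (y + 1) * t0.
 apply: le_trans le_t _; rewrite -[leRHS]invrK lef_pV2 ?posrE ?addr_gt0 ?invr_gt0//.
 by rewrite lerDl ltW ?invr_gt0.
 have tt : t <= t0.
 apply: le_trans le_t _; rewrite -[leRHS]invrK lef_pV2 ?posrE ?addr_gt0 ?invr_gt0//.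
 by rewrite lerDr ltW ?invr_gt0.
 pose z := t / t0; have zz0 : 0 <= z by rewrite divr_ge0 ?ltW.
 have zz1 : z <= 1 by rewrite ler_pdivrMr ?mul1r.
 move=> l ul; apply: le_trans (_ : _ <= z * y) _; last first.
 apply: le_trans (_ : _ <= x / (y + 1) * y) _.
 by rewrite ler_wpM2r// ler_pdivrMr.
 by rewrite mulrAC ler_pdivrMr// ler_wpM2l ?(ltW x0)// lerDl.
 apply: le_trans (ler_wpM2l zz0 (ny l ul)); rewrite mulr_sumr; apply: ler_sum => k _.
 rewrite mulrCA; have [->|k0] := eqVneq k mnm0.
 by rewrite [s i _]s0 normr0 !mul0r.
 rewrite ler_wpM2l// /mmap1 !prodrXr -!mdegE.
 have -> : t = z * t0 by rewrite mulfVK ?gt_eqF.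
 rewrite exprMn ler_wpM2r ?exprn_ge0 ?(ltW t0_gt0)//.
 rewrite -[leRHS]expr1 ler_wiXn2l//.
 by rewrite lt0n mdeg_eq0.
have inv_ge0 (T : 'I_n -> C) : (forall i, 0 < T i) -> forall i, 0 <= (T i)^-1.
 by move=> T0 i; rewrite invr_ge0 ltW.
have [T HT] := choice H.
have T0 i : 0 < T i by have [] := HT i.
have p : 0 < 1 + \sum_i (T i)^-1 by rewrite ltr_pwDl// sumr_ge0// => i _; apply: inv_ge0.
exists (1 + \sum_i (T i)^-1)^-1; first by rewrite invr_gt0.
move=> i; have [_] := HT i; apply; rewrite invr_gt0 p/=.
rewrite -[leRHS]invrK lef_pV2 ?posrE ?invr_gt0//.
rewrite (bigD1 i)//= addrCA lerDl addr_ge0 ?sumr_ge0// => j _; exact: inv_ge0.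
Qed.

Let conv_sub a : convergent (sub_fun a).
Proof.
have [x [y [x0 ny]]] := convergent_normle (coef_convergent a).
have {}ny : normle (fun=> x) a y by apply: ny => j; rewrite lexx ltW.
have [t t0 nt] := small_s x0.
apply: (@normle_convergent _ _ (fun=> t) _ y) => //.
move=> l ul; pose d := (\max_(m <- l) mdeg m).+1.
have ld k : k \in l -> (mdeg k < d)%N.
 by move=> ml; rewrite ltnS (big_rem k ml) /= leq_maxl.
pose E := enum {: bmultinom n d}.
have uE : uniq [seq val k | k <- E] by rewrite map_inj_uniq ?enum_uniq//; apply: val_inj.
have ba : \sum_(k : bmultinom n d) `|a k| * x ^+ mdeg k <= y.
 have := ny _ uE; rewrite big_map big_enum; apply: le_trans.
 by apply: ler_sum => k _; rewrite /mmap1 prodrXr -mdegE.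
apply: le_trans ba; apply: le_trans (_ : _ <= \sum_(k <- l)
 \sum_(m : bmultinom n d) `|a m| * (`|mmap1 s m k| * mmap1 (fun=> t) k)) _.
 rewrite big_seq [leRHS]big_seq; apply: ler_sum => k kl.
 rewrite (ev_jetE _ (ld _ kl)) evE gcoef_sum.
 apply: le_trans (ler_wpM2r _ (ler_norm_sum _ _ _)) _.
 by rewrite mmap1_ge0// => i; rewrite ltW.
 rewrite mulr_suml; apply: ler_sum => m _.
 by rewrite gcoefCM normrM mulrA.
rewrite exchange_big; apply: ler_sum => m _.
rewrite -mulr_sumr ler_wpM2l//; apply: normle_mmap1 => //; exact: ltW.
Qed.

Definition germ_subst a : B := HoloGerm (conv_sub a).

Let subE d a k : (mdeg k < d)%N -> germ_subst a k = ev (jet d a) k.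
Proof. exact: ev_jetE. Qed.
Lemma germ_subst_mpoly (p : {mpoly C[n]}) :
 germ_subst (germ_of_mpoly p) = mmap (@germC C n') s p.
Proof.
apply: holo_germP => k; rewrite (subE _ (ltnSn _)).
apply/eqP; rewrite -subr_eq0 -gcoefB -rmorphB; apply/negPn/negP => nz.
suff : wge one (mdeg k).+1 (ev (jet (mdeg k).+1 (germ_of_mpoly p) - p)).
 by move=> /(_ k nz); rewrite wdeg1 ltnn.
by apply: wge_ev => m md; rewrite mcoeffB mcoeff_jet ?subrr.
Qed.
Lemma germ_substC c : germ_subst (germC n c) = germC n' c.
Proof. by rewrite germ_subst_mpoly mmapC. Qed.
Lemma germ_substX i : germ_subst (gX C (mnm1 i)) = s i.
Proof. by rewrite germ_subst_mpoly mmapX mmap1U. Qed.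
Lemma germ_subst_is_zmod : zmod_morphism germ_subst.
Proof.
move=> a b; apply: holo_germP => k; rewrite gcoefB !(subE _ (ltnSn _)).
rewrite -gcoefB -rmorphB; congr (ev _ _).
by rewrite /jet -sumrB; apply: eq_bigr => m _; rewrite gcoefB scalerBl.
Qed.
Lemma germ_subst_is_monoid : monoid_morphism germ_subst.
Proof.
split=> [|a b]; first by rewrite -(rmorph1 (@germC C n)) germ_substC rmorph1.
apply: holo_germP => k; pose d := (mdeg k).+1.
have -> : (germ_subst a * germ_subst b) k = (ev (jet d a) * ev (jet d b)) k.
 by apply: eq_coefM => k' /lem_mdeg le; apply: subE; rewrite ltnS.
rewrite (subE _ (ltnSn _)) -rmorphM.
apply/eqP; rewrite -subr_eq0 -gcoefB -rmorphB; apply/negPn/negP => nz.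
suff : wge one d (ev (jet d (a * b) - jet d a * jet d b)).
 by move=> /(_ k nz); rewrite wdeg1 ltnn.
by apply: wge_ev => m md; rewrite mcoeffB mcoeff_jet// (coefM_jet _ _ md) subrr.
Qed.

HB.instance Definition _ := GRing.isZmodMorphism.Build A B
 germ_subst germ_subst_is_zmod.
HB.instance Definition _ := GRing.isMonoidMorphism.Build A B
 germ_subst germ_subst_is_monoid.

Lemma germ_substD a b : germ_subst (a + b) = germ_subst a + germ_subst b.
Proof. exact: rmorphD. Qed.
Lemma germ_substM a b : germ_subst (a * b) = germ_subst a * germ_subst b.
Proof. exact: rmorphM. Qed.
Lemma wge_subst d a : wge one d a -> wge one d (germ_subst a).
Proof.
move=> da k; rewrite (subE _ (ltnSn _)); set p := jet _ _.
have [] := leqP d (mdeg k); first by rewrite wdeg1.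
move=> lt nz; have : wge one d (ev p).
 apply: wge_ev => m md; have [lt'|ge] := ltnP (mdeg m) (mdeg k).+1.
 rewrite mcoeff_jet//; apply/eqP/negPn/negP => /da; rewrite wdeg1.
 by rewrite leqNgt md.
 rewrite /p /jet raddf_sum big1//= => m' _.
 rewrite mcoeffZ mcoeffX; case: eqP => [e|]; last by rewrite mulr0.
 by have := bmdeg m'; rewrite e ltnNge ge.
by move=> /(_ k nz).
Qed.
Lemma cst_subst a : cst (germ_subst a) = cst a.
Proof.
have -> : germ_subst a = germ_subst (a - germC n (cst a)) + germC n' (cst a).
 by rewrite -germ_substC -rmorphD subrK.
suff c0 : cst (germ_subst (a - germC n (cst a))) = 0.
 have cD (x y : B) : cst (x + y) = cst x + cst y by [].
 by rewrite cD c0 add0r /cst gcoefC eqxx mulr1.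
apply/eqP/negPn/negP => nz.
have : wge one 1 (a - germC n (cst a)).
 move=> m; have [->|m0] := eqVneq m mnm0; last by rewrite wdeg1 lt0n mdeg_eq0.
 by rewrite gcoefB gcoefC eqxx mulr1 subrr eqxx.
by move=> /wge_subst /(_ _ nz); rewrite wdeg1 mdeg0.
Qed.

End Substitution.

Section Composition.
Variables (C : numFieldType) (n n1 n2 : nat).
Variables (s : 'I_n -> holo_germ C n1) (s0 : forall i, cst (s i) = 0).
Variables (u : 'I_n1 -> holo_germ C n2) (u0 : forall i, cst (u i) = 0).
Local Notation one := (fun _ => 1%N).

Lemma subst_cst i : cst (germ_subst u0 (s i)) = 0.
Proof. by rewrite cst_subst. Qed.

(* A germ is the sum of a polynomial and a germ of high order. *)
Lemma germ_jet d (a : holo_germ C n) :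
 exists2 b, a = germ_of_mpoly (jet d a) + b & wge one d b.
Proof.
exists (a - germ_of_mpoly (jet d a)); first by rewrite addrC subrK.
move=> m; have [lt|] := ltnP (mdeg m) d; last by rewrite wdeg1.
by rewrite gcoefB /= mcoeff_jet// subrr eqxx.
Qed.
Lemma germ_subst_comp (a : holo_germ C n) :
 germ_subst u0 (germ_subst s0 a) = germ_subst subst_cst a.
Proof.
apply: holo_germP => k; have [b -> bd] := germ_jet (mdeg k).+1 a.
rewrite !germ_substD !gcoefD.
have low n3 n4 (v : 'I_n3 -> holo_germ C n4) (v0 : forall i, cst (v i) = 0) c
 (k' : multinom n4) : mdeg k' = mdeg k -> wge one (mdeg k).+1 c ->
 germ_subst v0 c k' = 0.
 move=> ek cd; apply/eqP/negPn/negP => /(@wge_subst _ _ _ _ v0 _ _ cd).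
 by rewrite wdeg1 ek ltnn.
congr (_ + _); last by rewrite !low//; apply: wge_subst.
rewrite !germ_subst_mpoly; congr (coef _ _).
rewrite /mmap rmorph_sum; apply: eq_bigr => m _ /=.
rewrite germ_substM germ_substC; congr (_ * _).
by rewrite /mmap1 rmorph_prod; apply: eq_bigr => i _; rewrite rmorphXn.
Qed.

End Composition.

Section SubstitutionExt.
Variables (C : numFieldType) (n n' : nat).
Local Notation A := (holo_germ C n).
Local Notation B := (holo_germ C n').

Lemma coef_subst (s : 'I_n -> B) (s0 : forall i, cst (s i) = 0) a d k :
 (mdeg k < d)%N ->
 germ_subst s0 a k = \sum_(m : bmultinom n d) a m * mmap1 s m k.
Proof.
move=> kd; have [b ab bd] := germ_jet d a; rewrite {1}ab germ_substD gcoefD.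
rewrite [X in _ + X = _](_ : _ = 0) ?addr0; last first.
 apply/eqP/negPn/negP => /(@wge_subst _ _ _ _ s0 _ _ bd).
 by rewrite wdeg1 leqNgt kd.
rewrite germ_subst_mpoly /jet raddf_sum gcoef_sum; apply: eq_bigr => m _.
by rewrite /= mmapZ mmapX gcoefCM.
Qed.
Lemma eq_germ_subst (s s' : 'I_n -> B) (s0 : forall i, cst (s i) = 0)
 (s0' : forall i, cst (s' i) = 0) (a : A) :
 (forall m, a m != 0 -> mmap1 s m = mmap1 s' m) ->
 germ_subst s0 a = germ_subst s0' a.
Proof.
move=> ss; apply: holo_germP => k; rewrite !(coef_subst _ _ (ltnSn _)).
apply: eq_bigr => m _; have [->|/ss->//] := eqVneq (a m) 0.
by rewrite !mul0r.
Qed.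

End SubstitutionExt.

(** Nakayama's lemma for finitely generated modules, in matrix form. *)
Lemma germ_unitmx (C : numFieldType) n k (M : 'M[holo_germ C n]_k) :
 (forall i j, cst (M i j) = (i == j)%:R) -> exists M', M' *m M = 1%:M.
Proof.
move=> M1; have [|v dv] := @germ_unit C n (\det M).
 rewrite -det_map_mx /= (_ : map_mx _ M = 1%:M) ?det1 ?oner_neq0//.
 by apply/matrixP => i j; rewrite !mxE M1.
exists (v *: \adj M); rewrite -scalemxAl mul_adj_mx scale_scalar_mx.
by rewrite mulrC dv.
Qed.

End Gc.
Import Gc.

(** * Arcs and implicit functions *)

Module Gd.
Section OneVariable.
Variable C : numFieldType.
Local Notation D := (holo_germ C 1).

Definition mk (k : nat) : multinom 1 := mnm_muln (mnm1 ord0) k.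
Definition sv : D := gX C (mnm1 ord0).

Lemma mkE k i : mk k i = k.
Proof. by rewrite mulmnE mnm1E (ord1 i) eqxx mul1n. Qed.
Lemma mdeg_mk k : mdeg (mk k) = k.
Proof. by rewrite mdegE big_ord1 mkE. Qed.
Lemma mk_surj (m : multinom 1) : m = mk (mdeg m).
Proof. by apply/mnmP => i; rewrite mkE mdegE big_ord1 ord1. Qed.
Lemma mk_inj : injective mk.
Proof. by move=> i j /(congr1 (@mdeg 1)); rewrite !mdeg_mk. Qed.
Lemma lem_mk i j : lem (mk i) (mk j) = (i <= j)%N.
Proof.
apply/mnm_lepP/idP => [/(_ ord0)|le l]; by rewrite !mkE.
Qed.
Lemma mkB i j : mnm_sub (mk i) (mk j) = mk (i - j).
Proof. by apply/mnmP => l; rewrite mnmBE !mkE. Qed.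
Lemma gXD n (m1 m2 : multinom n) : gX C (mnm_add m1 m2) = gX C m1 * gX C m2.
Proof. by rewrite /gX mpolyXD rmorphM. Qed.
Lemma sv_exp k : sv ^+ k = gX C (mk k).
Proof.
elim: k => [|k IH]; first by rewrite expr0 /mk mulm0n /gX mpolyX0 rmorph1.
by rewrite exprS IH -gXD /mk mulmS.
Qed.

(** Divisibility by a power of the coordinate, that is, a lower bound on the order
 of vanishing. *)
Definition dvs k (d : D) := exists d', d = sv ^+ k * d'.

Lemma dvsP k (d : D) : dvs k d <-> forall i, (i < k)%N -> d (mk i) = 0.
Proof.
split=> [[d' ->] i ik|H].
 by rewrite mulrC sv_exp gcoefMX lem_mk leqNgt ik.
have [||c [r [e r0]]] := @germ_division C 1 (fun=> 1%N) (fun=> isT) 1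
 (fun=> sv ^+ k) (fun=> mk k) _ _ d.
- by move=> i; rewrite sv_exp coef_gX eqxx.
- by move=> i m; rewrite sv_exp coef_gX; have [<-|_] := eqVneq (mk k) m; rewrite /= ?eqxx.
exists (c ord0); rewrite e big_ord1 mulrC.
suff -> : r = 0 by rewrite addr0.
apply: holo_germP => m; rewrite gcoef0; apply/eqP/negPn/negP => nz.
have := r0 m nz ord0; rewrite (mk_surj m) lem_mk -ltnNge => lt.
case/eqP: nz; rewrite (mk_surj m); have := H _ lt.
by rewrite {1}e big_ord1 gcoefD sv_exp gcoefMX lem_mk leqNgt lt add0r.
Qed.
Lemma dvsD k d1 d2 : dvs k d1 -> dvs k d2 -> dvs k (d1 + d2).
Proof. by move=> [a ->] [b ->]; exists (a + b); rewrite mulrDr. Qed.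
Lemma dvsMr k d1 d2 : dvs k d2 -> dvs k (d1 * d2).
Proof. by move=> [b ->]; exists (d1 * b); rewrite mulrCA. Qed.
Lemma dvsMl k d1 d2 : dvs k d1 -> dvs k (d1 * d2).
Proof. by move=> d1k; rewrite mulrC; apply: dvsMr. Qed.
Lemma dvs0 k : dvs k 0. Proof. by exists 0; rewrite mulr0. Qed.
Lemma dvsN k d : dvs k d -> dvs k (- d).
Proof. by rewrite -mulN1r; apply: dvsMr. Qed.
Lemma dvsM k l d1 d2 : dvs k d1 -> dvs l d2 -> dvs (k + l) (d1 * d2).
Proof. by move=> [a ->] [b ->]; exists (a * b); rewrite exprD; ring. Qed.
Lemma dvsX k l d : dvs k d -> dvs (k * l) (d ^+ l).
Proof.
by move=> dk; elim: l => [|l IH]; [rewrite muln0; exists 1; rewrite !expr0 mulr1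
 |rewrite mulnS exprS; apply: dvsM].
Qed.
Lemma dvsW k l d : (l <= k)%N -> dvs k d -> dvs l d.
Proof.
by move=> lk [a ->]; exists (sv ^+ (k - l) * a); rewrite mulrA -exprD subnKC.
Qed.
Lemma dvs_any d : dvs 0 d. Proof. by exists d; rewrite expr0 mul1r. Qed.
Lemma dvs_cst d : dvs 1 d <-> cst d = 0.
Proof.
by rewrite dvsP; split=> [/(_ 0%N isT)//|d0 i]; rewrite ltnS leqn0 => /eqP ->.
Qed.
Lemma sv_neq0 k : sv ^+ k <> 0.
Proof.
move=> /(congr1 (fun d : D => d (mk k))); rewrite sv_exp coef_gX eqxx gcoef0.
by move/eqP; rewrite oner_eq0.
Qed.
Lemma germ_mulfI n (a b c : holo_germ C n) : a <> 0 -> a * b = a * c -> b = c.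
Proof.
move=> a0 /eqP; rewrite -subr_eq0 -mulrBr => /eqP/germ_integral[//|/eqP].
by rewrite subr_eq0 => /eqP.
Qed.
Lemma dvs_svM k l d : dvs (k + l) (sv ^+ k * d) -> dvs l d.
Proof.
by move=> [a]; rewrite exprD -mulrA => /(germ_mulfI (@sv_neq0 k)) ->; exists a.
Qed.
Lemma cst_sv : cst sv = 0.
Proof. by apply/dvs_cst; exists 1; rewrite expr1 mulr1. Qed.

(** The order of vanishing. *)
Definition ord_eq k (d : D) := exists2 u, cst u <> 0 & d = sv ^+ k * u.

Lemma ord_exists d : d <> 0 -> exists k, ord_eq k d.
Proof.
move=> d0; have exk : exists k, d (mk k) != 0.
 apply: contrapT => /forallNP H; apply: d0; apply: holo_germP => m.
 by rewrite gcoef0 (mk_surj m); apply/eqP/negPn/negP => /H.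
case: (ex_minnP exk) => k dk kmin; exists k.
have [d' dE] : dvs k d.
 apply/dvsP => i ik; apply/eqP/negPn/negP => /kmin; by rewrite leqNgt ik.
exists d' => //; apply/eqP; move: dk; rewrite dE mulrC sv_exp gcoefMX lem_mk leqnn mkB subnn.
by rewrite /mk mulm0n.
Qed.
Lemma ord_dvs k d : ord_eq k d -> dvs k d.
Proof. by move=> [u _ ->]; exists u. Qed.
Lemma ord_Ndvs k d : ord_eq k d -> ~ dvs k.+1 d.
Proof.
by move=> [u u0 ->]; rewrite -addn1 => /dvs_svM/dvs_cst.
Qed.
Lemma ord_neq0 k d : ord_eq k d -> d <> 0.
Proof. by move=> /ord_Ndvs H d0; apply: H; rewrite d0; exact: dvs0. Qed.
Lemma ordM k l d1 d2 : ord_eq k d1 -> ord_eq l d2 -> ord_eq (k + l) (d1 * d2).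
Proof.
move=> [u u0 ->] [v v0 ->]; exists (u * v); last by rewrite exprD; ring.
by rewrite cstM => /eqP; rewrite mulf_eq0 => /orP[/eqP|/eqP].
Qed.
Lemma ord_one : ord_eq 0 1.
Proof. by exists 1; rewrite ?expr0 ?mulr1// cst1; apply/eqP/oner_neq0. Qed.
Lemma ordX k l d : ord_eq k d -> ord_eq (k * l) (d ^+ l).
Proof.
move=> dk; elim: l => [|l IH]; first by rewrite muln0 expr0; exact: ord_one.
by rewrite mulnS exprS; apply: ordM.
Qed.
Lemma ord_inj k l d : ord_eq k d -> ord_eq l d -> k = l.
Proof.
move=> dk dl; apply/eqP; rewrite eqn_leq; apply/andP; split; rewrite leqNgt; apply/negP => lt.
 by apply: (ord_Ndvs dl); apply: dvsW (ord_dvs dk).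
by apply: (ord_Ndvs dk); apply: dvsW (ord_dvs dl).
Qed.
Lemma ordB k d1 d2 : ord_eq k d1 -> dvs k.+1 d2 -> ord_eq k (d1 - d2).
Proof.
move=> [u u0 ->] [v ->]; exists (u - sv * v); last by rewrite exprSr; ring.
by rewrite cstB cstM cst_sv mul0r subr0.
Qed.
Lemma ord_div k d1 d2 : ord_eq k d1 -> dvs k d2 -> exists d, d2 = d1 * d.
Proof.
move=> [u /eqP/germ_unit[v uv] ->] [a ->]; exists (v * a).
by rewrite mulrA -[sv ^+ k * u * v]mulrA uv mulr1.
Qed.
Lemma ord_sv k : ord_eq k (sv ^+ k).
Proof. by exists 1; rewrite ?mulr1// cst1; apply/eqP/oner_neq0. Qed.

End OneVariable.

Section ImplicitFunctions.
Variables (C : numFieldType) (k : nat).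
Local Notation D := (holo_germ C 1).
Local Notation B := (holo_germ C k.+1).
Local Notation vx i := (mnm1 (lift ord0 i) : multinom k.+1).

Lemma coef1M n (i : 'I_n) (a b : holo_germ C n) :
 (a * b) (mnm1 i) = cst a * b (mnm1 i) + a (mnm1 i) * cst b.
Proof.
rewrite (gcoefM _ _ (_ : _ < 2)%N) ?mdeg1//.
have d0 : (mdeg (@mnm0 n) < 2)%N by rewrite mdeg0.
have d1 : (mdeg (@mnm1 n i) < 2)%N by rewrite mdeg1.
rewrite (bigD1 (BMultinom d0, BMultinom d1)) /= ?add0m//.
rewrite (bigD1 (BMultinom d1, BMultinom d0)) /=; last first.
 rewrite addm0 eqxx/=; apply/eqP => /(congr1 (fun p => mdeg (val p.1))) /=.
 by rewrite mdeg1 mdeg0.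
rewrite big1 ?addr0// => -[k1 k2] /= /andP[/andP[/eqP em n1] n2].
have := congr1 (@mdeg n) em; rewrite mdegD mdeg1.
case e1 : (mdeg k1) => [|[|//]]; case e2 : (mdeg k2) => [|[|//]]// _.
 case/eqP: n1; move/eqP: e1; rewrite mdeg_eq0 => /eqP e1; congr pair; apply/val_inj => //=.
 by rewrite em e1 add0m.
case/eqP: n2; move/eqP: e2; rewrite mdeg_eq0 => /eqP e2; congr pair; apply/val_inj => //=.
by rewrite em e2 addm0.
Qed.

Definition arc_sub (r : 'I_k -> D) (i : 'I_k.+1) : D :=
 if unlift ord0 i is Some j then r j else sv C.

Lemma arc_sub0 (r : 'I_k -> D) : (forall i, cst (r i) = 0) ->
 forall i, cst (arc_sub r i) = 0.
Proof. by move=> r0 i; rewrite /arc_sub; case: unliftP => [j|] _ //; exact: cst_sv. Qed.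

(** The implicit function theorem: dividing the unknowns by the equations leaves
 remainders in the parameter alone, which are the solution because the matrix
 of the quotients is invertible. *)
Theorem implicit_functions (g : 'I_k -> B) : (forall i, cst (g i) = 0) ->
 (\matrix_(i, j) g i (vx j)) \in unitmx ->
 exists (r : 'I_k -> D) (r0 : forall i, cst (r i) = 0),
 forall i, germ_subst (arc_sub0 r0) (g i) = 0.
Proof.
set J := \matrix_(i, j) _ => g0 Ju.
pose g' i := \sum_j germC k.+1 (invmx J i j) * g j.
have g'0 i : cst (g' i) = 0.
 by rewrite /g' cst_sum big1// => j _; rewrite cstM g0 mulr0.
have g'1 i j : g' i (vx j) = (i == j)%:R.
 have := congr1 (fun M : 'M_k => M i j) (mulVmx Ju); rewrite !mxE => <-.
 by rewrite /g' gcoef_sum; apply: eq_bigr => l _; rewrite gcoefCM mxE.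
pose w (i : 'I_k.+1) := if i == ord0 then 2%N else 1%N.
have w0 i : (0 < w i)%N by rewrite /w; case: ifP.
have wv i : wdeg w (vx i) = 1%N.
 rewrite /wdeg (bigD1 (lift ord0 i))//= mnm1E eqxx /w /= big1// => j ji.
 by rewrite mnm1E [lift _ _ == j]eq_sym (negPf ji) muln0.
have wle m : (wdeg w m <= 1)%N -> m = mnm0 \/ exists i, m = vx i.
 have le : (mdeg m <= wdeg w m)%N.
 by rewrite mdegE /wdeg leq_sum// => i _; rewrite leq_pmull.
 move=> w1; have := leq_trans le w1; case e : (mdeg m) => [|[|//]] _.
 by left; apply/eqP; rewrite -mdeg_eq0 e.
 right; move/eqP: e => /mdeg1P[i /eqP mi]; case: (unliftP ord0 i) => [j ij|i0].
 by exists j; rewrite mi ij.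
 move: w1; rewrite mi i0 /wdeg (bigD1 ord0)//= mnm1E eqxx /w /=.
 by rewrite ltnNge leq_addr.
have tail i m : g' i m != 0 -> m != vx i -> (wdeg w (vx i) < wdeg w m)%N.
 rewrite wv ltnNge => nz ne; apply/negP => /wle[e|[j e]].
 by move: nz; rewrite e [g' i _]g'0 eqxx.
 by move: nz ne; rewrite e g'1; have [->|_] := eqVneq i j; rewrite eqxx.
have lead1 i : g' i (vx i) = 1 by rewrite g'1 eqxx.
have div a := germ_division w0 lead1 tail a.
have {div} H i : exists c : 'I_k -> B, exists r : B,
 gX C (vx i) = \sum_j c j * g' j + r /\
 forall m, r m != 0 -> forall j, ~~ lem (vx j) m by apply: div.
have [c Hc] := choice H; have [r Hr] := choice Hc.
have rstd i m : r i m != 0 -> forall j, m (lift ord0 j) = 0%N.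
 move=> nz j; have [_ /(_ m nz j)] := Hr i.
 by rewrite lep1mP negbK => /eqP.
have rc i : cst (r i) = 0.
 have [/(congr1 (@cst C _)) e _] := Hr i; move: e.
 rewrite cstD cst_sum big1 => [|j _]; last by rewrite cstM g'0 mulr0.
 by rewrite add0r => <-; rewrite /cst coef_gX mnm1_eq0.
have cc i j : cst (c i j) = (i == j)%:R.
 have [/(congr1 (fun a : B => a (vx j))) e _] := Hr i; move: e.
 rewrite gcoefD gcoef_sum coef_gX eq_mnm1 (inj_eq lift_inj) => ->.
 rewrite [X in _ + X](_ : _ = 0) ?addr0.
 under eq_bigr do rewrite coef1M g'1 g'0 mulr0 addr0.
 rewrite (bigD1 j)//= eqxx mulr1 big1 ?addr0// => l lj.
 by rewrite (negPf lj) mulr0.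
 apply/eqP/negPn/negP => /rstd /(_ j); by rewrite mnm1E eqxx.
have zero0 : forall i : 'I_k, cst ((fun _ : 'I_k => 0 : D) i) = 0.
 by move=> _; rewrite cst0.
pose rho i : D := germ_subst (arc_sub0 (r := fun _ : 'I_k => 0) zero0) (r i).
have rho0 i : cst (rho i) = 0 by rewrite cst_subst rc.
exists rho, rho0; set S := germ_subst (arc_sub0 rho0).
have SD a b : S (a + b) = S a + S b by exact: germ_substD.
have SM a b : S (a * b) = S a * S b by exact: germ_substM.
have Ssum (F : 'I_k -> B) : S (\sum_j F j) = \sum_j S (F j) by exact: rmorph_sum.
have Sr i : S (r i) = rho i.
 apply: eq_germ_subst => m /rstd m0; rewrite /mmap1; apply: eq_bigr => l _.
 rewrite /arc_sub; case: unliftP => [j lj|//]; by rewrite lj m0 !expr0.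
have Sv i : S (gX C (vx i)) = rho i by rewrite /S germ_substX /arc_sub liftK.
have [M' M'1] : exists M', M' *m (\matrix_(i, j) S (c i j)) = 1%:M.
 by apply: germ_unitmx => i j; rewrite mxE cst_subst cc.
have Sg' j : S (g' j) = 0.
 have : (\matrix_(i, j) S (c i j)) *m (\col_j S (g' j)) = 0.
 apply/matrixP => i l; rewrite !mxE; under eq_bigr do rewrite !mxE.
 have [/(congr1 S) e _] := Hr i; move: e.
 rewrite Sv SD Sr -{1}[rho i]add0r => /addIr; rewrite Ssum => e; rewrite [RHS]e.
 by apply: eq_bigr => j' _; rewrite SM.
 move=> /(congr1 (mulmx M')); rewrite mulmxA M'1 mul1mx mulmx0.
 by move=> /(congr1 (fun M : 'cV_k => M j ord0)); rewrite !mxE.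
move=> i.
have -> : g i = \sum_j germC k.+1 (J i j) * g' j.
 rewrite /g'; under eq_bigr do rewrite mulr_sumr.
 rewrite exchange_big /= -[LHS]mul1r.
 transitivity (\sum_l germC k.+1 ((1%:M : 'M[C]_k) i l) * g l).
 rewrite (bigD1 i)//= mxE eqxx rmorph1 big1 ?addr0// => l li.
 by rewrite mxE eq_sym (negPf li) rmorph0 mul0r.
 apply: eq_bigr => l _; rewrite -(mulmxV Ju) mxE rmorph_sum mulr_suml.
 by apply: eq_bigr => j _; rewrite rmorphM mulrA.
by rewrite -/S Ssum big1// => j _; rewrite SM Sg' mulr0.
Qed.

End ImplicitFunctions.

End Gd.
Import Gd.

(** * Conductors and multiplicities of arcs *)

Module Ge.
Section Conductor.
Variables (C : numFieldType) (n : nat).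
Local Notation A := (holo_germ C n).
Local Notation D := (holo_germ C 1).
Variables (X : 'I_n -> D) (X0 : forall i, cst (X i) = 0).
Local Notation ga := (germ_subst X0).

Lemma arcD a b : ga (a + b) = ga a + ga b. Proof. exact: germ_substD. Qed.
Lemma arcM a b : ga (a * b) = ga a * ga b. Proof. exact: germ_substM. Qed.
Lemma arcB a b : ga (a - b) = ga a - ga b. Proof. exact: rmorphB. Qed.
Lemma arcX a k : ga (a ^+ k) = ga a ^+ k. Proof. exact: rmorphXn. Qed.
Lemma arc0 : ga 0 = 0. Proof. exact: rmorph0. Qed.
Lemma arc1 : ga 1 = 1. Proof. exact: rmorph1. Qed.
Lemma arc_sum I (r : seq I) (P : pred I) (F : I -> A) :
 ga (\sum_(i <- r | P i) F i) = \sum_(i <- r | P i) ga (F i).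
Proof. exact: rmorph_sum. Qed.
Lemma arc_prod I (r : seq I) (P : pred I) (F : I -> A) :
 ga (\prod_(i <- r | P i) F i) = \prod_(i <- r | P i) ga (F i).
Proof. exact: rmorph_prod. Qed.

Variables (i0 : 'I_n) (e : nat).
Hypothesis e_gt0 : (0 < e)%N.
Hypothesis Xi0 : X i0 = sv C ^+ e.

Let x : A := gX C (mnm1 i0).

Let x0 (i : 'I_1) : cst x = 0.
Proof. by rewrite /x cst_gX mnm1_eq0. Qed.
Let iota := germ_subst (s := fun _ : 'I_1 => x) x0.
Let sig (b : D) : D := ga (iota b).

Let coef_sig b k : sig b (mk k) = if (e %| k)%N then b (mk (k %/ e)) else 0.
Proof.
rewrite /sig germ_subst_comp.
have E (m : multinom 1) : mmap1 (fun _ : 'I_1 => ga x) m = gX C (mk (e * mdeg m)).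
 rewrite /mmap1 big_ord1 /x germ_substX Xi0 -exprM sv_exp mdegE big_ord1//.
rewrite (coef_subst _ _ (_ : _ < k.+1)%N) ?mdeg_mk//.
under eq_bigr do rewrite E coef_gX (inj_eq (@mk_inj)).
case: ifP => [/dvdnP[j ->]|ek]; last first.
 rewrite big1// => m _; case: eqP => [ek'|]; last by rewrite mulr0.
 by rewrite -ek' dvdn_mulr in ek.
rewrite mulnK//; have jk : (mdeg (mk j) < (j * e).+1)%N.
 by rewrite mdeg_mk ltnS leq_pmulr.
rewrite (bigD1 (BMultinom jk))//= big1 ?addr0 => [|m mk'].
 by rewrite mdeg_mk mulnC eqxx mulr1.
case: eqP => [/eqP|]; last by rewrite mulr0.
rewrite mulnC eqn_pmul2r// => /eqP em; case/eqP: mk'; apply/val_inj => /=.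
by rewrite [LHS]mk_surj em.
Qed.

(* The ring of convergent power series is free over the series in s^e. *)
Let decomp (d : D) : exists b : 'I_e -> D, d = \sum_(l < e) sv C ^+ l * sig (b l).
Proof.
have [M [r [r0 Hd]]] := coef_convergent d.
have M0 := convergent_ge0 Hd.
have conv (l : 'I_e) : convergent (fun m : multinom 1 => d (mk (l + e * mdeg m))).
 exists (M * r ^+ l), (r ^+ e); split=> [|m]; first by rewrite exprn_gt0.
 by apply: le_trans (Hd _) _; rewrite mdeg_mk exprD exprM mulrA.
exists (fun l => HoloGerm (conv l)); apply: holo_germP => m.
rewrite (mk_surj m) gcoef_sum; set k := mdeg m.
under eq_bigr => l _ do rewrite mulrC sv_exp gcoefMX lem_mk mkB coef_sig.
have lt : (k %% e < e)%N by rewrite ltn_mod.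
rewrite (bigD1 (Ordinal lt)) //= leq_mod.
have -> : (k - k %% e)%N = (k %/ e * e)%N by rewrite {1}(divn_eq k e) addnK.
rewrite dvdn_mull// mulnK// mdeg_mk mulnC addnC -divn_eq big1 ?addr0//.
move=> l ll; case: ifP => // lk; case: ifP => // el; case/eqP: ll; apply/val_inj => /=.
move: el; rewrite -eqn_mod_dvd// => /eqP ->; by rewrite modn_small.
Qed.

Variables (z : 'I_e -> A) (kk : 'I_e -> nat).
Hypothesis zk : forall i, ord_eq (kk i) (ga (z i)).
Hypothesis kmod : forall i, kk i = i %[mod e].

Let c := (\sum_i kk i)%N.

Let arcC (y : C) : ga (germC n y) = germC 1 y. Proof. exact: germ_substC. Qed.

Let step m d : (c <= m)%N -> dvs m d -> exists a, dvs m.+1 (d - ga a).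
Proof.
move=> cm [d' ->].
have lt : (m %% e < e)%N by rewrite ltn_mod.
pose i := Ordinal lt; have km : (kk i <= m)%N.
 by apply: leq_trans cm; rewrite /c (bigD1 i)//= leq_addr.
have /dvdnP[q mq] : (e %| m - kk i)%N by rewrite -eqn_mod_dvd// kmod modn_mod.
have [u /eqP u0 zu] := zk i.
exists (germC n (cst d' / cst u) * (x ^+ q * z i)).
rewrite !arcM arcC arcX germ_substX Xi0 -exprM zu mulnC -mq.
have [v dv] : dvs 1 (d' - germC 1 (cst d' / cst u) * u).
 by apply/dvs_cst; rewrite cstB cstM cstC divfK// subrr.
exists v; rewrite exprSr -mulrA -[sv C]expr1 -dv -{1}(subnK km) exprD.
by rewrite -{3}(subnK km) exprD; ring.
Qed.

Let steps j m d : (c <= m)%N -> dvs m d -> exists a, dvs (m + j) (d - ga a).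
Proof.
move=> cm dm; elim: j => [|j [a IH]]; first by exists 0; rewrite arc0 subr0 addn0.
have [b Hb] := step (leq_trans cm (leq_addr j m)) IH.
by exists (a + b); rewrite arcD opprD addrA addnS.
Qed.

(** The image of an arc contains every series of large order, when it contains the
 series in s^e and series whose orders run through all residues mod e: they
 generate modulo s^e the series of order at least c, so Nakayama's lemma
 applies. *)
Theorem conductor : exists c, forall d, dvs c d -> exists a, ga a = d.
Proof.
have st (l : 'I_e) : exists a b, sv C ^+ (c + l) = ga a + sv C ^+ (c + e) * b.
 have [|a [b E]] := @steps e (c + l) (sv C ^+ (c + l)) (leq_addr l c).
 by exists 1; rewrite mulr1.
 exists a, (sv C ^+ l * b); rewrite mulrA -exprD -addnA [(e + l)%N]addnC addnA -E.
 by rewrite addrC subrK.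
have [a Ha] := choice st; have [b Hb] := choice Ha.
have [w Hw] := choice (fun l => decomp (b l)).
pose M : 'M[A]_e := \matrix_(l, j) ((l == j)%:R - x * iota (w l j)).
have [M' M'M] : exists M', M' *m M = 1%:M.
 apply: germ_unitmx => l j; rewrite mxE cstB cstM (x0 ord0) mul0r subr0.
 by case: (l == j); rewrite ?cst1 ?cst0.
have Mw l : \sum_j ga (M l j) * sv C ^+ (c + j) = ga (a l).
 rewrite -[RHS](addrK (sv C ^+ (c + e) * b l)) -Hb Hw mulr_sumr -sumrN.
 rewrite -[sv C ^+ (c + l)](_ : \sum_j (l == j)%:R * sv C ^+ (c + j) = _); last first.
 rewrite (bigD1 l)//= eqxx mul1r big1 ?addr0// => j jl.
 by rewrite eq_sym (negPf jl) mul0r.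
 rewrite -big_split; apply: eq_bigr => j _ /=.
 rewrite mxE arcB arcM germ_substX Xi0 -/(sig _).
 have -> : ga ((l == j)%:R) = (l == j)%:R by exact: rmorph_nat.
 by rewrite !exprD; ring.
have W (l : 'I_e) : sv C ^+ (c + l) = ga (\sum_j M' l j * a j).
 transitivity (\sum_k ga ((M' *m M) l k) * sv C ^+ (c + k)).
 rewrite M'M (bigD1 l)//= mxE eqxx arc1 mul1r big1 ?addr0// => j jl.
 by rewrite mxE eq_sym (negPf jl) arc0 mul0r.
 rewrite arc_sum; under [RHS]eq_bigr => j _ do rewrite arcM -Mw mulr_sumr.
 rewrite exchange_big; apply: eq_bigr => k _ /=.
 rewrite mxE arc_sum mulr_suml; apply: eq_bigr => j _.
 by rewrite arcM mulrA.
exists c => _ [d ->]; have [v ->] := decomp d.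
exists (\sum_l iota (v l) * \sum_j M' l j * a j).
rewrite arc_sum mulr_sumr; apply: eq_bigr => l _.
by rewrite arcM -W -/(sig _) exprD; ring.
Qed.

End Conductor.

Lemma max_or0_eq (E : set nat) k : E k -> (forall j, E j -> (j <= k)%N) ->
 max_or0 E = k.
Proof.
move=> Ek kmax; rewrite /max_or0; apply: xget_unique => // j [Ej jmax].
by apply/eqP; rewrite eqn_leq kmax// jmax.
Qed.
Lemma max_or0_unbounded (E : set nat) : (forall k, exists2 j, E j & (k < j)%N) ->
 max_or0 E = 0%N.
Proof.
move=> H; rewrite /max_or0; case: xgetP => // k _ [_ kmax].
by have [j /kmax + lt] := H k; rewrite leqNgt lt.
Qed.

Section Length.
Variables (C : numFieldType) (n : nat).
Local Notation A := (holo_germ C n).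
Local Notation D := (holo_germ C 1).
Local Notation mm := (@germ_maximal_ideal C n).
Variables (X : 'I_n -> D) (X0 : forall i, cst (X i) = 0).
Local Notation ga := (germ_subst X0).

Lemma ideal0 (B : comNzRingType) (I : set B) : is_ideal I -> I 0. Proof. by case. Qed.
Lemma idealD (B : comNzRingType) (I : set B) x y :
 is_ideal I -> I x -> I y -> I (x + y).
Proof. by case=> _ + _; apply. Qed.
Lemma idealMl (B : comNzRingType) (I : set B) a x : is_ideal I -> I x -> I (a * x).
Proof. by case=> _ _; apply. Qed.
Lemma idealMr (B : comNzRingType) (I : set B) a x : is_ideal I -> I x -> I (x * a).
Proof. by rewrite mulrC; apply: idealMl. Qed.
Lemma idealN (B : comNzRingType) (I : set B) x : is_ideal I -> I x -> I (- x).
Proof. by rewrite -mulN1r; apply: idealMl. Qed.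
Lemma idealB (B : comNzRingType) (I : set B) x y :
 is_ideal I -> I x -> I y -> I (x - y).
Proof. by move=> iI Ix Iy; apply: idealD => //; apply: idealN. Qed.
Lemma idealBr (B : comNzRingType) (I : set B) x y :
 is_ideal I -> I (x - y) -> I y -> I x.
Proof. by move=> iI Ixy Iy; rewrite -(subrK y x); apply: idealD. Qed.
Lemma ideal_sum (B : comNzRingType) (I : set B) J (r : seq J) (P : pred J) F :
 is_ideal I -> (forall i, P i -> I (F i)) -> I (\sum_(i <- r | P i) F i).
Proof.
by move=> iI H; elim/big_ind: _ => //; [exact: ideal0|move=> *; exact: idealD].
Qed.
Lemma contracted_mm (I : set A) : is_ideal I -> contracted mm I.
Proof.
move=> iI s a /eqP s0 Isa; have [v sv] := germ_unit s0.
by rewrite -[a]mul1r -sv mulrAC mulrC; apply: idealMl.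
Qed.

Section ValueSets.
Variable N : nat.

(** The values of an ideal: the orders of vanishing along the arc of its elements. *)
Definition values (I : set A) : {set 'I_N} :=
 [set k : 'I_N | `[< exists2 a, I a & ord_eq k (ga a) >]].

Lemma valuesP (I : set A) (k : 'I_N) :
 reflect (exists2 a, I a & ord_eq k (ga a)) (k \in values I).
Proof. by rewrite inE; apply: asboolP. Qed.
Lemma values_sub (I J : set A) : I `<=` J -> values I \subset values J.
Proof.
by move=> IJ; apply/fintype.subsetP => k /valuesP[a /IJ Ja ak]; apply/valuesP; exists a.
Qed.
Lemma ord_scale k a b : ord_eq k (ga a) -> ord_eq k (ga b) ->
 exists c : C, dvs k.+1 (ga (a - germC n c * b)).
Proof.
move=> [u /eqP u0 au] [v /eqP v0 bv]; exists (cst u / cst v).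
rewrite arcB arcM germ_substC au bv.
have [w E] : dvs 1 (u - germC 1 (cst u / cst v) * v).
 by apply/dvs_cst; rewrite cstB cstM cstC divfK// subrr.
exists w; rewrite exprSr -mulrA -[sv C]expr1 -E; ring.
Qed.

(* Ideals which contain everything of large order are determined by their values. *)
Lemma values_inj (I J : set A) : is_ideal I -> is_ideal J -> I `<=` J ->
 (forall a, dvs N (ga a) -> I a) -> values J \subset values I -> J `<=` I.
Proof.
move=> iI iJ IJ HN sub a Ja.
suff H k : (k <= N)%N -> exists2 b, I b & dvs k (ga (a - b)).
 have [b Ib /HN] := H N (leqnn N); rewrite -{2}(subrK b a) => Iab; exact: idealD.
elim: k => [|k IH] lt; first by exists 0; [exact: ideal0|exact: dvs_any].
have [b Ib ab] := IH (ltnW lt).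
have [ab1|nab] := pselect (dvs k.+1 (ga (a - b))); first by exists b.
have abk : ord_eq k (ga (a - b)).
 case: ab => u E; exists u => // /dvs_cst[v uv]; apply: nab.
 by exists v; rewrite E uv expr1 exprSr mulrA.
have : Ordinal lt \in values J.
 by apply/valuesP; exists (a - b) => //; apply: idealB => //; exact: IJ.
move=> /(fintype.subsetP sub) /valuesP[b' Ib' b'k].
have [y Hy] := ord_scale abk b'k.
exists (b + germC n y * b'); first by apply: idealD => //; exact: idealMl.
by rewrite opprD addrA.
Qed.

(** The length of the quotient by an ideal counts the missing values. *)
Lemma local_length_values (I : set A) : is_ideal I ->
 (forall a, dvs N (ga a) -> I a) ->
 local_length mm I = (#|values setT| - #|values I|)%N.
Proof.
move=> iI0 HN; apply: max_or0_eq; last first.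
 move=> k [L [HL Lt]].
 have vL i : (i <= k)%N -> (#|values I| + i <= #|values (L i)|)%N.
 elim: i => [|i IH] ik.
 by rewrite addn0; apply/subset_leq_card/values_sub; have [] := HL _ ik.
 have [iL IL _] := HL _ (ltnW ik); have [iL' _ _] := HL _ ik.
 have [sub nsub] := Lt i ik.
 rewrite addnS; apply: leq_ltn_trans (IH (ltnW ik)) _.
 apply: proper_card; rewrite properE values_sub//=; apply/negP => sub'.
 by apply: nsub; apply: values_inj sub' => // a /HN/IL.
 rewrite leq_subRL; first exact: leq_trans (vL k (leqnn k)) (subset_leq_card (values_sub _)).
 by apply/subset_leq_card/values_sub.
move: {-1}(_ - _)%N (erefl (#|values setT| - #|values I|)%N) => k.
elim: k I iI0 HN => [|k IH] I iI HN ek.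
 exists (fun=> I); split=> // i _; split=> //; exact: contracted_mm.
have [a0 nIa0] : exists a, ~ I a.
 apply: contrapT => /forallNP H; have IT : I = setT.
 by rewrite -subTset => a _; apply: contrapT => /H.
 by rewrite IT subnn in ek.
(* an element of maximal order outside I *)
have exP : exists j, `[< exists2 a, ~ I a & dvs j (ga a) >].
 by exists 0%N; apply/asboolP; exists a0 => //; exact: dvs_any.
have bP j : `[< exists2 a, ~ I a & dvs j (ga a) >] -> (j <= N)%N.
 move=> /asboolP[a nIa aj]; rewrite leqNgt; apply/negP => /ltnW lt.
 by apply/nIa/HN/(dvsW lt aj).
case: (ex_maxnP exP bP) => j /asboolP[a nIa aj] jmax.
have maxI b : dvs j.+1 (ga b) -> I b.
 move=> bj; apply: contrapT => nIb.
 by have := jmax j.+1; rewrite ltnn => /(_ _)/negP H; apply: H => //; apply/asboolP; exists b.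
have jN : (j < N)%N.
 rewrite ltnNge; apply/negP => le; by apply/nIa/HN/(dvsW le aj).
have ajo : ord_eq j (ga a).
 case: (aj) => u E; exists u => // /dvs_cst[v uv]; apply/nIa/maxI.
 by exists v; rewrite E uv expr1 exprSr mulrA.
have jI : Ordinal jN \notin values I.
 apply/valuesP => -[b Ib bj]; have [y /maxI Iy] := ord_scale ajo bj.
 by apply: nIa; apply: (idealBr iI Iy); apply: idealMl.
pose I' : set A := [set b | exists y : C, I (b - germC n y * a)].
have II' : I `<=` I' by move=> b Ib; exists 0; rewrite rmorph0 mul0r subr0.
have Ima y : cst y = 0 -> I (y * a).
 move=> y0; apply: maxI; rewrite arcM -add1n; apply: dvsM => //.
 by apply/dvs_cst; rewrite cst_subst.
have I'C b y : I (b - germC n y * a) -> forall v, I' (v * b).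
 move=> Ib v; exists (cst v * y).
 have -> : v * b - germC n (cst v * y) * a =
 v * (b - germC n y * a) + (v - germC n (cst v)) * germC n y * a.
 by rewrite rmorphM; ring.
 apply: idealD => //; first exact: idealMl.
 by apply: Ima; rewrite cstM cstB cstC subrr mul0r.
have iI' : is_ideal I'.
 split; first by exists 0; rewrite rmorph0 mul0r subr0; exact: ideal0.
 move=> b1 b2 [y1 I1] [y2 I2]; exists (y1 + y2); rewrite rmorphD.
 by rewrite mulrDl opprD addrACA; exact: idealD.
 by move=> v b [y Ib]; exact: I'C Ib v.
have vI' : values I' = Ordinal jN |: values I.
 apply/finset.setP => k'; rewrite in_setU1; apply/valuesP/orP => [[b [y Ib] bk]|].
 have [y0|y0] := eqVneq y 0.
 right; apply/valuesP; exists b => //.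
 by move: Ib; rewrite y0 rmorph0 mul0r subr0.
 have ya : ord_eq j (ga (germC n y * a)).
 case: ajo => u u0 E; exists (germC 1 y * u).
 by rewrite cstM cstC => /eqP; rewrite mulf_eq0 (negPf y0) => /eqP; exact: u0.
 by rewrite arcM germ_substC E; ring.
 have E : ga b = ga (germC n y * a) + ga (b - germC n y * a) by rewrite -arcD addrC subrK.
 have [Ibj|nIbj] := pselect (dvs j.+1 (ga (b - germC n y * a))).
 left; apply/eqP/val_inj => /=; apply: ord_inj bk _.
 by rewrite E -[ga (b - _)]opprK; apply: ordB ya _; exact: dvsN.
 have [l lb] : exists l, ord_eq l (ga (b - germC n y * a)).
 by apply: ord_exists => z; apply: nIbj; rewrite z; exact: dvs0.
 have lj : (l <= j)%N.
 rewrite leqNgt; apply/negP => lt; apply: nIbj; exact: dvsW lt (ord_dvs lb).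
 move: lj; rewrite leq_eqVlt => /orP[/eqP lj|lj].
 case/negP: jI; apply/valuesP; exists (b - germC n y * a) => //=.
 by rewrite -lj.
 right; apply/valuesP; exists (b - germC n y * a) => //.
 rewrite (ord_inj bk (_ : ord_eq l (ga b)))//.
 rewrite E addrC -[ga (germC n y * a)]opprK; apply: ordB lb _; apply: dvsN.
 exact: dvsW lj (ord_dvs ya).
 case=> [/eqP ->|/(fintype.subsetP (values_sub II'))/valuesP//].
 by exists a => //; exists 1; rewrite rmorph1 mul1r subrr; exact: ideal0.
have ek' : (#|values setT| - #|values I'|)%N = k.
 by rewrite vI' cardsU1 jI add1n subnS ek.
have [L [HL Lt]] := IH I' iI' (fun b bN => II' _ (HN b bN)) ek'.
exists (fun i => if i is i'.+1 then L i' else I); split=> [[|i]|[|i]] ik.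
- by split=> //; exact: contracted_mm.
- have [? I'L ?] := HL i ik; split=> //; exact: subset_trans II' I'L.
- have [_ I'L _] := HL 0%N isT; split; first exact: subset_trans II' I'L.
 move=> LI; apply: nIa; apply/LI/I'L; exists 1.
 by rewrite rmorph1 mul1r subrr; exact: ideal0.
- exact: Lt.
Qed.

End ValueSets.

Section HilbertSamuel.
Variables (e c : nat) (u : A).
Hypothesis e_gt0 : (0 < e)%N.
Hypothesis X_e : forall i, dvs e (X i).
Hypothesis u0 : cst u = 0.
Hypothesis ue : ord_eq e (ga u).
Hypothesis cond : forall d, dvs c d -> exists a, ga a = d.

Lemma smallest_ideal (B : comNzRingType) (G : set B) : is_ideal (ideal_gen G).
Proof.
split=> [I [[]]//|x y Gx Gy I HI|a x Gx I HI].
 by have [[_ iD _] _] := HI; apply: iD; [exact: Gx|exact: Gy].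
by have [[_ _ iM] _] := HI; apply: iM; exact: Gx.
Qed.
Lemma sub_ideal_gen (B : comNzRingType) (G : set B) : G `<=` ideal_gen G.
Proof. exact: sub_gen_smallest. Qed.
Lemma ideal_gen_sub (B : comNzRingType) (G I : set B) :
 is_ideal I -> G `<=` I -> ideal_gen G `<=` I.
Proof. by move=> iI GI; apply: smallest_sub. Qed.
Lemma is_ideal_exp (B : comNzRingType) (I : set B) s : is_ideal (ideal_exp I s).
Proof. by case: s => [|s]; [|exact: smallest_ideal]. Qed.
Lemma dvs_arc a : cst a = 0 -> dvs e (ga a).
Proof.
move=> a0; apply/dvsP => k ke; rewrite (coef_subst _ _ (_ : _ < k.+1)%N) ?mdeg_mk//.
rewrite big1// => m _; have [->|m0] := eqVneq (val m) mnm0.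
 by rewrite [a _]a0 mul0r.
suff /dvsP -> : dvs e (mmap1 X m) by rewrite ?mulr0.
have [i mi] : exists i, m i != 0%N.
 apply: contrapT => /forallNP H; case/eqP: m0; apply/mnmP => i.
 by rewrite mnm0E; apply/eqP/negPn/negP/H.
rewrite /mmap1 (bigD1 i)//=; apply: dvsMl.
by apply: dvsW (dvsX (m i) (X_e i)); rewrite leq_pmulr// lt0n.
Qed.

Local Notation M := (ideal_exp mm).

Lemma dvs_exp s a : M s a -> dvs (e * s) (ga a).
Proof.
elim: s a => [|s IH] a; first by rewrite muln0 => _; exact: dvs_any.
move=> Ma; apply: (ideal_gen_sub (I := [set b | dvs (e * s.+1) (ga b)]) _ _ Ma).
 split=> /=; first by rewrite arc0; exact: dvs0.
 by move=> x y dx dy; rewrite arcD; exact: dvsD.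
 by move=> x y dy; rewrite arcM; exact: dvsMr.
move=> _ [x [y [x0 Iy ->]]] /=; rewrite arcM mulnS; apply: dvsM; first exact: dvs_arc.
exact: IH.
Qed.
Lemma exp_mul s x y : mm x -> M s y -> M s.+1 (x * y).
Proof. by move=> mx My; apply: sub_ideal_gen; exists x, y. Qed.
Lemma exp_u s a : M s (u ^+ s * a).
Proof.
elim: s a => [//|s IH] a; rewrite exprS -mulrA; exact: exp_mul.
Qed.

Definition powq (s : nat) : set A := ideal_gen ([set a | ga a = 0] `|` M s).

Lemma powqP s a : powq s a <-> exists2 b, M s b & ga a = ga b.
Proof.
split=> [|[b Mb ab]].
 apply: (ideal_gen_sub (I := [set a | exists2 b, M s b & ga a = ga b])).
 split=> /=.
 - by exists 0 => //; exact: ideal0 (is_ideal_exp _ _).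
 - move=> x y [b Mb xb] [b' Mb' yb']; exists (b + b'); rewrite ?arcD ?xb ?yb'//.
 exact: idealD (is_ideal_exp _ _) Mb Mb'.
 - move=> x y [b Mb yb]; exists (x * b); rewrite ?arcM ?yb//.
 exact: idealMl (is_ideal_exp _ _) Mb.
 move=> x [/= x0|Mx]; last by exists x.
 by exists 0; [exact: ideal0 (is_ideal_exp _ _)|rewrite arc0].
rewrite /powq -(subrK b a); apply: (idealD (smallest_ideal _)).
 by apply: sub_ideal_gen; left; rewrite /= arcB ab subrr.
by apply: sub_ideal_gen; right.
Qed.
Lemma powq_dvs s a : dvs (e * s + c) (ga a) -> powq s a.
Proof.
move=> [d ad].
have us : ord_eq (e * s) (ga (u ^+ s)) by rewrite arcX; exact: ordX.
have [|d' E] := @ord_div _ _ _ (ga a) us; first by exists (sv C ^+ c * d); rewrite ad exprD mulrA.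
have [|b bd'] := cond (d := d').
 case: us E => w /eqP/germ_unit[v wv] ->; rewrite ad exprD -!mulrA => /(germ_mulfI (@sv_neq0 _ _)) E.
 by exists (v * d); rewrite mulrCA E mulrA [v * w]mulrC wv mul1r.
by apply/powqP; exists (u ^+ s * b); [exact: exp_u|rewrite arcM E bd'].
Qed.

Definition cnt (N : nat) (P : nat -> Prop) : nat := (\sum_(k < N) `[< P k >])%N.

Lemma cnt_values (N : nat) (I : set A) :
 #|values N I| = cnt N (fun k => exists2 a, I a & ord_eq k (ga a)).
Proof. by rewrite /values cardsE -sum1_card big_mkcond. Qed.
Lemma cnt_split (N j : nat) (P : nat -> Prop) :
 cnt (N + j) P = (cnt N P + cnt j (fun k => P (N + k)%N))%N.
Proof. by rewrite /cnt big_split_ord. Qed.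
Lemma cnt_all j (P : nat -> Prop) : (forall k, P k) -> cnt j P = j.
Proof.
move=> HP; rewrite /cnt (eq_bigr (fun=> 1%N)) ?sum1_card ?card_ord// => k _.
by rewrite asboolT.
Qed.
Lemma cnt_none j (P : nat -> Prop) : (forall k, (k < j)%N -> ~ P k) -> cnt j P = 0%N.
Proof. by move=> HP; rewrite /cnt big1// => k _; rewrite asboolF//; apply: HP. Qed.
Lemma cnt_le j (P Q : nat -> Prop) : (forall k, P k -> Q k) -> (cnt j P <= cnt j Q)%N.
Proof.
move=> PQ; apply: leq_sum => k _; have [/PQ q|] := pselect (P k).
 by rewrite (asboolT q) leq_b1.
by move=> /asboolF ->.
Qed.
Lemma eventually_constant (f : nat -> nat) b : (forall i, (f i <= f i.+1)%N) ->
 (forall i, (f i <= b)%N) -> exists n0, forall i, (n0 <= i)%N -> f i = f n0.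
Proof.
move=> fS fb; have mono i j : (i <= j)%N -> (f i <= f j)%N.
 by move=> /subnK <-; elim: (j - i)%N => // l IH; apply: leq_trans (fS _).
have exP : exists y, `[< exists i, f i = y >].
 by exists (f 0%N); apply/asboolP; exists 0%N.
have bP y : `[< exists i, f i = y >] -> (y <= b)%N by move=> /asboolP[i <-].
case: (ex_maxnP exP bP) => y /asboolP[i fi] ymax; exists i => j ij.
apply/eqP; rewrite eqn_leq [X in _ && X]mono// andbT fi; apply: ymax.
by apply/asboolP; exists j.
Qed.

(** Multiplication by u shifts the values of the powers of the maximal ideal by e,
 and the shifted sets of values increase and lack only values below c; so they
 are eventually constant, and the lengths grow by e. *)
Theorem hs_multiplicity_arc : hs_multiplicity mm [set a | ga a = 0] = e.
Proof.
pose P s k := exists2 b, M s b & ord_eq (e * s + k) (ga b).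
have v_const : exists n0, forall s, (n0 <= s)%N -> cnt c (P s) = cnt c (P n0).
 apply: (@eventually_constant (fun s => cnt c (P s)) c) => s.
 apply: cnt_le => k [b Mb bk]; exists (u * b); first exact: exp_mul.
 by rewrite arcM mulnS -addnA; apply: ordM.
 rewrite /cnt; apply: leq_trans (leq_sum _ (fun k _ => leq_b1 _)) _.
 by rewrite sum1_card card_ord.
have [n0 Hn0] := v_const.
pose o := cnt c (fun k => exists2 a, [set: A] a & ord_eq k (ga a)).
have cT s : #|values (c + e * s) setT| = (o + e * s)%N.
 rewrite cnt_values cnt_split; congr (_ + _)%N; apply: cnt_all => k.
 have [|a E] := cond (d := sv C ^+ (c + k)); first by exists (sv C ^+ k); rewrite exprD.
 by exists a => //; rewrite E; exact: ord_sv.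
have cP s : #|values (c + e * s) (powq s)| = cnt c (P s).
 rewrite cnt_values addnC cnt_split cnt_none ?add0n => [|k ks [a /powqP[b /dvs_exp bs ab] ak]].
 apply/eqP; rewrite eqn_leq; apply/andP; split; apply: cnt_le => k.
 by move=> [a /powqP[b Mb ab] ak]; exists b; rewrite -?ab.
 by move=> [b Mb bk]; exists b => //; apply/powqP; exists b.
 by apply: (ord_Ndvs ak); rewrite ab; apply: dvsW bs.
have len s : local_length mm (powq s) = (o + e * s - cnt c (P s))%N.
 rewrite (@local_length_values (c + e * s)) ?cT ?cP//; first exact: smallest_ideal.
 by move=> a; rewrite addnC; exact: powq_dvs.
have le s : (cnt c (P s) <= o + e * s)%N.
 by rewrite -cT -cP; apply/subset_leq_card/values_sub.
pose v := cnt c (P n0).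
pose h : {poly rat} := (e%:R)%:P * 'X + (o%:R - v%:R)%:P.
have hE s : (n0 <= s)%N -> h.[s%:R] = (local_length mm (powq s))%:R.
 move=> ns; rewrite len natrB// natrD natrM Hn0// -/v /h hornerD hornerM !hornerC hornerX.
 by ring.
have e0 : e%:R != 0 :> rat by rewrite pnatr_eq0 -lt0n.
have sh : size h = 2%N by rewrite /h size_MXaddC polyC_eq0 (negPf e0) size_polyC e0.
have lh : lead_coef h = e%:R by rewrite lead_coefE sh /h coefD coefMX !coefC eqxx addr0.
apply: xget_unique; first by exists h, n0; split=> //; rewrite lh sh mulr1.
move=> e' [h' [N' [h'E e'E]]].
suff hh : h' = h by move: e'E; rewrite hh lh sh mulr1 => /eqP; rewrite eqr_nat => /eqP.
apply/eqP; rewrite -subr_eq0; apply/negPn/negP => nz.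
have := max_poly_roots nz (rs := [seq (i + (n0 + N'))%:R | i <- iota 0 (size (h' - h))]).
rewrite size_map size_iota ltnn => H; suff : false by [].
apply: H; last first.
 rewrite map_inj_uniq ?iota_uniq// => i j /eqP.
 by rewrite eqr_nat eqn_add2r => /eqP.
apply/allP => _ /mapP[i _ ->]; rewrite /root hornerD hornerN h'E; last by rewrite addnA leq_addl.
by rewrite hE ?subrr// addnCA leq_addr.
Qed.

End HilbertSamuel.
End Length.

End Ge.
Import Ge.

(** * Curves given by their arcs *)

Module Gf.
Section Separation.
Variables (C : numFieldType) (n : nat).
Local Notation A := (holo_germ C n).
Local Notation D := (holo_germ C 1).
Variables (X Y : 'I_n -> D).
Hypotheses (X0 : forall i, cst (X i) = 0) (Y0 : forall i, cst (Y i) = 0).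

(** An inequality between orders on one arc which fails on another one gives a germ
 vanishing on the first arc only: a large power of the quotient of the two germs
 lies in the image of the first arc. *)
Lemma arcs_separated c (a b : A) k l l' :
 (forall d, dvs c d -> exists h, germ_subst X0 h = d) ->
 ord_eq k (germ_subst X0 b) -> dvs k.+1 (germ_subst X0 a) ->
 ord_eq l (germ_subst Y0 b) -> ord_eq l' (germ_subst Y0 a) -> (l' <= l)%N ->
 exists h, germ_subst X0 h = 0 /\ germ_subst Y0 h <> 0.
Proof.
move=> cX bk ak bl al ll; pose K := c.+1.
have bK : ord_eq (k * K) (germ_subst X0 (b ^+ K)) by rewrite arcX; apply: ordX.
have aK : dvs (k * K + K) (germ_subst X0 (a ^+ K)).
 by rewrite arcX addnC -mulSn; apply: dvsX.
have [v Ev] : exists v, germ_subst X0 (a ^+ K) = germ_subst X0 (b ^+ K) * v.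
 by apply: ord_div bK _; apply: dvsW aK; rewrite leq_addr.
have vK : dvs K v.
 case: bK Ev => u /eqP/germ_unit[u' uu'] ->; case: aK => w ->.
 rewrite exprD -!mulrA => /(germ_mulfI (@sv_neq0 _ _)) E.
 exists (u' * w); rewrite mulrCA E mulrA [u' * u]mulrC uu' mul1r//.
have [h hv] := cX v (dvsW (leqnSn c) vK).
have h0 : cst h = 0.
 by rewrite -(cst_subst X0) hv; apply/dvs_cst; apply: dvsW vK.
exists (a ^+ K - b ^+ K * h); split.
 by rewrite arcB arcM hv Ev subrr.
rewrite arcB arcM !arcX; apply: (@ord_neq0 _ (l' * K)); apply: ordB; first exact: ordX.
apply: (@dvsW _ (l * K + 1)); first by rewrite addn1 ltnS leq_mul2r ll orbT.
apply: dvsM; first by apply: dvsX; exact: ord_dvs.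
by apply/dvs_cst; rewrite cst_subst.
Qed.

End Separation.

Section ArcsOfCurve.
Variables (C : numFieldType) (n r e : nat).
Local Notation A := (holo_germ C n).
Local Notation D := (holo_germ C 1).
Local Notation mnm := (multinom n).
Variables (X : 'I_r -> 'I_n -> D) (X0 : forall j i, cst (X j i) = 0).
Local Notation ga j := (germ_subst (X0 j)).
Hypothesis e_gt0 : (0 < e)%N.
Hypothesis X_e : forall j i, dvs e (X j i).
Hypothesis cond : forall j, exists c, forall d, dvs c d -> exists a, ga j a = d.
Hypothesis sep : forall i j, i != j -> exists h, ga i h = 0 /\ ga j h <> 0.

Lemma isolate j : exists h, ga j h <> 0 /\ forall i, i != j -> ga i h = 0.
Proof.
have H i : exists h, i != j -> ga i h = 0 /\ ga j h <> 0.
 have [->|ij] := eqVneq i j; first by exists 0.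
 by have [h] := sep ij; exists h.
have [h Hh] := choice H.
exists (\prod_(i | i != j) h i); split.
 rewrite arc_prod; elim/big_ind: _ => [|x y x0 y0|i /Hh[]//].
 by move/eqP; rewrite oner_eq0.
 by move=> /germ_integral[].
by move=> i ij; rewrite arc_prod (bigD1 i)//= (Hh i ij).1 mul0r.
Qed.

(** The arcs together: the image contains all families of series of large order. *)
Lemma joint_conductor : exists c, forall d : 'I_r -> D, (forall j, dvs c (d j)) ->
 exists a, forall j, ga j a = d j.
Proof.
have [h Hh] := choice isolate.
have [k Hk] := choice (fun j => ord_exists (Hh j).1).
have [c Hc] := choice cond.
exists (\sum_j (c j + k j))%N => d Hd.
have H j : exists a, ga j a = d j /\ forall i, i != j -> ga i a = 0.
 have le : (c j + k j <= \sum_j (c j + k j))%N by rewrite (bigD1 j)//= leq_addr.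
 have [w dw] := dvsW le (Hd j).
 have [u /eqP/germ_unit[u' uu'] hu] := Hk j.
 have [|a aw] := Hc j (sv C ^+ c j * (u' * w)); first by exists (u' * w).
 exists (h j * a); split=> [|i ij]; last by rewrite arcM (Hh j).2// mul0r.
 rewrite arcM aw hu dw exprD.
 have -> : sv C ^+ k j * u * (sv C ^+ c j * (u' * w)) =
 sv C ^+ c j * sv C ^+ k j * ((u * u') * w) by ring.
 by rewrite uu' mul1r.
have [a Ha] := choice H.
exists (\sum_j a j) => i; rewrite arc_sum (bigD1 i)//= (Ha i).1 big1 ?addr0//.
by move=> j ji; rewrite (Ha j).2// eq_sym.
Qed.

Variables (I : set A) (iI : is_ideal I).
Hypothesis I0 : forall j a, I a -> ga j a = 0.
Variables (mu : 'I_(r * e) -> mnm) (dir : 'I_(r * e) -> 'I_n).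
Let std i k : mnm := mnm_add (mu i) (mnm_muln (mnm1 (dir i)) k).
Hypothesis std_inj : forall i k i' k', std i k = std i' k' -> i = i' /\ k = k'.
Hypothesis reduce : forall a, exists b, I (a - b) /\
 forall m, b m != 0 -> exists i k, m = std i k.

Let is_std (b : A) := forall m, b m != 0 -> exists i k, m = std i k.

Section Count.
Variables (c : nat).
Hypothesis Hc : forall d : 'I_r -> D, (forall j, dvs c (d j)) ->
 exists a, forall j, ga j a = d j.

Local Notation R N := ('I_(r * e) * 'I_N)%type.
Local Notation T N := ('I_r * 'I_(e * N))%type.
Let MT N : 'M[C]_(#|{: R N}|, #|{: T N}|) := 
 \matrix_(i < #|{: R N}|, j < #|{: T N}|)
 ga (enum_val j).1 (gX C (std (enum_val i).1 (enum_val i).2)) (mk (enum_val j).2).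
Let cv N (b : A) : 'rV[C]_#|{: R N}| :=
 \row_(i < #|{: R N}|) b (std (enum_val i).1 (enum_val i).2).

Let card_RT N : #|{: R N}| = #|{: T N}|.
Proof. by rewrite !card_prod !card_ord mulnA. Qed.

(* The monomials std i k with N <= k vanish to order e N along the arcs. *)
Let cvMT N (b : A) : is_std b -> cv N b *m MT N =
 \row_(j < #|{: T N}|) ga (enum_val j).1 b (mk (enum_val j).2).
Proof.
move=> bstd; apply/rowP => j; rewrite !mxE.
set l := (enum_val j).1; set k := (enum_val j).2.
pose b1 := \sum_(i : R N) germC n (b (std i.1 i.2)) * gX C (std i.1 i.2).
have b1E m : b1 m = \sum_(i : R N) b (std i.1 i.2) * (std i.1 i.2 == m)%:R.
 by rewrite /b1 gcoef_sum; apply: eq_bigr => i _; rewrite gcoefCM coef_gX.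
have -> : ga l b (mk k) = ga l b1 (mk k) + ga l (b - b1) (mk k).
 by rewrite -gcoefD -arcD addrC subrK.
have -> : ga l (b - b1) (mk k) = 0.
 have high m : (b - b1) m != 0 -> exists i q, m = std i q /\ (N <= q)%N.
 rewrite gcoefB b1E => nz.
 have [bm|/bstd[i [q mE]]] := eqVneq (b m) 0.
 move: nz; rewrite bm sub0r oppr_eq0 big1 ?eqxx// => i _.
 by case: eqP => [->|]; rewrite ?bm ?mul0r ?mulr0.
 exists i, q; split=> //; rewrite leqNgt; apply/negP => qN; case/eqP: nz.
 rewrite (bigD1 (i, Ordinal qN))//= mE eqxx mulr1 big1 ?addr0 ?subrr// => -[i' q'] ne.
 case: eqP => [/std_inj[ei eq]|]; last by rewrite mulr0.
 by case/eqP: ne; congr pair; [|apply/val_inj].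
 rewrite (coef_subst _ _ (_ : _ < k.+1)%N) ?mdeg_mk//.
 rewrite big1// => m _; have [->|/high[i [q [mE Nq]]]] := eqVneq ((b - b1) m) 0.
 by rewrite mul0r.
 suff /dvsP -> // : dvs (e * N) (mmap1 (X l) m) by rewrite ?mulr0.
 apply: (@dvsW _ (e * q)); first by rewrite leq_mul2l Nq orbT.
 have <- : mmap1 (X l) (mnm_muln (mnm1 (dir i)) q) * mmap1 (X l) (mu i) = mmap1 (X l) m.
 by rewrite mE /std (mmap1D (X l)) mulrC.
 apply: dvsMl; rewrite /mmap1 (bigD1 (dir i))//= mulmnE mnm1E eqxx mul1n.
 by apply: dvsMl; apply: dvsX.
rewrite addr0 /b1 arc_sum gcoef_sum (reindex (@enum_val (R N) predT)); last first.
 by apply: onW_bij; exact: enum_val_bij.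
apply: eq_bigr => i _; rewrite !mxE arcM germ_substC gcoefCM//.
Qed.

Let rank_MT N : (#|{: T N}| <= \rank (MT N) + r * c)%N.
Proof.
pose Q : 'M[C]_(#|{: T N}|) := \matrix_(i < #|{: T N}|, j < #|{: T N}|)
 ((i == j) && ((enum_val i).2 < c)%N)%:R.
have rQ : (\rank Q <= r * c)%N.
 pose Q1 : 'M[C]_(#|{: T N}|, #|{: 'I_r * 'I_c}|) :=
 \matrix_(i < #|{: T N}|, j < #|{: 'I_r * 'I_c}|)
 (((enum_val i).1 == (enum_val j).1) && (val (enum_val i).2 == val (enum_val j).2))%:R.
 pose Q2 : 'M[C]_(#|{: 'I_r * 'I_c}|, #|{: T N}|) :=
 \matrix_(j < #|{: 'I_r * 'I_c}|, i < #|{: T N}|)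
 (((enum_val i).1 == (enum_val j).1) && (val (enum_val i).2 == val (enum_val j).2))%:R.
 have -> : Q = Q1 *m Q2.
 apply/matrixP => i j; rewrite !mxE; under eq_bigr do rewrite !mxE -natrM mulnb.
 case: (ltnP (enum_val i).2 c) => [lt|ge]; last first.
 rewrite andbF big1// => k _; case: eqP => //= _; case: eqP => //= ek.
 by have := ltn_ord (enum_val k).2; rewrite -ek ltnNge ge.
 rewrite andbT (bigD1 (enum_rank ((enum_val i).1, Ordinal lt)))//= enum_rankK /=.
 rewrite !eqxx/= big1 ?addr0 => [|k].
 congr (_%:R); congr nat_of_bool; apply/eqP/andP => [->|[/eqP e1 /eqP e2]]; first by rewrite !eqxx.
 apply/enum_val_inj; rewrite [LHS]surjective_pairing [RHS]surjective_pairing e1.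
 by congr pair; apply/val_inj.
 move=> ne; case: eqP => //= e1; case: eqP => //= e2; case/eqP: ne.
 apply/enum_val_inj; rewrite enum_rankK [LHS]surjective_pairing e1.
 by congr pair; apply/val_inj.
 rewrite -[X in (_ <= X)%N](_ : #|{: 'I_r * 'I_c}| = _); last by rewrite card_prod !card_ord.
 exact: (mulmx_max_rank Q1 Q2).
suff : (1%:M - Q <= MT N)%MS.
 move=> /mxrankS le; have := mxrank_add (1%:M - Q) Q; rewrite subrK mxrank1.
 by move=> /leq_trans; apply; exact: leq_add.
apply/row_subP => i; case: (ltnP (enum_val i).2 c) => [lt|ge].
 rewrite (_ : row i _ = 0) ?sub0mx//; apply/rowP => j; rewrite !mxE lt andbT.
 by rewrite subrr.
have [|a Ha] := Hc (d := fun l => if l == (enum_val i).1 then sv C ^+ (enum_val i).2 else 0).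
 move=> l; case: ifP => _; last exact: dvs0.
 by exists (sv C ^+ ((enum_val i).2 - c)); rewrite -exprD subnKC.
have [b [Iab bstd]] := reduce a.
apply/submxP; exists (cv N b); rewrite cvMT//; apply/rowP => j; rewrite !mxE.
have -> : ga (enum_val j).1 b = ga (enum_val j).1 a.
 by apply/esym/eqP; rewrite -subr_eq0 -arcB (I0 _ Iab).
rewrite Ha ltnNge ge/= andbF subr0; have [e1|ne] := eqVneq (enum_val j).1 (enum_val i).1; last first.
 by rewrite gcoef0; case: eqP => // ij; rewrite ij eqxx in ne.
rewrite sv_exp coef_gX (inj_eq (@mk_inj)); congr (_%:R); congr nat_of_bool.
apply/eqP/eqP => [->//|e2]; apply/enum_val_inj.
rewrite [LHS]surjective_pairing [RHS]surjective_pairing e1.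
by congr pair; apply/val_inj.
Qed.

(** Few germs vanish along all the arcs modulo I: the standard monomials are as
 many as the coefficients of the arcs. *)
Lemma few_vanish (P := (r * c)%N) (b : 'I_P.+1 -> A) :
 (forall i, is_std (b i)) -> (forall i j, ga j (b i) = 0) ->
 exists2 y : 'I_P.+1 -> C, (exists i, y i != 0) &
 forall m, \sum_i y i * b i m = 0.
Proof.
move=> bstd b0.
pose V N : 'M[C]_(P.+1, #|{: R N}|) := \matrix_i cv N (b i).
have VM N : V N *m MT N = 0.
 apply/row_matrixP => i; rewrite row_mul rowK cvMT// row0; apply/rowP => j.
 by rewrite !mxE b0 gcoef0.
have rV N : (\rank (V N) <= P)%N.
 have := mulmx0_rank_max (VM N); have := rank_MT N.
 have := card_RT N; rewrite -/P; move: (\rank _) (\rank _) => x y; lia.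
have kerP N (y : 'rV_P.+1) : (y <= kermx (V N))%MS <->
 forall i k, (k < N)%N -> \sum_l y ord0 l * b l (std i k) = 0.
 split=> [/sub_kermxP yV i k kN|H].
 have /rowP/(_ (enum_rank (i, Ordinal kN))) := yV; rewrite !mxE => E.
 by rewrite -[RHS]E; apply: eq_bigr => l _; rewrite !mxE enum_rankK.
 apply/sub_kermxP/rowP => j; rewrite !mxE.
 rewrite -[RHS](H (enum_val j).1 (enum_val j).2 (ltn_ord _)).
 by apply: eq_bigr => l _; rewrite !mxE.
have ker_sub N N' : (N <= N')%N -> (kermx (V N') <= kermx (V N))%MS.
 move=> NN; apply/row_subP => i; apply/kerP => i' k kN.
 by have /kerP := row_sub i (kermx (V N')); apply; apply: leq_trans NN.
have ker_gt0 N : (0 < \rank (kermx (V N)))%N by rewrite mxrank_ker subn_gt0 ltnS.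
have exP : exists s, `[< exists N, \rank (kermx (V N)) = s >].
 by exists (\rank (kermx (V 0%N))); apply/asboolP; exists 0%N.
case: (ex_minnP exP) => s /asboolP[N0 sN0] smin.
have stab N : (kermx (V N0) <= kermx (V (maxn N N0)))%MS.
 have le : (kermx (V (maxn N N0)) <= kermx (V N0))%MS by apply: ker_sub; exact: leq_maxr.
 have := mxrank_leqif_sup le => -[_ <-]; rewrite eqn_leq mxrankS//= sN0; apply: smin.
 by apply/asboolP; eexists.
have [i /eqP row_nz] : exists i, row i (kermx (V N0)) != 0.
 apply: contrapT => /forallNP H; have := ker_gt0 N0.
 rewrite (_ : kermx _ = 0) ?mxrank0//; apply/row_matrixP => i.
 by rewrite row0; apply/eqP/negPn/negP => /H.
exists (row i (kermx (V N0)) ord0).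
 apply: contrapT => /forallNP H; apply: row_nz; apply/rowP => j.
 by rewrite [RHS]mxE; apply/eqP/negPn/negP/H.
move=> m; have [[i0 [k ->]]|nstd] := pselect (exists i k, m = std i k); last first.
 rewrite big1// => l _; rewrite (_ : b l m = 0) ?mulr0//.
 by apply/eqP/negPn/negP => /bstd.
have /kerP := submx_trans (row_sub i (kermx (V N0))) (stab k.+1).
by apply; rewrite leq_max leqnn.
Qed.

End Count.

(** Germs vanishing along all the arcs lie in I up to a power of any nonunit. *)
Lemma vanish_nilpotent y : cst y = 0 ->
 exists P, forall a, (forall j, ga j a = 0) -> I (y ^+ P * a).
Proof.
move=> y0; have [c Hc] := joint_conductor.
pose P := (r * c)%N; exists P => a a0.
have H (i : 'I_P.+1) : exists b, I (y ^+ i * a - b) /\ is_std b by apply: reduce.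
have [b Hb] := choice H.
have [|i j|z [i0 zi0] zb] := @few_vanish c Hc b; first by move=> i; apply: (Hb i).2.
 have := I0 j (Hb i).1; rewrite arcB arcM a0 mulr0 sub0r => /eqP.
 by rewrite oppr_eq0 => /eqP.
have Iz : I (\sum_i germC n (z i) * y ^+ i * a).
 have -> : \sum_i germC n (z i) * y ^+ i * a =
 \sum_i germC n (z i) * (y ^+ i * a - b i) + \sum_i germC n (z i) * b i.
 by rewrite -big_split; apply: eq_bigr => i _ /=; ring.
 rewrite [X in _ + X](_ : _ = 0).
 by rewrite addr0; apply: ideal_sum => // i _; apply: idealMl => //; exact: (Hb i).1.
 apply: holo_germP => m; rewrite gcoef_sum gcoef0 -[RHS](zb m).
 by apply: eq_bigr => i _; rewrite gcoefCM.
(* the first nonzero coefficient *)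
have exi : exists i, (i < P.+1)%N && (z (inord i) != 0).
 by exists (val i0); rewrite ltn_ord inord_val.
case: (ex_minnP exi) => i /andP[iP zi] imin.
pose w := \sum_(l < P.+1) germC n (if (i <= l)%N then z l else 0) * y ^+ (l - i).
have Ew : \sum_(l < P.+1) germC n (z l) * y ^+ l * a = y ^+ i * a * w.
 rewrite /w mulr_sumr; apply: eq_bigr => l _; case: leqP => [il|li].
 by rewrite -{1}(subnK il) exprD; ring.
 rewrite rmorph0 mul0r mulr0 (_ : z l = 0) ?rmorph0 ?mul0r//.
 apply/eqP/negPn/negP => zl; have := imin l; rewrite ltn_ord inord_val zl => /(_ isT).
 by rewrite leqNgt li.
have w0 : cst w != 0.
 rewrite /w cst_sum (bigD1 (inord i : 'I_P.+1))//= inordK// leqnn subnn expr0 mulr1 cstC.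
 rewrite big1 ?addr0// => l li; rewrite cstM cstX y0; case: leqP => il; last first.
 by rewrite cstC mul0r.
 rewrite expr0n subn_eq0; case: leqP => [li'|_]; last by rewrite mulr0.
 case/eqP: li; apply/val_inj; rewrite /= inordK//; apply/eqP.
 by rewrite eqn_leq li' il.
have [v wv] := germ_unit w0.
have Iyi : I (y ^+ i * a).
 by rewrite -[y ^+ i * a]mulr1 -wv mulrA -Ew; apply: idealMr.
by rewrite -(subnK (iP : (i <= P)%N)) exprD -mulrA; apply: idealMl.
Qed.
Lemma arc_nonunit j : exists2 y, cst y = 0 & ga j y <> 0.
Proof.
have [c Hc] := cond j; have [|y yE] := Hc (sv C ^+ c.+1).
 by exists (sv C); rewrite exprSr.
exists y; last by rewrite yE; exact: sv_neq0.
by rewrite -(cst_subst (X0 j)) yE cstX cst_sv expr0n.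
Qed.

(** The curve is reduced along each arc. *)
Lemma arc_reduced j : exists2 s, ga j s <> 0 & forall a, ga j a = 0 -> I (s * a).
Proof.
have [y y0 yj] := arc_nonunit j; have [P HP] := vanish_nilpotent y0.
have [h [hj h0]] := isolate j.
exists (y ^+ P * h) => [|a a0].
 rewrite arcM arcX => /germ_integral[|//].
 elim: (P) => [|p IH]; first by rewrite expr0 => /eqP; rewrite oner_eq0.
 by rewrite exprS => /germ_integral[].
rewrite -mulrA; apply: HP => i; rewrite arcM.
by have [->|/h0 ->] := eqVneq i j; rewrite ?a0 ?mulr0 ?mul0r.
Qed.

(** The arcs are all the components. *)
Lemma arc_components (Pr : set A) : is_prime Pr -> I `<=` Pr ->
 (exists2 y, cst y = 0 & ~ Pr y) -> exists j, forall a, ga j a = 0 -> Pr a.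
Proof.
move=> [iP P1 PM] IP [y y0 nPy]; have [p Hp] := vanish_nilpotent y0.
apply: contrapT => /forallNP H.
have {}H j : exists a, ga j a = 0 /\ ~ Pr a.
 apply: contrapT => /forallNP H'; apply: (H j) => a a0.
 by apply: contrapT => nPa; apply: (H' a).
have [a Ha] := choice H.
have : Pr (y ^+ p * \prod_j a j).
 apply/IP/Hp => j; rewrite arc_prod (bigD1 j)//= (Ha j).1 mul0r//.
move=> /PM[|].
 elim: (p) => [|q IH]; first by rewrite expr0.
 by rewrite exprS => /PM[].
by elim/big_ind: _ => // [x z Hx Hz /PM[]//|j _]; exact: (Ha j).2.
Qed.

End ArcsOfCurve.

End Gf.
Import Gf.

(** * Strict transforms and lengths *)

Module Gg.
Local Notation contraction := Defs.contraction.

Section Primes.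
Variables (A : comNzRingType).
Implicit Types P I : set A.

Lemma idealDr I x y : is_ideal I -> I (x + y) -> I y -> I x.
Proof. by move=> iI xy Iy; rewrite -(addrK y x); apply: idealB. Qed.
Lemma primeX P x k : is_prime P -> P (x ^+ k) -> P x.
Proof.
move=> [iP P1 PM]; elim: k => [|k IH]; first by rewrite expr0.
by rewrite exprS => /PM[].
Qed.
Lemma primeXn P x k : is_prime P -> ~ P x -> ~ P (x ^+ k).
Proof. by move=> pP nx /(primeX pP). Qed.
Lemma nprimeM P x y : is_prime P -> ~ P x -> ~ P y -> ~ P (x * y).
Proof. by move=> [_ _ PM] nx ny /PM[]. Qed.

(** A contracted ideal containing I is either everything or the prime itself. *)
Lemma local_length1 P I : is_prime P -> I `<=` P ->
 (forall x, P x -> exists2 s, ~ P s & I (s * x)) -> local_length P I = 1%N.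
Proof.
move=> [iP P1 PM] IP H; apply: max_or0_eq.
 exists (fun i => if i == 0%N then P else setT); split=> [[|i] _|[|i]]//=.
 - by split=> // s x ns /PM[].
 - by move=> _; split=> // H1; apply: P1; exact: H1.
move=> k [L [HL lt]]; rewrite leqNgt; apply/negP => k1.
have cL i : (i <= k)%N -> L i = P \/ L i = setT.
 move=> ik; have [iL IL cL] := HL i ik.
 have PL : P `<=` L i by move=> x /H[s ns /IL]; exact: cL.
 have [LP|nLP] := pselect (L i `<=` P); [left|right]; first exact/seteqP.
 move/existsNP: nLP => [s /not_implyP[Ls ns]]; apply/seteqP; split=> // x _.
 by apply: (cL s) => //; apply: idealMr.
have := cL 2 k1; have := cL 1%N (ltnW k1); have := cL 0%N isT.
have nT X : ~ setT `<` X by move=> [_]; apply.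
have [n01 n12] := (lt 0%N (ltnW k1), lt 1%N k1).
move=> [e0|e0] [e1|e1] _; rewrite ?e0 ?e1 in n01 n12; last 2 first.
- exact: nT n01.
- exact: nT n01.
- by case: n01 => _; apply.
- exact: nT n12.
Qed.

End Primes.

Section Blowup.
Variables (A : comNzRingType) (n : nat) (d : 'I_n -> A).
Local Notation S := {mpoly A[n]}.
Local Notation y i := (mpolyX A (mnm1 i) : S).
Local Notation K c := (mpolyC n c : S).
Implicit Types (p : set A) (P : S).

Definition Phi P : {poly A} := mmap (@polyC A) (fun i => (d i)%:P * 'X) P.

Lemma PhiD P1 P2 : Phi (P1 + P2) = Phi P1 + Phi P2. Proof. exact: rmorphD. Qed.
Lemma PhiB P1 P2 : Phi (P1 - P2) = Phi P1 - Phi P2. Proof. exact: rmorphB. Qed.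
Lemma PhiM P1 P2 : Phi (P1 * P2) = Phi P1 * Phi P2. Proof. exact: rmorphM. Qed.
Lemma PhiXn P1 k : Phi (P1 ^+ k) = Phi P1 ^+ k. Proof. exact: rmorphXn. Qed.
Lemma Phi0 : Phi 0 = 0. Proof. exact: rmorph0. Qed.
Lemma Phi1 : Phi 1 = 1. Proof. exact: rmorph1. Qed.
Lemma Phi_sum I (r : seq I) (Q : pred I) (F : I -> S) :
 Phi (\sum_(i <- r | Q i) F i) = \sum_(i <- r | Q i) Phi (F i).
Proof. exact: rmorph_sum. Qed.
Lemma PhiC c : Phi (K c) = c%:P. Proof. exact: mmapC. Qed.
Lemma PhiX i : Phi (y i) = (d i)%:P * 'X.
Proof. by rewrite /Phi mmapX mmap1U. Qed.
Lemma PhiZ c P : Phi (c *: P) = c%:P * Phi P. Proof. exact: mmapZ. Qed.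
Lemma Phi_homog k P : P \is ishomog1 k mdeg -> Phi P = ((Phi P)`_k)%:P * 'X^k.
Proof.
move=> /dhomogP hP; suff [c ->] : exists c, Phi P = c%:P * 'X^k.
 by rewrite coefCM coefXn eqxx mulr1.
exists (\sum_(m <- msupp P) mcoeff m P * mmap1 d m).
rewrite /Phi /mmap rmorph_sum mulr_suml big_seq [RHS]big_seq; apply: eq_bigr => m mP.
rewrite rmorphM -mulrA; congr (_ * _); rewrite /mmap1 rmorph_prod.
have -> : k = (\sum_i m i)%N by rewrite -mdegE; exact/esym/(hP m mP).
rewrite -prodrXr -big_split; apply: eq_bigr => i _ /=.
by rewrite exprMn rmorphXn.
Qed.
Lemma mpoly_homog P k : exists2 N, (k < N)%N & P = \sum_(j < N) pihomog mdeg j P.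
Proof.
exists (maxn (msize P) k.+1); first by rewrite leq_max leqnn orbT.
by apply: pihomog_partitionE; rewrite leq_max leqnn.
Qed.
Lemma Phi_pihomog k P : Phi (pihomog mdeg k P) = ((Phi P)`_k)%:P * 'X^k.
Proof.
rewrite (Phi_homog (pihomogP _ _ _)); congr (_%:P * _).
have [N kN {2}->] := mpoly_homog P k.
rewrite [in RHS]Phi_sum [RHS]coef_sum [RHS](bigD1 (Ordinal kN))//= [X in _ + X]big1 ?addr0// => j jk.
rewrite (Phi_homog (pihomogP _ _ _)) coefCM coefXn.
case: eqP => [e|]; last by rewrite mulr0.
by case/eqP: jk; apply/val_inj.
Qed.

(** The strict transform of V(p) outside the zeros of the d_i: the forms which vanish
 on p at the values of the d_i. *)
Definition transform p : set S := [set P | forall k, p (Phi P)`_k].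
Local Notation Q := transform.

Lemma transform0E : Q [set 0] = blowup_ideal d.
Proof.
apply/seteqP; split=> P /=; first by move=> H; apply/polyP => k; rewrite coef0 H.
by rewrite /Q /= => H k; rewrite /Phi H coef0.
Qed.
Lemma transform_sub p p' : p `<=` p' -> Q p `<=` Q p'.
Proof. by move=> pp P HP k; apply: pp. Qed.
Lemma transform_ideal p : is_ideal p -> is_ideal (Q p).
Proof.
move=> ip; split=> [k|P1 P2 H1 H2 k|P1 P2 H2 k]; first by rewrite Phi0 coef0; exact: ideal0.
 by rewrite PhiD coefD; exact: idealD.
by rewrite PhiM coefM; apply: ideal_sum => // j _; apply: idealMl.
Qed.
Lemma transform_prime p : is_prime p -> is_prime (Q p).
Proof.
move=> pp; have [ip p1 pM] := pp; split; first exact: transform_ideal.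
 by move=> /(_ 0%N); rewrite Phi1 coef1.
move=> P1 P2 H; apply: contrapT => /not_orP[].
move=> /existsNP ex1 /existsNP ex2.
have {}ex1 : exists k, `[< ~ p (Phi P1)`_k >] by have [k ?] := ex1; exists k; apply/asboolP.
have {}ex2 : exists k, `[< ~ p (Phi P2)`_k >] by have [k ?] := ex2; exists k; apply/asboolP.
case: (ex_minnP ex1) => k /asboolP nk mk; case: (ex_minnP ex2) => l /asboolP nl ml.
have small1 i : (i < k)%N -> p (Phi P1)`_i.
 by move=> ik; apply: contrapT => /asboolP/mk; rewrite leqNgt ik.
have small2 i : (i < l)%N -> p (Phi P2)`_i.
 by move=> ik; apply: contrapT => /asboolP/ml; rewrite leqNgt ik.
have := H (k + l)%N; rewrite PhiM coefM.
have kl : (k < (k + l).+1)%N by rewrite ltnS leq_addr.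
rewrite (bigD1 (Ordinal kl))//= addKn => h.
have : p ((Phi P1)`_k * (Phi P2)`_l).
 apply: (idealDr ip h); apply: ideal_sum => // j jk.
 have [jlt|] := ltnP j k; first by apply: idealMr => //; exact: small1.
 rewrite leq_eqVlt => /orP[/eqP e|kj]; first by case/eqP: jk; apply/val_inj.
 by apply: idealMl => //; apply: small2; have := ltn_ord j; lia.
by move=> /pM[].
Qed.
Lemma transform_homog p : is_ideal p -> homogeneous_ideal (Q p).
Proof.
move=> ip P k HP j; rewrite Phi_pihomog coefCM coefXn; apply: idealMr => //; exact: HP.
Qed.
Lemma transform_C p c : is_ideal p -> Q p (K c) <-> p c.
Proof.
move=> ip; split=> [/(_ 0%N)|pc k]; rewrite PhiC coefC//.
by case: ifP => // _; exact: ideal0.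
Qed.
Lemma contraction_transform p : is_ideal p -> contraction (Q p) = p.
Proof. by move=> ip; apply/seteqP; split=> c /(transform_C _ ip). Qed.
Lemma transform_form1 p P c : is_ideal p -> Phi P = c%:P * 'X -> Q p P <-> p c.
Proof.
move=> ip E; split=> [/(_ 1%N)|pc k]; rewrite E coefCM coefX ?mulr1//.
exact: idealMr.
Qed.
Lemma transform_X p i : is_ideal p -> Q p (y i) <-> p (d i).
Proof. by move=> ip; apply: transform_form1 => //; rewrite PhiX. Qed.
Lemma proj_point_transform p i : is_prime p -> ~ p (d i) -> proj_point (Q p).
Proof.
move=> pp ni; have [ip _ _] := pp; split; first exact: transform_prime.
 exact: transform_homog.
by exists i => /(transform_X _ ip).
Qed.

(** Where d_i is invertible, every form is a multiple of a power of y_i modulo the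
 equations of the blowup. *)
Lemma blowup_form i k P : P \is ishomog1 k mdeg ->
 Q [set 0] (K (d i ^+ k) * P - K ((Phi P)`_k) * y i ^+ k).
Proof.
move=> /Phi_homog hP j /=; rewrite PhiB !PhiM !PhiC PhiXn PhiX hP.
rewrite coefCM coefXn eqxx mulr1 exprMn rmorphXn.
by rewrite mulrCA mulrA subrr coef0.
Qed.
Lemma blowup_comm i j : Q [set 0] (K (d i) * y j - K (d j) * y i).
Proof.
by move=> k /=; rewrite PhiB !PhiM !PhiC !PhiX mulrCA subrr coef0.
Qed.
Lemma homog_in (R : set S) P : is_ideal R ->
 (forall k, R (pihomog mdeg k P)) -> R P.
Proof. by move=> iR H; have [N _ ->] := mpoly_homog P 0; apply: ideal_sum. Qed.

(** Outside the zeros of the d_i the blowup is an isomorphism. *)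
Lemma transform_contraction (R : set S) i : proj_point R -> Q [set 0] `<=` R ->
 ~ R (K (d i)) -> R = Q (contraction R).
Proof.
move=> [pR hR [j nj]] BR ni; have [iR R1 RM] := pR.
have nyi : ~ R (y i).
 move=> Ry; have /BR h := blowup_comm i j.
 by have /RM[] := idealBr iR h (idealMl _ iR Ry).
have key k P : P \is ishomog1 k mdeg -> R P <-> R (K ((Phi P)`_k)).
 move=> /(blowup_form i)/BR H; split=> [RP|Rc].
 have : R (K ((Phi P)`_k) * y i ^+ k).
 by rewrite -[X in R X](subKr (K (d i ^+ k) * P)); apply: idealB => //; apply: idealMl.
 by move=> /RM[//|/(primeX pR)].
 have /RM[] : R (K (d i ^+ k) * P); last by [].
 by rewrite -[X in R X](subrK (K ((Phi P)`_k) * y i ^+ k)); apply: idealD => //; apply: idealMr.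
 by rewrite rmorphXn => /(primeX pR).
have icR : is_ideal (contraction R).
 split=> [|a b|a b]; rewrite /contraction /= ?mpolyC0 ?mpolyCD ?mpolyCM.
 - exact: ideal0.
 - exact: idealD.
 - exact: idealMl.
apply/seteqP; split=> P HP.
 move=> k; have := hR P k HP; rewrite (key k)//; last exact: pihomogP.
 by rewrite Phi_pihomog coefCM coefXn eqxx mulr1.
apply: homog_in => // k; apply/(key k); first exact: pihomogP.
by rewrite Phi_pihomog coefCM coefXn eqxx mulr1; exact: HP.
Qed.
Lemma contraction_prime (R : set S) : is_prime R -> is_prime (contraction R).
Proof.
move=> [iR R1 RM]; split; rewrite /contraction /=.
- split=> [|a b|a b]; rewrite /= ?mpolyC0 ?mpolyCD ?mpolyCM.
 + exact: ideal0.
 + exact: idealD.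
 + exact: idealMl.
- by rewrite mpolyC1.
- by move=> a b; rewrite mpolyCM => /RM.
Qed.
Lemma proj_degree_transform p i : is_prime p -> ~ p (d i) -> proj_degree (Q p) = 1%N.
Proof.
move=> pp ni; have [ip p1 pM] := pp; apply: max_or0_eq.
 exists 0%N, (fun=> 1); split=> [j|c]; first exact: dhomog1.
 by rewrite big_ord1 => H j; rewrite (ord1 j); move: H; rewrite -mul_mpolyC mulr1.
move=> k [e [u [hu Hu]]]; rewrite leqNgt; apply/negP => k1.
pose i0 := Ordinal (ltnW k1); pose i1 := Ordinal k1; pose w j := (Phi (u j))`_e.
have n01 : (i1 == i0) = false by [].
pose c j := if j == i0 then w i1 else if j == i1 then - w i0 else 0.
have Hc : Q p (\sum_j c j *: u j).
 rewrite (bigD1 i0)// (bigD1 i1)//= big1 => [|j /andP[/negbTE n0 /negbTE n1]]; last first.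
 by rewrite /c n0 n1 scale0r.
 have -> : c i0 = w i1 by rewrite /c eqxx.
 have -> : c i1 = - w i0 by rewrite /c n01 eqxx.
 move=> j; rewrite addr0 PhiD !PhiZ (Phi_homog (hu i0)) (Phi_homog (hu i1)).
 rewrite -[(Phi (u i0))`_e]/(w i0) -[(Phi (u i1))`_e]/(w i1).
 rewrite (_ : _ + _ = 0 :> {poly A}) ?coef0; first exact: ideal0.
 by rewrite rmorphN; ring.
have := Hu _ Hc i0; rewrite contraction_transform// /c eqxx => pw.
have Hc1 : Q p (\sum_j (if j == i1 then 1 else 0) *: u j).
 rewrite (bigD1 i1)//= scale1r big1 ?addr0 => [|j /negbTE ->]; last by rewrite scale0r.
 by move=> j; rewrite (Phi_homog (hu _)) coefCM; apply: idealMr.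
by have := Hu _ Hc1 i1; rewrite contraction_transform// eqxx.
Qed.

(** The transform of r is a reduced component of a subscheme I of the transform of p
 if r is so in degree k for large k. *)
Lemma length_transform p r (I : set S) i : is_prime r -> is_ideal I ->
 ~ r (d i) -> Q p `<=` I -> I `<=` Q r ->
 (forall x k, r x -> exists2 s, ~ r s &
 exists2 g, I g & forall j, p ((s * x)%:P * 'X^(k.+1) - Phi g : {poly A})`_j) ->
 local_length (Q r) I = 1%N.
Proof.
move=> pr iI ni QI IQ H; have [ir r1 rM] := pr.
have pQ := transform_prime pr; have [iQ Q1 QM] := pQ.
apply: local_length1 => // P HP; have [N _ EP] := mpoly_homog P 0.
have Hk k : exists s, ~ Q r s /\ I (s * pihomog mdeg k P).
 have [s ns [g Ig pg]] := H (d i * (Phi P)`_k) k (idealMl _ ir (HP k)).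
 exists (K s * y i); split.
 by apply: nprimeM => //; [move=> /(transform_C _ ir)|move=> /(transform_X _ ir)].
 rewrite -[X in I X](subrK g); apply: idealD => //; apply: QI => j.
 rewrite PhiB !PhiM PhiC PhiX Phi_pihomog (_ : _ * _ = (s * (d i * (Phi P)`_k))%:P * 'X^(k.+1)) //.
 by rewrite !rmorphM /= exprS; ring.
have [s Hs] := choice Hk; exists (\prod_(j < N) s j).
 by elim/big_ind: _ => // [a b|j _]; [exact: nprimeM|exact: (Hs j).1].
rewrite {1}EP mulr_sumr; apply: ideal_sum => // j _.
by rewrite (bigD1 j)//= mulrAC; apply: idealMr => //; exact: (Hs j).2.
Qed.
Lemma length_hyperplane p r c l i : is_prime r -> is_ideal p -> p `<=` r -> r c ->
 ~ r (d i) -> Phi l = c%:P * 'X ->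
 (forall x, r x -> exists2 s, ~ r s & exists v, p (s * x - v * c)) ->
 local_length (Q r) (ideal_gen (Q p `|` [set l])) = 1%N.
Proof.
move=> pr ip pr' rc ni El H; have [ir r1 rM] := pr.
have iI := @smallest_ideal _ (Q p `|` [set l]).
apply: (length_transform (p := p) (i := i) pr iI ni).
- by move=> P QP; apply: sub_ideal_gen; left.
- apply: ideal_gen_sub; first exact: transform_ideal.
 by move=> P [|->]; [exact: transform_sub|exact/(transform_form1 ir El)].
move=> x k rx; have [s ns [v pv]] := H x rx.
exists (s * d i ^+ k); first by apply: nprimeM => //; exact: primeXn.
exists (K v * y i ^+ k * l).
 by apply: (idealMl _ iI); apply: sub_ideal_gen; right.
move=> j; rewrite !PhiM PhiXn PhiC PhiX El.
rewrite (_ : _ - _ = (d i ^+ k * (s * x - v * c))%:P * 'X^(k.+1)).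
 by rewrite coefCM; apply: idealMr => //; apply: idealMl.
by rewrite !(rmorphM, rmorphB, rmorphXn) /= exprS exprMn; ring.
Qed.
Lemma length_exceptional r (a : 'I_n -> A) i h : is_prime r -> ~ r (d i) ->
 r h -> ~ r 2%:R -> (forall j, a j = 2%:R * h * d j) -> (forall x, r x -> exists c, x = c * h) ->
 local_length (Q r) (ideal_gen (Q [set 0] `|` range (fun j => K (a j)))) = 1%N.
Proof.
move=> pr ni rh n2 Ea H; have [ir r1 rM] := pr.
have iI := @smallest_ideal _ (Q [set 0] `|` range (fun j => K (a j))).
apply: (length_transform (i := i) (p := [set 0]) pr iI ni).
- by move=> P QP; apply: sub_ideal_gen; left.
- apply: ideal_gen_sub; first exact: transform_ideal.
 move=> P [|[j _ <-]]; first by apply: transform_sub => _ ->; exact: ideal0.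
 by apply/transform_C => //; rewrite Ea; apply: idealMr => //; apply: idealMl.
move=> x k rx; have [c xc] := H x rx.
exists (2%:R * (d i * (d i * d i ^+ k))).
 by do 3?apply: nprimeM => //; exact: primeXn.
exists (K c * y i ^+ k.+1 * K (a i)).
 by apply: (idealMl _ iI); apply: sub_ideal_gen; right; exists i.
move=> j /=; rewrite !PhiM PhiXn !PhiC PhiX Ea xc.
rewrite !(rmorphM, rmorphXn) /= exprMn.
by rewrite (_ : _ - _ = 0 :> {poly A}) ?coef0// !exprS; ring.
Qed.

End Blowup.

End Gg.
Import Gg.

(** * Two hyperplane sections *)

Module Gh.
Local Notation contraction := Defs.contraction.

Section Components.
Variables (A : comNzRingType) (n : nat).
Local Notation S := {mpoly A[n]}.
Implicit Types (I P Q R : set S) (Z : @Defs.cycle A n) (s : seq (set S)).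

Definition components I s := uniq s /\ forall R, proj_component I R <-> R \in s.

Lemma componentsI I s : uniq s ->
 (forall P, P \in s -> proj_point P /\ I `<=` P) ->
 (forall R, proj_point R -> I `<=` R -> exists2 P, P \in s & P `<=` R) ->
 (forall P Q, P \in s -> Q \in s -> P `<=` Q -> P = Q) -> components I s.
Proof.
move=> us sP sR inc; split=> // R; split=> [[pR IR minR]|Rs].
 have [P Ps PR] := sR R pR IR; have [pP IP] := sP P Ps.
 by rewrite -(minR P pP IP PR).
have [pR IR] := sP R Rs; split=> // Q pQ IQ QR.
have [P Ps PQ] := sR Q pQ IQ.
have PR : P = R by apply: inc => //; exact: subset_trans QR.
by apply/seteqP; split=> //; rewrite -PR.
Qed.
Lemma scheme_cycleE I s R : components I s ->
 scheme_cycle I R = if R \in s then local_length R I else 0%N.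
Proof.
by move=> [_ H]; rewrite /scheme_cycle; case: asboolP => [/H ->//|/H/negP/negbTE ->].
Qed.
Lemma hyperplane_capE l Z s R : uniq s -> (forall P, P \notin s -> Z P = 0%N) ->
 hyperplane_cap l Z R =
 (\sum_(P <- s) Z P * scheme_cycle (ideal_gen (P `|` [set l])) R)%N.
Proof.
move=> us Z0; rewrite /hyperplane_cap (fsbigE s)//=; last by move=> P _ /Z0 ->; rewrite mul0n.
by apply: eq_bigl => P; rewrite in_setT.
Qed.
Lemma pushforwardE Z s q : uniq s -> (forall P, P \notin s -> Z P = 0%N) ->
 pushforward Z q = (\sum_(P <- s | contraction P == q) Z P * proj_degree P)%N.
Proof.
move=> us Z0; rewrite /pushforward -big_filter (fsbigE [seq P <- s | contraction P == q])//=; first last.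
- by move=> P cP; rewrite mem_filter cP eqxx/= => /Z0 ->; exact: mul0n.
- by move=> P; rewrite /= mem_filter => /andP[/eqP].
- by rewrite filter_uniq.
rewrite big_mkcond [RHS]big_seq big_seq; apply: eq_bigr => P.
by rewrite mem_filter => /andP[/eqP cP _]; rewrite mem_set.
Qed.

(** The cycles cut out by two hyperplanes in an exceptional divisor with a horizontal
 component Q0 and a component M0 over the closed point mm. *)
Lemma two_hyperplanes I l0 l1 (M0 M1 M2 Q0 Q1 : set S) s (q : set A) (mm : set A) :
 components I [:: M0; Q0] -> components (ideal_gen (M0 `|` [set l1])) [:: M1] ->
 components (ideal_gen (M1 `|` [set l0])) [:: M2] ->
 components (ideal_gen (Q0 `|` [set l1])) [:: Q1] ->
 components (ideal_gen (Q1 `|` [set l0])) s ->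
 local_length Q0 I = 1%N -> local_length Q1 (ideal_gen (Q0 `|` [set l1])) = 1%N ->
 {in s, forall P, local_length P (ideal_gen (Q1 `|` [set l0])) = 1%N} ->
 Q1 != M1 -> {in s, forall P, contraction P != mm} -> contraction M2 = mm ->
 proj_degree M2 = 0%N -> {in s, forall P, proj_degree P = 1%N} ->
 pushforward (hyperplane_cap l0 (hyperplane_cap l1 (scheme_cycle I))) q =
 (\sum_(P <- s) (contraction P == q))%N.
Proof.
move=> cI cM0 cM1 cQ0 cQ1 len0 len1 len2 QM scon M2con M2deg sdeg.
have Z0 P : scheme_cycle I P = if P \in [:: M0; Q0] then local_length P I else 0%N.
 exact: scheme_cycleE.
have Z1 P : hyperplane_cap l1 (scheme_cycle I) P =
 (scheme_cycle I M0 * scheme_cycle (ideal_gen (M0 `|` [set l1])) P +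
 scheme_cycle (ideal_gen (Q0 `|` [set l1])) P)%N.
 rewrite (@hyperplane_capE _ _ [:: M0; Q0]); first last.
 - by move=> ? H; rewrite Z0 (negbTE H).
 - by case: cI.
 rewrite !big_cons big_nil addn0; congr (_ + _)%N.
 by rewrite Z0 !inE eqxx orbT len0 mul1n.
have Z2 P : hyperplane_cap l0 (hyperplane_cap l1 (scheme_cycle I)) P =
 (scheme_cycle I M0 * local_length M1 (ideal_gen (M0 `|` [set l1])) *
 scheme_cycle (ideal_gen (M1 `|` [set l0])) P +
 scheme_cycle (ideal_gen (Q1 `|` [set l0])) P)%N.
 rewrite (@hyperplane_capE _ _ [:: M1; Q1]); first last.
 - move=> R; rewrite !inE negb_or => /andP[n1 n2].
 by rewrite Z1 (scheme_cycleE _ cM0) (scheme_cycleE _ cQ0) !inE (negbTE n1) (negbTE n2) muln0.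
 - by rewrite /= inE andbT eq_sym.
 rewrite !big_cons big_nil addn0 !Z1 !(scheme_cycleE _ cM0) !(scheme_cycleE _ cQ0).
 by rewrite !inE !eqxx (negbTE QM) eq_sym (negbTE QM) muln0 len1 addn0 mul1n.
have M2s : M2 \notin s by apply/negP => /scon; rewrite M2con eqxx.
have us : uniq s by case: cQ1.
rewrite (@pushforwardE _ (M2 :: s)); first last.
- move=> R; rewrite !inE negb_or => /andP[n1 n2].
 by rewrite Z2 (scheme_cycleE _ cM1) (scheme_cycleE _ cQ1) inE (negbTE n1) (negbTE n2) muln0.
- by rewrite /= M2s.
rewrite big_cons M2deg muln0 add0n if_same big_mkcond; apply: eq_big_seq => P Ps.
have nP : P \notin [:: M2] by rewrite inE; apply: contraNneq M2s => <-.
rewrite Z2 (scheme_cycleE _ cM1) (negbTE nP) muln0 add0n (scheme_cycleE _ cQ1) Ps len2// sdeg//.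
Qed.

End Components.

Section LinearIdeals.
Variables (C : numFieldType) (k n : nat).
Local Notation A := (holo_germ C k).
Local Notation S := {mpoly A[n]}.
Local Notation y i := (mpolyX A (mnm1 i) : S).
Local Notation K c := (mpolyC n c : S).
Local Notation Y i := (mpolyX C (mnm1 i) : {mpoly C[n]}).
Variable c : 'I_n -> 'I_n -> C.

Definition theta (P : S) : {mpoly C[n]} :=
 mmap (@mpolyC n C \o @cst C k) (fun i => \sum_j c i j *: Y j) P.

Lemma thetaC a : theta (K a) = mpolyC n (cst a). Proof. exact: mmapC. Qed.
Lemma thetaX i : theta (y i) = \sum_j c i j *: Y j.
Proof. by rewrite /theta mmapX mmap1U. Qed.
Lemma thetaM P Q : theta (P * Q) = theta P * theta Q. Proof. exact: rmorphM. Qed.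
Lemma thetaD P Q : theta (P + Q) = theta P + theta Q. Proof. exact: rmorphD. Qed.
Lemma theta0 : theta 0 = 0. Proof. exact: rmorph0. Qed.
Lemma theta1 : theta 1 = 1. Proof. exact: rmorph1. Qed.
Lemma theta_sum I (r : seq I) (Q : pred I) (F : I -> S) :
 theta (\sum_(i <- r | Q i) F i) = \sum_(i <- r | Q i) theta (F i).
Proof. exact: rmorph_sum. Qed.
Lemma theta_homog d P : P \is ishomog1 d mdeg -> theta P \is ishomog1 d mdeg.
Proof.
move=> /dhomogP hP; rewrite /theta /mmap big_seq; apply: rpred_sum => m mP.
rewrite mul_mpolyC; apply: rpredZ; rewrite /mmap1.
have -> : d = (\sum_i m i)%N by rewrite -mdegE; exact/esym/(hP m mP).
elim/big_rec2: _ => [|i a b _ Hb]; first exact: dhomog1.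
apply: dhomogM => //.
suff h : \sum_j c i j *: Y j \is ishomog1 1 mdeg by have := dhomogMn (m i) h; rewrite mul1n.
by apply: rpred_sum => j _; apply: rpredZ; rewrite dhomogX /= mdeg1.
Qed.
Lemma theta_pihomog d P : theta (pihomog mdeg d P) = pihomog mdeg d (theta P).
Proof.
have [N dN EP] := mpoly_homog P d.
have -> : pihomog mdeg d (theta P) = \sum_(j < N) pihomog mdeg d (theta (pihomog mdeg j P)).
 by rewrite {1}EP theta_sum; exact: raddf_sum.
have th j : theta (pihomog mdeg j P) \is ishomog1 j mdeg by apply/theta_homog/pihomogP.
rewrite [RHS](bigD1 (Ordinal dN))//=.
rewrite [X in _ + X]big1 ?addr0 => [|j jd].
 by rewrite (pihomog_dE (th d)).
apply: (pihomog_ne0 _ (th j)).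
by apply: contraNneq jd => e; apply/eqP/val_inj.
Qed.

(** The cone over a linear subspace of the fibre of the closed point, given as the
 image of the matrix c. *)
Definition linear_ideal : set S := [set P | theta P = 0].

Lemma linear_ideal_prime : is_prime linear_ideal.
Proof.
split; rewrite /linear_ideal /=.
- split=> /= [|P Q hP hQ|P Q hQ]; first exact: theta0.
 by rewrite thetaD hP hQ addr0.
 by rewrite thetaM hQ mulr0.
- by rewrite theta1 => /eqP; rewrite oner_eq0.
- by move=> P Q; rewrite thetaM => /eqP; rewrite mulf_eq0 => /orP[]/eqP; [left|right].
Qed.
Lemma linear_ideal_point i : \sum_j c i j *: Y j != 0 -> proj_point linear_ideal.
Proof.
move=> ni; split; first exact: linear_ideal_prime.
 by move=> P d HP; rewrite /linear_ideal /= theta_pihomog HP raddf0.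
by exists i; rewrite /linear_ideal /= thetaX; apply/eqP.
Qed.
Lemma linear_ideal_C a : linear_ideal (K a) <-> cst a = 0.
Proof.
rewrite /linear_ideal /= thetaC; split=> [/eqP|->]; last by rewrite mpolyC0.
by rewrite mpolyC_eq0 => /eqP.
Qed.
Lemma contraction_linear : contraction linear_ideal = @germ_maximal_ideal C k.
Proof. by apply/seteqP; split=> a /linear_ideal_C. Qed.
Lemma linear_ideal_min (R : set S) : is_ideal R -> (forall a, cst a = 0 -> R (K a)) ->
 (forall i, R (y i - \sum_j K (germC k (c i j)) * y j)) -> linear_ideal `<=` R.
Proof.
move=> iR mR yR.
pose sg (p : {mpoly C[n]}) : S := mmap (@mpolyC n A \o @germC C k) (fun j => y j) p.
have H P : R (P - sg (theta P)).
 have RM U V : R (U - sg (theta U)) -> R (V - sg (theta V)) -> R (U * V - sg (theta (U * V))).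
 move=> hU hV; rewrite thetaM (_ : sg (_ * _) = sg (theta U) * sg (theta V)); last exact: rmorphM.
 have E (T : comNzRingType) (a b a' b' : T) : a * b - a' * b' = b * (a - a') + a' * (b - b').
 by ring.
 rewrite (E _ U V (sg (theta U)) (sg (theta V))).
 exact: (idealD iR (idealMl _ iR hU) (idealMl _ iR hV)).
 have RX i : R (y i - sg (theta (y i))).
 rewrite thetaX (_ : sg _ = \sum_j K (germC k (c i j)) * y j)//.
 rewrite /sg rmorph_sum; apply: eq_bigr => j _.
 by rewrite -mul_mpolyC rmorphM /= mmapC mmapX mmap1U.
 have R1 : R (1 - sg (theta 1)).
 by rewrite theta1 (_ : sg 1 = 1) ?subrr; [exact: ideal0|exact: rmorph1].
 have sg_sum (r : seq (multinom n)) F : sg (\sum_(i <- r) F i) = \sum_(i <- r) sg (F i).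
 exact: rmorph_sum.
 pose T m : S := mcoeff m P *: mpolyX A m.
 have EP : P = \sum_(m <- msupp P) T m by exact: mpolyE.
 have -> : P - sg (theta P) = \sum_(m <- msupp P) (T m - sg (theta (T m))).
 by rewrite sumrB -sg_sum -theta_sum -EP.
 have RK a : R (K a - sg (theta (K a))).
 rewrite thetaC (_ : sg _ = K (germC k (cst a))); last exact: mmapC.
 by rewrite -mpolyCB; apply: mR; rewrite cstB cstC subrr.
 have RXn i e : R (y i ^+ e - sg (theta (y i ^+ e))).
 elim: e => [|e IH]; first by rewrite expr0.
 by rewrite exprS; exact: (RM _ _ (RX i) IH).
 have Rm m : R (mpolyX A m - sg (theta (mpolyX A m))).
 rewrite mpolyXE_id.
 elim: (index_enum _) => [|i r IH]; first by rewrite big_nil.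
 by rewrite big_cons; exact: (RM _ _ (RXn i _) IH).
 elim/big_ind: _ => [|a b|m _]; [exact: ideal0|exact: idealD|].
 have -> : T m = K (mcoeff m P) * mpolyX A m by rewrite mul_mpolyC.
 exact: (RM _ _ (RK _) (Rm m)).
move=> P P0; have := H P; rewrite P0 (_ : sg 0 = 0) ?subr0//; exact: rmorph0.
Qed.

(** The image of a subspace of dimension at least two is a point. *)
Lemma proj_degree_linear i1 i2 : i1 != i2 ->
 (forall j, c i1 j = (j == i1)%:R) -> (forall j, c i2 j = (j == i2)%:R) ->
 proj_degree linear_ideal = 0%N.
Proof.
move=> ne c1 c2; apply: max_or0_unbounded => d; exists d.+1 => //.
exists d, (fun i => y i1 ^+ i * y i2 ^+ (d - i)); split=> [i|a].
 have h1 j e : y j ^+ e \is ishomog1 e mdeg.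
 by have := @dhomogMn _ A mdeg 1 (y j) e; rewrite mul1n; apply; rewrite dhomogX /= mdeg1.
 by have := dhomogM (h1 i1 i) (h1 i2 (d - i)%N); rewrite subnKC // -ltnS.
have tX i : (forall j, c i j = (j == i)%:R) -> theta (y i) = Y i.
 move=> ci; rewrite thetaX (bigD1 i)//= ci eqxx scale1r big1 ?addr0// => j /negbTE ji.
 by rewrite ci ji scale0r.
rewrite /linear_ideal /= theta_sum => H i; rewrite contraction_linear /germ_maximal_ideal /=.
have := congr1 (mcoeff (mnm_add (mnm_muln (mnm1 i1) i) (mnm_muln (mnm1 i2) (d - i)))) H.
rewrite mcoeff0 raddf_sum /= => E; rewrite -[RHS]E.
have T j : theta (a j *: (y i1 ^+ j * y i2 ^+ (d - j))) =
 cst (a j) *: mpolyX C (mnm_add (mnm_muln (mnm1 i1) j) (mnm_muln (mnm1 i2) (d - j))).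
 have tXn P e : theta (P ^+ e) = theta P ^+ e by exact: rmorphXn.
 by rewrite -mul_mpolyC !thetaM thetaC !tXn !tX// mul_mpolyC mpolyXD !mpolyXn.
rewrite (bigD1 i)//= T mcoeffZ mcoeffX eqxx mulr1 big1 ?addr0// => j ji.
rewrite T mcoeffZ mcoeffX; case: eqP => [/mnmP/(_ i1)|]; last by rewrite mulr0.
rewrite !mnmDE !mulmnE !mnm1E eqxx [i2 == i1]eq_sym (negbTE ne) !mul1n !mul0n !addn0 => e.
by case/eqP: ji; apply/val_inj.
Qed.

End LinearIdeals.

End Gh.
Import Gh.

(** * Relations in the fibre of the blowup *)

Module Gi.
Section Nakayama.
Variables (S : comNzRingType) (Q R : set S) (u v : S).
Hypotheses (pQ : is_prime Q) (pR : is_prime R) (QR : Q `<=` R) (Ru : R u) (Rv : R v).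

Let iQ : is_ideal Q. Proof. by case: pQ. Qed.
Let iR : is_ideal R. Proof. by case: pR. Qed.

(** The powers of the ideal (u, v) modulo Q. *)
Fixpoint upow k : set S :=
 if k is k'.+1 then [set p | exists a b, [/\ upow k' a, upow k' b & Q (p - (a * u + b * v))]]
 else setT.

Lemma upowM k l p x : upow k p -> upow l x -> upow (k + l) (p * x).
Proof.
have M1 m a y : upow m y -> upow m (a * y).
 elim: m a y => [//|m IH] a y /= [a1 [b1 [h1 h2 h]]].
 exists (a * a1), (a * b1); split; [exact: IH|exact: IH|].
 rewrite (_ : _ - _ = a * (y - (a1 * u + b1 * v))); last by ring.
 exact: idealMl.
elim: k p => [|k IH] p /= hp hx; first exact: M1.
have [a [b [ha hb h]]] := hp; exists (a * x), (b * x); split; [exact: IH|exact: IH|].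
rewrite (_ : _ - _ = (p - (a * u + b * v)) * x); last by ring.
exact: idealMr.
Qed.
Lemma upowQ k p : Q p -> upow k p.
Proof.
elim: k p => [//|k IH] p Qp /=; exists 0, 0; split.
- by apply: IH; exact: ideal0.
- by apply: IH; exact: ideal0.
by rewrite !mul0r addr0 subr0.
Qed.
Lemma upowD k p x : upow k p -> upow k x -> upow k (p + x).
Proof.
elim: k p x => [//|k IH] p x /= [a [b [ha hb h]]] [a' [b' [ha' hb' h']]].
exists (a + a'), (b + b'); split; [exact: IH|exact: IH|].
rewrite (_ : _ - _ = (p - (a * u + b * v)) + (x - (a' * u + b' * v))); last by ring.
exact: idealD.
Qed.
Lemma upow_span k p : upow k p ->
 exists e : nat -> S, Q (p - \sum_(j < k.+1) e j * (u ^+ j * v ^+ (k - j))).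
Proof.
elim: k p => [|k IH] p.
 move=> _; exists (fun=> p); rewrite big_ord1 mulr1 mulr1 subrr; exact: ideal0.
move=> [a [b [/IH[ea ha] /IH[eb hb] h]]].
exists (fun j => (if j is j'.+1 then ea j' else 0) + (if (j <= k)%N then eb j else 0)).
under eq_bigr do rewrite mulrDl.
rewrite big_split /= [X in _ - (X + _)]big_ord_recl [X in _ - (_ + X)]big_ord_recr /=.
rewrite ltnn mul0r mul0r add0r addr0.
set sa := \sum_(j < k.+1) ea j * _ in ha; set sb := \sum_(j < k.+1) eb j * _ in hb.
rewrite (_ : \sum_(i < k.+1) _ = u * sa); last first.
 rewrite mulr_sumr; apply: eq_bigr => j _.
 by rewrite /bump leq0n add1n add0n subSS exprS; ring.
rewrite (_ : \sum_(i < k.+1) _ = v * sb); last first.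
 rewrite mulr_sumr; apply: eq_bigr => j _.
 have jk : (j <= k)%N by rewrite -ltnS.
 by rewrite jk subSn // exprS; ring.
rewrite (_ : _ - _ = (p - (a * u + b * v)) + ((a - sa) * u + (b - sb) * v)); last by ring.
by apply: idealD => //; apply: idealD => //; apply: idealMr.
Qed.

(** Local version at R. *)
Definition lpow k : set S := [set p | exists2 s, ~ R s & upow k (s * p)].

Lemma lpow_upow k p : upow k p -> lpow k p.
Proof. by move=> h; exists 1; [case: pR|rewrite mul1r]. Qed.
Lemma lpowM k l p x : lpow k p -> lpow l x -> lpow (k + l) (p * x).
Proof.
move=> [s ns hs] [s' ns' hs']; exists (s * s'); first exact: nprimeM.
by rewrite mulrACA; apply: upowM.
Qed.
Lemma lpow_any p : lpow 0 p. Proof. exact: lpow_upow. Qed.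
Lemma lpowMl k a p : lpow k p -> lpow k (a * p).
Proof. by move=> h; apply: (@lpowM 0 k) => //; exact: lpow_any. Qed.
Lemma lpowMr k a p : lpow k p -> lpow k (p * a).
Proof. by rewrite mulrC; exact: lpowMl. Qed.
Lemma lpowD k p x : lpow k p -> lpow k x -> lpow k (p + x).
Proof.
move=> [s ns hs] [s' ns' hs']; exists (s * s'); first exact: nprimeM.
rewrite mulrDr; apply: upowD.
 by rewrite [s * s']mulrC -mulrA; exact: (@upowM 0 k).
by rewrite -mulrA; exact: (@upowM 0 k).
Qed.
Lemma lpowN k p : lpow k p -> lpow k (- p).
Proof. by rewrite -mulN1r; exact: lpowMl. Qed.
Lemma lpowB k p x : lpow k p -> lpow k x -> lpow k (p - x).
Proof. by move=> hp hx; apply: lpowD => //; apply: lpowN. Qed.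
Lemma lpowQ k p : Q p -> lpow k p. Proof. by move=> h; exact/lpow_upow/upowQ. Qed.
Lemma lpow_cancel k s p : ~ R s -> lpow k (s * p) -> lpow k p.
Proof.
by move=> ns [s' ns' h]; exists (s' * s); [exact: nprimeM|rewrite -mulrA].
Qed.
Lemma lpow_eqQ k p x : Q (p - x) -> lpow k x -> lpow k p.
Proof. by move=> h hx; rewrite -(subrK x p); apply: lpowD => //; exact: lpowQ. Qed.
Lemma lpowX k l p : lpow k p -> lpow (k * l) (p ^+ l).
Proof.
move=> h; elim: l => [|l IH]; first by rewrite muln0; exact: lpow_any.
by rewrite mulnS exprS; exact: lpowM.
Qed.
Lemma lpowW k l p : (k <= l)%N -> lpow l p -> lpow k p.
Proof.
have H m q : upow m.+1 q -> upow m q.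
 move=> [a [b [ha hb h]]]; rewrite -(subrK (a * u + b * v) q).
 apply: upowD; first exact: upowQ.
 by apply: upowD; rewrite mulrC; exact: (@upowM 0 m).
move=> kl [s ns h]; exists s => //; rewrite -(subnKC kl) in h.
by elim: (l - k)%N h => [|m IH]; rewrite ?addn0// addnS => /H.
Qed.
Lemma lpow_u : lpow 1 u.
Proof.
apply: lpow_upow; exists 1, 0; split=> //.
by rewrite mul1r mul0r addr0 subrr; exact: ideal0.
Qed.
Lemma lpow_v : lpow 1 v.
Proof.
apply: lpow_upow; exists 0, 1; split=> //.
by rewrite mul1r mul0r add0r subrr; exact: ideal0.
Qed.
Lemma det_modR m (M : 'M[S]_m) s : ~ R s ->
 (forall i j, R (M i j - s *+ (i == j))) -> ~ R (\det M).
Proof.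
move=> ns HM; rewrite /determinant (bigD1 (1%g : {perm 'I_m}))//= odd_perm1 expr0 mul1r => H.
have {}H := idealDr iR H.
suff : R (\prod_i M i ((1%g : {perm 'I_m}) i)).
 elim/big_ind: _ => [|a b IHa IHb|j _]; [by case: pR| |].
 by case: pR => _ _ PM /PM[].
 rewrite perm1 => h; apply: ns; have := HM j j; rewrite eqxx mulr1n => h2.
 by have := idealB iR h h2; rewrite subKr.
apply: H; apply: ideal_sum => // sg nsg; apply: idealMl => //.
have [j nj] : exists j, sg j != j.
 apply: contrapT => /forallNP h; case/eqP: nsg; apply/permP => j; rewrite perm1.
 by apply/eqP/negPn/negP/h.
rewrite (bigD1 j)//=; apply: idealMr => //; have := HM j (sg j).
by rewrite eq_sym (negbTE nj) mulr0n subr0.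
Qed.

(** Nakayama: if (u, v)^N lies in (u, v)^(N+1) near R, then (u, v) vanishes. *)
Lemma nakayama N : (forall j, (j <= N)%N -> lpow N.+1 (u ^+ j * v ^+ (N - j))) -> Q u /\ Q v.
Proof.
move=> H; pose g (j : 'I_N.+1) := u ^+ j * v ^+ (N - j).
have H1 (j : 'I_N.+1) : exists s, exists e : 'I_N.+1 -> S,
 [/\ ~ R s, forall i, R (e i) & Q (s * g j - \sum_i e i * g i)].
 have [s ns [a [b [/upow_span[ea ha] /upow_span[eb hb] h]]]] := H j (ltn_ord j : (j <= N)%N).
 exists s, (fun i => ea i * u + eb i * v); split=> // [i|].
 by apply: idealD => //; apply: idealMl.
 rewrite (_ : \sum_i _ = (\sum_(i < N.+1) ea i * g i) * u + (\sum_(i < N.+1) eb i * g i) * v); last first.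
 by rewrite !mulr_suml -big_split; apply: eq_bigr => i _ /=; ring.
 set sa := \sum_(i < N.+1) ea i * _; set sb := \sum_(i < N.+1) eb i * _.
 rewrite (_ : _ - _ = (s * g j - (a * u + b * v)) + ((a - sa) * u + (b - sb) * v)); last by ring.
 by apply: idealD => //; apply: idealD => //; apply: idealMr.
have [s Hs] := choice H1; have [e He] := choice Hs.
pose s0 := \prod_j s j.
have ns0 : ~ R s0.
 by rewrite /s0; elim/big_ind: _ => [|a b|j _]; [by case: pR|exact: nprimeM|case: (He j)].
pose t j := \prod_(i | i != j) s i.
pose M : 'M[S]_N.+1 := \matrix_(i, j) (s0 *+ (i == j) - t i * e i j).
have Mg i : Q (\sum_j M i j * g j).
 have [_ _ h] := He i; rewrite (_ : \sum_j _ = t i * (s i * g i - \sum_j e i j * g j)).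
 exact: idealMl.
 rewrite mulrBr mulr_sumr (eq_bigr (fun j => s0 *+ (i == j) * g j - t i * (e i j * g j))) => [|j _].
 rewrite sumrB; congr (_ - _); rewrite (bigD1 i)//= eqxx mulr1n big1 ?addr0 => [|j].
 by rewrite /s0 (bigD1 i)//= -/(t i); ring.
 by rewrite eq_sym => /negbTE ->; rewrite mulr0n mul0r.
 by rewrite !mxE mulrBl mulrA.
have nd : ~ R (\det M).
 apply: (det_modR ns0) => i j; rewrite !mxE addrC addKr; apply: idealN => //.
 by apply: idealMl => //; case: (He i).
have gQ i : Q (g i).
 have : Q (\det M * g i).
 rewrite (_ : _ * _ = \sum_k (\adj M) i k * \sum_j M k j * g j).
 by apply: ideal_sum => // k _; apply: idealMl.
 have /matrixP/(_ i) E := mul_adj_mx M.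
 under eq_bigr do rewrite mulr_sumr.
 rewrite exchange_big /=.
 under eq_bigr => j _.
 under eq_bigr do rewrite mulrA.
 rewrite -mulr_suml; have := E j; rewrite !mxE => ->.
 over.
 rewrite (bigD1 i)//= eqxx mulr1n big1 ?addr0// => j; rewrite eq_sym => /negbTE ->.
 by rewrite mulr0n mul0r.
 by case: pQ => _ _ PM /PM[/QR|].
split.
 by have := gQ ord_max; rewrite /g /= subnn mulr1; exact: primeX.
by have := gQ ord0; rewrite /g /= mul1r subn0; exact: primeX.
Qed.

End Nakayama.

Section Relations.
Variables (S : comNzRingType) (Q R : set S) (x y z w y1 y2 y3 y4 tt : S).
Hypotheses (pQ : is_prime Q) (pR : is_prime R) (QR : Q `<=` R).
Hypotheses (Rx : R x) (Ry : R y) (Rz : R z).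
Hypothesis nat_unit : forall k, ~ R k.+1%:R.
Let Fx := y ^+ 7 + 15%:R * x ^+ 14.
Let Fy := 6%:R * tt * (y ^+ 5 * z) + 7%:R * (x * y ^+ 6).
Let Fz := 5%:R * z ^+ 4 + tt * y ^+ 6.
Let Fw := 2%:R * w.
Hypothesis euler : Q (2%:R * x * y1 + 4%:R * y * y2 + 6%:R * z * y3 + 15%:R * w * y4).

Let iR : is_ideal R. Proof. by case: pR. Qed.
Let iQ : is_ideal Q. Proof. by case: pQ. Qed.

(** Where y1 is invertible all the derivatives are multiples of the first one, and so
 y^44 lies in (y, z)^45. *)
Lemma relation_generic : ~ R tt -> ~ Q y ->
 Q (y1 * Fy - y2 * Fx) -> Q (y1 * Fz - y3 * Fx) -> Q (y1 * Fw - y4 * Fx) -> R y1.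
Proof.
move=> nt nQy hy hz hw; apply: contrapT => n1; apply: nQy.
pose P := lpow Q R y z.
have Pu : P 1%N y by exact: lpow_u.
have Pv : P 1%N z by exact: lpow_v.
have PM k l p q : P k p -> P l q -> P (k + l)%N (p * q) by exact: lpowM.
have PMe m k l p q : (m = k + l)%N -> P k p -> P l q -> P m (p * q) by move=> ->; apply: PM.
have PX k l p : P k p -> P (k * l)%N (p ^+ l) by exact: lpowX.
have PMl k a p : P k p -> P k (a * p) by exact: lpowMl.
have PD k p q : P k p -> P k q -> P k (p + q) by exact: lpowD.
have PB k p q : P k p -> P k q -> P k (p - q) by exact: lpowB.
have PQ k p q : Q (p - q) -> P k q -> P k p by exact: lpow_eqQ.
have Pc k s p : ~ R s -> P k (s * p) -> P k p by exact: lpow_cancel.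
have PW k l p : (k <= l)%N -> P l p -> P k p by exact: lpowW.
have Py k : P k (y ^+ k) by have := PX _ k _ Pu; rewrite mul1n.
have Px : P 1%N x.
 apply: (Pc _ (4%:R * y1 ^+ 2 + 225%:R * (y4 ^+ 2 * x ^+ 13))).
 move=> /(idealDr iR) H; have {H}: R (4%:R * y1 ^+ 2).
 by apply: H; do 2?apply: idealMl => //; rewrite exprS; apply: idealMr.
 by case: pR => _ _ PMR /PMR[/nat_unit|/(primeX pR)].
 apply: (PQ _ _ (- 8%:R * y1 * y2 * y + (- 12%:R * y1 * y3 * z + - 15%:R * y4 ^+ 2 * y ^+ 6 * y))).
 rewrite (_ : _ - _ = 2%:R * y1 *
 (2%:R * x * y1 + 4%:R * y * y2 + 6%:R * z * y3 + 15%:R * w * y4)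
 - 15%:R * y4 * (y1 * Fw - y4 * Fx)); last by rewrite /Fw /Fx; ring.
 by apply: idealB => //; apply: idealMl.
 by apply: (PD); [|apply: (PD)]; apply: (PMl).
have PFx : P 7%N Fx.
 by apply: (PD) => //; apply: (PMl); apply: (PW 7%N 14%N) => //; exact: (PX 1%N 14%N).
have PFz : P 7%N Fz by apply: (Pc _ y1) => //; apply: PQ hz _; apply: (PMl).
have PFy : P 7%N Fy by apply: (Pc _ y1) => //; apply: PQ hy _; apply: (PMl).
have Pz4 : P 6%N (z ^+ 4).
 apply: (Pc _ 5%:R) => //; rewrite (_ : _ * _ = Fz - tt * y ^+ 6); last by rewrite /Fz; ring.
 by apply: (PB); [exact: PW PFz|apply: (PMl)].
have Pyz : P 7%N (y ^+ 5 * z).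
 apply: (Pc _ (6%:R * tt)); first exact: nprimeM.
 rewrite (_ : _ * _ = Fy - 7%:R * (x * y ^+ 6)); last by rewrite /Fy; ring.
 by apply: (PB) => //; apply: (PMl); exact: (PM 1%N 6%N).
have Py44 : P 45%N (y ^+ 44).
 apply: (Pc _ (tt ^+ 4)); first exact: primeXn.
 pose b := 5%:R * z ^+ 4; have Pb : P 6%N b by apply: (PMl).
 rewrite (_ : _ * _ = Fz * (Fz ^+ 3 - 4%:R * (Fz ^+ 2 * b) + 6%:R * (Fz * b ^+ 2) - 4%:R * b ^+ 3) * y ^+ 20
 + 625%:R * ((y ^+ 5 * z) ^+ 4 * (z ^+ 4) ^+ 3)); last by rewrite /b /Fz; ring.
 apply: (PD); last first.
 by apply: (PMl); apply: (PW 45%N 46%N) => //; apply: (PM 28%N 18%N); [exact: (PX 7%N 4%N)|exact: (PX 6%N 3%N)].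
 apply: (PM 25%N 20%N) => //; apply: (PM 7%N 18%N) => //.
 apply: (PB); last by apply: (PMl); exact: (PX 6%N 3%N).
 apply: (PD); last by apply: (PMl); apply: (PW 18%N 19%N) => //; apply: (PM 7%N 12%N) => //; exact: (PX 6%N 2%N).
 apply: (PB); first by apply: (PW 18%N 21%N) => //; exact: (PX 7%N 3%N).
 apply: (PMl); apply: (PW 18%N 20%N) => //; apply: (PM 14%N 6%N) => //; exact: (PX 7%N 2%N).
suff : Q y /\ Q z by case.
apply: (nakayama pQ pR QR Ry Rz (N := 47)) => j jN; rewrite -/P.
have Pz k : P k (z ^+ k) by have := PX _ k _ Pv; rewrite mul1n.
case: (leqP 44 j) => [j44|j43].
 rewrite -(subnKC j44) exprD -mulrA; apply: (PM 45%N 3%N) => //.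
 by apply: (PMe _ (j - 44)%N (47 - (44 + (j - 44)))%N) => //; lia.
rewrite (_ : 47 - j = 4 + (43 - j))%N; last by lia.
rewrite exprD mulrCA; apply: (PW 48%N (6 + 43)%N) => //; apply: (PM) => //.
by apply: (PMe _ j (43 - j)%N) => //; lia.
Qed.

(** For tt = 0 the same happens outside y1 y2 = 0, with the ideal (x, y). *)
Lemma relation_special : tt = 0 -> ~ Q x ->
 Q (y2 * Fx - y1 * Fy) -> Q (y2 * Fz - y3 * Fy) -> Q (y2 * Fw - y4 * Fy) ->
 R y1 \/ R y2.
Proof.
move=> t0 nQx hx hz hw; apply: contrapT => /not_orP[n1 n2]; apply: nQx.
pose u := 2%:R * y2 * y + y1 * x.
have Ru : R u by apply: idealD => //; apply: idealMl.
pose P := lpow Q R u x.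
have Pu : P 1%N u by exact: lpow_u.
have Pv : P 1%N x by exact: lpow_v.
have PM k l p q : P k p -> P l q -> P (k + l)%N (p * q) by exact: lpowM.
have PMe m k l p q : (m = k + l)%N -> P k p -> P l q -> P m (p * q) by move=> ->; apply: PM.
have PX k l p : P k p -> P (k * l)%N (p ^+ l) by exact: lpowX.
have PMl k a p : P k p -> P k (a * p) by exact: lpowMl.
have PMr k a p : P k p -> P k (p * a) by exact: lpowMr.
have PD k p q : P k p -> P k q -> P k (p + q) by exact: lpowD.
have PB k p q : P k p -> P k q -> P k (p - q) by exact: lpowB.
have PQ k p q : Q (p - q) -> P k q -> P k p by exact: lpow_eqQ.
have Pc k s p : ~ R s -> P k (s * p) -> P k p by exact: lpow_cancel.
have PW k l p : (k <= l)%N -> P l p -> P k p by exact: lpowW.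
have Px k : P k (x ^+ k) by have := PX _ k _ Pv; rewrite mul1n.
have Puk k : P k (u ^+ k) by have := PX _ k _ Pu; rewrite mul1n.
have Py : P 1%N y.
 apply: (Pc _ (2%:R * y2)); first exact: nprimeM.
 rewrite (_ : _ * _ = u - y1 * x); last by rewrite /u; ring.
 by apply: (PB) => //; apply: (PMl).
have Pxy : P 7%N (x * y ^+ 6) by apply: (PM 1%N 6%N) => //; exact: (PX 1%N 6%N).
have PFy : P 7%N Fy.
 by rewrite /Fy t0 mulr0 mul0r add0r; apply: (PMl).
have Pz4 : P 7%N (z ^+ 4).
 apply: (Pc _ 5%:R) => //; apply: (Pc _ y2) => //.
 by apply: PQ (PMl _ y3 _ PFy); move: hz; rewrite /Fz t0 mul0r addr0.
have Pw : P 7%N w.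
 by apply: (Pc _ 2%:R) => //; apply: (Pc _ y2) => //; apply: PQ hw (PMl _ y4 _ PFy).
have Pu4 : P 7%N (u ^+ 4).
 apply: (Pc _ (2%:R ^+ 4)); first exact: primeXn.
 pose b := 15%:R * w * y4; have Pb : P 7%N b by apply: (PMr); apply: (PMl).
 pose a := 6%:R * z * y3.
 have hu : Q (2%:R * u - - (a + b)) by rewrite opprK /u /a /b; move: euler; congr Q; ring.
 rewrite -exprMn; apply: (PQ _ _ ((a + b) ^+ 4)).
 rewrite (_ : _ - _ = (2%:R * u - - (a + b)) * (2%:R * u - (a + b)) * ((2%:R * u) ^+ 2 + (a + b) ^+ 2)); last by ring.
 by do 2?apply: idealMr => //.
 rewrite (_ : _ ^+ 4 = (6%:R * y3) ^+ 4 * z ^+ 4 +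
 (4%:R * a ^+ 3 + 6%:R * a ^+ 2 * b + 4%:R * a * b ^+ 2 + b ^+ 3) * b); last by rewrite /a; ring.
 by apply: (PD); apply: (PMl).
pose a := y1 * x; have Pa : P 1%N a by apply: (PMl).
pose r6 := \sum_(i < 6) (u - a) ^+ (5 - i) * (- a) ^+ i.
have Pua : P 1%N (u - a) by exact: PB.
have Pna : P 1%N (- a) by rewrite -mulN1r; apply: (PMl).
have P1X k p : P 1%N p -> P k (p ^+ k) by move=> /(PX _ k); rewrite mul1n.
have Pr6 : P 5%N r6.
 rewrite /r6; elim/big_ind: _ => [|p1 p2|i _]; [|exact: PD|].
 by rewrite -(mul0r (u ^+ 5)); apply: (PMl).
 by apply: (PMe _ (5 - i)%N i); [rewrite subnK// -ltnS|exact: P1X|exact: P1X].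
have E6 : (u - a) ^+ 6 = a ^+ 6 + u * r6.
 have -> : u * r6 = (u - a) ^+ 6 - (- a) ^+ 6 by rewrite subrXX opprK subrK.
 by ring.
pose q' := a ^+ 6 + r6 * (u - 15%:R * a).
have Pq : P 6%N q'.
 apply: (PD); first exact: P1X.
 by apply: (PM 5%N 1%N) => //; apply: (PB) => //; apply: (PMl).
pose T := (u - a) ^+ 6 * (u - 15%:R * a).
have PT : P 14%N T.
 apply: (PQ _ _ (- (2%:R ^+ 7 * y2 ^+ 6 * 15%:R * y2 * x ^+ 14))); last first.
 by rewrite -mulNr; apply: (PMl).
 rewrite (_ : _ - _ = 2%:R ^+ 7 * y2 ^+ 6 * (y2 * Fx - y1 * Fy)); first exact: idealMl.
 by rewrite /T /a /u /Fx /Fy t0; ring.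
have Ea : 15%:R * a ^+ 7 = u * q' - T by rewrite /T E6 /q'; ring.
have Px28 : P 29%N (x ^+ 28).
 apply: (Pc _ (15%:R ^+ 4 * y1 ^+ 28)); first by apply: nprimeM => //; exact: primeXn.
 rewrite (_ : _ * _ = (15%:R * a ^+ 7) ^+ 4); last by rewrite /a; ring.
 have PA : P 7%N (u * q') by exact: (PM 1%N 6%N).
 rewrite Ea (_ : _ ^+ 4 = u ^+ 4 * q' ^+ 4 -
 T * (4%:R * (u * q') ^+ 3 + T * (- 6%:R * (u * q') ^+ 2 + 4%:R * (u * q') * T - T ^+ 2))); last by ring.
 apply: (PB).
 by apply: (PW 29%N 31%N) => //; apply: (PM 7%N 24%N) => //; exact: (PX 6%N 4%N).
 apply: (PW 29%N 35%N) => //; apply: (PM 14%N 21%N) => //; apply: (PD).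
 by apply: (PMl); exact: (PX 7%N 3%N).
 apply: (PW 21%N 28%N) => //; apply: (PM 14%N 14%N) => //.
 apply: (PB); last by apply: (PW 14%N 28%N) => //; exact: (PX 14%N 2%N).
 by apply: (PD); [apply: (PMl); exact: (PX 7%N 2%N)|apply: (PMl)].
suff : Q u /\ Q x by case.
apply: (nakayama pQ pR QR Ru Rx (N := 31)) => j jN; rewrite -/P.
case: (leqP 4 j) => [j4|j3].
 rewrite -(subnKC j4) exprD -mulrA; apply: (PW 32%N (7 + 27)%N) => //; apply: (PM) => //.
 by apply: (PMe _ (j - 4)%N (31 - (4 + (j - 4)))%N) => //; lia.
rewrite (_ : 31 - j = 28 + (3 - j))%N; last by lia.
rewrite exprD mulrCA; apply: (PM 29%N 3%N) => //.
by apply: (PMe _ j (3 - j)%N) => //; lia.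
Qed.

End Relations.

End Gi.
Import Gi.

(** * The singular locus and limits along arcs *)

Module Gj.
Local Notation contraction := Defs.contraction.

Section SingularLocus.
Variables (S : comNzRingType) (P : set S) (x y z w tt : S).
Hypothesis pP : is_prime P.
Hypothesis nat_unit : forall k, ~ P k.+1%:R.
Hypotheses (Px : P (y ^+ 7 + 15%:R * x ^+ 14))
 (Py : P (6%:R * tt * (y ^+ 5 * z) + 7%:R * (x * y ^+ 6)))
 (Pz : P (5%:R * z ^+ 4 + tt * y ^+ 6)) (Pw : P (2%:R * w)).

Lemma singular_locus : (tt = 0 \/ (~ P tt /\ ~ P (12005%:R ^+ 7 + 225%:R * (1296%:R * tt ^+ 5) ^+ 7))) ->
 [/\ P x, P y, P z & P w].
Proof.
have [iP _ PM] := pP.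
have Pc s a : ~ P s -> P (s * a) -> P a by move=> ns /PM[].
have Pww : P w by apply: Pc Pw.
have PyE : P y -> [/\ P x, P y, P z & P w].
 move=> Hy; have Hyn k : P (y ^+ k.+1) by rewrite exprS; apply: idealMr.
 split=> //.
 apply: (primeX pP (k := 14)); apply: (Pc 15%:R) => //.
 by move: Px; rewrite addrC => h; exact: (idealDr iP h).
 apply: (primeX pP (k := 4)); apply: (Pc 5%:R) => //.
 by apply: (idealDr iP Pz); apply: idealMl.
have [/PyE//|nPy] := pselect (P y).
have Pe : P (6%:R * tt * z + 7%:R * (x * y)).
 apply: (Pc (y ^+ 5)); first exact: primeXn.
 by move: Py; congr P; ring.
case=> [t0|[nt nK]].
 have [/PyE//|] := pselect (P y).
 have [Hx|nx] := pselect (P x).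
 move=> _; apply: PyE; apply: (primeX pP (k := 7)); apply: (idealDr iP Px).
 by rewrite exprS mulrCA; apply: idealMr.
 by case; move: Pe; rewrite t0 mulr0 mul0r add0r => /(Pc _ _ (@nat_unit 6))/(Pc _ _ nx).
have nx : ~ P x.
 move=> Hx; apply: nPy; apply: (primeX pP (k := 7)); apply: (idealDr iP Px).
 by rewrite exprS mulrCA; apply: idealMr.
set K := 12005%:R in nK *; set M := 1296%:R * tt ^+ 5 in nK *.
have PG : P (K * x ^+ 4 + M * y ^+ 2).
 apply: (Pc (y ^+ 4)); first exact: primeXn.
 pose a := 6%:R * tt * z; pose b := 7%:R * (x * y).
 rewrite (_ : _ * _ = (6%:R * tt) ^+ 4 * (5%:R * z ^+ 4 + tt * y ^+ 6) -
 5%:R * ((a + b) * (a - b) * (a ^+ 2 + b ^+ 2))); last by rewrite /K /M /a /b; ring.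
 by apply: idealB => //; apply: idealMl => //; do 2?apply: idealMr => //.
have PH : P (K ^+ 4 * x ^+ 2 + 15%:R * M ^+ 4 * y).
 apply: (Pc (x ^+ 14)); first exact: primeXn.
 rewrite (_ : _ * _ = M ^+ 4 * y * (y ^+ 7 + 15%:R * x ^+ 14) +
 ((K * x ^+ 4) ^+ 2 + (M * y ^+ 2) ^+ 2) * (K * x ^+ 4 - M * y ^+ 2) *
 (K * x ^+ 4 + M * y ^+ 2)); last by ring.
 by apply: idealD => //; apply: idealMl.
case: nK; apply: (Pc (K * x ^+ 4)); first by apply: nprimeM => //; [exact: nat_unit|exact: primeXn].
rewrite (_ : _ * _ = 225%:R * M ^+ 7 * (K * x ^+ 4 + M * y ^+ 2) +
 (K ^+ 4 * x ^+ 2 - 15%:R * M ^+ 4 * y) * (K ^+ 4 * x ^+ 2 + 15%:R * M ^+ 4 * y)); last by ring.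
by apply: idealD => //; apply: idealMl.
Qed.

End SingularLocus.

Section Vanishing.
Variables (C : numFieldType) (n : nat).
Implicit Types p q : {mpoly C[n]}.

Lemma base_inj D k (f g : nat -> nat) : (forall i, (f i < D)%N) -> (forall i, (g i < D)%N) ->
 (\sum_(i < k) f i * D ^ i = \sum_(i < k) g i * D ^ i)%N -> forall i, (i < k)%N -> f i = g i.
Proof.
move=> fD gD; have D0 : (0 < D)%N by apply: leq_ltn_trans (fD 0%N).
elim: k f g fD gD => [//|k IH] f g fD gD.
have step (h : nat -> nat) : (\sum_(i < k.+1) h i * D ^ i = h 0%N + (\sum_(i < k) h i.+1 * D ^ i) * D)%N.
 rewrite big_ord_recl expn0 muln1 big_distrl; congr (_ + _)%N; apply: eq_bigr => i _ /=.
 by rewrite /bump leq0n add1n expnSr mulnA.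
rewrite !step => e; have e0 : f 0%N = g 0%N.
 have := congr1 (modn^~ D) e.
 by rewrite /= ![(_ + _ * D)%N]addnC !modnMDl !modn_small.
move: e; rewrite e0 => /addnI/eqP; rewrite eqn_pmul2r// => /eqP e [|i]// ik.
by apply: (IH (fun i => f i.+1) (fun i => g i.+1)).
Qed.
Lemma poly_eq0_inf (p : {poly C}) : (forall a, p.[a] = 0) -> p = 0.
Proof.
move=> H; apply/eqP; apply: contraT => p0.
have := @max_poly_roots _ p [seq k%:R | k <- iota 0 (size p)] p0.
rewrite size_map size_iota ltnn => -> //.
 by apply/allP => a _; rewrite /root H.
rewrite map_inj_uniq ?iota_uniq// => k l /eqP.
by rewrite eqr_nat => /eqP.
Qed.

(** A polynomial with the zero function is zero: substitute very different powers of a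
 single variable. *)
Lemma mpoly_eq0_inf p : (forall v, meval v p = 0) -> p = 0.
Proof.
move=> H; pose D := (msize p).+1; pose e (m : multinom n) := (\sum_i m i * D ^ i)%N.
have mD m i : m \in msupp p -> (m i < D)%N.
 move=> /msize_mdeg_lt/ltnW mp; rewrite ltnS; apply: leq_trans mp.
 by rewrite mdegE (bigD1 i)//= leq_addr.
have inj_e m m' : m \in msupp p -> m' \in msupp p -> e m = e m' -> m = m'.
 move=> mp mp' ee; apply/mnmP => i.
 pose f (m : multinom n) k := if insub k is Some i then m i else 0%N.
 have fE (m0 : multinom n) (j : 'I_n) : f m0 j = m0 j by rewrite /f valK.
 have fD m0 k : m0 \in msupp p -> (f m0 k < D)%N.
 by move=> h; rewrite /f; case: insubP => // j _ _; exact: mD.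
 rewrite -!fE; apply: (@base_inj D n) (ltn_ord i) => [k|k|]; rewrite ?fD//.
 rewrite (eq_bigr (fun j : 'I_n => (m j * D ^ j)%N)) => [|j _]; last by rewrite fE.
 by rewrite [RHS](eq_bigr (fun j : 'I_n => (m' j * D ^ j)%N)) => [|j _]; last by rewrite fE.
pose P : {poly C} := \sum_(m <- msupp p) (mcoeff m p)%:P * 'X^(e m).
have P0 : P = 0.
 apply: poly_eq0_inf => a; rewrite -[RHS](H (fun i => a ^+ (D ^ i))) mevalE horner_sum.
 apply: eq_bigr => m _; rewrite hornerM hornerC hornerXn; congr (_ * _).
 by rewrite /e -prodrXr; apply: eq_bigr => i _; rewrite -exprM mulnC.
apply/mpolyP => m; rewrite mcoeff0; have [mp|/memN_msupp_eq0//] := boolP (m \in msupp p).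
have := congr1 (fun q : {poly C} => q`_(e m)) P0.
rewrite coef0 coef_sum (bigD1_seq m)//= coefCM coefXn eqxx mulr1 big_seq_cond big1 ?addr0//.
move=> m' /andP[mp' ne]; rewrite coefCM coefXn; case: eqP => [/(inj_e _ _ mp mp')/eqP|]; last by rewrite mulr0.
by rewrite eq_sym (negbTE ne).
Qed.
Lemma mpoly_neq0_ex p : p != 0 -> exists v, meval v p != 0.
Proof.
move=> p0; apply: contrapT => /forallNP H; move/eqP: p0; apply; apply: mpoly_eq0_inf => v.
exact/eqP/negPn/negP/H.
Qed.
Lemma meval_scale d q (l : C) v : q \is ishomog1 d mdeg ->
 meval (fun i => l * v i) q = l ^+ d * meval v q.
Proof.
move=> /dhomogP hq; rewrite !mevalE mulr_sumr big_seq [RHS]big_seq; apply: eq_bigr => m mq.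
rewrite mulrCA; congr (_ * _).
have -> : d = (\sum_i m i)%N by rewrite -mdegE; exact/esym/(hq m mq).
by rewrite -prodrXr -big_split; apply: eq_bigr => i _; rewrite exprMn.
Qed.
Lemma form_eq0 d q i0 i1 : q \is ishomog1 d mdeg ->
 (forall v, v i0 = 1 -> v i1 != 0 -> meval v q = 0) -> q = 0.
Proof.
move=> hq H; have n0 i : mpolyX C (mnm1 i) != 0 :> {mpoly C[n]}.
 apply/eqP => /(congr1 (meval (fun=> 1))); rewrite mevalXU meval0 => /eqP.
 by rewrite oner_eq0.
have : q * (mpolyX C (mnm1 i0) * mpolyX C (mnm1 i1)) == 0.
 apply/eqP/mpoly_eq0_inf => v; rewrite !mevalM !mevalXU.
 have [->|v0] := eqVneq (v i0) 0; first by rewrite mul0r mulr0.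
 have [->|v1] := eqVneq (v i1) 0; first by rewrite !mulr0.
 have /eqP := H (fun i => (v i0)^-1 * v i) (mulVf v0) (mulf_neq0 (invr_neq0 v0) v1).
 rewrite (meval_scale _ _ hq) mulf_eq0 expf_eq0 invr_eq0 (negbTE v0) andbF => /eqP ->.
 by rewrite mul0r.
by rewrite !mulf_eq0 !(negbTE (n0 _)) !orbF => /eqP.
Qed.

End Vanishing.

Section ArcLimits.
Variables (C : numFieldType) (k n : nat).
Local Notation A := (holo_germ C k).
Local Notation D := (holo_germ C 1).
Local Notation S := {mpoly A[n]}.
Variable (d : 'I_n -> A).

(** The direction of the values of the d_i along an arc tends to v. *)
Definition arc_limit (X : 'I_k -> D) (X0 : forall i, cst (X i) = 0) (v : 'I_n -> C) :=
 exists N lam, lam != 0 /\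
 forall i, dvs N.+1 (germ_subst X0 (d i) - sv C ^+ N * germC 1 (lam * v i)).

Lemma transform_limit X (X0 : forall i, cst (X i) = 0) v (p : set A) (c : 'I_n -> 'I_n -> C) w P e :
 arc_limit X0 v -> (forall a, p a -> germ_subst X0 a = 0) ->
 (forall i, v i = \sum_j c i j * w j) ->
 P \is ishomog1 e mdeg -> transform d p P -> meval w (theta c P) = 0.
Proof.
move=> [N [lam [lam0 Hd]]] p0 vE hP QP.
have Hd' i : exists u, germ_subst X0 (d i) = sv C ^+ N * (germC 1 (lam * v i) + sv C * u).
 have [u hu] := Hd i; exists u.
 by rewrite -[LHS](subrK (sv C ^+ N * germC 1 (lam * v i))) hu exprSr; ring.
have [u Hu] := choice Hd'.
pose E i := germC 1 (lam * v i) + sv C * u i.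
have key : \sum_(m <- msupp P) germ_subst X0 (mcoeff m P) * \prod_i E i ^+ m i = 0.
 apply: (germ_mulfI (@sv_neq0 C (N * e))); rewrite mulr0 -[RHS](p0 _ (QP e)).
 rewrite /Phi /mmap coef_sum [RHS]arc_sum mulr_sumr big_seq [RHS]big_seq; apply: eq_bigr => m mP.
 have em : e = (\sum_i m i)%N by rewrite -mdegE; move/dhomogP: hP => /(_ m mP) /esym.
 rewrite mulrCA coefCM arcM; congr (_ * _).
 have -> : mmap1 (fun i => (d i)%:P * 'X) m = (\prod_i d i ^+ m i)%:P * 'X^e.
 rewrite em -prodrXr rmorph_prod -big_split; apply: eq_bigr => i _ /=.
 by rewrite exprMn rmorphXn.
 rewrite coefCM coefXn eqxx mulr1 arc_prod exprM {1}em -prodrXr -big_split.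
 by apply: eq_bigr => i _ /=; rewrite -exprMn arcX Hu.
have := congr1 (@cst C 1) key; rewrite cst0 cst_sum => h.
have : lam ^+ e * meval w (theta c P) = 0.
 rewrite -[RHS]h /theta /mmap [meval _ _](_ : _ = \sum_(m <- msupp P) cst (mcoeff m P) * \prod_i v i ^+ m i).
 rewrite mulr_sumr big_seq [RHS]big_seq; apply: eq_bigr => m mP.
 have em : e = (\sum_i m i)%N by rewrite -mdegE; move/dhomogP: hP => /(_ m mP) /esym.
 rewrite cstM cst_subst mulrCA; congr (_ * _).
 rewrite (_ : cst (\prod_i _) = \prod_i cst (E i ^+ m i)); last exact: rmorph_prod.
 rewrite {1}em -prodrXr -big_split; apply: eq_bigr => i _ /=.
 by rewrite cstX /E cstD cstC cstM cst_sv mul0r addr0 exprMn.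
 rewrite raddf_sum; apply: eq_bigr => m _ /=; rewrite mevalM mevalC; congr (_ * _).
 rewrite /mmap1 rmorph_prod; apply: eq_bigr => i _ /=; rewrite rmorphXn; congr (_ ^+ _).
 by rewrite raddf_sum vE; apply: eq_bigr => j _ /=; rewrite mevalZ mevalXU.
by move=> /eqP; rewrite mulf_eq0 expf_eq0 (negbTE lam0) andbF => /eqP.
Qed.

(** A transform whose arcs have limits dense in a linear space lies in its ideal. *)
Lemma transform_sub_linear (p : set A) (c : 'I_n -> 'I_n -> C) i0 i1 : is_ideal p ->
 (forall w : 'I_n -> C, w i0 = 1 -> w i1 != 0 -> exists X (X0 : forall i, cst (X i) = 0),
 (forall a, p a -> germ_subst X0 a = 0) /\
 arc_limit X0 (fun i => \sum_j c i j * w j)) ->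
 transform d p `<=` linear_ideal c.
Proof.
move=> ip H P QP; apply: homog_in; first by case: (@linear_ideal_prime C k n c).
move=> e; have hP : pihomog mdeg e P \is ishomog1 e mdeg by exact: pihomogP.
have hT := theta_homog c hP.
apply: (form_eq0 hT (i0 := i0) (i1 := i1)) => w w0 w1.
have [X [X0 [pX lim]]] := H w w0 w1.
apply: (transform_limit (v := fun i => \sum_j c i j * w j)) lim pX _ hP _ => //.
exact: (transform_homog (d := d) ip).
Qed.

End ArcLimits.

End Gj.
Import Gj.

(** * An irreducible curve *)

Module Gk.
Section Irreducible.
Variables (C : numClosedFieldType) (t : C).
Local Notation CY := {poly C}.
Implicit Types (p q r : CY) (G H : {poly CY}).

Definition curve : {poly CY} := 'X^5 + (t%:P * 'X^6)%:P * 'X + ('X^7 + 1)%:P.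

Lemma curveE i : curve`_i =
 if i == 5%N then 1 else if i == 1%N then t%:P * 'X^6 else if i == 0%N then 'X^7 + 1 else 0.
Proof.
rewrite /curve !coefD coefXn coefCM coefX coefC.
by case: i => [|[|[|[|[|[|i]]]]]] /=; rewrite ?mulr1 ?mulr0 ?addr0 ?add0r.
Qed.
Lemma size_curve : size curve = 6%N.
Proof.
apply/eqP; rewrite eqn_leq; apply/andP; split.
 by apply/leq_sizeP => -[|[|[|[|[|[|j]]]]]]// _; rewrite curveE.
by rewrite ltnNge; apply/negP => /leq_sizeP/(_ 5%N isT); rewrite curveE /= => /eqP; rewrite oner_eq0.
Qed.
Lemma curve_no_root r : curve.[r] != 0.
Proof.
apply/eqP; rewrite /curve !hornerD hornerXn hornerM !hornerC hornerX => E.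
have E' : r ^+ 5 = - (t%:P * 'X^6 * r + ('X^7 + 1)) by apply/eqP; rewrite -addr_eq0 addrA; apply/eqP.
have [r3|r2] := leqP 3 (size r).
 have r0 : r != 0 by rewrite -size_poly_gt0; apply: leq_trans r3.
 have e : size (r ^+ 5) = size (t%:P * 'X^6 * r + ('X^7 + 1)) by rewrite E' size_polyN.
 have e5 := size_exp r 5.
 have le1 : (size (t%:P * 'X^6 * r)%R <= (size r) + 6)%N.
 rewrite -mulrA mul_polyC; apply: leq_trans (size_scale_leq _ _) _.
 by rewrite mulrC size_mulXn // addnC.
 have le2 : (size ('X^7 + 1 : CY)%R <= 8)%N.
 by rewrite size_polyDl size_polyXn ?size_poly1.
 have := size_polyD (t%:P * 'X^6 * r) ('X^7 + 1); rewrite -e.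
 move: e5 le1 le2 r3; move: (size (polyseq (r ^+ 5))) (size (polyseq (_ * r))) (size (polyseq ('X^7 + 1))) (size r) => a b c d; lia.
have s5 : (size (r ^+ 5) <= 6)%N.
 have := size_poly_exp_leq r 5; move: r2; move: (size r) (size _) => a b; lia.
have c7 := congr1 (fun p : CY => p`_7) E'; have c6 := congr1 (fun p : CY => p`_6) E'.
move: c7 c6; rewrite /= !(nth_default 0 (s := r ^+ 5)) ?(leq_trans s5)//.
rewrite mulrAC !coefN !coefD !coefMXn !coefCM !coefXn !coef1 /=.
rewrite !addr0 => /esym/eqP; rewrite oppr_eq0 => /eqP c7 /esym/eqP.
rewrite oppr_eq0 mulf_eq0 => /orP[/eqP t0|/eqP r0].
 by move: c7 => /eqP; rewrite t0 mul0r add0r oner_eq0.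
have := congr1 (horner^~ 0) E'; rewrite /= !hornerE /= horner_coef0 r0 !expr0n /= => /eqP.
by rewrite mulr0 !add0r eq_sym oppr_eq0 oner_eq0.
Qed.
Lemma dvdp_Xn_scale p n : p %| 'X^n -> exists2 c, c != 0 & exists k, p = c *: 'X^k.
Proof.
move=> H; have : p %| ('X - 0%:P) ^+ n by rewrite subr0.
move=> /dvdp_exp_XsubCP[k _]; rewrite subr0 => /eqpP[[c1 c2] /= /andP[c10 c20] E].
exists (c1^-1 * c2); first by rewrite mulf_neq0 ?invr_eq0.
by exists k; rewrite -scalerA -E scalerA mulVf ?scale1r.
Qed.

(** The binomial b X^(m+1) + a is separable outside the origin. *)
Lemma not_power c b a p m n : b != 0 -> p`_0 != 0 ->
 c *: p ^+ n.+2 <> b *: 'X^(m.+1) + a%:P.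
Proof.
move=> b0 p0 E; have := congr1 (@deriv C) E.
rewrite derivD derivC addr0 !derivZ derivXn deriv_exp /= => E'.
have pX : p %| 'X^m.
 have -> : 'X^m = (b * m.+1%:R)^-1 *: (b *: ('X^m *+ m.+1)) :> CY.
 have -> : 'X^m *+ m.+1 = m.+1%:R *: 'X^m :> CY by rewrite scaler_nat.
 by rewrite scalerA [_ *: (_ *: _)]scalerA mulVf ?scale1r // mulf_neq0// pnatr_eq0.
 rewrite -E' -!mul_polyC; do 2?apply: dvdp_mull; rewrite exprS.
 by rewrite mulrCA -mulrnAr; apply: dvdp_mulr.
have [c' c'0 [k pE]] := dvdp_Xn_scale pX.
case: k pE => [|k] pE; last by rewrite pE coefZ coefXn mulr0 eqxx in p0.
move: E'; rewrite pE expr0 derivZ derivC scaler0 mul0r mul0rn scaler0 => /esym/eqP.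
by rewrite scaler_eq0 (negbTE b0) -scaler_nat scaler_eq0 pnatr_eq0 expf_eq0 polyX_eq0 andbF.
Qed.
Lemma curve_no_quadratic p q a b r :
 ('X^2 + p%:P * 'X + q%:P) * ('X^3 + a%:P * 'X^2 + b%:P * 'X + r%:P) <> curve.
Proof.
move=> E.
have {}E : 'X^5 + (a + p)%:P * 'X^4 + (b + a * p + q)%:P * 'X^3 + (r + b * p + a * q)%:P * 'X^2 +
 (r * p + b * q)%:P * 'X + (r * q)%:P = curve by rewrite -E !(rmorphD, rmorphM) /=; ring.
have cE i := congr1 (fun P : {poly CY} => P`_i) E.
have := cE 4%N; have := cE 3%N; have := cE 2%N; have := cE 1%N; have := cE 0%N.
rewrite !curveE !coefD !coefCM !coefXn !coefX !coefC /=.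
rewrite !(mulr0, mulr1, addr0, add0r) => E0 E1 E2 E3 E4.
have {E4} ea : a = - p by apply/eqP; rewrite -addr_eq0 E4.
have {E3} eb : b = p ^+ 2 - q.
 by apply/eqP; rewrite -subr_eq0 -E3 ea; apply/eqP; ring.
have {E2} er : r = 2%:R * p * q - p ^+ 3.
 by apply/eqP; rewrite -subr_eq0 -E2 ea eb; apply/eqP; ring.
have p0 : p`_0 != 0.
 have := congr1 (horner^~ 0) E0; rewrite /= er !hornerE /= -!horner_coef0 => h.
 apply: contraTneq (oner_neq0 C) => h0; move: h; rewrite h0 !expr0n /= => h.
 by apply/negPn/eqP; move: h; rewrite mulr0 mul0r subr0 mul0r add0r => <-.
pose s5 : C := sqrtC 5%:R; have s5E : s5 ^+ 2 = 5%:R by exact: sqrtCK.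
have s5P : s5%:P ^+ 2 = 5%:R :> CY by rewrite -rmorphXn s5E rmorph_nat.
pose A := 2%:R * q - (3%:R + s5%:P) * p ^+ 2; pose B := 2%:R * q - (3%:R - s5%:P) * p ^+ 2.
have AB : A * B = (- 4%:R * t) *: 'X^6.
 rewrite -mul_polyC rmorphM rmorphN rmorph_nat -mulrA -E1 er eb /A /B.
 rewrite (_ : _ * _ = 4%:R * q ^+ 2 - 12%:R * q * p ^+ 2 + (9%:R - s5%:P ^+ 2) * p ^+ 4); last by ring.
 by rewrite s5P; ring.
have s50 : s5 != 0 by rewrite sqrtC_eq0 pnatr_eq0.
have BA : (2%:R * s5) *: p ^+ 2 = B - A.
 by rewrite -mul_polyC rmorphM rmorph_nat /A /B; ring.
have qE : r * q = p * q * (2%:R * q - p ^+ 2) by rewrite er; ring.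
have [t0|t0] := eqVneq t 0.
 have [s Es] : exists s : C, 2%:R * q = s%:P * p ^+ 2.
 move: AB; rewrite t0 mulr0 scale0r => /eqP; rewrite mulf_eq0 => /orP[]/eqP/subr0_eq e.
 by exists (3%:R + s5); rewrite e rmorphD rmorph_nat.
 by exists (3%:R - s5); rewrite e rmorphB rmorph_nat.
 apply: (@not_power (s * (s - 1)) 2%:R 2%:R p 6 3) => //; first by rewrite pnatr_eq0.
 rewrite -!mul_polyC rmorphM rmorphB rmorph1 !rmorph_nat.
 rewrite [RHS](_ : _ = 2%:R * ('X^7 + 1)); last by ring.
 rewrite -E0 qE [RHS](_ : _ = p * (2%:R * q) * (2%:R * q - p ^+ 2)); last by ring.
 by rewrite Es; ring.
have X6 P P' : P * P' = (- 4%:R * t) *: 'X^6 -> P %| 'X^6.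
 move=> e; have -> : 'X^6 = (- 4%:R * t)^-1 *: (P * P').
 by rewrite e scalerA mulVf ?scale1r// mulf_neq0// oppr_eq0 pnatr_eq0.
 by rewrite -mul_polyC; apply: dvdp_mull; apply: dvdp_mulr.
have [al al0 [k Ak]] := dvdp_Xn_scale (X6 _ _ AB).
have [be be0 [l Bl]] : exists2 c, c != 0 & exists k, B = c *: 'X^k.
 by apply: (@dvdp_Xn_scale _ 6); apply: (X6 _ A); rewrite mulrC.
have kl : (k + l)%N = 6%N.
 have := congr1 (size : CY -> nat) AB.
 rewrite Ak Bl -scalerAl -scalerAr scalerA -exprD !size_scale ?mulf_neq0 ?oppr_eq0 ?pnatr_eq0//.
 by rewrite !size_polyXn => -[].
have := congr1 (fun P : CY => P`_0) BA; rewrite /= coefZ expr2 coef0M coefB Ak Bl !coefZ !coefXn => EE.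
have nz : (2%:R * s5) * (p`_0 * p`_0) != 0 by rewrite !mulf_neq0// pnatr_eq0.
rewrite EE in nz; case: k l kl Ak Bl nz {EE} => [|k] [|l] // kl Ak Bl nz.
- apply: (@not_power (2%:R * s5) be (- al) p l 0) => //.
 by rewrite BA Ak Bl expr0 -[al *: 1]mul_polyC mulr1 rmorphN.
- apply: (@not_power (2%:R * s5) (- al) be p k 0) => //; first by rewrite oppr_eq0.
 by rewrite BA Ak Bl expr0 -[be *: 1]mul_polyC mulr1 scaleNr addrC.
- by rewrite !mulr0 subr0 eqxx in nz.
Qed.

(** Gauss' lemma: a nonzero constant in y can be cancelled from a factorization. *)
Lemma gauss c G H : c != 0 -> c *: curve = G * H ->
 exists G' H', [/\ G' * H' = curve, size G' = size G & size H' = size H].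
Proof.
have [N] := ubnP (size c); elim: N c G H => // N IH c G H cN c0 E.
have [/eqP/size_poly1P[u u0 cu]|c1] := eqVneq (size c) 1%N.
 have uu : u^-1%:P * c = 1 by rewrite cu -rmorphM mulVf.
 exists (u^-1%:P *: G), H; split=> //.
 by rewrite -scalerAl -E scalerA uu scale1r.
 by rewrite size_scale// polyC_eq0 invr_eq0.
have /closed_rootP[y0 cy] : size c != 1%N by [].
pose ev : {poly CY} -> CY := map_poly (horner_eval y0).
have div G1 : ev G1 = 0 -> exists G2, G1 = ('X - y0%:P) *: G2.
 move=> e; have H1 i : exists a, G1`_i = a * ('X - y0%:P).
 have /factor_theorem : root G1`_i y0.
 by have := congr1 (fun P : CY => P`_i) e; rewrite coef_map coef0 => /eqP.
 by move=> [a ->]; exists a.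
 have [a Ha] := choice H1; exists (\poly_(i < size G1) a i).
 apply/polyP => i; rewrite coefZ coef_poly; case: ltnP => [_|ge]; first by rewrite Ha mulrC.
 by rewrite mulr0 nth_default.
have X0 : 'X - y0%:P != 0 :> CY by rewrite polyXsubC_eq0.
have cancelX (U V : {poly CY}) : ('X - y0%:P) *: U = ('X - y0%:P) *: V -> U = V.
 by rewrite -!mul_polyC; apply: mulfI; rewrite polyC_eq0.
have [c' Ec] : exists c', c = c' * ('X - y0%:P) by apply/factor_theorem.
have c'0 : c' != 0 by apply: contraNneq c0 => e; rewrite Ec e mul0r.
have sc' : (size c' < N)%N.
 by move: cN; rewrite Ec size_Mmonic ?monicXsubC// size_XsubC addn2 /= !ltnS.
have : ev G * ev H = 0.
 rewrite -rmorphM -E -mul_polyC rmorphM /= map_polyC /= (_ : horner_eval y0 c = 0) ?mul0r//.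
 exact/eqP.
move=> /eqP; rewrite mulf_eq0 => /orP[]/eqP/div[G2 EG].
 have [G' [H' [e1 e2 e3]]] : exists G' H', [/\ G' * H' = curve, size G' = size G2 & size H' = size H].
 apply: (IH c') => //; apply: cancelX.
 by rewrite scalerA mulrC -Ec E EG scalerAl.
 by exists G', H'; split=> //; rewrite e2 EG size_scale.
have [G' [H' [e1 e2 e3]]] : exists G' H', [/\ G' * H' = curve, size G' = size G & size H' = size G2].
 apply: (IH c') => //; apply: cancelX.
 by rewrite scalerA mulrC -Ec E EG scalerAr.
by exists G', H'; split=> //; rewrite e3 EG size_scale.
Qed.
Lemma curve_neq0 : curve != 0. Proof. by rewrite -size_poly_gt0 size_curve. Qed.
Lemma curve_factor G H : G * H = curve -> (size G <= size H)%N -> size G = 1%N.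
Proof.
move=> E GH; have : G * H != 0 by rewrite E curve_neq0.
rewrite mulf_eq0 => /norP[G0 H0].
have sGH : (size G + size H)%N = 7%N.
 have := size_mul G0 H0; rewrite E size_curve; move: (size_poly_gt0 G); rewrite G0.
 by move: (size G) (size H) => a b; lia.
pose u := lead_coef H; pose v := lead_coef G.
have uv : v * u = 1.
 by rewrite -lead_coefM E lead_coefE size_curve curveE.
pose G1 := u *: G; pose H1 := v *: H.
have u0 : u != 0 by rewrite lead_coef_eq0.
have v0 : v != 0 by rewrite lead_coef_eq0.
have sG : size G1 = size G by rewrite size_scale.
have sH : size H1 = size H by rewrite size_scale.
have E1 : G1 * H1 = curve by rewrite -scalerAl -scalerAr scalerA mulrC uv scale1r.
have lG : G1`_(size G).-1 = 1 by rewrite coefZ -lead_coefE mulrC.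
have lH : H1`_(size H).-1 = 1 by rewrite coefZ -lead_coefE.
have := size_poly_gt0 G; rewrite G0; case: (size G) sG lG sGH GH => [|[|[|[|k]]]]// sG lG sGH GH _.
- have EG : G1 = 'X + (G1`_0)%:P.
 apply/polyP => -[|[|i]]; rewrite coefD coefX coefC /= ?add0r ?addr0//.
 by rewrite nth_default// sG.
 have := curve_no_root (- G1`_0); rewrite -E1 hornerM {1}EG hornerD hornerX hornerC addNr.
 by rewrite mul0r eqxx.
- have EG : G1 = 'X^2 + (G1`_1)%:P * 'X + (G1`_0)%:P.
 apply/polyP => -[|[|[|i]]]; rewrite !coefD coefXn coefCM coefX coefC /=
 ?(mulr0, mulr1, add0r, addr0)//.
 by rewrite nth_default// sG.
 have sH4 : size H = 4%N by lia.
 rewrite sH4 in sH lH.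
 have EH : H1 = 'X^3 + (H1`_2)%:P * 'X^2 + (H1`_1)%:P * 'X + (H1`_0)%:P.
 apply/polyP => -[|[|[|[|i]]]]; rewrite !coefD !coefCM !coefXn coefX coefC /=
 ?(mulr0, mulr1, add0r, addr0)//.
 by rewrite nth_default// sH.
 by have := @curve_no_quadratic G1`_1 G1`_0 H1`_2 H1`_1 H1`_0; rewrite -EG -EH E1.
by move: sGH GH; rewrite !addSn => -[]; move: (size H) => b; lia.
Qed.
Lemma curve_irreducible G H : G * H = curve -> size G = 1%N \/ size H = 1%N.
Proof.
move=> E; have [GH|/ltnW HG] := leqP (size G) (size H).
 by left; exact: curve_factor E GH.
by right; apply: curve_factor HG; rewrite mulrC.
Qed.

Import Pdiv.CommonIdomain.

Lemma curve_prime c G H : c * curve = G * H -> (size G <= 5)%N -> (size H <= 5)%N ->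
 G = 0 \/ H = 0.
Proof.
move=> E sG sH; have [->|G0] := eqVneq G 0; [by left|right].
pose g := gcdp curve G; have gG : (size g <= 5)%N.
 by apply: leq_trans sG; apply: dvdp_leq => //; exact: dvdp_gcdr.
have /Pdiv.Idomain.dvdpP[[c' q] /= c'0 Eq] := dvdp_gcdl curve G.
have [G' [H' [e sG' sH']]] := gauss c'0 Eq.
case: (curve_irreducible e) => s1.
 have G'0 : G' != 0 by rewrite -size_poly_gt0 s1.
 have H'0 : H' != 0 by apply: contraTneq curve_neq0 => h; rewrite -e h mulr0 negbK.
 have := size_mul G'0 H'0; rewrite e size_curve s1 sH' add1n /= => h.
 by move: gG; rewrite -h.
have cop : coprimep curve G by rewrite /coprimep -sH' s1.
have : curve %| G * H by rewrite -E dvdp_mulIr.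
rewrite (Gauss_dvdpr _ cop) => dH; apply/eqP; apply: contraTT sH => H0.
by rewrite -ltnNge -size_curve; exact: dvdp_leq.
Qed.

End Irreducible.

End Gk.
Import Gk.

(** * Germs in four variables *)

Module Gl.
Local Notation contraction := Defs.contraction.
Notation o4 k := (inord k : 'I_4).

Section FourVariables.

Lemma ord4E (i : 'I_4) : [\/ i = o4 0, i = o4 1, i = o4 2 | i = o4 3].
Proof.
case: i => -[|[|[|[|//]]]] p; [apply: Or41|apply: Or42|apply: Or43|apply: Or44];
 by apply/val_inj; rewrite /= inordK.
Qed.
Lemma big4 (R : Type) (idx : R) (op : Monoid.com_law idx) (F : 'I_4 -> R) :
 \big[op/idx]_i F i = op (F (o4 0)) (op (F (o4 1)) (op (F (o4 2)) (F (o4 3)))).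
Proof.
rewrite !big_ord_recl big_ord0 Monoid.mulm1.
by do !congr (op _ _); congr F; apply/val_inj; rewrite /= inordK.
Qed.

Definition wt (s : seq nat) (i : 'I_4) : nat := nth 0%N s i.
Definition mn4 a b c d : multinom 4 := Multinom [tuple nth 0%N [:: a; b; c; d] i | i < 4].

Lemma nth4 (T : Type) (x0 : T) s k : (k < 4)%N -> nth x0 s (o4 k) = nth x0 s k.
Proof. by move=> k4; rewrite inordK. Qed.
Lemma mn4E a b c d i : mn4 a b c d i = nth 0%N [:: a; b; c; d] i.
Proof. by rewrite multinomE tnth_mktuple. Qed.
Lemma mn4_eta (m : multinom 4) : m = mn4 (m (o4 0)) (m (o4 1)) (m (o4 2)) (m (o4 3)).
Proof.
by apply/mnmP => i; rewrite mn4E; case: (ord4E i) => ->; rewrite nth4.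
Qed.
Lemma mn4_inj a b c d a' b' c' d' : mn4 a b c d = mn4 a' b' c' d' ->
 [/\ a = a', b = b', c = c' & d = d'].
Proof.
move=> /mnmP e; have := e (o4 0); have := e (o4 1); have := e (o4 2); have := e (o4 3).
by rewrite !mn4E !nth4.
Qed.
Lemma wdeg4 s (m : multinom 4) : wdeg (wt s) m = (nth 0 s 0 * m (o4 0) + (nth 0 s 1 * m (o4 1) +
 (nth 0 s 2 * m (o4 2) + nth 0 s 3 * m (o4 3))))%N.
Proof. by rewrite /wdeg big4 /wt !nth4. Qed.
Lemma wdeg_mn4 s a b c d : wdeg (wt s) (mn4 a b c d) = (nth 0 s 0 * a + (nth 0 s 1 * b +
 (nth 0 s 2 * c + nth 0 s 3 * d)))%N.
Proof. by rewrite wdeg4 !mn4E !nth4. Qed.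
Lemma lem4 a b c d (m : multinom 4) : lem (mn4 a b c d) m =
 [&& a <= m (o4 0), b <= m (o4 1), c <= m (o4 2) & d <= m (o4 3)]%N.
Proof.
apply/mnm_lepP/and4P => [H|[h0 h1 h2 h3] i].
 have := H (o4 0); have := H (o4 1); have := H (o4 2); have := H (o4 3).
 by rewrite !mn4E !nth4.
by rewrite mn4E; case: (ord4E i) => ->; rewrite nth4.
Qed.

End FourVariables.

Section Weights.
Variables (C : numFieldType) (n : nat) (w : 'I_n -> nat).
Local Notation A := (holo_germ C n).
Implicit Types a b : A.

Lemma wgeD d a b : wge w d a -> wge w d b -> wge w d (a + b).
Proof.
move=> ha hb m; rewrite gcoefD; have [->|/ha//] := eqVneq (a m) 0.
by rewrite add0r => /hb.
Qed.
Lemma wgeN d a : wge w d a -> wge w d (- a).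
Proof. by move=> ha m; rewrite gcoefN oppr_eq0 => /ha. Qed.
Lemma wgeB d a b : wge w d a -> wge w d b -> wge w d (a - b).
Proof. by move=> ha hb; apply: wgeD => //; apply: wgeN. Qed.
Lemma wgeX d k a : wge w d a -> wge w (k * d) (a ^+ k).
Proof.
by move=> ha; elim: k => [|k IH]; [exact: wge0|rewrite exprS mulSn; exact: wgeM].
Qed.
Lemma wge_gX m : wge w (wdeg w m) (gX C m).
Proof. by move=> m'; rewrite coef_gX; case: (m =P m') => [->//|_]; rewrite eqxx. Qed.
Lemma wgeM0 d a b : wge w d b -> wge w d (a * b).
Proof. by move=> hb; rewrite -[d]add0n; apply: wgeM. Qed.

(** Division with the divisors given as a leading monomial plus terms of larger
 weight. *)
Lemma division (w_gt0 : forall i, (0 < w i)%N) k (al : 'I_k -> multinom n) (r : 'I_k -> A) a :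
 (forall i, wge w (wdeg w (al i)).+1 (r i)) ->
 exists (c : 'I_k -> A) (s : A), a = \sum_i c i * (gX C (al i) + r i) + s /\
 forall m, s m != 0 -> forall i, ~~ lem (al i) m.
Proof.
move=> hr; apply: (@germ_division _ _ w w_gt0) => i.
 rewrite gcoefD coef_gX eqxx; have [->|/hr] := eqVneq (r i (al i)) 0; first by rewrite addr0.
 by rewrite ltnn.
move=> m; rewrite gcoefD coef_gX; case: (al i =P m) => [->|_]; first by rewrite eqxx.
by rewrite add0r => /hr.
Qed.
Lemma division_uniq (al : multinom n) (r c s : A) :
 wge w (wdeg w al).+1 r -> s = c * (gX C al + r) ->
 (forall m, s m != 0 -> ~~ lem al m) -> s = 0.
Proof.
move=> hr sE std; rewrite sE (_ : c = 0) ?mul0r//.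
apply: (@germ_division_uniq _ _ w 1 (fun=> gX C al + r) (fun=> al) _ _ ord0 c s) => //.
 move=> i; rewrite gcoefD coef_gX eqxx; have [->|/hr] := eqVneq (r al) 0; first by rewrite addr0.
 by rewrite ltnn.
move=> i m; rewrite gcoefD coef_gX; case: (al =P m) => [->|_]; first by rewrite eqxx.
by rewrite add0r => /hr.
Qed.

End Weights.

Section Family.
Variables (C : numFieldType) (t : C).
Local Notation A := (holo_germ C 4).

Definition vx k : A := gX C (mnm1 (o4 k)).
Local Notation x := (vx 0).
Local Notation y := (vx 1).
Local Notation z := (vx 2).
Local Notation w := (vx 3).
Definition tt : A := germC 4 t.

Lemma cst_vx k : cst (vx k) = 0. Proof. by rewrite cst_gX mnm1_eq0. Qed.
Lemma gX_mn4 a b c d : gX C (mn4 a b c d) = x ^+ a * y ^+ b * z ^+ c * w ^+ d.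
Proof.
have E (m : multinom 4) : gX C m = \prod_i gX C (mnm1 i) ^+ m i.
 rewrite /gX (mpolyXE_id C m) rmorph_prod; apply: eq_bigr => i _; exact: rmorphXn.
by rewrite E big4 !mn4E !nth4 //= -!mulrA.
Qed.
Lemma wge_vx s k d : (k < 4)%N -> nth 0%N s k = d -> wge (wt s) d (vx k).
Proof.
move=> k4 <-; have := @wge_gX C 4 (wt s) (mnm1 (o4 k)); rewrite (_ : wdeg _ _ = nth 0%N s k)//.
rewrite /wdeg (bigD1 (o4 k))//= mnm1E eqxx muln1 /wt nth4// big1 ?addn0// => i ik.
by rewrite mnm1E eq_sym (negbTE ik) muln0.
Qed.

Definition fF : A := z ^+ 5 + tt * (y ^+ 6 * z) + y ^+ 7 * x + x ^+ 15.
Definition ff : A := fF + w ^+ 2.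
Definition fx : A := y ^+ 7 + 15%:R * x ^+ 14.
Definition fy : A := 6%:R * tt * (y ^+ 5 * z) + 7%:R * (x * y ^+ 6).
Definition fz : A := 5%:R * z ^+ 4 + tt * y ^+ 6.
Definition fw : A := 2%:R * w.
Definition df (i : 'I_4) : A := nth 0 [:: fx; fy; fz; fw] i.

Lemma ff_mpoly : germ_of_mpoly (f_family t) = ff.
Proof.
rewrite /f_family -mul_mpolyC !(rmorphD, rmorphXn, rmorphM) /=.
by rewrite /ff /fF /tt.
Qed.
Lemma mderiv_exp i (p : {mpoly C[4]}) k : mderiv i (p ^+ k) = k%:R * p ^+ k.-1 * mderiv i p.
Proof.
elim: k => [|k IH]; first by rewrite expr0 mul0r mul0r -mpolyC1 mderivC.
rewrite exprS mderivM IH; case: k {IH} => [|k]; first by rewrite expr0 !mul0r mulr0 addr0 !mulr1 mul1r.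
by rewrite -[k.+1.-1]/k -[k.+2.-1]/k.+1 exprS -[k.+2%:R]natr1; ring.
Qed.
Lemma mderiv_var i j : mderiv i (mpolyX C (mnm1 j) : {mpoly C[4]}) = (i == j)%:R.
Proof.
rewrite mderivX mnm1E eq_sym; case: eqP => [->|_]; last by rewrite scale0r.
by rewrite scale1r (_ : mnm_sub _ _ = mnm0) ?mpolyX0//; apply/mnmP => k; rewrite mnmBE subnn mnm0E.
Qed.
Lemma germ_derivE i (p : {mpoly C[4]}) : germ_deriv i (germ_of_mpoly p) = germ_of_mpoly (mderiv i p).
Proof. by apply: holo_germP => m /=; rewrite mcoeff_deriv. Qed.
Lemma mderiv_f i : germ_of_mpoly (mderiv i (f_family t)) = df i.
Proof.
rewrite /f_family -mul_mpolyC !(mderivD, mderiv_exp, mderiv_var, mderivC, mderivM).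
rewrite !(rmorphD, rmorphXn, rmorph_nat, rmorphM) /= -/(vx 0) -/(vx 1) -/(vx 2) -/(vx 3) -/tt.
have o4_eq k l : (k < 4)%N -> (l < 4)%N -> (o4 k == o4 l) = (k == l).
 by move=> k4 l4; apply/eqP/eqP => [/(congr1 val)|->//]; rewrite /= !inordK.
by case: (ord4E i) => ->; rewrite !o4_eq // /df nth4//= /fx /fy /fz /fw /=; ring.
Qed.
Lemma deriv_f2 i : germ_deriv i (germ_of_mpoly (f_family t ^+ 2)) = 2%:R * ff * df i.
Proof.
rewrite germ_derivE mderiv_exp expr1 -mderiv_f -ff_mpoly.
rewrite -(rmorph_nat (@germ_of_mpoly C 4)) -rmorphM; exact: rmorphM.
Qed.
Lemma euler : 2%:R * x * fx + 4%:R * y * fy + 6%:R * z * fz + 15%:R * w * fw = 30%:R * ff.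
Proof. by rewrite /fx /fy /fz /fw /ff /fF; ring. Qed.

End Family.

End Gl.
Import Gl.

(** * The hypersurface of the family is irreducible *)

Module Gm.
Local Notation contraction := Defs.contraction.

Ltac wge_mono := lazymatch goal with
 | |- wge _ _ (_ * _) => eapply wgeM; [wge_mono|wge_mono]
 | |- wge _ _ (_ ^+ _) => eapply wgeX; wge_mono
 | |- wge _ _ (vx _ _) => apply: wge_vx; [done|reflexivity]
 | |- wge _ _ (- _) => apply: wgeN; wge_mono
 | |- _ => first [eassumption | apply: wge0]
 end.
Ltac wge_tac := lazymatch goal with
 | |- wge _ _ (_ - _) => apply: wgeB; wge_tac
 | |- wge _ _ (_ + _) => apply: wgeD; wge_tac
 | |- _ => (eapply wgeW; [|wge_mono]); rewrite ?wdeg_mn4 //=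
 end.

Section Independent.
Variables (C : numFieldType) (n : nat) (i : 'I_n).
Local Notation A := (holo_germ C n).
Implicit Types a b : A.

Definition indep a := forall m, a m != 0 -> m i = 0%N.

Lemma indepD a b : indep a -> indep b -> indep (a + b).
Proof.
move=> ha hb m; rewrite gcoefD; have [->|/ha//] := eqVneq (a m) 0.
by rewrite add0r => /hb.
Qed.
Lemma indepN a : indep a -> indep (- a).
Proof. by move=> ha m; rewrite gcoefN oppr_eq0 => /ha. Qed.
Lemma indepB a b : indep a -> indep b -> indep (a - b).
Proof. by move=> ha hb; apply: indepD => //; apply: indepN. Qed.
Lemma indepM a b : indep a -> indep b -> indep (a * b).
Proof.
by move=> ha hb m /coefM_neq0[m1 [m2 [-> /ha e1 /hb e2]]]; rewrite mnmDE e1 e2.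
Qed.
Lemma indepC c : indep (germC n c).
Proof.
move=> m; rewrite gcoefC; case: (m =P mnm0) => [-> _|_]; first by rewrite mnm0E.
by rewrite mulr0 eqxx.
Qed.
Lemma indepX a k : indep a -> indep (a ^+ k).
Proof.
move=> ha; elim: k => [|k IH]; last by rewrite exprS; apply: indepM.
by rewrite expr0 -(rmorph1 (@germC C n)); apply: indepC.
Qed.
Lemma indep_nat k : indep k%:R.
Proof. by rewrite -(rmorph_nat (@germC C n)); apply: indepC. Qed.
Lemma indep_gX (m : multinom n) : m i = 0%N -> indep (gX C m).
Proof. by move=> mi m'; rewrite coef_gX; case: (m =P m') => [<-//|_]; rewrite eqxx. Qed.

End Independent.

Ltac indep_tac := lazymatch goal with
 | |- indep _ (_ - _) => apply: indepB; [indep_tac|indep_tac]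
 | |- indep _ (_ + _) => apply: indepD; [indep_tac|indep_tac]
 | |- indep _ (_ * _) => apply: indepM; [indep_tac|indep_tac]
 | |- indep _ (_ ^+ _) => apply: indepX; indep_tac
 | |- indep _ (germC _ _) => apply: indepC
 | |- indep _ (_ *+ _) => apply: indep_nat
 | |- _ => first [assumption | done | idtac]
 end.

Section PrimeFamily.
Variables (C : numFieldType) (t : C).
Local Notation A := (holo_germ C 4).
Local Notation x := (vx C 0).
Local Notation y := (vx C 1).
Local Notation z := (vx C 2).
Local Notation w := (vx C 3).
Local Notation ff := (ff t).
Local Notation fF := (fF t).
Local Notation noW := (indep (o4 3)).

Lemma noW_vx k : (k < 3)%N -> noW (vx C k).
Proof.
move=> k3; apply: indep_gX; rewrite mnm1E; case: eqP => // /(congr1 val) /=.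
by rewrite !inordK ?(ltn_trans k3)// => e; rewrite e in k3.
Qed.
Lemma noW_tt : noW (tt t). Proof. exact: indepC. Qed.
Lemma noW_fF : noW fF.
Proof.
by rewrite /fF; indep_tac; first [exact: noW_tt|exact: noW_vx].
Qed.

Definition pf : set A := [set a | exists c, a = c * ff].

Lemma pf_ideal : is_ideal pf.
Proof.
split=> [|a b [c ->] [c' ->]|a b [c ->]]; first by exists 0; rewrite mul0r.
 by exists (c + c'); rewrite mulrDl.
by exists (a * c); rewrite mulrA.
Qed.
Lemma ff_lead : ff = gX C (mn4 0 0 0 2) + fF.
Proof. by rewrite gX_mn4 !expr0 !mul1r /ff addrC. Qed.
Lemma wge_fF s d : (d <= nth 0 s 2 * 5)%N -> (d <= nth 0 s 1 * 6 + nth 0 s 2)%N ->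
 (d <= nth 0 s 0 + nth 0 s 1 * 7)%N -> (d <= nth 0 s 0 * 15)%N -> wge (wt s) d fF.
Proof.
by move=> h1 h2 h3 h4; rewrite /fF; wge_tac;
 move: h1 h2 h3 h4; rewrite /= ?(mulnC 5) ?(mulnC 6) ?(mulnC 7) ?(mulnC 15); lia.
Qed.
Lemma std_eq0 (P Q c : A) : noW P -> noW Q -> P + Q * w = c * ff -> P = 0 /\ Q = 0.
Proof.
move=> hP hQ E.
have hQw m : (Q * w) m != 0 -> m (o4 3) = 1%N.
 by move=> /coefM_neq0[m1 [m2 [-> /hQ e1]]]; rewrite coef_gX; case: (mnm1 _ =P m2) => [<- _|_]; rewrite ?eqxx// mnmDE e1 mnm1E eqxx.
have PQ : P + Q * w = 0.
 have w1 i : (0 < wt [:: 1; 1; 1; 1]%N i)%N by case: (ord4E i) => ->; rewrite /wt nth4.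
 apply: (@division_uniq C 4 (wt [:: 1; 1; 1; 1]%N) (mn4 0 0 0 2) fF c); last 2 first.
 - by rewrite E ff_lead.
 - move=> m; rewrite lem4 gcoefD => nz; apply/negP => /and4P[_ _ _ m2].
 case/eqP: nz; have [->|/hP e] := eqVneq (P m) 0; last by rewrite e in m2.
 by have [->|/hQw e] := eqVneq ((Q * w) m) 0; [rewrite addr0|rewrite e in m2].
 - by rewrite wdeg_mn4; apply: wge_fF.
have P0 : P = 0.
 apply: holo_germP => m; rewrite gcoef0; apply/eqP/negPn/negP => nz; have m0 := hP m nz.
 have := congr1 (fun a : A => a m) PQ; rewrite gcoefD gcoef0.
 have [->|/hQw] := eqVneq ((Q * w) m) 0; last by rewrite m0.
 by rewrite addr0 => /eqP; rewrite (negbTE nz).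
split=> //; move: PQ; rewrite P0 add0r => /germ_integral[//|w0].
by have := coef_gX C (mnm1 (o4 3)) (mnm1 (o4 3)); rewrite -/w w0 gcoef0 eqxx => /esym/eqP; rewrite oner_eq0.
Qed.
Lemma std_rem (a : A) : exists P Q c : A, [/\ noW P, noW Q & a = c * ff + (P + Q * w)].
Proof.
have w1 i : (0 < wt [:: 1; 1; 1; 1]%N i)%N by case: (ord4E i) => ->; rewrite /wt nth4.
have [|c [s []]] := @division C 4 _ w1 1 (fun=> mn4 0 0 0 2) (fun=> fF) a.
 by move=> _; rewrite wdeg_mn4; apply: wge_fF.
rewrite big_ord1 -ff_lead => Ea std.
have divw b : exists c1 P : A, b = c1 * w + P /\ noW P.
 have [|c1 [P []]] := @division C 4 _ w1 1 (fun=> mnm1 (o4 3)) (fun=> 0) b.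
 by move=> _ m; rewrite gcoef0 eqxx.
 rewrite big_ord1 addr0 => Eb stdP; exists (c1 ord0), P; split=> // m nz.
 by have := stdP m nz ord0; rewrite lep1mP negbK => /eqP.
have [c1 [P [Es hP]]] := divw s; have [c2 [Q [Ec hQ]]] := divw c1.
exists P, Q, (c ord0); split=> //.
rewrite {1}Ea; congr (_ + _).
suff c2w : c2 * gX C (mn4 0 0 0 2) = 0.
 rewrite Es Ec addrC; congr (_ + _).
 have -> : (c2 * w + Q) * w = c2 * w ^+ 2 + Q * w by ring.
 by move: c2w; rewrite gX_mn4 !expr0 !mul1r => ->; rewrite add0r.
apply: holo_germP => m; rewrite gcoef0; apply/eqP/negPn/negP => nz.
have m2 : lem (mn4 0 0 0 2) m by move: nz; rewrite gcoefMX; case: ifP; rewrite ?eqxx.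
have m3 : (2 <= m (o4 3))%N by move: m2; rewrite lem4 => /and4P[].
have E : c2 * gX C (mn4 0 0 0 2) = s - P - Q * w.
 by rewrite gX_mn4 !expr0 !mul1r Es Ec; ring.
move: nz; rewrite E !gcoefB.
have -> : s m = 0.
 by apply/eqP/negPn/negP => /std /(_ ord0); rewrite m2.
have -> : P m = 0 by apply/eqP/negPn/negP => /hP e; rewrite e in m3.
have -> : (Q * w) m = 0.
 rewrite gcoefMX; case: ifP => // _; apply/eqP/negPn/negP => /hQ.
 by rewrite mnmBE mnm1E eqxx; lia.
by rewrite !subr0 eqxx.
Qed.
Lemma pf_std (P Q : A) : noW P -> noW Q -> pf (P + Q * w) -> P = 0 /\ Q = 0.
Proof. by move=> hP hQ [c]; exact: std_eq0. Qed.
Lemma noW_notin P : noW P -> pf P -> P = 0.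
Proof.
move=> hP h; have [] := @pf_std P 0 hP => //; last by rewrite mul0r addr0.
by move=> m; rewrite gcoef0 eqxx.
Qed.

(** The weighted degree of F is odd, so -F is not a square of a fraction. *)
Lemma no_square (a b : A) : a ^+ 2 + b ^+ 2 * fF = 0 -> a = 0 /\ b = 0.
Proof.
pose s := [:: 1; 2; 3; 1]%N => E.
have EF : fF = gX C (mn4 0 0 5 0) + tt t * gX C (mn4 0 6 1 0) + gX C (mn4 1 7 0 0) + gX C (mn4 15 0 0 0).
 by rewrite !gX_mn4 /fF; ring.
have hF m : fF m != 0 -> wdeg (wt s) m = 15%N.
 rewrite EF !gcoefD gcoefCM !coef_gX.
 case: (mn4 0 0 5 0 =P m) => [<- _|_]; first by rewrite wdeg_mn4.
 case: (mn4 0 6 1 0 =P m) => [<- _|_]; first by rewrite wdeg_mn4.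
 case: (mn4 1 7 0 0 =P m) => [<- _|_]; first by rewrite wdeg_mn4.
 case: (mn4 15 0 0 0 =P m) => [<- _|_]; first by rewrite wdeg_mn4.
 by rewrite mulr0 !addr0 eqxx.
have F0 : fF != 0.
 apply/eqP => F0; have := congr1 (fun a : A => a (mn4 0 0 5 0)) EF.
 rewrite F0 gcoef0 !gcoefD gcoefCM !coef_gX eqxx.
 have -> : (mn4 0 6 1 0 == mn4 0 0 5 0) = false by apply/eqP => /mn4_inj[].
 have -> : (mn4 1 7 0 0 == mn4 0 0 5 0) = false by apply/eqP => /mn4_inj[].
 have -> : (mn4 15 0 0 0 == mn4 0 0 5 0) = false by apply/eqP => /mn4_inj[].
 by rewrite mulr0 !addr0 => /esym/eqP; rewrite oner_eq0.
have [b0|b0] := eqVneq b 0.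
 by move: E; rewrite b0 expr0n mul0r addr0 expr2 => /germ_integral[] ->.
have [a0|a0] := eqVneq a 0.
 move: E; rewrite a0 expr0n add0r => /germ_integral[]; last by move/eqP: F0.
 by rewrite expr2 => /germ_integral[] /eqP; rewrite (negbTE b0).
have [ma la] := lead_exists (wt s) a0; have [mb lb] := lead_exists (wt s) b0.
have [mF lF] := lead_exists (wt s) F0.
have [_ laa] := leadM la la; have [_ lbb] := leadM lb lb; have [_ lbF] := leadM lbb lF.
have EE : a * a = - (b * b * fF) by apply/eqP; rewrite -addr_eq0 -!expr2; apply/eqP.
have wF : wdeg (wt s) mF = 15%N by apply: hF; case: lF.
have le1 : (wdeg (wt s) (mnm_add ma ma) <= wdeg (wt s) (mnm_add (mnm_add mb mb) mF))%N.
 case: laa => _ /(_ (mnm_add (mnm_add mb mb) mF)); rewrite EE gcoefN oppr_eq0.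
 by case: lbF => -> _ /(_ isT)[/ltnW|[->]].
have le2 : (wdeg (wt s) (mnm_add (mnm_add mb mb) mF) <= wdeg (wt s) (mnm_add ma ma))%N.
 case: lbF => _ /(_ (mnm_add ma ma)); rewrite -[b * b * fF]opprK -EE gcoefN oppr_eq0.
 by case: laa => -> _ /(_ isT)[/ltnW|[->]].
by move: le1 le2; rewrite !wdegD wF; lia.
Qed.
Lemma pf_prime : is_prime pf.
Proof.
split; first exact: pf_ideal.
 move=> /noW_notin h; have : (1 : A) = 0.
 by apply: h; rewrite -(rmorph1 (@germC C 4)); apply: indepC.
 by move/eqP; rewrite oner_eq0.
move=> a b [c Eab].
have [a1 [a2 [ca [ha1 ha2 Ea]]]] := std_rem a; have [b1 [b2 [cb [hb1 hb2 Eb]]]] := std_rem b.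
have [E1 E2] : a1 * b1 - a2 * b2 * fF = 0 /\ a1 * b2 + a2 * b1 = 0.
 apply: pf_std.
 - by indep_tac; exact: noW_fF.
 - by indep_tac.
 exists (c - ca * (cb * ff + (b1 + b2 * w)) - cb * (a1 + a2 * w) - a2 * b2).
 have {}Eab : (ca * ff + (a1 + a2 * w)) * (cb * ff + (b1 + b2 * w)) = c * ff by rewrite -Ea -Eb.
 rewrite !mulrBl -Eab {Eab Ea Eb} /ff; ring.
have h1 : b1 * (a1 ^+ 2 + a2 ^+ 2 * fF) = 0.
 have -> : b1 * (a1 ^+ 2 + a2 ^+ 2 * fF) =
 a1 * (a1 * b1 - a2 * b2 * fF) + a2 * fF * (a1 * b2 + a2 * b1) by ring.
 by rewrite E1 E2 !mulr0 addr0.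
have h2 : b2 * (a1 ^+ 2 + a2 ^+ 2 * fF) = 0.
 have -> : b2 * (a1 ^+ 2 + a2 ^+ 2 * fF) =
 a1 * (a1 * b2 + a2 * b1) - a2 * (a1 * b1 - a2 * b2 * fF) by ring.
 by rewrite E1 E2 !mulr0 subr0.
have [n0|] := pselect (a1 ^+ 2 + a2 ^+ 2 * fF = 0).
 by have [e1 e2] := no_square n0; left; exists ca; rewrite Ea e1 e2 mul0r !addr0.
move=> n0; right; exists cb; case: (germ_integral h1) => // b10; case: (germ_integral h2) => // b20.
by rewrite Eb b10 b20 mul0r !addr0.
Qed.

End PrimeFamily.

End Gm.
Import Gm.

(** * Polar surfaces *)

Module Gn.
Local Notation contraction := Defs.contraction.

Section WeightedParts.
Variables (C : numFieldType) (n : nat) (w : 'I_n -> nat).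
Hypothesis w_gt0 : forall i, (0 < w i)%N.
Local Notation A := (holo_germ C n).
Implicit Types a b : A.

Definition part d a : {mpoly C[n]} :=
 \sum_(k : bmultinom n d.+1 | wdeg w k == d) a k *: mpolyX C k.

Lemma mdeg_wdeg m : (mdeg m <= wdeg w m)%N.
Proof. by rewrite mdegE /wdeg leq_sum// => i _; rewrite leq_pmull. Qed.
Lemma mcoeff_part d a m : mcoeff m (part d a) = if wdeg w m == d then a m else 0.
Proof.
rewrite /part raddf_sum /=; under eq_bigr do rewrite mcoeffZ mcoeffX.
case: eqP => [wm|wm]; last first.
 rewrite big1// => k /eqP wk; case: eqP => [km|]; last by rewrite mulr0.
 by case: wm; rewrite -km.
have md : (mdeg m < d.+1)%N by rewrite ltnS -wm mdeg_wdeg.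
rewrite (bigD1 (BMultinom md))/=; last by rewrite wm.
rewrite eqxx mulr1 big1 ?addr0// => k /andP[_ ne]; case: eqP => [km|]; last by rewrite mulr0.
by case/eqP: ne; apply/val_inj.
Qed.

(** Initial forms are multiplicative. *)
Lemma partM d e a b : wge w d a -> wge w e b -> part (d + e) (a * b) = part d a * part e b.
Proof.
move=> ha hb; apply/mpolyP => m; rewrite mcoeff_part mcoeffM.
have aux (p q : nat) : (d <= p)%N -> (e <= q)%N -> (p + q = d + e)%N -> p = d /\ q = e by lia.
case: eqP => wm; last first.
 rewrite big1// => k /eqP mk; rewrite !mcoeff_part.
 case: eqP => w1; last by rewrite mul0r.
 case: eqP => w2; last by rewrite mulr0.
 by case: wm; rewrite mk wdegD w1 w2.
rewrite (gcoefM _ _ (ltnSn (mdeg m))); apply: eq_bigr => k /eqP mk; rewrite !mcoeff_part.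
have [->|n1] := eqVneq (a k.1) 0; first by rewrite if_same !mul0r.
have [->|n2] := eqVneq (b k.2) 0; first by rewrite if_same !mulr0.
by have [|-> ->] := aux _ _ (ha _ n1) (hb _ n2); rewrite ?eqxx// -wdegD -mk.
Qed.
Lemma partD d a b : part d (a + b) = part d a + part d b.
Proof.
by apply/mpolyP => m; rewrite mcoeffD !mcoeff_part; case: ifP; rewrite ?addr0.
Qed.
Lemma part_eq0 d a : wge w d.+1 a -> part d a = 0.
Proof.
move=> ha; apply/mpolyP => m; rewrite mcoeff_part mcoeff0; case: eqP => // wm.
by apply/eqP/negPn/negP => /ha; rewrite wm ltnn.
Qed.
Lemma part_exists a : a != 0 -> exists2 d, wge w d a & part d a != 0.
Proof.
move=> /(lead_exists w)[m [nz lm]]; exists (wdeg w m).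
 by move=> m' /lm[/ltnW|[->]].
by apply: contraNneq nz => /(congr1 (mcoeff m)); rewrite mcoeff_part eqxx mcoeff0 => ->.
Qed.
Lemma part_uniq d e a : wge w d a -> part d a != 0 -> wge w e a -> part e a != 0 -> d = e.
Proof.
have aux d' e' : wge w d' a -> part e' a != 0 -> (d' <= e')%N.
 move=> hd; rewrite leqNgt; apply: contraNN => lt; apply/eqP/part_eq0.
 exact: wgeW hd.
by move=> h1 h2 h3 h4; apply/eqP; rewrite eqn_leq !aux.
Qed.

End WeightedParts.

Lemma germ_subst_id (C : numFieldType) n (s : 'I_n -> holo_germ C n) (s0 : forall i, cst (s i) = 0)
 (a : holo_germ C n) :
 (forall m, a m != 0 -> mmap1 s m = gX C m) -> germ_subst s0 a = a.
Proof.
move=> H; apply: holo_germP => k; rewrite (coef_subst _ _ (ltnSn _)).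
rewrite (bigD1 (BMultinom (ltnSn (mdeg k))))//= big1 ?addr0 => [|m mk].
 have [->|nz] := eqVneq (a k) 0; first by rewrite mul0r.
 by rewrite H// coef_gX eqxx mulr1.
have [->|nz] := eqVneq (a m) 0; first by rewrite mul0r.
rewrite H// coef_gX; case: (val m =P k) => [e|]; last by rewrite mulr0.
by case/eqP: mk; apply/val_inj.
Qed.

Section PrimePolar.
Variables (C : numClosedFieldType) (t : C) (lv : 'I_4 -> C).
Local Notation A := (holo_germ C 4).
Local Notation x := (vx C 0).
Local Notation y := (vx C 1).
Local Notation z := (vx C 2).
Local Notation w := (vx C 3).
Local Notation ff := (ff t).
Local Notation fF := (fF t).
Local Notation noW := (indep (o4 3)).
Hypothesis l3 : lv (o4 3) != 0.

Definition polar : A := \sum_i germC 4 (lv i) * df t i.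
Definition p1 : set A := [set a | exists b c, a = b * ff + c * polar].

Definition r0 : A := germC 4 (2%:R * lv (o4 3))^-1 *
 (germC 4 (lv (o4 0)) * fx C + germC 4 (lv (o4 1)) * fy t + germC 4 (lv (o4 2)) * fz t).

Lemma polarE : polar = germC 4 (2%:R * lv (o4 3)) * (w + r0).
Proof.
have u : germC 4 (2%:R * lv (o4 3)) * germC 4 (2%:R * lv (o4 3))^-1 = 1.
 by rewrite -rmorphM mulfV ?rmorph1// mulf_neq0 ?pnatr_eq0.
rewrite mulrDr /r0 [X in _ = _ + X]mulrA u mul1r rmorphM rmorph_nat.
by rewrite /polar big4 /df !nth4//= /fw; ring.
Qed.
Lemma noW_part : [/\ noW (fx C), noW (fy t) & noW (fz t)].
Proof.
split; rewrite /fx /fy /fz; indep_tac; first [exact: noW_tt|exact: noW_vx].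
Qed.
Lemma noW_r0 : noW r0.
Proof. by have [? ? ?] := noW_part; rewrite /r0; indep_tac. Qed.

Definition sW (i : 'I_4) : A := nth 0 [:: x; y; z; - r0] i.

Lemma wge_part s d : (d <= nth 0 s 1 * 7)%N -> (d <= nth 0 s 0 * 14)%N ->
 (d <= nth 0 s 1 * 5 + nth 0 s 2)%N -> (d <= nth 0 s 0 + nth 0 s 1 * 6)%N ->
 (d <= nth 0 s 2 * 4)%N -> (d <= nth 0 s 1 * 6)%N -> 
 [/\ wge (wt s) d (fx C), wge (wt s) d (fy t) & wge (wt s) d (fz t)].
Proof.
move=> h1 h2 h3 h4 h5 h6; split; rewrite /fx /fy /fz; wge_tac;
 move: h1 h2 h3 h4 h5 h6; rewrite /= ?(mulnC 5) ?(mulnC 4) ?(mulnC 6) ?(mulnC 7) ?(mulnC 14); lia.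
Qed.
Lemma wge_r0 s d : (d <= nth 0 s 1 * 7)%N -> (d <= nth 0 s 0 * 14)%N ->
 (d <= nth 0 s 1 * 5 + nth 0 s 2)%N -> (d <= nth 0 s 0 + nth 0 s 1 * 6)%N ->
 (d <= nth 0 s 2 * 4)%N -> (d <= nth 0 s 1 * 6)%N -> wge (wt s) d r0.
Proof.
move=> h1 h2 h3 h4 h5 h6; have [? ? ?] := wge_part h1 h2 h3 h4 h5 h6.
by apply: wgeM0; do ?apply: wgeD; apply: wgeM0.
Qed.
Lemma sW0 i : cst (sW i) = 0.
Proof.
have c0 : cst r0 = 0.
 have : wge (wt [:: 1; 1; 1; 1]%N) 1 r0 by apply: wge_r0.
 move=> h; apply/eqP/negPn/negP => /h.
 by rewrite (wdeg0 (wt [:: 1; 1; 1; 1]%N)).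
by case: (ord4E i) => ->; rewrite /sW nth4//= ?cst_vx// cstN c0 oppr0.
Qed.

Local Notation sg := (germ_subst sW0).

Lemma sg_noW a : noW a -> sg a = a.
Proof.
move=> ha; apply: germ_subst_id => m /ha m3.
rewrite [in RHS](mn4_eta m) gX_mn4 /mmap1 big4 /= m3 !expr0 !mulr1 mulrA.
by rewrite /sW !nth4.
Qed.
Lemma sg_w : sg w = - r0.
Proof. by rewrite germ_substX /sW nth4. Qed.

Definition gG : A := fF + r0 ^+ 2.

Lemma sg_ff : sg ff = gG.
Proof.
rewrite /ff germ_substD (sg_noW (@noW_fF C t)).
by rewrite expr2 germ_substM sg_w mulrNN.
Qed.
Lemma sg_polar : sg polar = 0.
Proof.
by rewrite polarE germ_substM germ_substD sg_w (sg_noW noW_r0) addNr mulr0.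
Qed.

Definition rG : A := tt t * (y ^+ 6 * z) + y ^+ 7 * x + x ^+ 15 + r0 ^+ 2.
Lemma gG_lead : gG = gX C (mn4 0 0 5 0) + rG.
Proof. by rewrite gX_mn4 /gG /rG /fF; ring. Qed.

Definition std1 (a : A) := forall m, a m != 0 -> m (o4 3) = 0%N /\ (m (o4 2) < 5)%N.

Lemma std1_noW a : std1 a -> noW a. Proof. by move=> h m /h[]. Qed.
Lemma wge_rG : wge (wt [:: 2; 3; 3; 8]%N) 16 rG.
Proof.
have h : wge (wt [:: 2; 3; 3; 8]%N) 12 r0 by apply: wge_r0.
by rewrite /rG; wge_tac.
Qed.

Let w_gt0 i : (0 < wt [:: 2; 3; 3; 8]%N i)%N.
Proof. by case: (ord4E i) => ->; rewrite /wt nth4. Qed.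
Lemma std1_p1 a : std1 a -> p1 a -> a = 0.
Proof.
move=> ha [b [c Ea]].
have : sg a = sg b * gG by rewrite Ea germ_substD !germ_substM sg_ff sg_polar mulr0 addr0.
rewrite (sg_noW (std1_noW ha)).
rewrite gG_lead => /division_uniq h; apply: (h (wt [:: 2; 3; 3; 8]%N)).
 by rewrite wdeg_mn4; exact: wge_rG.
by move=> m /ha[_ m2]; rewrite lem4 !negb_and -!ltnNge m2 !orbT.
Qed.
Lemma p1_ideal : is_ideal p1.
Proof.
split=> [|a b [c [d ->]] [c' [d' ->]]|a b [c [d ->]]].
- by exists 0, 0; rewrite !mul0r addr0.
- by exists (c + c'), (d + d'); rewrite !mulrDl addrACA.
by exists (a * c), (a * d); rewrite mulrDr !mulrA.
Qed.
Lemma std1_rem (a : A) : exists2 s, std1 s & p1 (a - s).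
Proof.
pose al (i : 'I_2) := if i == ord0 then mn4 0 0 0 1 else mn4 0 0 5 0.
pose r (i : 'I_2) := if i == ord0 then r0 else fF - z ^+ 5 + w ^+ 2.
have [|c [s [Ea std]]] := @division C 4 _ w_gt0 2 al r a.
 move=> i; rewrite /al /r; case: ifP => _; rewrite wdeg_mn4 /=.
 by apply: wgeW (@wge_r0 [:: 2; 3; 3; 8]%N 12 _ _ _ _ _ _).
 have -> : fF - z ^+ 5 + w ^+ 2 = tt t * (y ^+ 6 * z) + y ^+ 7 * x + x ^+ 15 + w ^+ 2.
 by rewrite /fF; ring.
 by wge_tac.
exists s.
 move=> m nz; have := std m nz ord0; have := std m nz (lift ord0 ord0).
 by rewrite /al /= !lem4 /= !andbT => h1 h2; split; lia.
exists (c (lift ord0 ord0)), (c ord0 * germC 4 (2%:R * lv (o4 3))^-1).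
rewrite Ea addrK big_ord_recl big_ord1 addrC /al /r /= !gX_mn4 !expr0 !mul1r !mulr1 expr1.
rewrite polarE -mulrA [germC _ _ * (germC _ _ * _)]mulrA -rmorphM mulVf ?mulf_neq0 ?pnatr_eq0//.
by rewrite rmorph1 mul1r /ff; congr (_ * _ + _); rewrite [RHS]addrC; ring.
Qed.

(* the part of the germ at x = 1 and w = 0, in C[y][z] *)
Local Notation CY := {poly C}.
Let eta_v (i : 'I_4) : {poly CY} := nth 0 [:: 1; ('X : CY)%:P; 'X; 0] i.
Let eta (p : {mpoly C[4]}) : {poly CY} := mmap (@polyC CY \o @polyC C) eta_v p.

Let etaE p : eta p = \sum_(m <- msupp p)
 if m (o4 3) == 0%N then ((mcoeff m p)%:P * 'X^(m (o4 1)))%:P * 'X^(m (o4 2)) else 0.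
Proof.
rewrite /eta /mmap; apply: eq_bigr => m _.
rewrite /mmap1 big4 /= /eta_v !nth4//= expr1n mul1r.
case: eqP => [->|/eqP m3]; last by rewrite expr0n (negbTE m3) !mulr0.
by rewrite expr0 mulr1 rmorphM rmorphXn mulrA.
Qed.

Let w123 i : (0 < wt [:: 1; 2; 3; 1]%N i)%N.
Proof. by case: (ord4E i) => ->; rewrite /wt nth4. Qed.

Let eta_part d a : std1 a -> part (wt [:: 1; 2; 3; 1]%N) d a != 0 ->
 eta (part (wt [:: 1; 2; 3; 1]%N) d a) != 0 /\
 (size (eta (part (wt [:: 1; 2; 3; 1]%N) d a)) <= 5)%N.
Proof.
move=> ha; set p := part _ d a => p0.
have supp m : m \in msupp p -> [/\ wdeg (wt [:: 1; 2; 3; 1]%N) m = d, m (o4 3) = 0%N & (m (o4 2) < 5)%N].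
 rewrite mcoeff_msupp mcoeff_part//; case: (wdeg _ m =P d) => [wm|]; last by rewrite eqxx.
 by move=> /ha[].
split; last first.
 rewrite etaE; apply/leq_sizeP => j j5; rewrite coef_sum big_seq big1// => m /supp[_ -> m2].
 rewrite eqxx coefCM coefXn; case: eqP => [jm|]; last by rewrite mulr0.
 by move: m2; rewrite -jm ltnNge j5.
have [m mp] : exists m, m \in msupp p.
 by exists (mlead p); rewrite mlead_supp.
have [wm m3 m2] := supp m mp.
apply: contraTneq mp => /(congr1 (fun P : {poly CY} => (P`_(m (o4 2)))`_(m (o4 1)))).
rewrite !coef0 etaE !coef_sum => E; rewrite mcoeff_msupp negbK; apply/eqP.
have [mp|/memN_msupp_eq0//] := boolP (m \in msupp p).
rewrite -[RHS]E (bigD1_seq m)//= m3 eqxx coefCM coefXn eqxx mulr1 coefCM coefXn eqxx mulr1.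
rewrite big_seq_cond big1 ?addr0// => m' /andP[/supp[wm' m3' _] ne].
rewrite m3' eqxx coefCM coefXn; case: eqP => [e2|]; last by rewrite mulr0 coef0.
rewrite mulr1 coefCM coefXn; case: eqP => [e1|]; last by rewrite mulr0.
case/eqP: ne; rewrite (mn4_eta m) (mn4_eta m') m3 m3' e1 e2; congr mn4.
move: wm wm'; rewrite !wdeg4 /= m3 m3' e1 e2; lia.
Qed.

(** The polar surface is irreducible: its initial form is the curve at x = 1. *)
Lemma p1_prime : is_prime p1.
Proof.
split; first exact: p1_ideal.
 move=> /std1_p1 h; have : (1 : A) = 0.
 apply: h => m; rewrite -(rmorph1 (@germC C 4)) gcoefC.
 by case: (m =P mnm0) => [-> _|_]; rewrite ?mulr0 ?eqxx// !mnm0E.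
 by move/eqP; rewrite oner_eq0.
move=> a b pab; have ip := p1_ideal.
have [a' sa pa] := std1_rem a; have [b' sb pb] := std1_rem b.
have : p1 (a' * b').
 have -> : a' * b' = a * b - (a * (b - b') + b' * (a - a')) by ring.
 by apply: idealB => //; apply: idealD => //; apply: idealMl.
have [a0|a0] := eqVneq a' 0; first by left; move: pa; rewrite a0 subr0.
have [b0|b0] := eqVneq b' 0; first by right; move: pb; rewrite b0 subr0.
move=> [b1 [c1 Eab]]; exfalso; pose c := sg b1; pose s := wt [:: 1; 2; 3; 1]%N.
have {Eab} E : a' * b' = c * gG.
 have : sg (a' * b') = c * gG by rewrite Eab germ_substD !germ_substM sg_ff sg_polar mulr0 addr0.
 by rewrite germ_substM (sg_noW (std1_noW sa)) (sg_noW (std1_noW sb)).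
have ab0 : a' * b' != 0.
 by apply/eqP => /germ_integral[]/eqP; rewrite ?(negbTE a0) ?(negbTE b0).
have c0 : c != 0 by apply: contraNneq ab0 => c0; rewrite E c0 mul0r.
have [da wa na] := part_exists w123 a0; have [db wb nb] := part_exists w123 b0.
have [dc wc nc] := part_exists w123 c0.
have wG : wge s 15 gG.
 have h : wge s 12 r0 by apply: wge_r0.
 by apply: wgeD; [apply: wge_fF|apply: wgeW (wgeX (k := 2) h)].
have GF : part s 15 gG = mpolyX C (mn4 0 0 5 0) + mpolyC 4 t * mpolyX C (mn4 0 6 1 0) +
 mpolyX C (mn4 1 7 0 0) + mpolyX C (mn4 15 0 0 0).
 rewrite partD// [X in _ + X](part_eq0 w123) ?addr0; last first.
 have h : wge s 12 r0 by apply: wge_r0.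
 by apply: wgeW (wgeX (k := 2) h).
 set F0 := (X in _ = X); have -> : fF = germ_of_mpoly F0.
 by rewrite /F0 !rmorphD rmorphM /= -!/(gX C _) !gX_mn4 /fF /tt; ring.
 apply/mpolyP => m; rewrite mcoeff_part// coef_mpoly; case: (wdeg s m =P 15%N) => // wm.
 apply/esym; rewrite /F0 !mcoeffD mcoeffCM !mcoeffX.
 do 4?[case: (mn4 _ _ _ _ =P m) => [mE|_]; first by case: wm; rewrite -mE wdeg_mn4].
 by rewrite mulr0 !addr0.
have nG : part s 15 gG != 0.
 apply/eqP => /(congr1 (mcoeff (mn4 0 0 5 0))); rewrite GF mcoeff0 !mcoeffD mcoeffCM !mcoeffX eqxx.
 have -> : (mn4 0 6 1 0 == mn4 0 0 5 0) = false by apply/eqP => /mn4_inj[].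
 have -> : (mn4 1 7 0 0 == mn4 0 0 5 0) = false by apply/eqP => /mn4_inj[].
 have -> : (mn4 15 0 0 0 == mn4 0 0 5 0) = false by apply/eqP => /mn4_inj[].
 by rewrite mulr0 !addr0 => /eqP; rewrite oner_eq0.
have Pab := partM w123 wa wb; have PcG := partM w123 wc wG.
have dE : (da + db = dc + 15)%N.
 apply: (part_uniq w123 (a := a' * b')).
 - exact: wgeM.
 - by rewrite Pab mulf_neq0.
 - by rewrite E; exact: wgeM.
 - by rewrite E PcG mulf_neq0.
have EE : part s da a' * part s db b' = part s dc c * part s 15 gG.
 by rewrite -Pab E dE PcG.
have [ea za] := eta_part sa na; have [eb zb] := eta_part sb nb.
have etaM p q : eta (p * q) = eta p * eta q by exact: rmorphM.
have etaG : eta (part s 15 gG) = curve t.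
 rewrite GF /eta !rmorphD rmorphM /= mmapC !mmapX /mmap1 !big4 /= !mn4E !nth4//=.
 have -> : eta_v (o4 0) = 1 by rewrite /eta_v nth4.
 have -> : eta_v (o4 1) = ('X)%:P by rewrite /eta_v nth4.
 have -> : eta_v (o4 2) = 'X by rewrite /eta_v nth4.
 by rewrite /curve !(rmorphD, rmorphXn, rmorph1, rmorphM) /=; ring.
have := congr1 eta EE; rewrite !etaM etaG => /esym/curve_prime/(_ za zb) [h|h].
 by rewrite h eqxx in ea.
by rewrite h eqxx in eb.
Qed.

End PrimePolar.

End Gn.
Import Gn.

(** * The cycles and their sections *)

Module Go.
Local Notation contraction := Defs.contraction.

Lemma gen_le (A : comNzRingType) (G R : set A) : ideal_gen G `<=` R -> G `<=` R.
Proof. by move=> h a Ga; apply: h; exact: sub_ideal_gen. Qed.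
Lemma Phi_coef (A : comNzRingType) n (d : 'I_n -> A) (P : {mpoly A[n]}) k :
 (Phi d P)`_k = \sum_(m <- msupp P | mdeg m == k) mcoeff m P * \prod_i d i ^+ m i.
Proof.
rewrite /Phi /mmap coef_sum [RHS]big_mkcond; apply: eq_bigr => m _.
have -> : mmap1 (fun i => (d i)%:P * 'X) m = (\prod_i d i ^+ m i)%:P * 'X^(mdeg m).
 rewrite mdegE -prodrXr rmorph_prod -big_split; apply: eq_bigr => i _ /=.
 by rewrite exprMn rmorphXn.
rewrite mulrA -rmorphM coefCM coefXn eq_sym; case: eqP => _; first by rewrite mulr1.
by rewrite mulr0.
Qed.
Lemma Phi_scale (A : comNzRingType) n (d : 'I_n -> A) (h : A) (P : {mpoly A[n]}) k :
 (Phi (fun i => h * d i) P)`_k = h ^+ k * (Phi d P)`_k.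
Proof.
rewrite !Phi_coef mulr_sumr; apply: eq_bigr => m /eqP <-; rewrite mulrCA; congr (_ * _).
by rewrite mdegE -prodrXr -big_split; apply: eq_bigr => i _; rewrite exprMn.
Qed.
Lemma germ_pow_neq0 (C : numFieldType) n (h : holo_germ C n) k : h <> 0 -> h ^+ k = 0 -> False.
Proof.
move=> h0; elim: k => [|k IH]; first by move/eqP; rewrite expr0 oner_eq0.
by rewrite exprS => /germ_integral[].
Qed.

Section Assembly.
Variables (C : numClosedFieldType) (t : C) (L : 'M[C]_(2, 4)).
Local Notation A := (holo_germ C 4).
Local Notation D := (holo_germ C 1).
Local Notation S := {mpoly A[4]}.
Local Notation y i := (mpolyX A (mnm1 i) : S).
Local Notation K c := (mpolyC 4 c : S).
Local Notation d := (df t).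
Local Notation ff := (ff t).
Local Notation Q := (transform d).
Local Notation mm := (@germ_maximal_ideal C 4).
Local Notation i0 := (ord0 : 'I_2).
Local Notation i1 := (lift ord0 ord0 : 'I_2).
Local Notation lv k := (fun j : 'I_4 => L k j).
Local Notation lf k := (linear_form (row k L) : S).
Local Notation pol k := (polar t (lv k)).

Lemma linear_formE k : lf k = \sum_j K (germC 4 (L k j)) * y j.
Proof. by rewrite /linear_form; apply: eq_bigr => j _; rewrite mxE mul_mpolyC. Qed.
Lemma Phi_linear k : Phi d (lf k) = (pol k)%:P * 'X.
Proof.
rewrite linear_formE Phi_sum /polar rmorph_sum mulr_suml; apply: eq_bigr => j _.
by rewrite PhiM PhiC PhiX rmorphM mulrA.
Qed.

Definition above (R : set S) := forall a, cst a = 0 -> R (K a).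

Definition curve_ideal : set A := [set a | exists b c1 c0, a = b * ff + c1 * pol i1 + c0 * pol i0].
Local Notation I := curve_ideal.

Lemma curve_ideal_ideal : is_ideal I.
Proof.
split=> [|a b [c [d [e ->]]] [c' [d' [e' ->]]]|a b [c [d [e ->]]]].
- by exists 0, 0, 0; rewrite !mul0r !addr0.
- by exists (c + c'), (d + d'), (e + e'); ring.
by exists (a * c), (a * d), (a * e); ring.
Qed.

Variables (c1 c2 : 'I_4 -> 'I_4 -> C).
Let cid (i j : 'I_4) : C := (j == i)%:R.
Hypothesis L13 : L i1 (o4 3) != 0.
Hypothesis sing : forall P : set A, is_prime P -> (forall i, P (d i)) -> forall a, cst a = 0 -> P a.
Hypothesis blow : Q [set 0] `<=` linear_ideal cid.
Variable V : pred 'I_4.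
Hypothesis V4 : ~~ V (o4 3).
Hypothesis fibre0 : forall R, proj_point R -> above R -> Q (pf t) `<=` R -> exists2 i, V i & R (y i).
Hypothesis fibre1 : forall i R, V i -> is_ideal R -> above R -> R (y i) -> R (lf i1) -> Q (p1 t (lv i1)) `<=` R.
Hypothesis c1_min : forall R, is_ideal R -> above R -> R (lf i1) -> linear_ideal c1 `<=` R.
Hypothesis c1_l : linear_ideal c1 (lf i1).
Hypothesis c2_min : forall R, is_ideal R -> above R -> R (lf i0) -> R (lf i1) -> linear_ideal c2 `<=` R.
Hypothesis c2_l : linear_ideal c2 (lf i0) /\ linear_ideal c2 (lf i1).
Hypothesis c1_id : forall i, i != o4 3 -> forall j, c1 i j = (j == i)%:R.
Hypothesis c2_id : forall i, (i == o4 0) || (i == o4 1) -> forall j, c2 i j = (j == i)%:R.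
Variables (r e : nat) (X : 'I_r -> 'I_4 -> D) (X0 : forall j i, cst (X j i) = 0).
Local Notation ga j := (germ_subst (X0 j)).
Local Notation q j := [set a : A | ga j a = 0].
Hypothesis arc0 : forall j a, I a -> ga j a = 0.
Hypothesis arc_sep : forall i j, i != j -> exists h, ga i h = 0 /\ ga j h <> 0.
Hypothesis arc_red : forall j, exists2 s, ga j s <> 0 & forall a, ga j a = 0 -> I (s * a).
Hypothesis arc_comp : forall P : set A, is_prime P -> I `<=` P ->
 (exists2 a, cst a = 0 & ~ P a) -> exists j, forall a, ga j a = 0 -> P a.
Hypothesis arc_nz : forall j, exists i, ga j (d i) <> 0.
Hypothesis arc_hs : forall j, hs_multiplicity mm (q j) = e.
Hypothesis fibre2 : forall i, V i -> exists j, forall R, is_ideal R -> above R ->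
 R (y i) -> R (lf i0) -> R (lf i1) -> Q (q j) `<=` R.

Let pI := @p1_ideal C t (lv i1).
Let pP := @p1_prime C t (lv i1) L13.

Lemma kernel_prime j : is_prime (q j).
Proof.
split=> /=.
- split=> /= [|a b ha hb|a b hb]; first exact: Ge.arc0.
 by rewrite arcD ha hb addr0.
 by rewrite arcM hb mulr0.
- by rewrite arc1 => /eqP; rewrite oner_eq0.
- by move=> a b; rewrite arcM; exact: germ_integral.
Qed.
Lemma cst_d i : cst (d i) = 0.
Proof.
by case: (ord4E i) => ->; rewrite /df nth4//= /fx /fy /fz /fw !(cstD, cstX, cstM) !cst_vx
 ?(expr0n, mulr0, mul0r, addr0).
Qed.
Lemma above_id (R : set S) : is_ideal R -> above R -> linear_ideal cid `<=` R.
Proof.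
move=> iR aR; apply: linear_ideal_min => // i.
rewrite (bigD1 i)//= /cid eqxx !rmorph1 mul1r big1 ?addr0 ?subrr; first exact: ideal0.
by move=> j /negbTE ->; rewrite !rmorph0 mul0r.
Qed.
Lemma linear_above c : above (linear_ideal c).
Proof. by move=> a a0; apply/linear_ideal_C. Qed.
Lemma fibre_or (R : set S) : proj_point R -> Q [set 0] `<=` R ->
 above R \/ exists2 i, ~ contraction R (d i) & R = Q (contraction R).
Proof.
move=> pR BR; have [|/existsNP[i ni]] := pselect (forall i, contraction R (d i)); [move=> H; left|right].
 by move=> a a0; apply: (sing (contraction_prime _)) => //; case: pR.
by exists i => //; exact: (transform_contraction pR BR ni).
Qed.
Lemma proj_linear c i : (forall j, c i j = (j == i)%:R) -> proj_point (@linear_ideal C 4 4 c).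
Proof.
move=> ci; apply: (@linear_ideal_point _ _ _ _ i).
rewrite (bigD1 i)//= ci eqxx scale1r big1 ?addr0 => [|j /negbTE ji].
 by apply/eqP => /(congr1 (mcoeff (mnm1 i))) /eqP; rewrite mcoeffX eqxx mcoeff0 oner_eq0.
by rewrite ci ji scale0r.
Qed.
Lemma nonzero_theta c i : (forall j, c i j = (j == i)%:R) -> ~ @linear_ideal C 4 4 c (y i).
Proof.
move=> ci; rewrite /linear_ideal /= thetaX (bigD1 i)//= ci eqxx scale1r big1 ?addr0 => [|j /negbTE ji].
 by apply/eqP/eqP => /(congr1 (mcoeff (mnm1 i))) /eqP; rewrite mcoeffX eqxx mcoeff0 oner_eq0.
by rewrite ci ji scale0r.
Qed.
Lemma x_notin_pf : ~ pf t (vx C 0).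
Proof.
move=> /(noW_notin (@noW_vx C 0 isT)) x0.
have := coef_gX C (mnm1 (o4 0)) (mnm1 (o4 0)); rewrite -/(vx C 0) x0 gcoef0 eqxx => /esym/eqP.
by rewrite oner_eq0.
Qed.
Lemma x_notin_p1 : ~ p1 t (lv i1) (vx C 0).
Proof.
have h : std1 (vx C 0).
 move=> m; rewrite coef_gX; case: (mnm1 _ =P m) => [<- _|_]; last by rewrite eqxx.
 by rewrite !mnm1E -!val_eqE /= !inordK.
move=> /(std1_p1 L13 h) x0.
have := coef_gX C (mnm1 (o4 0)) (mnm1 (o4 0)); rewrite -/(vx C 0) x0 gcoef0 eqxx => /esym/eqP.
by rewrite oner_eq0.
Qed.
Lemma pf_p1 : pf t `<=` p1 t (lv i1).
Proof. by move=> a [c ->]; exists c, 0; rewrite mul0r addr0. Qed.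
Lemma p1_I : p1 t (lv i1) `<=` I.
Proof. by move=> a [b [c ->]]; exists b, c, 0; rewrite mul0r addr0. Qed.
Lemma I_q j : I `<=` q j. Proof. by move=> a; exact: arc0. Qed.
Lemma d_notin_p1 (P : set A) : is_prime P -> ~ P (vx C 0) -> exists i, ~ P (d i).
Proof.
move=> PP nx; apply/existsNP => H; apply: nx; apply: (sing PP H); exact: cst_vx.
Qed.

Let E : set S := ideal_gen (Q [set 0] `|` range (fun j => K (2%:R * ff * d j))).

Let nV : exists2 i, i != o4 3 & True. Proof. by exists (o4 0) => //; rewrite -val_eqE /= !inordK. Qed.

Let y_c1 i : V i -> ~ linear_ideal c1 (y i).
Proof.
move=> Vi; apply: nonzero_theta; apply: c1_id.
by apply: contraNneq V4 => <-.
Qed.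

Let y_id i : ~ linear_ideal cid (y i). Proof. by apply: nonzero_theta. Qed.
Lemma nat_notin (P : set A) k : is_prime P -> ~ P k.+1%:R.
Proof.
move=> [iP P1 _] H; apply: P1; have -> : (1 : A) = germC 4 (k.+1%:R^-1) * k.+1%:R.
 by rewrite -(rmorph_nat (@germC C 4)) -rmorphM mulVf ?rmorph1// pnatr_eq0.
exact: idealMl.
Qed.
Lemma comp_E : components E [:: linear_ideal cid; Q (pf t)].
Proof.
have pfP := pf_prime t; have pfi := pf_ideal t; have [i ni] := d_notin_p1 pfP x_notin_pf.
have Qn : ~ (Q (pf t) `<=` linear_ideal cid).
 move=> h; have [j _] := fibre0 (@proj_linear cid (o4 0) (fun=> erefl)) (@linear_above cid) h.
 exact: y_id.
have Mn : ~ (linear_ideal cid `<=` Q (pf t)).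
 move=> h; apply: x_notin_pf; apply/(transform_C d _ pfi); apply: h.
 by apply/linear_ideal_C; exact: cst_vx.
apply: componentsI.
- by rewrite /= mem_seq1 andbT; apply/eqP => e1; apply: Mn; rewrite e1.
- move=> P; rewrite in_cons mem_seq1 => /orP[]/eqP ->; split.
 + exact: (@proj_linear _ (o4 0)).
 + apply: ideal_gen_sub; first by case: (@linear_ideal_prime C 4 4 cid).
 move=> p [/blow//|[j _ <-]]; apply/linear_ideal_C.
 by rewrite cstM cst_d mulr0.
 + exact: (proj_point_transform pfP ni).
 + apply: ideal_gen_sub; first exact: transform_ideal.
 move=> p [|[j _ <-]]; first by apply: transform_sub => _ ->; exact: ideal0.
 by apply/transform_C => //; rewrite mulrAC; exists (2%:R * d j).
- move=> R pR ER; have [pRp _ _] := pR; have [iR _ _] := pRp.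
 have BR : Q [set 0] `<=` R by move=> p Bp; apply: (gen_le ER); left.
 have aR j : R (K (2%:R * ff * d j)) by apply: (gen_le ER); right; exists j.
 have [aboveR|[j nj RE]] := fibre_or pR BR.
 by exists (linear_ideal cid); [rewrite in_cons eqxx|exact: above_id].
 exists (Q (pf t)); first by rewrite in_cons mem_seq1 eqxx orbT.
 have cP := contraction_prime pRp; have [icR _ cM] := cP.
 have : contraction R (2%:R * ff * d j) by apply: aR.
 move=> /cM[/cM[|cf]|//]; first by move/(nat_notin (k := 1) cP).
 by rewrite RE; apply: transform_sub => a [c ->]; apply: idealMl.
- by move=> P1 P2; rewrite !in_cons !in_nil !orbF => /orP[]/eqP -> /orP[]/eqP -> // h.
Qed.
Lemma comp_M1 : components (ideal_gen (linear_ideal cid `|` [set lf i1])) [:: linear_ideal c1].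
Proof.
have iM : is_ideal (@linear_ideal C 4 4 c1) by case: (@linear_ideal_prime C 4 4 c1).
apply: componentsI => // [P|R [[iR _ _] _ _] h|P1 P2]; rewrite ?mem_seq1.
- move=> /eqP ->; split.
 by apply: (@proj_linear _ (o4 0)); apply: c1_id; rewrite -val_eqE /= !inordK.
 apply: ideal_gen_sub => // p [|->//]; apply: above_id => //; exact: linear_above.
- exists (linear_ideal c1); first by rewrite mem_seq1.
 apply: c1_min => //; last by apply: (gen_le h); right.
 by move=> a a0; apply: (gen_le h); left; apply/linear_ideal_C.
- by move=> /eqP -> /eqP ->.
Qed.
Lemma comp_M2 : components (ideal_gen (linear_ideal c1 `|` [set lf i0])) [:: linear_ideal c2].
Proof.
have iM : is_ideal (@linear_ideal C 4 4 c2) by case: (@linear_ideal_prime C 4 4 c2).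
have [h0 h1] := c2_l.
apply: componentsI => // [P|R [[iR _ _] _ _] h|P1 P2]; rewrite ?mem_seq1.
- move=> /eqP ->; split.
 by apply: (@proj_linear _ (o4 0)); apply: c2_id; rewrite eqxx.
 apply: ideal_gen_sub => // p [|->//]; apply: c1_min => //; exact: linear_above.
- exists (linear_ideal c2); first by rewrite mem_seq1.
 apply: c2_min => //.
 + by move=> a a0; apply: (gen_le h); left; apply/linear_ideal_C.
 + by apply: (gen_le h); right.
 + by apply: (gen_le h); left; exact: c1_l.
- by move=> /eqP -> /eqP ->.
Qed.
Lemma B_sub (p : set A) : is_ideal p -> Q [set 0] `<=` Q p.
Proof. by move=> ip; apply: transform_sub => _ ->; exact: ideal0. Qed.
Lemma comp_Q1 : components (ideal_gen (Q (pf t) `|` [set lf i1])) [:: Q (p1 t (lv i1))].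
Proof.
have [i ni] := d_notin_p1 pP x_notin_p1.
apply: componentsI => // [P|R pR h|P1 P2]; rewrite ?mem_seq1.
- move=> /eqP ->; split; first exact: (proj_point_transform pP ni).
 apply: ideal_gen_sub; first exact: transform_ideal.
 move=> p [|->]; first exact: (transform_sub pf_p1).
 by apply/(transform_form1 pI (Phi_linear _)); exists 0, 1; rewrite mul0r mul1r add0r.
- exists (Q (p1 t (lv i1))); first by rewrite mem_seq1.
 have [pRp _ _] := pR; have [iR _ _] := pRp.
 have fR : Q (pf t) `<=` R by move=> p Qp; apply: (gen_le h); left.
 have lR : R (lf i1) by apply: (gen_le h); right.
 have BR : Q [set 0] `<=` R by apply: subset_trans fR; apply: B_sub; exact: pf_ideal.
 have [aboveR|[j nj RE]] := fibre_or pR BR.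
 by have [k Vk Rk] := fibre0 pR aboveR fR; exact: (fibre1 Vk).
 have [icR _ _] := contraction_prime pRp.
 rewrite RE; apply: transform_sub => a [b [c ->]]; apply: idealD => //; apply: idealMl => //.
 rewrite -(contraction_transform d icR) -RE; apply: fR; apply/transform_C; first exact: pf_ideal.
 by exists 1; rewrite mul1r.
 by move: lR; rewrite {1}RE => /(transform_form1 icR (Phi_linear _)).
- by move=> /eqP -> /eqP ->.
Qed.
Lemma q_inj i j : q i `<=` q j -> i = j.
Proof.
move=> h; apply/eqP/negPn/negP => /arc_sep[a [ha nb]]; exact/nb/h.
Qed.
Lemma comp_Q2 : components (ideal_gen (Q (p1 t (lv i1)) `|` [set lf i0]))
 [seq Q (q j) | j <- enum 'I_r].
Proof.
have qi j : is_ideal (q j) by case: (kernel_prime j).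
have Qsub i j : Q (q i) `<=` Q (q j) -> i = j.
 move=> h; apply: q_inj => a ha; apply/(transform_C d _ (qi j)); apply: h.
 exact/(transform_C d _ (qi i)).
apply: componentsI.
- by rewrite map_inj_uniq ?enum_uniq// => i j e1; apply: Qsub; rewrite e1.
- move=> P /mapP[j _ ->]; have [i ni] := arc_nz j; split.
 exact: (proj_point_transform (kernel_prime j) ni).
 apply: ideal_gen_sub; first exact: transform_ideal.
 move=> p [|->]; first by apply: transform_sub; exact: (subset_trans p1_I (@I_q j)).
 apply/(transform_form1 (qi j) (Phi_linear _)); apply: arc0.
 by exists 0, 0, 1; rewrite !mul0r mul1r !add0r.
- move=> R pR h; have [pRp _ _] := pR; have [iR _ _] := pRp.
 have fR : Q (p1 t (lv i1)) `<=` R by move=> p Qp; apply: (gen_le h); left.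
 have lR : R (lf i0) by apply: (gen_le h); right.
 have lR1 : R (lf i1).
 apply: fR; apply/(transform_form1 pI (Phi_linear _)).
 by exists 0, 1; rewrite mul0r mul1r add0r.
 have BR : Q [set 0] `<=` R by apply: subset_trans fR; apply: B_sub.
 have [aboveR|[j nj RE]] := fibre_or pR BR.
 have [k Vk Rk] := fibre0 pR aboveR (subset_trans (transform_sub pf_p1) fR).
 have [j Hj] := fibre2 Vk; exists (Q (q j)); first by apply: map_f; rewrite mem_enum.
 exact: Hj.
 have cP := contraction_prime pRp; have [icR _ _] := cP.
 have IR : I `<=` contraction R.
 move=> a [b [c [e' ->]]]; apply: idealD => //; first apply: idealD => //; apply: idealMl => //.
 * rewrite -(contraction_transform d icR) -RE; apply: fR; apply/transform_C => //.
 by exists 1, 0; rewrite mul1r mul0r addr0.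
 * by move: lR1; rewrite {1}RE => /(transform_form1 icR (Phi_linear _)).
 * by move: lR; rewrite {1}RE => /(transform_form1 icR (Phi_linear _)).
 have [k Hk] := arc_comp cP IR (ex_intro2 _ _ (d j) (cst_d j) nj).
 exists (Q (q k)); first by apply: map_f; rewrite mem_enum.
 by rewrite RE; exact: transform_sub.
- by move=> P1 P2 /mapP[i _ ->] /mapP[j _ ->] /Qsub ->.
Qed.
Lemma Le_multiplicity_arcs : (0 < r)%N ->
 Le_multiplicity (k := 1) (germ_of_mpoly (f_family t ^+ 2)) L = (r * e)%N.
Proof.
move=> r0; have [i ni] := d_notin_p1 (pf_prime t) x_notin_pf.
have [k nk] := d_notin_p1 pP x_notin_p1.
have qi j : is_ideal (q j) by case: (kernel_prime j).
have h0 : 2%:R * ff <> 0.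
 move=> /germ_integral[/eqP|f0].
 rewrite -(rmorph_nat (@germC C 4)) -[0](rmorph0 (@germC C 4)) => /eqP/(congr1 (@cst C 4)).
 by rewrite !cstC => /eqP; rewrite pnatr_eq0.
 have [|_ /eqP] := @no_square C t (vx C 3) 1; last by rewrite oner_eq0.
 by rewrite expr1n mul1r addrC.
have bl : blowup_ideal (fun i => 2%:R * ff * d i) = Q [set 0].
 rewrite transform0E; apply/seteqP; split=> P HP; apply/polyP => n;
 move/(congr1 (fun p : {poly A} => p`_n)): HP.
 rewrite -/(Phi (fun i => 2%:R * ff * d i) P) Phi_scale coef0 => /germ_integral[|//].
 by move=> /(germ_pow_neq0 h0).
 by rewrite -/(Phi d P) -/(Phi (fun i => 2%:R * ff * d i) P) Phi_scale coef0 => ->; rewrite mulr0.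
have fE : (fun i => germ_deriv i (germ_of_mpoly (f_family t ^+ 2))) = (fun i => 2%:R * ff * d i).
 by apply/funext => j; rewrite deriv_f2.
have Ecyc : exceptional_cycle (fun i => germ_deriv i (germ_of_mpoly (f_family t ^+ 2))) = scheme_cycle E.
 by rewrite fE /exceptional_cycle bl.
have cyc p : Le_cycle (k := 1) (germ_of_mpoly (f_family t ^+ 2)) L p = (\sum_(j < r) (q j == p))%N.
 rewrite /Le_cycle Ecyc.
 have -> : enum 'I_(4 - 1 - 1) = [:: i0; i1] by rewrite enum_ordSl enum_ordSl /= enum_ord0.
 rewrite /= (@two_hyperplanes _ _ _ _ _ (linear_ideal cid) (linear_ideal c1) (linear_ideal c2)
 (Q (pf t)) (Q (p1 t (lv i1))) [seq Q (q j) | j <- enum 'I_r] p mm) //.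
 - rewrite big_map big_enum; apply: eq_bigr => j _; by rewrite contraction_transform.
 - exact: comp_E.
 - exact: comp_M1.
 - exact: comp_M2.
 - exact: comp_Q1.
 - exact: comp_Q2.
 - apply: (length_exceptional (i := i) (h := ff)) => //; first exact: pf_prime.
 + by exists 1; rewrite mul1r.
 + exact: (nat_notin (k := 1) (pf_prime t)).
 - apply: (length_hyperplane (c := pol i1) (i := k)) => //; first exact: pf_ideal.
 + exact: pf_p1.
 + by exists 0, 1; rewrite mul0r mul1r add0r.
 + exact: Phi_linear.
 + move=> a [b [c ->]]; exists 1; first by case: pP.
 by exists c, b; rewrite mul1r addrK.
 - move=> P /mapP[j _ ->]; have [l nl] := arc_nz j; have [s ns hs] := arc_red j.
 apply: (length_hyperplane (c := pol i0) (i := l)) => //; first exact: kernel_prime.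
 + exact: (subset_trans p1_I (@I_q j)).
 + by apply: arc0; exists 0, 0, 1; rewrite !mul0r mul1r !add0r.
 + exact: Phi_linear.
 + move=> a ha; exists s => //; have [b [c1' [c0 ->]]] := hs a ha.
 by exists c0, b, c1'; rewrite addrK.
 - apply/eqP => e1; apply: x_notin_p1; apply/(transform_C d _ pI); rewrite e1.
 by apply/linear_ideal_C; exact: cst_vx.
 - move=> P /mapP[j _ ->]; rewrite contraction_transform//; apply/eqP => e1.
 have [l nl] := arc_nz j; apply: nl; have : mm (d l) by exact: cst_d.
 by rewrite -e1.
 - exact: contraction_linear.
 - apply: (@proj_degree_linear C 4 4 c2 (o4 0) (o4 1)); first by rewrite -val_eqE /= !inordK.
 + by apply: c2_id; rewrite eqxx.
 + by apply: c2_id; rewrite eqxx orbT.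
 - move=> P /mapP[j _ ->]; have [l nl] := arc_nz j.
 exact: (proj_degree_transform (kernel_prime j) nl).
rewrite /Le_multiplicity (fsbigE [seq q j | j <- enum 'I_r])//=; first last.
- move=> p _ np; rewrite cyc big1 ?muln0// => j _; apply/eqP; rewrite eqb0.
 by apply: contraNneq np => <-; apply: map_f; rewrite mem_enum.
- by rewrite map_inj_uniq ?enum_uniq// => j j' e1; apply: q_inj; rewrite e1.
rewrite (eq_bigl predT) => [|p]; last by rewrite in_setT.
rewrite big_map big_enum (eq_bigr (fun=> e)) => [|j _]; first by rewrite sum_nat_const card_ord.
rewrite arc_hs cyc (bigD1 j)//= eqxx big1 ?addn0 ?muln1// => j' jj; apply/eqP; rewrite eqb0.
by apply: contraNneq jj => e1; apply/eqP/q_inj; rewrite e1.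
Qed.

End Assembly.

End Go.
Import Go.

(** * The polar arcs *)

Module Gp.
Section LinearCoefficients.
Variables (C : numFieldType) (n : nat) (i : 'I_n).
Local Notation A := (holo_germ C n).
Definition lin (a : A) : C := a (mnm1 i).
Lemma linD a b : lin (a + b) = lin a + lin b. Proof. by []. Qed.
Lemma linB a b : lin (a - b) = lin a - lin b. Proof. by []. Qed.
Lemma linM a b : lin (a * b) = cst a * lin b + lin a * cst b. Proof. exact: coef1M. Qed.
Lemma linC c : lin (germC n c) = 0.
Proof. by rewrite /lin gcoefC mnm1_eq0 mulr0. Qed.
Lemma lin_nat k : lin k%:R = 0.
Proof. by rewrite -(rmorph_nat (@germC C n)) linC. Qed.
Lemma linX a k : lin (a ^+ k) = k%:R * cst a ^+ k.-1 * lin a.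
Proof.
elim: k => [|k IH]; first by rewrite expr0 !mul0r (lin_nat 1).
rewrite exprS linM IH cstX; case: k {IH} => [|k]; first by rewrite expr0 !mul0r mulr0 add0r !mulr1 mul1r.
by rewrite -[k.+1.-1]/k -[k.+2.-1]/k.+1 exprS -[k.+2%:R]natr1; ring.
Qed.
Lemma lin_gX j : lin (gX C (mnm1 j)) = (j == i)%:R.
Proof. by rewrite /lin coef_gX eq_mnm1. Qed.
End LinearCoefficients.

Lemma cst_nat (C : numFieldType) n k : cst (k%:R : holo_germ C n) = k%:R.
Proof. exact: rmorph_nat. Qed.
Lemma unitmx2 (C : fieldType) (M : 'M[C]_2) :
 M ord0 ord0 * M (lift ord0 ord0) (lift ord0 ord0) -
 M ord0 (lift ord0 ord0) * M (lift ord0 ord0) ord0 != 0 -> M \in unitmx.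
Proof.
rewrite unitmxE (expand_det_row M ord0) big_ord_recl big_ord1 /cofactor !det_mx11 !mxE /=.
rewrite unitfE /bump /= expr0 mul1r expr1 mulN1r mulrN.
by congr (_ * M _ _ - _ * M _ _ != 0); apply/val_inj.
Qed.

Section Arcs.
Variables (C : numClosedFieldType) (t : C).
Local Notation A := (holo_germ C 4).
Local Notation D := (holo_germ C 1).
Local Notation c1 := (@germC C 1).
Local Notation s := (sv C).
Local Notation x := (vx C 0).
Local Notation y := (vx C 1).
Local Notation z := (vx C 2).
Local Notation w := (vx C 3).

Definition arc4 (a b c e : D) (i : 'I_4) : D := nth 0 [:: a; b; c; e] i.

Section Values.
Variables (a b c e : D).
Hypothesis h0 : forall i, cst (arc4 a b c e i) = 0.
Local Notation ga := (germ_subst h0).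

Lemma arc_vx : [/\ ga x = a, ga y = b, ga z = c & ga w = e].
Proof. by rewrite /vx; split; rewrite germ_substX /arc4 nth4. Qed.
Lemma arc_values : [/\ ga (fx C) = b ^+ 7 + 15%:R * a ^+ 14,
 ga (fy t) = 6%:R * c1 t * (b ^+ 5 * c) + 7%:R * (a * b ^+ 6),
 ga (fz t) = 5%:R * c ^+ 4 + c1 t * b ^+ 6, ga (fw C) = 2%:R * e &
 ga (ff t) = c ^+ 5 + c1 t * (b ^+ 6 * c) + b ^+ 7 * a + a ^+ 15 + e ^+ 2].
Proof.
have [ex ey ez ew] := arc_vx; have et : ga (tt t) = c1 t by exact: germ_substC.
by split; rewrite ?/fx ?/fy ?/fz ?/fw ?/ff ?/fF !(rmorph_nat, rmorphD, rmorphXn, rmorphM) /=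
 ?ex ?ey ?ez ?ew ?et.
Qed.

End Values.

Lemma arc4_cst a b c e : cst a = 0 -> cst b = 0 -> cst c = 0 -> cst e = 0 ->
 forall i, cst (arc4 a b c e i) = 0.
Proof. by move=> ? ? ? ? i; case: (ord4E i) => ->; rewrite /arc4 nth4. Qed.

Definition vec4 (a b c e : C) (i : 'I_4) : C := nth 0 [:: a; b; c; e] i.

Lemma arc_limit4 (X : 'I_4 -> D) (X0 : forall i, cst (X i) = 0) N lam v0 v1 v2 v3 : lam != 0 ->
 dvs N.+1 (germ_subst X0 (fx C) - s ^+ N * c1 (lam * v0)) ->
 dvs N.+1 (germ_subst X0 (fy t) - s ^+ N * c1 (lam * v1)) ->
 dvs N.+1 (germ_subst X0 (fz t) - s ^+ N * c1 (lam * v2)) ->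
 dvs N.+1 (germ_subst X0 (fw C) - s ^+ N * c1 (lam * v3)) ->
 arc_limit (df t) X0 (vec4 v0 v1 v2 v3).
Proof.
by move=> l0 h0 h1 h2 h3; exists N, lam; split=> // i; case: (ord4E i) => ->; rewrite /df /vec4 !nth4.
Qed.

Definition polar_arc (al be al' be' : C) (X : 'I_4 -> D) (X0 : forall i, cst (X i) = 0) :=
 [/\ germ_subst X0 (fz t) = c1 al * germ_subst X0 (fx C) + c1 be * germ_subst X0 (fy t),
 germ_subst X0 (fw C) = c1 al' * germ_subst X0 (fx C) + c1 be' * germ_subst X0 (fy t) &
 germ_subst X0 (ff t) = 0].

Lemma polar_arc_limit al be al' be' X (X0 : forall i, cst (X i) = 0) N lam v0 v1 :
 polar_arc al be al' be' X0 -> lam != 0 ->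
 dvs N.+1 (germ_subst X0 (fx C) - s ^+ N * c1 (lam * v0)) ->
 dvs N.+1 (germ_subst X0 (fy t) - s ^+ N * c1 (lam * v1)) ->
 arc_limit (df t) X0 (vec4 v0 v1 (al * v0 + be * v1) (al' * v0 + be' * v1)).
Proof.
move=> [e2 e3 _] l0 h0 h1; apply: (arc_limit4 l0 h0 h1).
 have -> : germ_subst X0 (fz t) - s ^+ N * c1 (lam * (al * v0 + be * v1)) =
 c1 al * (germ_subst X0 (fx C) - s ^+ N * c1 (lam * v0)) +
 c1 be * (germ_subst X0 (fy t) - s ^+ N * c1 (lam * v1)).
 by rewrite e2 !(rmorphD, rmorphM) /=; ring.
 by apply: dvsD; apply: dvsMr.
have -> : germ_subst X0 (fw C) - s ^+ N * c1 (lam * (al' * v0 + be' * v1)) =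
 c1 al' * (germ_subst X0 (fx C) - s ^+ N * c1 (lam * v0)) +
 c1 be' * (germ_subst X0 (fy t) - s ^+ N * c1 (lam * v1)).
 by rewrite e3 !(rmorphD, rmorphM) /=; ring.
by apply: dvsD; apply: dvsMr.
Qed.

(* the variables of the implicit function theorem *)
Local Notation B := (holo_germ C 3).
Local Notation c3 := (@germC C 3).
Local Notation p0 := (ord0 : 'I_2).
Local Notation p1 := (lift ord0 ord0 : 'I_2).
Definition sB : B := gX C (mnm1 ord0).
Definition uB (u0 : C) : B := c3 u0 + gX C (mnm1 (lift ord0 p0)).
Definition vB (v0 : C) : B := c3 v0 + gX C (mnm1 (lift ord0 p1)).

Lemma solve2 (u0 v0 : C) (G0 G1 : B) : cst G0 = 0 -> cst G1 = 0 ->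
 lin (lift ord0 p0) G0 * lin (lift ord0 p1) G1 -
 lin (lift ord0 p1) G0 * lin (lift ord0 p0) G1 != 0 ->
 exists f : {rmorphism B -> D}, [/\ f sB = s /\ (forall c, f (c3 c) = c1 c),
 f G0 = 0, f G1 = 0, cst (f (uB u0)) = u0 & cst (f (vB v0)) = v0].
Proof.
move=> g0 g1 J; pose g (i : 'I_2) := if i == p0 then G0 else G1.
have [||r [r0 Hr]] := @implicit_functions C 2 g.
- by move=> i; rewrite /g; case: ifP.
- by apply: unitmx2; rewrite !mxE /g /=.
exists (germ_subst (arc_sub0 r0)); split.
- split; last by move=> c; exact: germ_substC.
 by apply: etrans (germ_substX _ _) _; rewrite /arc_sub unlift_none.
- exact: (Hr p0).
- exact: (Hr p1).
- by rewrite cst_subst /uB cstD cstC cst_gX mnm1_eq0 addr0.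
- by rewrite cst_subst /vB cstD cstC cst_gX mnm1_eq0 addr0.
Qed.
Lemma lin_uv (u0 v0 : C) : [/\ lin (lift ord0 p0) (uB u0) = 1, lin (lift ord0 p1) (uB u0) = 0,
 lin (lift ord0 p0) (vB v0) = 0 & lin (lift ord0 p1) (vB v0) = 1].
Proof. by split; rewrite /uB /vB linD linC lin_gX add0r. Qed.
Lemma lin_s j : lin (lift ord0 j) sB = 0. Proof. by rewrite /sB lin_gX. Qed.
Lemma cst_sB : cst sB = 0. Proof. by rewrite cst_gX mnm1_eq0. Qed.
Lemma cst_uB u0 : cst (uB u0) = u0. Proof. by rewrite cstD cstC cst_gX mnm1_eq0 addr0. Qed.
Lemma cst_vB u0 : cst (vB u0) = u0. Proof. by rewrite cstD cstC cst_gX mnm1_eq0 addr0. Qed.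
Lemma dvs_s k l (d : D) : (k <= l)%N -> dvs k (s ^+ l * d).
Proof. by move=> kl; apply: (dvsW kl); exists d. Qed.
Lemma dvs_unit N (d : D) c : cst d = c -> dvs N.+1 (s ^+ N * d - s ^+ N * c1 c).
Proof.
move=> dc; rewrite -mulrBr -addn1; apply: dvsM; first by exists 1; rewrite mulr1.
by apply/dvs_cst; rewrite cstB cstC dc subrr.
Qed.
Lemma half2 : c1 2%:R^-1 * 2%:R = 1.
Proof. by rewrite -(rmorph_nat (@germC C 1)) -rmorphM mulVf ?rmorph1// pnatr_eq0. Qed.
Lemma sn (k : nat) (d : D) : cst (s ^+ k.+1 * d) = 0.
Proof. by rewrite exprS -mulrA cstM cst_sv mul0r. Qed.

(** The polar arcs for t <> 0, through the 30 solutions (Y0, Z0). *)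
Lemma arc_generic al be al' be' Y0 Z0 :
 5%:R * Z0 ^+ 4 + t * Y0 ^+ 6 = 0 -> Z0 ^+ 5 + t * Y0 ^+ 6 * Z0 + Y0 ^+ 7 + 1 = 0 ->
 Z0 != 0 -> Y0 != 0 -> 6%:R * t * Z0 + 7%:R * Y0 != 0 ->
 exists Y Z e (X0 : forall i, cst (arc4 s (s ^+ 2 * Y) (s ^+ 3 * Z) e i) = 0),
 [/\ cst Y = Y0, cst Z = Z0, polar_arc al be al' be' X0 &
 arc_limit (df t) X0 (vec4 0 1 be be')].
Proof.
move=> E0 E1 Z00 Y00 nz.
have [Y YE] : exists Y, Y = uB Y0 by eexists.
have [Z ZE] : exists Z, Z = vB Z0 by eexists.
have [h2 h2E] : exists h, h = c1 2%:R^-1 by eexists.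
have h22 : h2 * 2%:R = 1 by rewrite h2E half2.
have [PX PXE] : exists P, P = Y ^+ 7 + 15%:R :> B by eexists.
have [PY PYE] : exists P, P = 6%:R * c3 t * (Y ^+ 5 * Z) + 7%:R * Y ^+ 6 :> B by eexists.
pose G0 : B := 5%:R * Z ^+ 4 + c3 t * Y ^+ 6 - sB * (c3 al * sB * PX + c3 be * PY).
pose G1 : B := Z ^+ 5 + c3 t * Y ^+ 6 * Z + Y ^+ 7 + 1 +
 sB * (sB ^+ 10 * c3 4%:R^-1 * (c3 al' * sB * PX + c3 be' * PY) ^+ 2).
have [lu0 lu1 lv0 lv1] := lin_uv Y0 Z0.
have linE := (linB, linD, linM, linX, linC, lin_nat, lin_s, lu0, lu1, lv0, lv1, cst_sB, cst_nat, cstC, cstD, cstM, cstX, cst_uB, cst_vB).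
have [|||f [[fs fc] f0 f1 fY fZ]] := @solve2 Y0 Z0 G0 G1.
- by rewrite /G0 cstB cstM cst_sB mul0r subr0 ?PYE ?PXE ?YE ?ZE !(cstD, cstM, cstX, cst_nat, cstC, cst_uB, cst_vB).
- by rewrite /G1 cstD [cst (sB * _)]cstM cst_sB mul0r addr0 ?YE ?ZE !(cstD, cstM, cstX, cst_nat, cstC, cst_uB, cst_vB, cst1).
- have -> : lin (lift ord0 p0) G0 = 6%:R * t * Y0 ^+ 5.
 rewrite /G0 linB [lin _ (sB * _)]linM cst_sB lin_s !mul0r addr0 subr0 ?PYE ?PXE ?YE ?ZE.
 by rewrite !linE; ring.
 have -> : lin (lift ord0 p1) G0 = 20%:R * Z0 ^+ 3.
 rewrite /G0 linB [lin _ (sB * _)]linM cst_sB lin_s !mul0r addr0 subr0 ?PYE ?PXE ?YE ?ZE.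
 by rewrite !linE; ring.
 have -> : lin (lift ord0 p0) G1 = Y0 ^+ 5 * Y0 ^+ 0 * (6%:R * t * Z0 + 7%:R * Y0).
 rewrite /G1 linD [lin _ (sB * _)]linM cst_sB lin_s !mul0r addr0 addr0 ?YE ?ZE.
 by rewrite !linE /=; ring.
 have -> : lin (lift ord0 p1) G1 = 0.
 rewrite -E0 /G1 linD [lin _ (sB * _)]linM cst_sB lin_s !mul0r addr0 addr0 ?YE ?ZE.
 by rewrite !linE /=; ring.
 by rewrite mulr0 sub0r oppr_eq0 expr0 mulr1 !mulf_neq0 ?expf_neq0// pnatr_eq0.
pose y' := f Y; pose z' := f Z.
have fPX : f PX = y' ^+ 7 + 15%:R by rewrite PXE rmorphD rmorphXn rmorph_nat.
have fPY : f PY = 6%:R * c1 t * (y' ^+ 5 * z') + 7%:R * y' ^+ 6.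
 by rewrite PYE !(rmorph_nat, rmorphD, rmorphXn, rmorphM) /= fc.
have e0 : 5%:R * z' ^+ 4 + c1 t * y' ^+ 6 = s * (c1 al * s * f PX + c1 be * f PY).
 apply/eqP; rewrite -subr_eq0; apply/eqP; rewrite -[RHS]f0 /G0.
 by rewrite !(rmorph_nat, rmorphB, rmorphD, rmorphXn, rmorphM) /= !fc fs.
have e1 : z' ^+ 5 + c1 t * y' ^+ 6 * z' + y' ^+ 7 + 1 +
 s * (s ^+ 10 * c1 4%:R^-1 * (c1 al' * s * f PX + c1 be' * f PY) ^+ 2) = 0.
 by rewrite -f1 /G1 !(rmorph_nat, rmorphB, rmorphD, rmorphXn, rmorph1, rmorphM) /= !fc fs.
pose e := h2 * (c1 al' * (s ^+ 14 * f PX) + c1 be' * (s ^+ 13 * f PY)).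
exists y', z', e.
rewrite -YE in fY; rewrite -ZE in fZ.
have ce : cst e = 0 by rewrite /e cstM cstD [cst (_ * (_ * _))]cstM [cst (c1 be' * _)]cstM !sn !mulr0 addr0 mulr0.
exists (arc4_cst (cst_sv C) (sn 1 y') (sn 2 z') ce).
have [vfx vfy vfz vfw vff] := arc_values (arc4_cst (cst_sv C) (sn 1 y') (sn 2 z') ce).
have vx' : germ_subst (arc4_cst (cst_sv C) (sn 1 y') (sn 2 z') ce) (fx C) = s ^+ 14 * f PX.
 by rewrite vfx fPX; ring.
have vy' : germ_subst (arc4_cst (cst_sv C) (sn 1 y') (sn 2 z') ce) (fy t) = s ^+ 13 * f PY.
 by rewrite vfy fPY; ring.
have pa : polar_arc al be al' be' (arc4_cst (cst_sv C) (sn 1 y') (sn 2 z') ce).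
 split; rewrite ?vx' ?vy'.
 - rewrite vfz (_ : _ + _ = s ^+ 12 * (5%:R * z' ^+ 4 + c1 t * y' ^+ 6)); last by ring.
 by rewrite e0; ring.
 - by rewrite vfw /e; move: (s ^+ 14) (s ^+ 13) => ? ?; rewrite [in LHS]mulrA [_ * h2]mulrC h22 mul1r.
 rewrite vff /e; rewrite (_ : c1 4%:R^-1 = h2 ^+ 2) in e1; last by rewrite h2E -rmorphXn exprVn -natrX.
 rewrite -[RHS](mulr0 (s ^+ 15)) -e1; ring.
split=> //.
have -> : vec4 0 1 be be' = vec4 0 1 (al * 0 + be * 1) (al' * 0 + be' * 1) by rewrite !mulr0 !mulr1 !add0r.
have lamE : cst (f PY) = Y0 ^+ 5 * (6%:R * t * Z0 + 7%:R * Y0).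
 by rewrite fPY !(cstD, cstM, cstX, cst_nat, cstC) fY fZ; ring.
apply: (polar_arc_limit (N := 13) (lam := Y0 ^+ 5 * (6%:R * t * Z0 + 7%:R * Y0)) pa).
- by rewrite mulf_neq0// expf_neq0.
- by rewrite mulr0 rmorph0 mulr0 subr0 vx'; apply: dvs_s.
- by rewrite vy' mulr1; apply: dvs_unit.
Qed.

(** The explicit arcs showing that the blowup has a fibre of full dimension. *)
Lemma arc_dense (v : 'I_4 -> C) (c0 : C) : t = - 5%:R * c0 ^+ 4 -> c0 != 0 ->
 1 + 15%:R * (30%:R / 7%:R * c0 ^+ 5) ^+ 14 != 0 -> v (o4 0) = 1 ->
 exists X (X0 : forall i, cst (X i) = 0), arc_limit (df t) X0 v.
Proof.
move=> tE c00 nz v0; pose al := 30%:R / 7%:R * c0 ^+ 5; pose lam := 1 + 15%:R * al ^+ 14.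
pose be := lam * v (o4 1) / 7%:R; pose k := lam * v (o4 2) / (20%:R * c0 ^+ 4).
pose de := lam * v (o4 3) / 2%:R.
pose a := s ^+ 1 * (c1 al * (1 + c1 k * s ^+ 2) + c1 be * s).
pose b := s ^+ 2 * 1; pose c := s ^+ 3 * (c1 c0 * (1 + c1 k * s ^+ 2)); pose e := s ^+ 14 * c1 de.
pose X0 := arc4_cst (sn 0 _ : cst a = 0) (sn 1 _ : cst b = 0) (sn 2 _ : cst c = 0) (sn 13 _ : cst e = 0).
exists (arc4 a b c e), X0.
have -> : v = vec4 1 (v (o4 1)) (v (o4 2)) (v (o4 3)).
 by apply/funext => i; case: (ord4E i) => ->; rewrite /vec4 nth4.
have [vfx vfy vfz vfw _] := arc_values X0.
have n7 : 7%:R != 0 :> C by rewrite pnatr_eq0.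
have n2 : 2%:R != 0 :> C by rewrite pnatr_eq0.
have n20 : 20%:R != 0 :> C by rewrite pnatr_eq0.
have cnat m : c1 m%:R = m%:R by exact: rmorph_nat.
have tE1 : c1 t = - 5%:R * c1 c0 ^+ 4 by rewrite tE rmorphM rmorphN rmorphXn rmorph_nat.
apply: (arc_limit4 (N := 14) (lam := lam)) => //.
- rewrite vfx mulr1 (_ : _ + _ = s ^+ 14 * (1 + 15%:R * (c1 al * (1 + c1 k * s ^+ 2) + c1 be * s) ^+ 14)); last by rewrite /a /b; ring.
 apply: dvs_unit; rewrite !(cstD, cstM, cstX, cst_nat, cstC, cst1, cst_sv) expr0n /=.
 by rewrite !mulr0 !addr0 mulr1.
- have E : 7%:R * be = lam * v (o4 1) by rewrite /be; field.
 have E2 : 7%:R * c1 al = 30%:R * c1 c0 ^+ 5.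
 by rewrite -!cnat -rmorphXn -!rmorphM; congr c1; rewrite /al; field.
 rewrite vfy -E rmorphM rmorph_nat tE1 (_ : _ - _ = 0); first exact: dvs0.
 rewrite /a /b /c (_ : _ - _ = s ^+ 13 * (1 + c1 k * s ^+ 2) * (7%:R * c1 al - 30%:R * c1 c0 ^+ 5)); last by ring.
 by rewrite E2 subrr mulr0.
- have E : 20%:R * c0 ^+ 4 * k = lam * v (o4 2) by rewrite /k; field; rewrite c00.
 have E3 : c1 (lam * v (o4 2)) = 20%:R * c1 c0 ^+ 4 * c1 k by rewrite -E !(rmorph_nat, rmorphXn, rmorphM).
 rewrite vfz E3 tE1.
 rewrite (_ : _ - _ = s ^+ 16 * (5%:R * c1 c0 ^+ 4 * (6%:R * c1 k ^+ 2 + 4%:R * c1 k ^+ 3 * s ^+ 2 + c1 k ^+ 4 * s ^+ 4))); last by rewrite /b /c; ring.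
 exact: dvs_s.
- have E : 2%:R * de = lam * v (o4 3) by rewrite /de; field.
 by rewrite vfw -E rmorphM rmorph_nat /e (_ : _ - _ = 0); [exact: dvs0|ring].
Qed.
Lemma arc_dense0 (v : 'I_4 -> C) : t = 0 -> v (o4 0) = 1 ->
 exists X (X0 : forall i, cst (X i) = 0), arc_limit (df t) X0 v.
Proof.
move=> t0 v0; pose al := v (o4 1) / 7%:R; pose c0 := 4.-root (v (o4 2) / 5%:R).
pose de := v (o4 3) / 2%:R.
pose a := s ^+ 4 * c1 al; pose b := s ^+ 4 * 1; pose c := s ^+ 7 * c1 c0; pose e := s ^+ 28 * c1 de.
pose X0 := arc4_cst (sn 3 _ : cst a = 0) (sn 3 _ : cst b = 0) (sn 6 _ : cst c = 0) (sn 27 _ : cst e = 0).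
exists (arc4 a b c e), X0.
have -> : v = vec4 1 (v (o4 1)) (v (o4 2)) (v (o4 3)).
 by apply/funext => i; case: (ord4E i) => ->; rewrite /vec4 nth4.
have [vfx vfy vfz vfw _] := arc_values X0.
have n7 : 7%:R != 0 :> C by rewrite pnatr_eq0.
have n2 : 2%:R != 0 :> C by rewrite pnatr_eq0.
have n5 : 5%:R != 0 :> C by rewrite pnatr_eq0.
have cnat m : c1 m%:R = m%:R by exact: rmorph_nat.
have tE1 : c1 t = 0 by rewrite t0 rmorph0.
apply: (arc_limit4 (N := 28) (lam := 1)); rewrite ?oner_neq0// ?mul1r.
- rewrite vfx rmorph1 (_ : _ - _ = s ^+ 56 * (15%:R * c1 al ^+ 14)); last by rewrite /a /b; ring.
 exact: dvs_s.
- have E : 7%:R * al = v (o4 1) by rewrite /al; field.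
 by rewrite vfy -E rmorphM rmorph_nat tE1 /a /b (_ : _ - _ = 0); [exact: dvs0|ring].
- have E : 5%:R * c0 ^+ 4 = v (o4 2) by rewrite /c0 rootCK//; field.
 have E3 : c1 (v (o4 2)) = 5%:R * c1 c0 ^+ 4 by rewrite -E !(rmorph_nat, rmorphXn, rmorphM).
 by rewrite vfz E3 tE1 /b /c (_ : _ - _ = 0); [exact: dvs0|ring].
- have E : 2%:R * de = v (o4 3) by rewrite /de; field.
 by rewrite vfw -E rmorphM rmorph_nat /e (_ : _ - _ = 0); [exact: dvs0|ring].
Qed.

(** The polar arcs for t = 0 tangent to the curves y = w x^2 with w^7 = -1. *)
Lemma arc_special2 al be al' be' Y0 Z0 : t = 0 -> Y0 ^+ 7 = -1 ->
 5%:R * Z0 ^+ 4 = 7%:R * be * Y0 ^+ 6 -> Z0 != 0 ->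
 exists Y Z e (X0 : forall i, cst (arc4 (s ^+ 4) (s ^+ 8 * Y) (s ^+ 13 * Z) e i) = 0),
 [/\ cst Y = Y0, cst Z = Z0, polar_arc al be al' be' X0, dvs 52 e &
 arc_limit (df t) X0 (vec4 0 1 be be')].
Proof.
move=> t0 E1 E0 Z00.
have Y00 : Y0 != 0.
 by apply/eqP => Y00; move: E1 => /eqP; rewrite Y00 expr0n eq_sym oppr_eq0 oner_eq0.
have [Y YE] : exists Y, Y = uB Y0 by eexists.
have [Z ZE] : exists Z, Z = vB Z0 by eexists.
have [h2 h2E] : exists h, h = c1 2%:R^-1 by eexists.
have h22 : h2 * 2%:R = 1 by rewrite h2E half2.
have [PX PXE] : exists P, P = Y ^+ 7 + 15%:R :> B by eexists.
have [PY PYE] : exists P, P = 7%:R * Y ^+ 6 :> B by eexists.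
pose G0 : B := 5%:R * Z ^+ 4 - c3 be * PY - sB * (sB ^+ 3 * c3 al * PX).
pose G1 : B := Y ^+ 7 + 1 +
 sB * (sB ^+ 4 * Z ^+ 5 + sB ^+ 43 * c3 4%:R^-1 * (c3 al' * sB ^+ 4 * PX + c3 be' * PY) ^+ 2).
have [lu0 lu1 lv0 lv1] := lin_uv Y0 Z0.
have linE := (linB, linD, linM, linX, linC, lin_nat, lin_s, lu0, lu1, lv0, lv1, cst_sB, cst_nat, cstC, cstD, cstM, cstX, cst_uB, cst_vB).
have [|||f [[fs fc] f0 f1 fY fZ]] := @solve2 Y0 Z0 G0 G1.
- rewrite /G0 cstB [cst (sB * _)]cstM cst_sB mul0r subr0 cstB ?PYE ?YE ?ZE !(cstD, cstM, cstX, cst_nat, cstC, cst_uB, cst_vB).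
 by rewrite E0; ring.
- rewrite /G1 cstD [cst (sB * _)]cstM cst_sB mul0r addr0 ?YE ?ZE !(cstD, cstM, cstX, cst_nat, cstC, cst_uB, cst_vB, cst1).
 by rewrite E1 addNr.
- have -> : lin (lift ord0 p1) G0 = 20%:R * Z0 ^+ 3.
 rewrite /G0 linB [lin _ (sB * _)]linM cst_sB lin_s !mul0r addr0 subr0 PYE YE ZE.
 by rewrite !linE /=; ring.
 have -> : lin (lift ord0 p0) G1 = 7%:R * Y0 ^+ 6.
 rewrite /G1 linD [lin _ (sB * _)]linM cst_sB lin_s !mul0r addr0 addr0 ?YE ?ZE.
 by rewrite !linE /=; ring.
 have -> : lin (lift ord0 p1) G1 = 0.
 rewrite /G1 linD [lin _ (sB * _)]linM cst_sB lin_s !mul0r addr0 addr0 ?YE ?ZE.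
 by rewrite !linE /=; ring.
 by rewrite mulr0 sub0r oppr_eq0 !mulf_neq0 ?expf_neq0// pnatr_eq0.
pose y' := f Y; pose z' := f Z.
have fPX : f PX = y' ^+ 7 + 15%:R by rewrite PXE rmorphD rmorphXn rmorph_nat.
have fPY : f PY = 7%:R * y' ^+ 6 by rewrite PYE rmorphM rmorphXn rmorph_nat.
have e0 : 5%:R * z' ^+ 4 = c1 be * f PY + s * (s ^+ 3 * c1 al * f PX).
 apply/eqP; rewrite -subr_eq0 opprD addrA; apply/eqP; rewrite -[RHS]f0 /G0.
 by rewrite !(rmorph_nat, rmorphB, rmorphD, rmorphXn, rmorphM) /= !fc fs.
have e1 : y' ^+ 7 + 1 +
 s * (s ^+ 4 * z' ^+ 5 + s ^+ 43 * c1 4%:R^-1 * (c1 al' * s ^+ 4 * f PX + c1 be' * f PY) ^+ 2) = 0.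
 by rewrite -f1 /G1 !(rmorph_nat, rmorphB, rmorphD, rmorphXn, rmorph1, rmorphM) /= !fc fs.
pose e := s ^+ 52 * (h2 * (c1 al' * (s ^+ 4 * f PX) + c1 be' * f PY)).
exists y', z', e.
rewrite -?YE in fY; rewrite -?ZE in fZ.
pose X0 := arc4_cst (etrans (congr1 (@cst C 1) (esym (mulr1 (s ^+ 4)))) (sn 3 1)) (sn 7 y') (sn 12 z') (sn 51 _ : cst e = 0).
exists X0.
have [vfx vfy vfz vfw vff] := arc_values X0.
have tE1 : c1 t = 0 by rewrite t0 rmorph0.
have vx' : germ_subst X0 (fx C) = s ^+ 56 * f PX by rewrite vfx fPX; ring.
have vy' : germ_subst X0 (fy t) = s ^+ 52 * f PY by rewrite vfy fPY tE1; ring.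
have pa : polar_arc al be al' be' X0.
 split; rewrite ?vx' ?vy'.
 - rewrite vfz tE1 (_ : _ + _ = s ^+ 52 * (5%:R * z' ^+ 4)); last by ring.
 by rewrite e0; ring.
 - rewrite vfw /e mulrCA [2%:R * _]mulrA [_ * h2]mulrC h22 mul1r; ring.
 rewrite vff /e tE1 mul0r addr0; rewrite (_ : c1 4%:R^-1 = h2 ^+ 2) in e1; last by rewrite h2E -rmorphXn exprVn -natrX.
 rewrite -[RHS](mulr0 (s ^+ 60)) -e1; ring.
split=> //; first exact: dvs_s.
have -> : vec4 0 1 be be' = vec4 0 1 (al * 0 + be * 1) (al' * 0 + be' * 1) by rewrite !mulr0 !mulr1 !add0r.
have lamE : cst (f PY) = 7%:R * Y0 ^+ 6 by rewrite fPY !(cstM, cstX, cst_nat) fY.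
apply: (polar_arc_limit (N := 52) (lam := 7%:R * Y0 ^+ 6) pa).
- by rewrite mulf_neq0 ?expf_neq0// pnatr_eq0.
- by rewrite mulr0 rmorph0 mulr0 subr0 vx'; apply: dvs_s.
- by rewrite vy' mulr1; apply: dvs_unit.
Qed.

(** The last polar arc for t = 0. *)
Lemma arc_special1 al be al' be' Z0 : t = 0 -> 5%:R * Z0 ^+ 4 = al -> Z0 != 0 ->
 exists X Z e (X0 : forall i, cst (arc4 (s ^+ 7 * X) (s ^+ 4) (s ^+ 7 * Z) e i) = 0),
 [/\ cst X = - Z0 ^+ 5, cst Z = Z0, polar_arc al be al' be' X0, dvs 28 e &
 arc_limit (df t) X0 (vec4 1 0 al al')].
Proof.
move=> t0 E0 Z00; pose Y0 := - Z0 ^+ 5.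
have [Y YE] : exists Y, Y = uB Y0 by eexists.
have [Z ZE] : exists Z, Z = vB Z0 by eexists.
have [h2 h2E] : exists h, h = c1 2%:R^-1 by eexists.
have h22 : h2 * 2%:R = 1 by rewrite h2E half2.
have [PX PXE] : exists P, P = 1 + sB * (15%:R * sB ^+ 69 * Y ^+ 14) :> B by eexists.
pose G0 : B := 5%:R * Z ^+ 4 - c3 al - sB * (c3 al * (15%:R * sB ^+ 69 * Y ^+ 14) + c3 be * (7%:R * sB ^+ 2 * Y)).
pose G1 : B := Z ^+ 5 + Y +
 sB * (sB ^+ 69 * Y ^+ 15 + sB ^+ 20 * c3 4%:R^-1 * (c3 al' * PX + c3 be' * (7%:R * sB ^+ 3 * Y)) ^+ 2).
have [lu0 lu1 lv0 lv1] := lin_uv Y0 Z0.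
have linE := (linB, linD, linM, linX, linC, lin_nat, lin_s, lu0, lu1, lv0, lv1, cst_sB, cst_nat, cstC, cstD, cstM, cstX, cst_uB, cst_vB).
have [|||f [[fs fc] f0 f1 fY fZ]] := @solve2 Y0 Z0 G0 G1.
- rewrite /G0 cstB [cst (sB * _)]cstM cst_sB mul0r subr0 cstB ?PYE ?YE ?ZE !(cstD, cstM, cstX, cst_nat, cstC, cst_uB, cst_vB).
 by rewrite E0 subrr.
- rewrite /G1 cstD [cst (sB * _)]cstM cst_sB mul0r addr0 ?YE ?ZE !(cstD, cstM, cstX, cst_nat, cstC, cst_uB, cst_vB, cst1).
 by rewrite /Y0 subrr.
- have -> : lin (lift ord0 p0) G0 = 0.
 rewrite /G0 linB [lin _ (sB * _)]linM cst_sB lin_s !mul0r addr0 subr0 ?PYE ?PXE ?YE ?ZE.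
 by rewrite !linE /=; ring.
 have -> : lin (lift ord0 p1) G0 = 20%:R * Z0 ^+ 3.
 rewrite /G0 linB [lin _ (sB * _)]linM cst_sB lin_s !mul0r addr0 subr0 ?PYE ?PXE ?YE ?ZE.
 by rewrite !linE /=; ring.
 have -> : lin (lift ord0 p0) G1 = 1.
 rewrite /G1 linD [lin _ (sB * _)]linM cst_sB lin_s !mul0r addr0 addr0 ?YE ?ZE.
 by rewrite !linE /=; ring.
 by rewrite mul0r sub0r oppr_eq0 mulr1 !mulf_neq0 ?expf_neq0// pnatr_eq0.
pose y' := f Y; pose z' := f Z.
have fPX : f PX = 1 + s * (15%:R * s ^+ 69 * y' ^+ 14).
 by rewrite PXE !(rmorph_nat, rmorphD, rmorphXn, rmorph1, rmorphM) /= fs.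
have e0 : 5%:R * z' ^+ 4 = c1 al + s * (c1 al * (15%:R * s ^+ 69 * y' ^+ 14) + c1 be * (7%:R * s ^+ 2 * y')).
 apply/eqP; rewrite -subr_eq0 opprD addrA; apply/eqP; rewrite -[RHS]f0 /G0.
 by rewrite !(rmorph_nat, rmorphB, rmorphD, rmorphXn, rmorphM) /= !fc fs.
have e1 : z' ^+ 5 + y' +
 s * (s ^+ 69 * y' ^+ 15 + s ^+ 20 * c1 4%:R^-1 * (c1 al' * f PX + c1 be' * (7%:R * s ^+ 3 * y')) ^+ 2) = 0.
 by rewrite -f1 /G1 !(rmorph_nat, rmorphB, rmorphD, rmorphXn, rmorph1, rmorphM) /= !fc fs fPX.
pose e := s ^+ 28 * (h2 * (c1 al' * f PX + c1 be' * (7%:R * s ^+ 3 * y'))).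
exists y', z', e.
rewrite -?YE in fY; rewrite -?ZE in fZ.
pose X0 := arc4_cst (sn 6 y') (etrans (congr1 (@cst C 1) (esym (mulr1 (s ^+ 4)))) (sn 3 1)) (sn 6 z') (sn 27 _ : cst e = 0).
exists X0.
have [vfx vfy vfz vfw vff] := arc_values X0.
have tE1 : c1 t = 0 by rewrite t0 rmorph0.
have vx' : germ_subst X0 (fx C) = s ^+ 28 * f PX by rewrite vfx fPX; ring.
have vy' : germ_subst X0 (fy t) = s ^+ 31 * (7%:R * y') by rewrite vfy tE1; ring.
have pa : polar_arc al be al' be' X0.
 split; rewrite ?vx' ?vy'.
 - rewrite vfz tE1 (_ : _ + _ = s ^+ 28 * (5%:R * z' ^+ 4)); last by ring.
 by rewrite e0 fPX; ring.
 - rewrite vfw /e mulrCA [2%:R * _]mulrA [_ * h2]mulrC h22 mul1r; ring.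
 rewrite vff /e tE1 mul0r addr0; rewrite (_ : c1 4%:R^-1 = h2 ^+ 2) in e1; last by rewrite h2E -rmorphXn exprVn -natrX.
 rewrite -[RHS](mulr0 (s ^+ 35)) -e1; ring.
split=> //; first exact: dvs_s.
have -> : vec4 1 0 al al' = vec4 1 0 (al * 1 + be * 0) (al' * 1 + be' * 0) by rewrite !mulr0 !mulr1 !addr0.
apply: (polar_arc_limit (N := 28) (lam := 1) pa); first exact: oner_neq0.
- rewrite vx'; apply: dvs_unit; rewrite fPX cstD cst1 cstM cst_sv mul0r addr0 mulr1//.
- by rewrite mulr0 rmorph0 mulr0 subr0 vy'; apply: dvs_s.
Qed.

End Arcs.

End Gp.
Import Gp.

(** * Sections by two general hyperplanes *)

Module Gq.
Local Notation contraction := Defs.contraction.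

Lemma eq_o4 a b : (a < 4)%N -> (b < 4)%N -> (o4 a == o4 b) = (a == b).
Proof. by move=> a4 b4; rewrite -val_eqE /= !inordK. Qed.

Section LinearForms.
Variable C : numClosedFieldType.
Local Notation S := {mpoly (holo_germ C 4)[4]}.
Local Notation y i := (mpolyX (holo_germ C 4) (mnm1 i) : S).
Local Notation K c := (mpolyC 4 (c : holo_germ C 4) : S).

Definition lform (v : 'I_4 -> C) : S := \sum_j K (germC 4 (v j)) * y j.

Lemma lform_comb a b c u v w : lform (fun j => a * u j + b * v j + c * w j) =
 K (germC 4 a) * lform u + K (germC 4 b) * lform v + K (germC 4 c) * lform w.
Proof.
rewrite /lform !mulr_sumr -!big_split; apply: eq_bigr => j _ /=.
have M (p q : C) : K (germC 4 (p * q)) = K (germC 4 p) * K (germC 4 q) by rewrite !rmorphM.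
have Dd (p q : C) : K (germC 4 (p + q)) = K (germC 4 p) + K (germC 4 q) by rewrite !rmorphD.
by rewrite !Dd !M !mulrDl !mulrA.
Qed.
Lemma lform_delta i : lform (fun j => (j == i)%:R) = y i.
Proof.
rewrite /lform (bigD1 i)//= eqxx !rmorph1 mul1r big1 ?addr0// => j /negbTE ->.
by rewrite !rmorph0 mul0r.
Qed.
Lemma linear_ideal_span (c : 'I_4 -> 'I_4 -> C) (R : set S) g0 g1 g2 : is_ideal R -> above R ->
 R (lform g0) -> R (lform g1) -> R (lform g2) ->
 (forall i, exists a b d, forall j, (j == i)%:R - c i j = a * g0 j + b * g1 j + d * g2 j) ->
 linear_ideal c `<=` R.
Proof.
move=> iR ab h0 h1 h2 H; apply: linear_ideal_min => // i; have [a [b [d E]]] := H i.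
have -> : y i - \sum_j K (germC 4 (c i j)) * y j = lform (fun j => a * g0 j + b * g1 j + d * g2 j).
 rewrite -(lform_delta i) /lform -sumrB; apply: eq_bigr => j _.
 by rewrite -E -mulrBl !rmorphB.
rewrite lform_comb; apply: (idealD iR); last exact: (idealMl _ iR).
by apply: (idealD iR); exact: (idealMl _ iR).
Qed.
Lemma linear_ideal_lform (c : 'I_4 -> 'I_4 -> C) v :
 (forall j', \sum_j v j * c j j' = 0) -> linear_ideal c (lform v).
Proof.
move=> H; rewrite /linear_ideal /= /lform theta_sum.
rewrite (eq_bigr (fun j => \sum_j' (v j * c j j') *: mpolyX C (mnm1 j'))).
 by rewrite exchange_big big1 // => j' _; rewrite -scaler_suml H scale0r.
move=> j _; rewrite thetaM thetaC cstC thetaX mul_mpolyC scaler_sumr.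
by apply: eq_bigr => j' _; rewrite scalerA.
Qed.
Lemma polar_comb (t : C) a b u v : germC 4 a * polar t u + germC 4 b * polar t v =
 polar t (fun j => a * u j + b * v j).
Proof.
rewrite /polar !mulr_sumr -big_split; apply: eq_bigr => j _ /=.
by rewrite rmorphD !rmorphM mulrDl !mulrA.
Qed.

End LinearForms.

Section Slices.
Variables (C : numClosedFieldType) (t : C) (L : 'M[C]_(2, 4)).
Local Notation A := (holo_germ C 4).
Local Notation D := (holo_germ C 1).
Local Notation S := {mpoly A[4]}.
Local Notation y i := (mpolyX A (mnm1 i) : S).
Local Notation K c := (mpolyC 4 c : S).
Local Notation d := (df t).
Local Notation ff := (ff t).
Local Notation Q := (transform d).
Local Notation i0 := (ord0 : 'I_2).
Local Notation i1 := (lift ord0 ord0 : 'I_2).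
Local Notation lv k := (fun j : 'I_4 => L k j).
Local Notation lf k := (linear_form (row k L) : S).
Local Notation pol k := (polar t (lv k)).

Definition minor k := L i0 (o4 k) * L i1 (o4 3) - L i0 (o4 3) * L i1 (o4 k).
(** On the line cut out by the two forms the last two coordinates are
 sz 0 y1 + sz 1 y2 and sw 0 y1 + sw 1 y2. *)
Definition sz k := - minor k / minor 2.
Definition sw k := - (L i1 (o4 k) + L i1 (o4 2) * sz k) / L i1 (o4 3).

Hypothesis L13 : L i1 (o4 3) != 0.
Hypothesis M2 : minor 2 != 0.
Let nM := M2.

Lemma slopes k : L i1 (o4 k) + L i1 (o4 2) * sz k + L i1 (o4 3) * sw k = 0 /\
 L i0 (o4 k) + L i0 (o4 2) * sz k + L i0 (o4 3) * sw k = 0.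
Proof.
move: nM; rewrite /sw /sz /minor => n; split; first by field; rewrite L13 n.
by field; rewrite L13 n.
Qed.

Definition slice1 (i j : 'I_4) : C :=
 if i == o4 3 then vec4 (- L i1 (o4 0) / L i1 (o4 3)) (- L i1 (o4 1) / L i1 (o4 3))
 (- L i1 (o4 2) / L i1 (o4 3)) 0 j else (j == i)%:R.
Definition slice2 (i j : 'I_4) : C :=
 if i == o4 3 then vec4 (sw 0) (sw 1) 0 0 j else
 if i == o4 2 then vec4 (sz 0) (sz 1) 0 0 j else (j == i)%:R.

Lemma lf_lform k : lf k = lform (lv k). Proof. exact: linear_formE. Qed.

Ltac ord4 i := case: (ord4E i) => -> ; rewrite ?eq_o4 //= /vec4 ?nth4 //=.

Lemma slice1_min R : is_ideal R -> above R -> R (lf i1) -> linear_ideal slice1 `<=` R.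
Proof.
move=> iR ab h; rewrite lf_lform in h; apply: (linear_ideal_span iR ab h h h) => i.
rewrite /slice1; have [->|_] := eqVneq i (o4 3); last by exists 0, 0, 0 => j; rewrite subrr; ring.
by exists (L i1 (o4 3))^-1, 0, 0 => j; ord4 j; field.
Qed.
Lemma slice1_l : linear_ideal slice1 (lf i1).
Proof.
rewrite lf_lform; apply: linear_ideal_lform => j; rewrite big4 /slice1 !eq_o4 //=.
by ord4 j; field.
Qed.

(* y3 - sz 0 y1 - sz 1 y2 and y4 - sw 0 y1 - sw 1 y2 as combinations of the rows *)
Lemma minorE j : (L i1 (o4 3) / minor 2) * L i0 j + (- L i0 (o4 3) / minor 2) * L i1 j =
 vec4 (- sz 0) (- sz 1) 1 0 j.
Proof.
by move: nM; rewrite /sz => n; ord4 j; move: n; rewrite /minor => n; field.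
Qed.
Lemma minorE' j : (- L i1 (o4 2) / minor 2) * L i0 j + (L i0 (o4 2) / minor 2) * L i1 j =
 vec4 (- sw 0) (- sw 1) 0 1 j.
Proof.
by move: nM; rewrite /sw /sz => n; ord4 j; move: n; rewrite /minor => n; field; rewrite ?L13 ?n.
Qed.
Lemma slice2_min R : is_ideal R -> above R -> R (lf i0) -> R (lf i1) -> linear_ideal slice2 `<=` R.
Proof.
move=> iR ab h0 h1; rewrite !lf_lform in h0 h1; apply: (linear_ideal_span iR ab h0 h1 h1) => i.
rewrite /slice2; have [->|_] := eqVneq i (o4 3).
 exists (- L i1 (o4 2) / minor 2), (L i0 (o4 2) / minor 2), 0 => j.
 by rewrite mul0r addr0 minorE'; ord4 j; ring.
have [->|_] := eqVneq i (o4 2); last by exists 0, 0, 0 => j; rewrite subrr; ring.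
exists (L i1 (o4 3) / minor 2), (- L i0 (o4 3) / minor 2), 0 => j.
by rewrite mul0r addr0 minorE; ord4 j; ring.
Qed.
Lemma slice2_l : linear_ideal slice2 (lf i0) /\ linear_ideal slice2 (lf i1).
Proof.
have [a1 a0] := slopes 0; have [b1 b0] := slopes 1.
split; rewrite lf_lform; apply: linear_ideal_lform => j; rewrite big4 /slice2 !eq_o4 //=; ord4 j.
all: rewrite ?mulr1 ?mulr0 ?addr0 ?add0r ?addrA //.
Qed.

Variable V : pred 'I_4.
Hypothesis VE : forall i, V i -> i = o4 0 \/ i = o4 1.
Hypothesis polar0 : V (o4 0) -> forall al be al' be', be != 0 ->
 exists X (X0 : forall i, cst (X i) = 0), polar_arc t al be al' be' X0 /\
 arc_limit d X0 (vec4 0 1 be be').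
Hypothesis polar1 : V (o4 1) -> forall al be al' be', al != 0 ->
 exists X (X0 : forall i, cst (X i) = 0), polar_arc t al be al' be' X0 /\
 arc_limit d X0 (vec4 1 0 al al').

Lemma polar_arc_subst al be al' be' X (X0 : forall i, cst (X i) = 0) u :
 polar_arc t al be al' be' X0 -> u (o4 0) + u (o4 2) * al + u (o4 3) * al' = 0 ->
 u (o4 1) + u (o4 2) * be + u (o4 3) * be' = 0 -> germ_subst X0 (polar t u) = 0.
Proof.
move=> [e2 e3 _] h0 h1; rewrite /polar big4 /df !nth4 //= 3!germ_substD 4!germ_substM e2 e3.
have sC (c : C) : germ_subst X0 (germC 4 c) = germC 1 c by exact: germ_substC.
rewrite !sC.
transitivity (germC 1 (u (o4 0) + u (o4 2) * al + u (o4 3) * al') * germ_subst X0 (fx C) +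
 germC 1 (u (o4 1) + u (o4 2) * be + u (o4 3) * be') * germ_subst X0 (fy t)).
 by rewrite !(rmorphD, rmorphM) /=; ring.
by rewrite h0 h1 rmorph0 !mul0r addr0.
Qed.
Lemma slice1_fibre i R : V i -> is_ideal R -> above R -> R (y i) -> R (lf i1) ->
 Q (p1 t (lv i1)) `<=` R.
Proof.
move=> Vi iR ab hy hl; rewrite lf_lform in hl; rewrite -lform_delta in hy.
pose c j k : C := if (j == i) || (k == i) then 0 else slice1 j k.
apply: (@subset_trans _ (linear_ideal c)); last first.
 apply: (linear_ideal_span iR ab hl hy hy) => j; rewrite /c /slice1.
 have [->|ji] /= := eqVneq j i; first by exists 0, 1, 0 => k; ring.
 have [j3|_] := eqVneq j (o4 3); last first.
 exists 0, 0, 0 => k; have [->|_] := eqVneq k i; last by rewrite subrr; ring.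
 by rewrite eq_sym (negbTE ji) !mul0r !addr0 subrr.
 rewrite j3 in ji *; exists (L i1 (o4 3))^-1, (- L i1 i / L i1 (o4 3)), 0 => k.
 have [->|ki] /= := eqVneq k i.
 by case: (VE Vi) => ->; rewrite ?eq_o4 //=; field.
 by ord4 k; field.
case: (VE Vi) => iE; rewrite iE in Vi c *.
- apply: (@transform_sub_linear _ _ _ _ _ c (o4 1) (o4 2)) => [|w w1 w2]; first exact: p1_ideal.
 have [X [X0 [pa lim]]] := polar0 Vi 0 (- L i1 (o4 0) / L i1 (o4 3))
 (- (L i1 (o4 1) + L i1 (o4 2) * w (o4 2)) / L i1 (o4 3)) w2.
 exists X, X0; split.
 move=> a [b [e ->]]; rewrite germ_substD !germ_substM; have [_ _ ->] := pa.
 by rewrite (polar_arc_subst pa) ?mulr0 ?addr0//; field.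
 rewrite (_ : (fun _ => _) = vec4 0 1 (w (o4 2)) (- (L i1 (o4 1) + L i1 (o4 2) * w (o4 2)) / L i1 (o4 3)))//.
 apply/funext => j; rewrite big4 /c /slice1 !eq_o4 //=; ord4 j; rewrite ?w1; ring.
- apply: (@transform_sub_linear _ _ _ _ _ c (o4 0) (o4 2)) => [|w w1 w2]; first exact: p1_ideal.
 have [X [X0 [pa lim]]] := polar1 Vi 0 (- (L i1 (o4 0) + L i1 (o4 2) * w (o4 2)) / L i1 (o4 3))
 (- L i1 (o4 1) / L i1 (o4 3)) w2.
 exists X, X0; split.
 move=> a [b [e ->]]; rewrite germ_substD !germ_substM; have [_ _ ->] := pa.
 by rewrite (polar_arc_subst pa) ?mulr0 ?addr0//; field.
 rewrite (_ : (fun _ => _) = vec4 1 0 (w (o4 2)) (- (L i1 (o4 0) + L i1 (o4 2) * w (o4 2)) / L i1 (o4 3)))//.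
 apply/funext => j; rewrite big4 /c /slice1 !eq_o4 //=; ord4 j; rewrite ?w1; ring.
Qed.

Hypothesis good_t : t = 0 \/ (t != 0 /\ 12005%:R ^+ 7 + 225%:R * (1296%:R * t ^+ 5) ^+ 7 != 0).
Hypothesis dense : forall w : 'I_4 -> C, w (o4 0) = 1 ->
 exists X (X0 : forall i, cst (X i) = 0), arc_limit d X0 w.
Hypothesis fibre0 : forall R, proj_point R -> above R -> Q (pf t) `<=` R -> exists2 i, V i & R (y i).

Variables (r e : nat) (X : 'I_r -> 'I_4 -> D) (X0 : forall j i, cst (X j i) = 0).
Local Notation ga j := (germ_subst (X0 j)).
Local Notation q j := [set a : A | ga j a = 0].
Hypotheses (r_gt0 : (0 < r)%N) (e_gt0 : (0 < e)%N).
Hypothesis X_e : forall j i, dvs e (X j i).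
Hypothesis cond : forall j, exists c, forall b, dvs c b -> exists a, ga j a = b.
Hypothesis sep : forall i j, i != j -> exists h, ga i h = 0 /\ ga j h <> 0.
Hypothesis pa : forall j, polar_arc t (sz 0) (sz 1) (sw 0) (sw 1) (X0 j).
Hypothesis unif : forall j, exists2 u, cst u = 0 & ord_eq e (ga j u).
Hypothesis lim : forall j, exists i v, v i != 0 /\ arc_limit d (X0 j) v.
Hypothesis lim0 : V (o4 0) -> exists j, arc_limit d (X0 j) (vec4 0 1 (sz 1) (sw 1)).
Hypothesis lim1 : V (o4 1) -> exists j, arc_limit d (X0 j) (vec4 1 0 (sz 0) (sw 0)).
Variables (mu : 'I_(r * e) -> multinom 4) (dir : 'I_(r * e) -> 'I_4).
Let std i k := mnm_add (mu i) (mnm_muln (mnm1 (dir i)) k).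
Hypothesis std_inj : forall i k i' k', std i k = std i' k' -> i = i' /\ k = k'.
Hypothesis reduce : forall a : A, exists b : A,
 (exists b0 b1 b2, a - b = b0 * ff + b1 * (fz t - germC 4 (sz 0) * fx C - germC 4 (sz 1) * fy t) +
 b2 * (fw C - germC 4 (sw 0) * fx C - germC 4 (sw 1) * fy t)) /\
 forall m, b m != 0 -> exists i k, m = std i k.

Local Notation I := (curve_ideal t L).

Let iI : is_ideal I := @curve_ideal_ideal C t L.

Let Ipol u v : I (polar t (fun j => u * L i0 j + v * L i1 j)).
Proof. by exists 0, (germC 4 v), (germC 4 u); rewrite mul0r add0r addrC polar_comb. Qed.
Lemma arc_kills j a : I a -> ga j a = 0.
Proof.
have [a1 a0] := slopes 0; have [b1 b0] := slopes 1; have [_ _ f0] := pa j.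
move=> [b [c1 [c0 ->]]]; rewrite !germ_substD !germ_substM f0.
by rewrite !(polar_arc_subst (pa j)) // !mulr0 !addr0.
Qed.
Lemma curve_reduce (a : A) : exists b : A, I (a - b) /\ forall m, b m != 0 -> exists i k, m = std i k.
Proof.
have [b [[b0 [b1 [b2 E]]] hb]] := reduce a; exists b; split=> //; rewrite E.
have If : I ff by exists 1, 0, 0; rewrite mul1r !mul0r !addr0.
apply: (idealD iI); first apply: (idealD iI); apply: (idealMl _ iI) => //.
- have := Ipol (L i1 (o4 3) / minor 2) (- L i0 (o4 3) / minor 2).
 rewrite (_ : (fun _ => _) = vec4 (- sz 0) (- sz 1) 1 0); last by apply/funext => j; exact: minorE.
 rewrite /polar big4 /df /vec4 !nth4 //= !rmorphN rmorph1 rmorph0 mul0r mul1r addr0 !mulNr.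
 have -> : fz t - germC 4 (sz 0) * fx C - germC 4 (sz 1) * fy t =
 - (germC 4 (sz 0) * fx C) + (- (germC 4 (sz 1) * fy t) + fz t) by ring.
 exact.
have := Ipol (- L i1 (o4 2) / minor 2) (L i0 (o4 2) / minor 2).
rewrite (_ : (fun _ => _) = vec4 (- sw 0) (- sw 1) 0 1); last by apply/funext => j; exact: minorE'.
rewrite /polar big4 /df /vec4 !nth4 //= !rmorphN rmorph1 rmorph0 mul0r mul1r !mulNr.
have -> : fw C - germC 4 (sw 0) * fx C - germC 4 (sw 1) * fy t =
 - (germC 4 (sw 0) * fx C) + (- (germC 4 (sw 1) * fy t) + (0 + fw C)) by ring.
exact.
Qed.
Lemma slice2_fibre i : V i -> exists j, forall R, is_ideal R -> above R ->
 R (y i) -> R (lf i0) -> R (lf i1) -> Q (q j) `<=` R.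
Proof.
have qi j : is_ideal (q j).
 split=> [|a b|a b] /=; first exact: rmorph0.
 by move=> ha hb; rewrite germ_substD ha hb addr0.
 by move=> hb; rewrite germ_substM hb mulr0.
move=> Vi; have h (v : 'I_4 -> C) (k : 'I_4) : k != i -> v k = 1 -> v i = 0 -> 
 (k == o4 0) || (k == o4 1) -> v (o4 2) = vec4 (sz 0) (sz 1) 0 0 k -> v (o4 3) = vec4 (sw 0) (sw 1) 0 0 k ->
 (exists j, arc_limit d (X0 j) v) ->
 exists j, forall R, is_ideal R -> above R -> R (y i) -> R (lf i0) -> R (lf i1) -> Q (q j) `<=` R.
 move=> ki vk vi kE v2 v3 [j lj]; exists j => R iR ab hy h0 h1.
 rewrite !lf_lform in h0 h1; rewrite -lform_delta in hy.
 pose c l m : C := (m == k)%:R * v l.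
 apply: (@subset_trans _ (linear_ideal c)).
 apply: (@transform_sub_linear _ _ _ _ _ c k k) => [//|w w1 _].
 exists (X j), (X0 j); split=> //.
 rewrite (_ : (fun _ => _) = v)//; apply/funext => l; rewrite (bigD1 k)//= /c eqxx w1 mul1r mulr1.
 by rewrite big1 ?addr0// => m /negbTE ->; rewrite !mul0r.
 apply: (linear_ideal_span iR ab h0 h1 hy) => l; rewrite /c.
 have ex (l' : 'I_4) (dd : C) : v l' = dd -> exists2 a : C, a = dd & v l' = a by exists dd.
 have iE := VE Vi; case: (ord4E l) => ->.
 - exists 0, 0, (if o4 0 == i then 1 else 0) => m; rewrite !mul0r !add0r.
 have [E0|n0] := eqVneq (o4 0) i; first by rewrite E0 vi mulr0 subr0 mul1r.
 have -> : o4 0 = k.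
 case/orP: kE => /eqP kE; first by [].
 by case: iE n0 ki => ->; rewrite ?kE eqxx.
 by rewrite vk mulr1 subrr mul0r.
 - exists 0, 0, (if o4 1 == i then 1 else 0) => m; rewrite !mul0r !add0r.
 have [E0|n0] := eqVneq (o4 1) i; first by rewrite E0 vi mulr0 subr0 mul1r.
 have -> : o4 1 = k.
 case/orP: kE => /eqP kE; last by [].
 by case: iE n0 ki => ->; rewrite ?kE eqxx.
 by rewrite vk mulr1 subrr mul0r.
 - exists (L i1 (o4 3) / minor 2), (- L i0 (o4 3) / minor 2), (vec4 (sz 0) (sz 1) 0 0 i) => m.
 rewrite minorE v2; case: iE ki => ->; case/orP: kE => /eqP ->; rewrite ?eqxx// => _; ord4 m; ring.
 - exists (- L i1 (o4 2) / minor 2), (L i0 (o4 2) / minor 2), (vec4 (sw 0) (sw 1) 0 0 i) => m.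
 rewrite minorE' v3; case: iE ki => ->; case/orP: kE => /eqP ->; rewrite ?eqxx// => _; ord4 m; ring.
case: (VE Vi) => iE; rewrite iE in Vi h.
 by rewrite iE; apply: (h (vec4 0 1 (sz 1) (sw 1)) (o4 1)); rewrite ?eq_o4 // /vec4 ?nth4 //; exact: lim0.
by rewrite iE; apply: (h (vec4 1 0 (sz 0) (sw 0)) (o4 0)); rewrite ?eq_o4 // /vec4 ?nth4 //; exact: lim1.
Qed.
Lemma sing_point (P : set A) : is_prime P -> (forall i, P (d i)) -> forall a, cst a = 0 -> P a.
Proof.
move=> pP Pd; have [iP P1 _] := pP.
have unit c : c != 0 -> ~ P (germC 4 c).
 move=> c0 Pc; apply: P1; have -> : 1 = germC 4 c^-1 * germC 4 c by rewrite -rmorphM mulVf ?rmorph1.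
 exact: (idealMl _ iP).
have nat_unit k : ~ P k.+1%:R by rewrite -(rmorph_nat (@germC C 4)); apply: unit; rewrite pnatr_eq0.
have Pdi k : (k < 4)%N -> P (nth 0 [:: fx C; fy t; fz t; fw C] k).
 by move=> k4; have := Pd (o4 k); rewrite /df nth4.
have := @singular_locus A P (vx C 0) (vx C 1) (vx C 2) (vx C 3) (tt t) pP nat_unit
 (Pdi 0%N isT) (Pdi 1%N isT) (Pdi 2%N isT) (Pdi 3%N isT).
case.
- case: good_t => [t0|[t0 n]]; [left|right].
 by rewrite /tt t0 rmorph0.
 split; first exact: unit.
 have := unit _ n.
 by rewrite !(rmorph_nat, rmorphD, rmorphXn, rmorphM).
move=> Px Py Pz Pw a a0; have [|c [s [Ea hs]]] := @division C 4 (fun=> 1%N) (fun=> isT) 4 (fun i => mnm1 i) (fun=> 0) a.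
 by move=> i; by move=> m; rewrite gcoef0 eqxx.
have s0 : s = 0.
 have s0m m : m != mnm0 -> s m = 0.
 move=> m0; apply/eqP/negP => /negP/hs H; case/negP: m0; apply/eqP/mnmP => i.
 have := H i; rewrite mnm0E; case: (posnP (m i)) => // mi /negP[].
 apply/mnm_lepP => j; rewrite mnm1E; case: eqP => [<-//|//].
 apply: holo_germP => m; rewrite gcoef0; have [->|/s0m//] := eqVneq m mnm0.
 have := congr1 (@cst C 4) Ea; rewrite a0 cstD cst_sum big1 ?add0r => [/esym|i _]; first by [].
 by rewrite addr0 cstM cst_gX mnm1_eq0 mulr0.
rewrite Ea s0; apply: (idealD iP); last by case: iP.
elim/big_ind: _ => [|u v|i _]; [by case: iP|exact: (idealD iP)|].
apply: (idealMl _ iP); rewrite addr0.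
by case: (ord4E i) => ->.
Qed.

Theorem slice_multiplicity : Le_multiplicity (k := 1) (germ_of_mpoly (f_family t ^+ 2)) L = (r * e)%N.
Proof.
apply: (@Le_multiplicity_arcs C t L slice1 slice2 L13 sing_point _ V fibre0 slice1_fibre
 slice1_min slice1_l slice2_min slice2_l _ _ r e X X0 arc_kills sep _ _ _ _ slice2_fibre r_gt0).
- apply: (@transform_sub_linear _ _ _ _ _ _ (o4 0) (o4 0)) => [|w w0 _].
 by split=> [|a b -> ->|a b ->]; rewrite /= ?addr0 ?mulr0.
 have [Y [Y0 lY]] := dense w0; exists Y, Y0; split=> [a ->|]; first exact: rmorph0.
 rewrite (_ : (fun _ => _) = w)//; apply/funext => i; rewrite (bigD1 i)//= eqxx mul1r.
 by rewrite big1 ?addr0// => j /negbTE ->; rewrite mul0r.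
- by move=> i i3 j; rewrite /slice1 (negbTE i3).
- by move=> i /orP[]/eqP -> j; rewrite /slice2 !eq_o4.
- exact: (arc_reduced e_gt0 X_e cond sep iI arc_kills std_inj curve_reduce).
- exact: (arc_components e_gt0 X_e cond sep iI arc_kills std_inj curve_reduce).
- move=> j; have [i [v [vi [N [lam [l0 H]]]]]] := lim j; exists i => h.
 have := H i; rewrite h sub0r => /dvsN; rewrite opprK -addn1 => /dvs_svM/dvs_cst.
 by rewrite cstC => /eqP; rewrite mulf_eq0 (negbTE l0) (negbTE vi).
- move=> j; have [u u0 hu] := unif j; have [c hc] := cond j.
 exact: (hs_multiplicity_arc e_gt0 (X_e j) u0 hu hc).
Qed.

End Slices.

End Gq.
Import Gq.

(** * The fibres and the standard monomials *)

Module Gr.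
Lemma hom_partials (C : numClosedFieldType) (t : C) (B : comNzRingType)
 (g : {rmorphism holo_germ C 4 -> B}) (x y z w tt' : B) :
 g (vx C 0) = x -> g (vx C 1) = y -> g (vx C 2) = z -> g (vx C 3) = w -> g (tt t) = tt' ->
 [/\ g (fx C) = y ^+ 7 + 15%:R * x ^+ 14,
 g (fy t) = 6%:R * tt' * (y ^+ 5 * z) + 7%:R * (x * y ^+ 6),
 g (fz t) = 5%:R * z ^+ 4 + tt' * y ^+ 6 & g (fw C) = 2%:R * w].
Proof.
by move=> ex ey ez ew et; split; rewrite ?/fx ?/fy ?/fz ?/fw
 !(rmorph_nat, rmorphD, rmorphXn, rmorphM) /= ?ex ?ey ?ez ?ew ?et.
Qed.

Section Fibres.
Variables (C : numClosedFieldType) (t : C).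
Local Notation A := (holo_germ C 4).
Local Notation S := {mpoly A[4]}.
Local Notation y i := (mpolyX A (mnm1 i) : S).
Local Notation K c := (mpolyC 4 (c : A) : S).
Local Notation d := (df t).
Local Notation Q := (transform d (pf t)).

Lemma jacobian_relation i j : Q (y i * K (d j) - y j * K (d i)).
Proof.
apply/(transform_form1 (c := 0) (pf_ideal t)); last exact: (ideal0 (pf_ideal t)).
rewrite PhiB !PhiM !PhiX !PhiC polyC0 mul0r.
by rewrite mulrAC [X in _ - X]mulrAC [(d j)%:P * _]mulrC subrr.
Qed.
Lemma euler_relation : Q (2%:R * K (vx C 0) * y (o4 0) + 4%:R * K (vx C 1) * y (o4 1) +
 6%:R * K (vx C 2) * y (o4 2) + 15%:R * K (vx C 3) * y (o4 3)).
Proof.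
have -> : 2%:R * K (vx C 0) * y (o4 0) + 4%:R * K (vx C 1) * y (o4 1) +
 6%:R * K (vx C 2) * y (o4 2) + 15%:R * K (vx C 3) * y (o4 3) =
 K (2%:R * vx C 0) * y (o4 0) + K (4%:R * vx C 1) * y (o4 1) +
 K (6%:R * vx C 2) * y (o4 2) + K (15%:R * vx C 3) * y (o4 3).
 by rewrite !rmorphM !rmorph_nat.
apply/(transform_form1 (c := 2%:R * vx C 0 * d (o4 0) + 4%:R * vx C 1 * d (o4 1) +
 6%:R * vx C 2 * d (o4 2) + 15%:R * vx C 3 * d (o4 3)) (pf_ideal t)).
 rewrite !PhiD !PhiM !PhiX !PhiC !mulrA -!polyCM -!mulrDl -!polyCD.
 by [].
rewrite /df !nth4 //= euler; exists 30%:R; first by [].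
Qed.

Section Point.
Variable R : set S.
Hypotheses (RP : proj_point R) (Ra : above R) (QR : Q `<=` R).
Let pR : is_prime R. Proof. by case: RP. Qed.
Let pQ : is_prime Q := transform_prime (df t) (pf_prime t).

Let unit c : c != 0 -> ~ R (K (germC 4 c)).
Proof.
have [iR R1 _] := pR; move=> c0 Rc; apply: R1.
have -> : 1 = K (germC 4 c^-1) * K (germC 4 c) :> S by rewrite -!rmorphM mulVf ?rmorph1.
exact: (idealMl _ iR).
Qed.

Let nat_unit k : ~ R k.+1%:R.
Proof.
have := @unit k.+1%:R; rewrite pnatr_eq0 => /(_ isT).
by rewrite !rmorph_nat.
Qed.

Let vx_notin k : (k < 3)%N -> ~ Q (K (vx C k)).
Proof.
move=> k3 /(transform_C _ _ (pf_ideal t))/(noW_notin (@noW_vx C k k3)) x0.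
have := coef_gX C (mnm1 (o4 k)) (mnm1 (o4 k)); rewrite -/(vx C k) x0 gcoef0 eqxx => /esym/eqP.
by rewrite oner_eq0.
Qed.

Let Kfx : K (fx C) = K (vx C 1) ^+ 7 + 15%:R * K (vx C 0) ^+ 14.
Proof. have [H1 H2 H3 H4] := hom_partials (t := t) (g := (@mpolyC 4 A : {rmorphism A -> S})) erefl erefl erefl erefl (erefl (K (tt t))). exact: H1. Qed.
Let Kfy : K (fy t) = 6%:R * K (tt t) * (K (vx C 1) ^+ 5 * K (vx C 2)) + 7%:R * (K (vx C 0) * K (vx C 1) ^+ 6).
Proof. have [H1 H2 H3 H4] := hom_partials (t := t) (g := (@mpolyC 4 A : {rmorphism A -> S})) erefl erefl erefl erefl (erefl (K (tt t))). exact: H2. Qed.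
Let Kfz : K (fz t) = 5%:R * K (vx C 2) ^+ 4 + K (tt t) * K (vx C 1) ^+ 6.
Proof. have [H1 H2 H3 H4] := hom_partials (t := t) (g := (@mpolyC 4 A : {rmorphism A -> S})) erefl erefl erefl erefl (erefl (K (tt t))). exact: H3. Qed.
Let Kfw : K (fw C) = 2%:R * K (vx C 3).
Proof. have [H1 H2 H3 H4] := hom_partials (t := t) (g := (@mpolyC 4 A : {rmorphism A -> S})) erefl erefl erefl erefl (erefl (K (tt t))). exact: H4. Qed.

Let rel i j : (i < 4)%N -> (j < 4)%N ->
 Q (y (o4 i) * K (nth 0 [:: fx C; fy t; fz t; fw C] j) - y (o4 j) * K (nth 0 [:: fx C; fy t; fz t; fw C] i)).
Proof. by move=> i4 j4; have := jacobian_relation (o4 i) (o4 j); rewrite /df !nth4. Qed.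

Let Rv k : R (K (vx C k)). Proof. by apply: Ra; exact: cst_vx. Qed.
Lemma fibre_generic : t != 0 -> R (y (o4 0)).
Proof.
move=> t0; have r1 := @rel 0 1 isT isT; have r2 := @rel 0 2 isT isT; have r3 := @rel 0 3 isT isT.
rewrite /= Kfx Kfy in r1; rewrite /= Kfx Kfz in r2; rewrite /= Kfx Kfw in r3.
exact: (relation_generic pQ pR QR (Rv 0) (Rv 1) (Rv 2) nat_unit euler_relation
 (unit t0) (@vx_notin 1 isT) r1 r2 r3).
Qed.
Lemma fibre_special : t = 0 -> R (y (o4 0)) \/ R (y (o4 1)).
Proof.
move=> t0; have r1 := @rel 1 0 isT isT; have r2 := @rel 1 2 isT isT; have r3 := @rel 1 3 isT isT.
rewrite /= Kfx Kfy in r1; rewrite /= Kfy Kfz in r2; rewrite /= Kfy Kfw in r3.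
apply: (relation_special pQ pR QR (Rv 0) (Rv 1) nat_unit euler_relation _ (@vx_notin 0 isT) r1 r2 r3).
by rewrite /tt t0 !rmorph0.
Qed.

End Point.
End Fibres.

Section Reduction.
Variables (C : numClosedFieldType) (t al be al' be' : C).
Local Notation A := (holo_germ C 4).
Local Notation x := (vx C 0).
Local Notation y := (vx C 1).
Local Notation z := (vx C 2).
Local Notation w := (vx C 3).
Local Notation gC := (@germC C 4).
Local Notation ff := (ff t).
Let G1 := fz t - gC al * fx C - gC be * fy t.
Let G2 := fw C - gC al' * fx C - gC be' * fy t.
Let J : set A := [set a | exists b0 b1 b2, a = b0 * ff + b1 * G1 + b2 * G2].

Let iJ : is_ideal J.
Proof.
split=> [|a b [a0 [a1 [a2 ->]]] [b0 [b1 [b2 ->]]]|a b [b0 [b1 [b2 ->]]]].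
- by exists 0, 0, 0; rewrite !mul0r !addr0.
- by exists (a0 + b0), (a1 + b1), (a2 + b2); ring.
- by exists (a * b0), (a * b1), (a * b2); ring.
Qed.

Let h1 := gC (al / 5%:R) * fx C + gC (be / 5%:R) * fy t.
Let t1 := gC (t / 5%:R).
Let P0 := w - (gC (al' / 2%:R) * fx C + gC (be' / 2%:R) * fy t).
Let P1 := z ^+ 4 + (t1 * y ^+ 6 - h1).

Let constM (c e : C) : e != 0 -> gC c = gC (c / e) * gC e.
Proof. by move=> e0; rewrite -rmorphM divfK. Qed.
Let natC k : gC k%:R = k%:R. Proof. exact: rmorph_nat. Qed.

Let J0 : J P0.
Proof.
exists 0, 0, (gC 2%:R^-1); rewrite !mul0r !add0r /G2 (@constM al' 2%:R) ?pnatr_eq0// (@constM be' 2%:R) ?pnatr_eq0//.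
rewrite natC /fw /P0.
have e : gC 2%:R^-1 * 2%:R = 1 by rewrite -natC -rmorphM mulVf ?rmorph1 ?pnatr_eq0.
transitivity (gC 2%:R^-1 * 2%:R * (w - (gC (al' / 2%:R) * fx C + gC (be' / 2%:R) * fy t))).
 by rewrite e mul1r.
by move: (gC 2%:R^-1) (gC (al' / _)) (gC (be' / _)) (fx C) (fy t) => ? ? ? ? ?; ring.
Qed.

Let G1E : G1 = 5%:R * P1.
Proof.
rewrite /G1 (@constM al 5%:R) ?pnatr_eq0// (@constM be 5%:R) ?pnatr_eq0// natC /fz /P1 /h1 /t1.
rewrite /tt (@constM t 5%:R) ?pnatr_eq0// natC.
by move: (gC (t / _)) (gC (al / _)) (gC (be / _)) (fx C) (fy t) => ? ? ? ? ?; ring.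
Qed.

Let J1 : J P1.
Proof.
exists 0, (gC 5%:R^-1), 0; rewrite !mul0r add0r addr0 G1E mulrA -natC -rmorphM.
by rewrite mulVf ?rmorph1 ?mul1r// pnatr_eq0.
Qed.

Let E := y ^+ 7 * x + x ^+ 15 + w ^+ 2 + z * h1.
Let fE : ff - z * P1 = 4%:R * t1 * (y ^+ 6 * z) + E.
Proof.
rewrite /ff /fF /P1 /E /tt (@constM t 5%:R) ?pnatr_eq0// natC -/t1.
by move: t1 h1 => ? ?; ring.
Qed.

Let JE : J (ff - z * P1).
Proof.
apply: (idealB iJ); last exact: (idealMl _ iJ).
by exists 1, 0, 0; rewrite mul1r !mul0r !addr0.
Qed.
Lemma reduce_generic (a : A) : t != 0 -> exists b : A,
 (exists b0 b1 b2, a - b = b0 * ff + b1 * G1 + b2 * G2) /\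
 forall m, b m != 0 -> [/\ m (o4 3) = 0, m (o4 2) < 4, m (o4 2) = 0 \/ m (o4 1) < 6 & m (o4 1) < 12]%N.
Proof.
move=> t0.
have t10 : t / 5%:R != 0 by rewrite mulf_neq0// invr_eq0 pnatr_eq0.
pose v1 := gC (t / 5%:R)^-1; pose v := gC (4%:R * (t / 5%:R))^-1.
have v1E : v1 * t1 = 1 by rewrite -rmorphM mulVf ?rmorph1.
have vE : v * (4%:R * t1) = 1 by rewrite -natC -!rmorphM mulVf ?rmorph1// mulf_neq0// pnatr_eq0.
pose P2 := y ^+ 6 * z + v * E.
pose P3 := y ^+ 12 + (- (v1 * (y ^+ 6 * h1 + z ^+ 3 * (v * E)))).
have J2 : J P2.
 have -> : P2 = v * (ff - z * P1) by rewrite fE mulrDr mulrA vE mul1r.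
 exact: (idealMl _ iJ).
have J3 : J P3.
 have -> : P3 = v1 * (y ^+ 6 * P1 - z ^+ 3 * P2).
 transitivity (v1 * t1 * y ^+ 12 - v1 * (y ^+ 6 * h1 + z ^+ 3 * (v * E))).
 by rewrite v1E mul1r.
 by rewrite /P1 /P2; move: E h1 t1 => ? ? ?; ring.
 by apply: (idealMl _ iJ); apply: (idealB iJ); exact: (idealMl _ iJ).
pose s := wt [:: 20; 20; 29; 100]%N.
pose al_ (i : 'I_4) := nth mnm0 [:: mn4 0 0 0 1; mn4 0 0 4 0; mn4 0 6 1 0; mn4 0 12 0 0] i.
pose r_ (i : 'I_4) : A := nth 0 [:: - (gC (al' / 2%:R) * fx C + gC (be' / 2%:R) * fy t);
 t1 * y ^+ 6 - h1; v * E; - (v1 * (y ^+ 6 * h1 + z ^+ 3 * (v * E)))] i.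
have wfx : wge s 140 (fx C) by rewrite /fx; wge_tac.
have wfy : wge s 129 (fy t) by rewrite /fy; wge_tac.
have wc c d (a1 : A) : wge s d a1 -> wge s d (c * a1) by exact: wgeM0.
have wh (c e : C) : wge s 129 (gC c * fx C + gC e * fy t).
 by apply: wgeD; apply: wc => //; apply: wgeW wfx.
have wh1 : wge s 129 h1 by exact: wh.
have wE : wge s 158 E by rewrite /E; wge_tac.
have wvE : wge s 158 (v * E) by exact: wc.
have [||c [b [Ea hb]]] := @division C 4 s _ 4 al_ r_ a.
- by move=> i; case: (ord4E i) => ->; rewrite /s /wt nth4.
- move=> i; case: (ord4E i) => ->; rewrite /al_ /r_ !nth4 //= wdeg_mn4 /=.
 + by apply: wgeN; apply: wgeW (wh _ _).
 + by wge_tac.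
 + by apply: wgeW wvE.
 + apply: wgeN; apply: wc; apply: wgeD.
 by wge_tac.
 by apply: (@wgeW _ _ _ (3 * 29 + 158)) => //; apply: wgeM => //; wge_tac.
exists b; split.
 have : J (\sum_i c i * (gX C (al_ i) + r_ i)).
 elim/big_ind: _ => [|u u'|i _]; [exact: (ideal0 iJ)|exact: (idealD iJ)|].
 apply: (idealMl _ iJ).
 case: (ord4E i) => ->; rewrite /al_ /r_ !nth4 //= gX_mn4 ?expr0 ?mul1r ?mulr1 ?expr1 //.
 by rewrite Ea addrK.
move=> m /hb H.
have := H (o4 0); have := H (o4 1); have := H (o4 2); have := H (o4 3).
rewrite /al_ !nth4 //= !lem4 !leq0n /= !andbT => h3 h2 h1' h0.
by split; lia.
Qed.
Lemma reduce_special (a : A) : t = 0 -> exists b : A,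
 (exists b0 b1 b2, a - b = b0 * ff + b1 * G1 + b2 * G2) /\
 forall m, b m != 0 -> [/\ m (o4 3) = 0, m (o4 2) < 4 & m (o4 0) = 0 \/ m (o4 1) < 7]%N.
Proof.
move=> t0; have t10 : t1 = 0 by rewrite /t1 t0 mul0r rmorph0.
pose s := wt [:: 2; 3; 4; 12]%N.
pose al_ (i : 'I_3) := nth mnm0 [:: mn4 0 0 0 1; mn4 0 0 4 0; mn4 1 7 0 0] i.
pose r_ (i : 'I_3) : A := nth 0 [:: - (gC (al' / 2%:R) * fx C + gC (be' / 2%:R) * fy t);
 - h1; x ^+ 15 + w ^+ 2 + z * h1] i.
have wfx : wge s 20 (fx C) by rewrite /fx; wge_tac.
have wfy : wge s 20 (fy t) by rewrite /fy /tt t0 rmorph0 mulr0 mul0r add0r; wge_tac.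
have wc c d (a1 : A) : wge s d a1 -> wge s d (c * a1) by exact: wgeM0.
have wh (c e : C) : wge s 20 (gC c * fx C + gC e * fy t) by apply: wgeD; apply: wc.
have wh1 : wge s 20 h1 by exact: wh.
have ord3 (i : 'I_3) : [\/ i = ord0, i = lift ord0 ord0 | i = lift ord0 (lift ord0 ord0)].
 by case: i => -[|[|[|//]]] p; [apply: Or31|apply: Or32|apply: Or33]; apply/val_inj.
have [||c [b [Ea hb]]] := @division C 4 s _ 3 al_ r_ a.
- by move=> i; case: (ord4E i) => ->; rewrite /s /wt nth4.
- move=> i; case: (ord3 i) => ->; rewrite /al_ /r_ /= wdeg_mn4 /=.
 + by apply: wgeN; apply: wgeW (wh _ _).
 + by apply: wgeN; apply: wgeW wh1.
 + by wge_tac.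
exists b; split.
 have : J (\sum_i c i * (gX C (al_ i) + r_ i)).
 elim/big_ind: _ => [|u u'|i _]; [exact: (ideal0 iJ)|exact: (idealD iJ)|].
 apply: (idealMl _ iJ).
 case: (ord3 i) => ->; rewrite /al_ /r_ /= gX_mn4 ?expr0 ?mul1r ?mulr1 ?expr1.
 + exact: J0.
 + by move: J1; rewrite /P1 t10 mul0r sub0r.
 + move: JE; rewrite fE t10 mulr0 mul0r add0r /E.
 by rewrite -!addrA [y ^+ 7 * x]mulrC.
 by rewrite Ea addrK.
move=> m /hb H.
have := H ord0; have := H (lift ord0 ord0); have := H (lift ord0 (lift ord0 ord0)).
rewrite /al_ /= !lem4 !leq0n /= !andbT => h2 h1' h0.
by split; lia.
Qed.

End Reduction.

Lemma mn4_add0 a b c d k : mnm_add (mn4 a b c d) (mnm_muln (mnm1 (o4 0)) k) = mn4 (a + k) b c d.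
Proof.
apply/mnmP => i; rewrite mnmDE mulmnE mnm1E !mn4E.
by case: (ord4E i) => ->; rewrite !nth4 //= eq_o4 //= ?mul1n ?mul0n ?addn0.
Qed.
Lemma mn4_add1 a b c d k : mnm_add (mn4 a b c d) (mnm_muln (mnm1 (o4 1)) k) = mn4 a (b + k) c d.
Proof.
apply/mnmP => i; rewrite mnmDE mulmnE mnm1E !mn4E.
by case: (ord4E i) => ->; rewrite !nth4 //= eq_o4 //= ?mul1n ?mul0n ?addn0.
Qed.

End Gr.
Import Gr.

(** * The two multiplicities *)

Module Gs.
Lemma distinct_roots (C : closedFieldType) (p : {poly C}) n : size p = n.+1 ->
 (forall x, root p x -> p^`().[x] != 0) ->
 exists2 r : 'I_n -> C, injective r & forall j, root p (r j).
Proof.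
move=> sp H; have [rs pE] := closed_field_poly_normal p.
have lc : lead_coef p != 0 by rewrite lead_coef_eq0 -size_poly_eq0 sp.
have srs : size rs = n.
 by move: sp; rewrite pE size_scale// size_prod_XsubC => -[].
have urs : uniq rs.
 rewrite -separable_prod_XsubC -(eqp_separable (p := p)); last first.
 by rewrite {1}pE; apply: eqp_scale.
 by rewrite unlock; apply: Pdiv.ClosedField.root_coprimep => x; exact: H.
exists (fun j => nth 0 rs j) => [i j /eqP|j].
 by rewrite nth_uniq ?srs// => /eqP/val_inj.
by rewrite pE rootZ// root_prod_XsubC mem_nth// srs.
Qed.

Section StandardMonomials.
Local Notation std mu dir i k := (mnm_add (mu i) (mnm_muln (mnm1 (dir i)) k)).

Definition mu_generic (n : 'I_(30 * 1)) :=
 if (n < 24)%N then mn4 0 (n %% 6) (n %/ 6) 0 else mn4 0 (n - 18) 0 0.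
Definition dir_generic (n : 'I_(30 * 1)) := o4 0.
Definition mu_special (n : 'I_(8 * 4)) :=
 if (n < 28)%N then mn4 0 (n %% 7) (n %/ 7) 0 else mn4 0 7 (n - 28) 0.
Definition dir_special (n : 'I_(8 * 4)) := if (n < 28)%N then o4 0 else o4 1.

Lemma std_generic_inj i k i' k' :
 std mu_generic dir_generic i k = std mu_generic dir_generic i' k' -> i = i' /\ k = k'.
Proof.
rewrite /mu_generic /dir_generic.
have ei : (i < 30)%N by case: i. have ei' : (i' < 30)%N by case: i'.
have [i24|i24] := ltnP i 24; have [j24|j24] := ltnP i' 24; rewrite !mn4_add0 => /mn4_inj[h0 h1 h2 _];
 (split; [apply/val_inj => /=|]; lia).
Qed.
Lemma std_generic (m : multinom 4) :
 [/\ m (o4 3) = 0, m (o4 2) < 4, m (o4 2) = 0 \/ m (o4 1) < 6 & m (o4 1) < 12]%N ->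
 exists i k, m = std mu_generic dir_generic i k.
Proof.
rewrite [m in exists _ _, m = _]mn4_eta => -[->]; move: (m (o4 0)) (m (o4 1)) (m (o4 2)) => a b c m2 m1 m1'.
have [m16|m16] := ltnP b 6.
 have p : (c * 6 + b < 30 * 1)%N by lia.
 exists (Ordinal p), a; rewrite /mu_generic /dir_generic /= ifT; last by lia.
 by rewrite mn4_add0; congr mn4; lia.
have p : (b + 18 < 30 * 1)%N by lia.
exists (Ordinal p), a; rewrite /mu_generic /dir_generic /= ifF; last by lia.
by rewrite mn4_add0; congr mn4; lia.
Qed.
Lemma std_special_inj i k i' k' :
 std mu_special dir_special i k = std mu_special dir_special i' k' -> i = i' /\ k = k'.
Proof.
rewrite /mu_special /dir_special.
have ei : (i < 32)%N by case: i. have ei' : (i' < 32)%N by case: i'.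
have [i24|i24] := ltnP i 28; have [j24|j24] := ltnP i' 28;
 rewrite ?mn4_add0 ?mn4_add1 => /mn4_inj[h0 h1 h2 _]; (split; [apply/val_inj => /=|]; lia).
Qed.
Lemma std_special (m : multinom 4) :
 [/\ m (o4 3) = 0, m (o4 2) < 4 & m (o4 0) = 0 \/ m (o4 1) < 7]%N ->
 exists i k, m = std mu_special dir_special i k.
Proof.
rewrite [m in exists _ _, m = _]mn4_eta => -[->]; move: (m (o4 0)) (m (o4 1)) (m (o4 2)) => a b c m2 m1.
have [m17|m17] := ltnP b 7.
 have p : (c * 7 + b < 8 * 4)%N by lia.
 exists (Ordinal p), a; rewrite /mu_special /dir_special /= ifT; last by lia.
 by rewrite ifT ?mn4_add0; [congr mn4; lia|lia].
have p : (c + 28 < 8 * 4)%N by lia.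
exists (Ordinal p), (b - 7)%N; rewrite /mu_special /dir_special /= ifF; last by lia.
by rewrite ifF ?mn4_add1; [congr mn4; lia|lia].
Qed.
Lemma mod4_21 i : (7 * (3 * i) = i %[mod 4])%N. Proof. by lia. Qed.
Lemma mod4_13 i : (13 * i = i %[mod 4])%N. Proof. by lia. Qed.

End StandardMonomials.

Section Multiplicities.
Variable C : numClosedFieldType.
Local Notation A := (holo_germ C 4).
Local Notation D := (holo_germ C 1).
Local Notation s := (sv C).
Local Notation x := (vx C 0).
Local Notation y := (vx C 1).
Local Notation z := (vx C 2).
Local Notation arcs := {X : 'I_4 -> D | forall i, cst (X i) = 0}.

Lemma arc_at (X : 'I_4 -> D) (X0 : forall i, cst (X i) = 0) a b c e : X = arc4 a b c e ->
 [/\ germ_subst X0 x = a, germ_subst X0 y = b, germ_subst X0 z = c & germ_subst X0 (vx C 3) = e].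
Proof. by move=> E; rewrite /vx; split; rewrite germ_substX E /arc4 nth4. Qed.
Lemma ord_c (k : nat) (u : D) : cst u != 0 -> ord_eq k (s ^+ k * u).
Proof. by move=> /eqP u0; exists u. Qed.

Section Generic.
Variables (t : C) (L : 'M[C]_(2, 4)).
Hypotheses (t0 : t != 0) (good : 12005%:R ^+ 7 + 225%:R * (1296%:R * t ^+ 5) ^+ 7 != 0).
Hypotheses (L13 : L (lift ord0 ord0) (o4 3) != 0) (M2 : minor L 2 != 0).
Hypothesis dense : forall w : 'I_4 -> C, w (o4 0) = 1 ->
 exists X (X0 : forall i, cst (X i) = 0), arc_limit (df t) X0 w.
Variables Y0 Z0 : 'I_30 -> C.
Hypothesis E0 : forall j, 5%:R * Z0 j ^+ 4 + t * Y0 j ^+ 6 = 0.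
Hypothesis E1 : forall j, Z0 j ^+ 5 + t * Y0 j ^+ 6 * Z0 j + Y0 j ^+ 7 + 1 = 0.
Hypotheses (Z00 : forall j, Z0 j != 0) (Y00 : forall j, Y0 j != 0).
Hypothesis J0 : forall j, 6%:R * t * Z0 j + 7%:R * Y0 j != 0.
Hypothesis YZ : forall i j, i != j -> Y0 i != Y0 j \/ Z0 i != Z0 j.

Lemma multiplicity_generic : Le_multiplicity (k := 1) (germ_of_mpoly (f_family t ^+ 2)) L = 30%N.
Proof.
have arcP j : exists X : arcs, exists Y Z e,
 [/\ cst Y = Y0 j, cst Z = Z0 j, sval X = arc4 s (s ^+ 2 * Y) (s ^+ 3 * Z) e,
 polar_arc t (sz L 0) (sz L 1) (sw L 0) (sw L 1) (proj2_sig X) &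
 arc_limit (df t) (proj2_sig X) (vec4 0 1 (sz L 1) (sw L 1))].
 have [Y [Z [e [X0 [cY cZ pa l]]]]] := arc_generic (sz L 0) (sz L 1) (sw L 0) (sw L 1)
 (E0 j) (E1 j) (Z00 j) (Y00 j) (J0 j).
 by exists (exist _ _ X0), Y, Z, e; split.
have [X XP] := choice arcP.
pose X0 j : forall i, cst (sval (X j) i) = 0 := proj2_sig (X j).
have gx j : germ_subst (X0 j) x = s.
 by have [Y [Z [e [_ _ /(arc_at (X0 j))[]]]]] := XP j.
have cond j : exists c, forall b, dvs c b -> exists a, germ_subst (X0 j) a = b.
 apply: (@conductor _ _ _ (X0 j) (o4 0) 1 isT _ (fun=> 1) (fun=> 0%N)) => //.
 - by have := gx j; rewrite /vx germ_substX expr1.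
 - by move=> i; rewrite rmorph1; exact: ord_one.
 - by move=> i; rewrite !modn1.
have gB (a b : A) j : germ_subst (X0 j) (a - b) = germ_subst (X0 j) a - germ_subst (X0 j) b by exact: rmorphB.
have gXn (a : A) j k : germ_subst (X0 j) (a ^+ k) = germ_subst (X0 j) a ^+ k by exact: rmorphXn.
have [c0 gC] : exists c : nat, forall (a : C) j, germ_subst (X0 j) (germC 4 a) = germC 1 a.
 by exists 0%N => a j; exact: germ_substC.
have sep i j : i != j -> exists h, germ_subst (X0 i) h = 0 /\ germ_subst (X0 j) h <> 0.
 move=> ij; have [c hc] := cond i.
 have [Y [Z [e [cY cZ XE _ _]]]] := XP i; have [Y' [Z' [e' [cY' cZ' XE' _ _]]]] := XP j.
 have [_ gy gz _] := arc_at (X0 i) XE; have [_ gy' gz' _] := arc_at (X0 j) XE'.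
 have [nY|nZ] := YZ ij.
 - apply: (arcs_separated (a := y - germC 4 (Y0 i) * x ^+ 2) (b := x ^+ 2) (k := 2) (l := 2) (l' := 2) hc);
 rewrite ?gB ?[germ_subst _ (germC _ _ * _)]germ_substM ?gXn ?gC ?gx ?gy ?gy' //; try exact: ord_sv.
 + by rewrite [germC _ _ * _]mulrC; apply: dvs_unit.
 + rewrite [germC _ _ * _]mulrC -mulrBr; apply: ord_c.
 by rewrite cstB cstC cY' subr_eq0 eq_sym.
 - apply: (arcs_separated (a := z - germC 4 (Z0 i) * x ^+ 3) (b := x ^+ 3) (k := 3) (l := 3) (l' := 3) hc);
 rewrite ?gB ?[germ_subst _ (germC _ _ * _)]germ_substM ?gXn ?gC ?gx ?gz ?gz' //; try exact: ord_sv.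
 + by rewrite [germC _ _ * _]mulrC; apply: dvs_unit.
 + rewrite [germC _ _ * _]mulrC -mulrBr; apply: ord_c.
 by rewrite cstB cstC cZ' subr_eq0 eq_sym.
have n10 : (1 : C) != 0 by exact: oner_neq0.
rewrite -[RHS]/(30 * 1)%N.
apply: (@slice_multiplicity C t L L13 M2 (pred1 (o4 0)) _ _ _ _ dense _ 30 1 (fun j => sval (X j)) X0
 isT isT _ cond sep _ _ _ _ _ mu_generic dir_generic).
- by move=> i /eqP ->; left.
- move=> _ al be al' be' _.
 have [Y [Z [e [Y1 [_ _ pa l]]]]] := arc_generic al be al' be' (E0 ord0) (E1 ord0) (Z00 ord0) (Y00 ord0) (J0 ord0).
 by exists (arc4 s (s ^+ 2 * Y) (s ^+ 3 * Z) e), Y1.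
- by move=> /eqP/eqP; rewrite eq_o4.
- by right.
- move=> R RP Ra QR; exists (o4 0); first by rewrite /= eqxx.
 exact: (fibre_generic RP Ra QR t0).
- by move=> j i; apply/dvs_cst; exact: X0.
- by move=> j; have [Y [Z [e []]]] := XP j.
- move=> j; exists x; first exact: cst_vx.
 by rewrite gx -[s]expr1; exact: ord_sv.
- move=> j; exists (o4 1), (vec4 0 1 (sz L 1) (sw L 1)); split; first by rewrite /vec4 nth4.
 by have [Y [Z [e []]]] := XP j.
- by move=> _; exists ord0; have [Y [Z [e []]]] := XP ord0.
- by move=> /eqP/eqP; rewrite eq_o4.
- exact: std_generic_inj.
- move=> a; have [b [h hb]] := reduce_generic (sz L 0) (sz L 1) (sw L 0) (sw L 1) a t0.
 by exists b; split=> // m /hb/std_generic.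
Qed.

End Generic.

Section Special.
Variable L : 'M[C]_(2, 4).
Hypotheses (L13 : L (lift ord0 ord0) (o4 3) != 0) (M2 : minor L 2 != 0).
Hypotheses (M0 : minor L 0 != 0) (M1 : minor L 1 != 0).

Lemma root4 (c k : C) : c != 0 -> k != 0 -> exists2 r : C, r != 0 & k * r ^+ 4 = c.
Proof.
move=> c0 k0; exists (4.-root (c / k)); last by rewrite rootCK// mulrC divfK.
by rewrite rootC_eq0// mulf_neq0// invr_eq0.
Qed.
Lemma multiplicity_special : Le_multiplicity (k := 1) (germ_of_mpoly (f_family (0 : C) ^+ 2)) L = 32%N.
Proof.
have nn k : k.+1%:R != 0 :> C by rewrite pnatr_eq0.
have sz0 : sz L 0 != 0 by rewrite /sz mulf_neq0 ?oppr_eq0 ?invr_eq0.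
have sz1 : sz L 1 != 0 by rewrite /sz mulf_neq0 ?oppr_eq0 ?invr_eq0.
have [Y0 Yinj Yr] : exists2 r : 'I_7 -> C, injective r & forall j, root ('X^7 + 1%:P) (r j).
 apply: distinct_roots; first by rewrite size_XnaddC.
 move=> u; rewrite /root !hornerE derivD derivXn derivC addr0 => /eqP h.
 rewrite hornerMn hornerXn -mulr_natl mulf_neq0 ?nn// expf_neq0//; apply/eqP => u0.
 by move: h => /eqP; rewrite u0 expr0n add0r oner_eq0.
have Y7 j : Y0 j ^+ 7 = -1.
 by have := Yr j; rewrite /root !hornerE addr_eq0 => /eqP.
have Yn j : Y0 j != 0.
 by apply/eqP => h; have /eqP := Y7 j; rewrite h expr0n eq_sym oppr_eq0 oner_eq0.
have curved (Y : C) al be al' be' : Y ^+ 7 = -1 -> be != 0 -> exists X : arcs, exists Y' Z e,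
 [/\ cst Y' = Y, cst Z != 0, sval X = arc4 (s ^+ 4) (s ^+ 8 * Y') (s ^+ 13 * Z) e, dvs 52 e &
 polar_arc 0 al be al' be' (proj2_sig X) /\ arc_limit (df 0) (proj2_sig X) (vec4 0 1 be be')].
 move=> hY be0.
 have Yn' : Y != 0 by apply/eqP => h; have /eqP := hY; rewrite h expr0n eq_sym oppr_eq0 oner_eq0.
 have [|Z Zn ZE] := @root4 (7%:R * be * Y ^+ 6) 5%:R _ (nn 4%N).
 by rewrite !mulf_neq0 ?expf_neq0 ?nn.
 have [Y' [Z' [e [X0 [cY cZ pa de l]]]]] := arc_special2 al al' be' erefl hY ZE Zn.
 by exists (exist _ _ X0), Y', Z', e; split=> //; rewrite cZ.
have straight al be al' be' : al != 0 -> exists X : arcs, exists X' Z e,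
 [/\ cst X' != 0, cst Z != 0, sval X = arc4 (s ^+ 7 * X') (s ^+ 4) (s ^+ 7 * Z) e, dvs 28 e &
 polar_arc 0 al be al' be' (proj2_sig X) /\ arc_limit (df 0) (proj2_sig X) (vec4 1 0 al al')].
 move=> al0; have [Z Zn ZE] := @root4 al 5%:R al0 (nn 4%N).
 have [X' [Z' [e [X0 [cX cZ pa de l]]]]] := arc_special1 be al' be' erefl ZE Zn.
 exists (exist _ _ X0), X', Z', e; split=> //; rewrite ?cZ// cX oppr_eq0 expf_neq0//.
have [XX XXP] := choice (fun j => curved (Y0 j) (sz L 0) (sz L 1) (sw L 0) (sw L 1) (Y7 j) sz1).
have [Xs [X' [Zs [es [cX' cZs XsE des [pas ls]]]]]] := straight (sz L 0) (sz L 1) (sw L 0) (sw L 1) sz0.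
pose X (j : 'I_8) : arcs := if unlift ord0 j is Some i then XX i else Xs.
pose X0 j : forall i, cst (sval (X j) i) = 0 := proj2_sig (X j).
have X00 : X ord0 = Xs by rewrite /X unlift_none.
have X0l i : X (lift ord0 i) = XX i by rewrite /X liftK.
have all (P : 'I_8 -> arcs -> Prop) : P ord0 Xs -> (forall i, P (lift ord0 i) (XX i)) -> forall j, P j (X j).
 move=> p0 pl j; rewrite /X; case: unliftP => [i ->|->] //.
have gB (a b : A) (Z : arcs) : germ_subst (proj2_sig Z) (a - b) = germ_subst (proj2_sig Z) a - germ_subst (proj2_sig Z) b by exact: rmorphB.
have gXn (a : A) (Z : arcs) k : germ_subst (proj2_sig Z) (a ^+ k) = germ_subst (proj2_sig Z) a ^+ k by exact: rmorphXn.
have gC (a : C) (Z : arcs) : germ_subst (proj2_sig Z) (germC 4 a) = germC 1 a by exact: germ_substC.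
have cond j : exists c, forall b, dvs c b -> exists a, germ_subst (X0 j) a = b.
 rewrite /X0; apply: (all (fun j Z => exists c, forall b, dvs c b -> exists a, germ_subst (proj2_sig Z) a = b)) => [|i].
 have [gx gy gz _] := arc_at (proj2_sig Xs) XsE.
 apply: (@conductor _ _ _ (proj2_sig Xs) (o4 1) 4 isT _ (fun i : 'I_4 => z ^+ (3 * i)) (fun i : 'I_4 => (7 * (3 * i))%N)) => //.
 - by have := gy; rewrite /vx germ_substX.
 - by move=> i; rewrite rmorphXn /= gz; apply: ordX; exact: ord_c.
 - by move=> i; exact: mod4_21.
 have [Y' [Z [e [cY cZ XE de _]]]] := XXP i; have [gx gy gz _] := arc_at (proj2_sig (XX i)) XE.
 apply: (@conductor _ _ _ (proj2_sig (XX i)) (o4 0) 4 isT _ (fun i : 'I_4 => z ^+ i) (fun i : 'I_4 => (13 * i)%N)) => //.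
 - by have := gx; rewrite /vx germ_substX.
 - by move=> k; rewrite rmorphXn /= gz; apply: ordX; exact: ord_c.
 - by move=> k; exact: mod4_13.
have conds Z j : Z = X j -> exists c, forall b, dvs c b -> exists a, germ_subst (proj2_sig Z) a = b.
 by move=> ->; exact: cond.
have sep i j : i != j -> exists h, germ_subst (X0 i) h = 0 /\ germ_subst (X0 j) h <> 0.
 have [gxs gys _ _] := arc_at (proj2_sig Xs) XsE.
 rewrite /X0; case: (unliftP ord0 i) => [k ->|->]; case: (unliftP ord0 j) => [l ->|->]; rewrite ?X00 ?X0l ?eqxx// => ij.
 - have [Y [Z [e [cY cZ XE _ _]]]] := XXP k; have [Y' [Z' [e' [cY' cZ' XE' _ _]]]] := XXP l.
 have [gx gy gz _] := arc_at (proj2_sig (XX k)) XE; have [gx' gy' gz' _] := arc_at (proj2_sig (XX l)) XE'.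
 have [c hc] := conds _ _ (esym (X0l k)).
 have kl : Y0 k != Y0 l by apply: contraNneq ij => /Yinj ->.
 have s8 : (s ^+ 4) ^+ 2 = s ^+ 8 by rewrite -exprM.
 apply: (arcs_separated (a := y - germC 4 (Y0 k) * x ^+ 2) (b := x ^+ 2) (k := 8) (l := 8) (l' := 8) hc);
 rewrite ?gB ?[germ_subst _ (germC _ _ * _)]germ_substM ?gXn ?gC ?gx ?gx' ?gy ?gy' ?s8 //; try exact: ord_sv.
 + by rewrite [germC _ _ * _]mulrC; apply: dvs_unit.
 + rewrite [germC _ _ * _]mulrC -mulrBr; apply: ord_c.
 by rewrite cstB cstC cY' subr_eq0 eq_sym.
 - have [Y [Z [e [cY cZ XE _ _]]]] := XXP k.
 have [gx gy gz _] := arc_at (proj2_sig (XX k)) XE; have [c hc] := conds _ _ (esym (X0l k)).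
 apply: (arcs_separated (a := y) (b := x) (k := 4) (l := 7) (l' := 4) hc); rewrite ?gx ?gy ?gxs ?gys //.
 + exact: ord_sv.
 + exact: dvs_s.
 + exact: ord_c.
 + exact: ord_sv.
 - have [Y [Z [e [cY cZ XE _ _]]]] := XXP l.
 have [gx gy gz _] := arc_at (proj2_sig (XX l)) XE; have [c hc] := conds _ _ (esym X00).
 apply: (arcs_separated (a := x) (b := y) (k := 4) (l := 8) (l' := 4) hc); rewrite ?gx ?gy ?gxs ?gys //.
 + exact: ord_sv.
 + exact: dvs_s.
 + by apply: ord_c; rewrite cY.
 + exact: ord_sv.
have n10 : (1 : C) != 0 by exact: oner_neq0.
have VE (i : 'I_4) : pred2 (o4 0) (o4 1) i -> i = o4 0 \/ i = o4 1.
 by move=> /orP[]/eqP; [left|right].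
rewrite -[RHS]/(8 * 4)%N.
apply: (@slice_multiplicity C 0 L L13 M2 (pred2 (o4 0) (o4 1)) VE _ _ _ _ _ 8 4 (fun j => sval (X j)) X0
 isT isT _ cond sep _ _ _ _ _ mu_special dir_special).
- move=> _ al be al' be' be0.
 have [|Z [_ [_ [_ [_ _ _ _ [pa l]]]]]] := curved (-1) al be al' be' _ be0; first by rewrite -signr_odd expr1.
 by exists (sval Z), (proj2_sig Z).
- move=> _ al be al' be' al0.
 have [Z [_ [_ [_ [_ _ _ _ [pa l]]]]]] := straight al be al' be' al0.
 by exists (sval Z), (proj2_sig Z).
- by left.
- by move=> w w0; exact: arc_dense0.
- move=> R RP Ra QR; have [h|h] := fibre_special RP Ra QR erefl.
 by exists (o4 0) => //=; rewrite eqxx.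
 by exists (o4 1) => //=; rewrite eqxx orbT.
- move=> j; apply: (all (fun _ Z => forall i, dvs 4 (sval Z i))) => [i|k i].
 rewrite XsE; case: (ord4E i) => ->; rewrite /arc4 nth4 //=; try exact: dvs_s.
 by rewrite -[s ^+ 4]mulr1; exact: dvs_s.
 exact: dvsW des.
 have [Y [Z [e [cY cZ XE de _]]]] := XXP k; rewrite XE; case: (ord4E i) => ->; rewrite /arc4 nth4 //=; try exact: dvs_s.
 by rewrite -[s ^+ 4]mulr1; exact: dvs_s.
 exact: dvsW de.
- move=> j; apply: (all (fun _ Z => polar_arc 0 _ _ _ _ (proj2_sig Z))) => // i.
 by have [Y [Z [e [_ _ _ _ []]]]] := XXP i.
- move=> j; apply: (all (fun _ Z => exists2 u, cst u = 0 & ord_eq 4 (germ_subst (proj2_sig Z) u))) => [|i].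
 exists y; first exact: cst_vx. have [_ -> _ _] := arc_at (proj2_sig Xs) XsE; exact: ord_sv.
 exists x; first exact: cst_vx.
 by have [Y [Z [e [_ _ XE _ _]]]] := XXP i; have [-> _ _ _] := arc_at (proj2_sig (XX i)) XE; exact: ord_sv.
- move=> j; apply: (all (fun _ Z => exists i v, v i != 0 /\ arc_limit (df 0) (proj2_sig Z) v)) => [|i].
 exists (o4 0), (vec4 1 0 (sz L 0) (sw L 0)); split=> //; by rewrite /vec4 nth4.
 exists (o4 1), (vec4 0 1 (sz L 1) (sw L 1)); split; first by rewrite /vec4 nth4.
 by have [Y [Z [e [_ _ _ _ []]]]] := XXP i.
- move=> _; exists (lift ord0 ord0); rewrite /X0 X0l.
 by have [Y [Z [e [_ _ _ _ []]]]] := XXP ord0.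
- by move=> _; exists ord0; rewrite /X0 X00.
- exact: std_special_inj.
- move=> a; have [b [h hb]] := reduce_special (sz L 0) (sz L 1) (sw L 0) (sw L 1) a (erefl (0 : C)).
 by exists b; split=> // m /hb/std_special.
Qed.

End Special.
End Multiplicities.

End Gs.
Import Gs.

(** * The first Le number varies *)

Module Gt.
Section LeNumbersVary.
Variable C : numClosedFieldType.
Local Notation i0 := (ord0 : 'I_2).
Local Notation i1 := (lift ord0 ord0 : 'I_2).
Local Notation XX i j := (mpolyX C (mnm1 (mxvec_index (i : 'I_2) (j : 'I_4))) : {mpoly C[2 * 4]}).

Definition minor_poly k : {mpoly C[2 * 4]} := XX i0 (o4 k) * XX i1 (o4 3) - XX i0 (o4 3) * XX i1 (o4 k).
Definition general : {mpoly C[2 * 4]} := XX i1 (o4 3) * minor_poly 2 * (minor_poly 0 * minor_poly 1).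

Lemma meval_general (L : 'M[C]_(2, 4)) : meval (fun i => mxvec L ord0 i) general =
 L i1 (o4 3) * minor L 2 * (minor L 0 * minor L 1).
Proof. by rewrite /general /minor_poly /minor !(mevalM, mevalB, mevalXU) !mxvecE. Qed.
Lemma general_neq0 : general != 0.
Proof.
pose L : 'M[C]_(2, 4) := \matrix_(i, j) if i == i0 then (j != o4 3)%:R else (j == o4 3)%:R.
apply/eqP => h; have := meval_general L; rewrite h meval0 /minor !mxE !eq_o4 //=.
rewrite !mulr1 !mul0r !subr0 => /eqP; rewrite eq_sym.
by rewrite -!natrM ?pnatr_eq0 oner_eq0.
Qed.
Lemma Le_numberE (t : C) m :
 (forall L : 'M[C]_(2, 4), L i1 (o4 3) != 0 -> minor L 2 != 0 -> minor L 0 != 0 -> minor L 1 != 0 ->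
 Le_multiplicity (k := 1) (germ_of_mpoly (f_family t ^+ 2)) L = m) ->
 Le_number (germ_of_mpoly (f_family t ^+ 2)) 1 = m.
Proof.
move=> H; set g := germ_of_mpoly _ in H *.
have Hm (L : 'M[C]_(2, 4)) : meval (fun i => mxvec L ord0 i) general != 0 ->
 Le_multiplicity (k := 1) g L = m.
 rewrite meval_general !mulf_eq0 !negb_or => /andP[/andP[h3 h2] /andP[h0 h1]].
 exact: H.
rewrite /Le_number; case: xgetP => [l _ [F F0 HF]|/(_ m) h]; last first.
 by exfalso; apply: h; exists general; [exact: general_neq0|exact: Hm].
have [v hv] := mpoly_neq0_ex (mulf_neq0 F0 general_neq0).
pose L : 'M[C]_(2, 4) := vec_mx (\row_i v i).
have vE : v = (fun i => mxvec L ord0 i) by apply/funext => i; rewrite vec_mxK mxE.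
move: hv; rewrite vE mevalM mulf_eq0 negb_or => /andP[/HF <- /Hm].
by [].
Qed.
Lemma Le_number_special : Le_number (germ_of_mpoly (f_family (0 : C) ^+ 2)) 1 = 32%N.
Proof. by apply: Le_numberE => L *; exact: multiplicity_special. Qed.

(** With t = - 5 c^4 the initial forms of the arcs are y = w^2, z = ze c w^3,
 where ze is 1 or the imaginary unit and w is a root of this polynomial. *)
Lemma initial_forms (ze e c : C) : c != 0 -> ze != 0 -> ze ^+ 14 = e ->
 7%:R ^+ 14 + 15%:R * 30%:R ^+ 14 * e * c ^+ 70 != 0 ->
 exists r : 'I_15 -> C, [/\ injective r, forall j, 4%:R * ze * c ^+ 5 * r j ^+ 15 = r j ^+ 14 + 1 &
 forall j, 7%:R - 30%:R * ze * c ^+ 5 * r j != 0].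
Proof.
move=> c0 ze0 zeE nz.
have simple x : 4%:R * ze * c ^+ 5 * x ^+ 15 = x ^+ 14 + 1 -> 7%:R - 30%:R * ze * c ^+ 5 * x != 0.
 move=> h; apply: contra_neq nz => k; rewrite -zeE.
 have k' : 30%:R * ze * c ^+ 5 * x = 7%:R by apply/eqP; rewrite -subr_eq0 -oppr_eq0 opprB k.
 have x14 : x ^+ 14 = - 15%:R.
 have : 30%:R * (4%:R * ze * c ^+ 5 * x ^+ 15) = 4%:R * 7%:R * x ^+ 14 by rewrite -k'; ring.
 rewrite h => h2; have : 2%:R * (x ^+ 14 + 15%:R) = 0.
 have -> : 2%:R * (x ^+ 14 + 15%:R) = 30%:R * (x ^+ 14 + 1) - 4%:R * 7%:R * x ^+ 14 by ring.
 by rewrite h2 subrr.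
 by move=> /eqP; rewrite mulf_eq0 pnatr_eq0 addr_eq0 => /eqP.
 have : (30%:R * ze * c ^+ 5 * x) ^+ 14 = 7%:R ^+ 14 by rewrite k'.
 have E (a : C) : (a * ze * c ^+ 5 * x) ^+ 14 = a ^+ 14 * ze ^+ 14 * c ^+ 70 * x ^+ 14 by ring.
 by rewrite E x14 => <-; move: (30%:R ^+ 14) => a; ring.
have a0 : 4%:R * ze * c ^+ 5 != 0 by rewrite !mulf_neq0 ?expf_neq0 ?pnatr_eq0.
pose p : {poly C} := (4%:R * ze * c ^+ 5) *: 'X^15 - ('X^14 + 1%:P).
have rootE x : root p x -> 4%:R * ze * c ^+ 5 * x ^+ 15 = x ^+ 14 + 1.
 by rewrite /root /p !hornerE subr_eq0 => /eqP.
have [||r ri rr] := @distinct_roots C p 15.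
- rewrite /p size_polyDl size_scale// size_polyXn// size_polyN size_XnaddC//.
- move=> x /rootE h; have -> : p^`().[x] = - (2%:R * x ^+ 13 * (7%:R - 30%:R * ze * c ^+ 5 * x)).
 rewrite /p derivB derivZ derivD !derivXn derivC addr0 hornerD hornerN hornerZ !hornerMn !hornerXn /=.
 by rewrite -(mulr_natr _ 15) -(mulr_natr _ 14); ring.
 have x0 : x != 0.
 by apply/eqP => x0; move: h => /eqP; rewrite x0 !expr0n /= mulr0 add0r eq_sym oner_eq0.
 by rewrite oppr_eq0 mulf_neq0 ?simple// mulf_neq0 ?pnatr_eq0// expf_neq0.
by exists r; split=> // j; [exact/rootE|exact/simple/rootE].
Qed.
Lemma Le_number_generic (c t : C) : c != 0 -> t = - 5%:R * c ^+ 4 ->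
 12005%:R ^+ 7 + 225%:R * (1296%:R * t ^+ 5) ^+ 7 != 0 ->
 1 + 15%:R * (30%:R / 7%:R * c ^+ 5) ^+ 14 != 0 ->
 7%:R ^+ 14 + 15%:R * 30%:R ^+ 14 * 1 * c ^+ 70 != 0 ->
 7%:R ^+ 14 + 15%:R * 30%:R ^+ 14 * (-1) * c ^+ 70 != 0 ->
 Le_number (germ_of_mpoly (f_family t ^+ 2)) 1 = 30%N.
Proof.
move=> c0 tE n1 n2 n3 n4.
have t0 : t != 0 by rewrite tE mulf_neq0 ?oppr_eq0 ?pnatr_eq0 ?expf_neq0.
have i0' : 'i != 0 :> C by exact: neq0Ci.
have i2 : 'i ^+ 2 = -1 :> C by exact: sqrCi.
have i14 : 'i ^+ 14 = -1 :> C by rewrite (_ : 14 = 2 * 7)%N// exprM i2 -signr_odd expr1.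
have [r [ri rE rn]] := initial_forms c0 (oner_neq0 C) (expr1n C 14) n3.
have [u [ui uE un]] := initial_forms c0 i0' i14 n4.
pose w (j : 'I_30) := match fintype.split (j : 'I_(15 + 15)) with inl a => r a | inr b => u b end.
pose ze (j : 'I_30) : C := if fintype.split (j : 'I_(15 + 15)) is inl _ then 1 else 'i.
have wE j : 4%:R * ze j * c ^+ 5 * w j ^+ 15 = w j ^+ 14 + 1.
 by rewrite /ze /w; case: (fintype.split _) => k.
have wn j : 7%:R - 30%:R * ze j * c ^+ 5 * w j != 0.
 by rewrite /ze /w; case: (fintype.split _) => k.
have ze4 j : ze j ^+ 4 = 1.
 rewrite /ze; case: (fintype.split _) => _; first by rewrite expr1n.
 by rewrite (_ : 4 = 2 * 2)%N// exprM i2 sqrrN expr1n.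
have ze0 j : ze j != 0 by rewrite /ze; case: (fintype.split _) => _ //; exact: oner_neq0.
have w0 j : w j != 0.
 apply/eqP => h; have /eqP := wE j; rewrite h !expr0n /= mulr0 add0r eq_sym.
 by rewrite oner_eq0.
apply: Le_numberE => L L13 M2 _ _.
apply: (@multiplicity_generic C t L t0 n1 L13 M2 _ (fun j => w j ^+ 2) (fun j => ze j * c * w j ^+ 3)).
- by move=> v v0; exact: (arc_dense tE c0 n2 v0).
- move=> j; rewrite tE.
 transitivity (5%:R * c ^+ 4 * w j ^+ 12 * (ze j ^+ 4 - 1)); first by ring.
 by rewrite ze4 subrr mulr0.
- move=> j; rewrite tE.
 transitivity (w j ^+ 14 + 1 - 4%:R * ze j * c ^+ 5 * w j ^+ 15 +
 c ^+ 5 * w j ^+ 15 * ze j * (ze j ^+ 4 - 1)); first by ring.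
 by rewrite wE ze4 !subrr mulr0 addr0.
- by move=> j; rewrite !mulf_neq0 ?expf_neq0.
- by move=> j; rewrite expf_neq0.
- move=> j; rewrite tE (_ : _ + _ = w j ^+ 2 * (7%:R - 30%:R * ze j * c ^+ 5 * w j)); last by ring.
 by rewrite mulf_neq0 ?expf_neq0.
- move=> i j; have [wij|] := eqVneq (w i ^+ 2) (w j ^+ 2); last by left.
 have [zij|] := eqVneq (ze i * c * w i ^+ 3) (ze j * c * w j ^+ 3); last by right.
 have zw : ze i * w i = ze j * w j.
 have cw : c * w j ^+ 2 != 0 by rewrite mulf_neq0 ?expf_neq0.
 apply: (mulIf cw); have -> : ze j * w j * (c * w j ^+ 2) = ze j * c * w j ^+ 3 by ring.
 by rewrite -zij -{1}wij; ring.
 have z2 : ze i ^+ 2 = ze j ^+ 2.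
 by apply: (mulIf (expf_neq0 2 (w0 j))); rewrite -{1}wij -!exprMn zw.
 have m11 : (-1 : C) != 1 by rewrite -subr_eq0 -opprD oppr_eq0 -[1 + 1]/(2%:R) pnatr_eq0.
 case/negP; apply/eqP; apply: (can_inj (@splitK 15 15)).
 move: z2 zw; rewrite /ze /w; case: (fintype.split _) => a; case: (fintype.split _) => b;
 rewrite ?expr1n ?i2 ?mul1r => z2.
 + by move=> /ri ->.
 + by move: m11; rewrite -z2 eqxx.
 + by move: m11; rewrite z2 eqxx.
 + by move=> /(mulfI i0')/ui ->.
Qed.
Lemma avoid_small (p : {poly C}) (tau : C) : p != 0 -> 0 < tau ->
 exists c, [/\ c != 0, p.[c] != 0 & `|- 5%:R * c ^+ 4| < tau].
Proof.
move=> p0 t0; pose b := tau / (5%:R * (1 + tau)).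
have t1 : 0 < 1 + tau by rewrite addr_gt0.
have b0 : 0 < b by rewrite divr_gt0// mulr_gt0// ltr0n.
have [j pj] : exists j : 'I_(size p), p.[b / j.+1%:R] != 0.
 apply/existsP; rewrite -negb_forall; apply/negP => /forallP H.
 have := @max_poly_roots C p [seq b / j.+1%:R | j : 'I_(size p)] p0.
 rewrite size_image card_ord ltnn => h; suff : false by []; apply: h.
 by apply/allP => x /mapP[j _ ->]; exact: H.
 rewrite map_inj_uniq ?enum_uniq// => i j /(mulfI (lt0r_neq0 b0))/invr_inj/eqP.
 by rewrite eqr_nat eqSS => /eqP/val_inj.
exists (b / j.+1%:R).
have c0 : 0 < b / j.+1%:R by rewrite divr_gt0// ltr0n.
have cb : b / j.+1%:R <= b by rewrite ler_pdivrMr ?ltr0n// ler_peMr ?ler1n// ltW.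
have b5 : 5%:R * b < tau.
 have -> : 5%:R * b = tau / (1 + tau).
 by rewrite /b; field; rewrite gt_eqF.
 by rewrite ltr_pdivrMr// mulrDr mulr1 ltrDl mulr_gt0.
have b1 : b <= 1.
 rewrite /b ler_pdivrMr ?mulr_gt0 ?ltr0n// mul1r mulrDr mulr1.
 rewrite (le_trans (y := 5%:R * tau)) ?lerDr ?ler0n//.
 by rewrite ler_peMl ?ler1n// ltW.
split=> //; first by rewrite gt_eqF.
rewrite mulNr normrN ger0_norm; last by rewrite mulr_ge0 ?exprn_ge0 ?ltW// ltr0n.
apply: le_lt_trans b5; rewrite ler_pM2l ?ltr0n//; apply: (le_trans _ (cb)).
rewrite -[leRHS]expr1; apply: ler_wiXn2l => //; first exact: ltW.
exact: le_trans cb b1.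
Qed.

Theorem Le_numbers_vary : ~ (exists2 tau : C, 0 < tau &
 forall (t : C) (k : 'I_4), `|t| < tau ->
 Le_number (germ_of_mpoly (f_family t ^+ 2)) k =
 Le_number (germ_of_mpoly (f_family (0 : C) ^+ 2)) k).
Proof.
case=> tau tau0 H.
pose p1 : {poly C} := (12005%:R ^+ 7)%:P + (225%:R)%:P * ((1296%:R)%:P * ((- 5%:R)%:P * 'X^4) ^+ 5) ^+ 7.
pose p2 : {poly C} := 1%:P + 15%:R%:P * ((30%:R / 7%:R)%:P * 'X^5) ^+ 14.
pose p3 (e : C) : {poly C} := (7%:R ^+ 14)%:P + (15%:R * 30%:R ^+ 14 * e)%:P * 'X^70.
have nz (p : {poly C}) : p.[0] != 0 -> p != 0.
 by move=> h; apply: contra_neq h => ->; rewrite horner0.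
have h1 c : p1.[c] = 12005%:R ^+ 7 + 225%:R * (1296%:R * (- 5%:R * c ^+ 4) ^+ 5) ^+ 7.
 by rewrite /p1 !(hornerD, hornerC, hornerXn, horner_exp, hornerM).
have h2 c : p2.[c] = 1 + 15%:R * (30%:R / 7%:R * c ^+ 5) ^+ 14.
 by rewrite /p2 !(hornerD, hornerC, hornerXn, horner_exp, hornerM).
have h3 e c : (p3 e).[c] = 7%:R ^+ 14 + 15%:R * 30%:R ^+ 14 * e * c ^+ 70.
 by rewrite /p3 !(hornerD, hornerC, hornerXn, horner_exp, hornerM).
have z1 : p1 != 0 by apply: nz; rewrite h1 !(expr0n, mulr0, addr0) expf_neq0// pnatr_eq0.
have z2 : p2 != 0 by apply: nz; rewrite h2 !(expr0n, mulr0, addr0) oner_neq0.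
have z3 e : p3 e != 0 by apply: nz; rewrite h3 expr0n mulr0 addr0 expf_neq0// pnatr_eq0.
have [|c [c0 pc tc]] := @avoid_small (p1 * p2 * (p3 1 * p3 (-1))) tau _ tau0.
 by rewrite !mulf_neq0.
move: pc; rewrite !hornerM !mulf_eq0 !negb_or h1 h2 !h3 => /andP[/andP[a1 a2] /andP[a3 a4]].
have := H _ (Ordinal (isT : (1 < 4)%N)) tc.
by rewrite /= (Le_number_generic c0 erefl a1 a2 a3 a4) Le_number_special.
Qed.

End LeNumbersVary.

End Gt.
Import Gt.

(** * Bounded Lipschitz functions and fixed points *)

Module Ta.
Section BoundedLipschitz.
Variables (C : numClosedFieldType) (P : Type) (D : P -> Prop) (d : P -> P -> C).
Hypothesis d_ge0 : forall p q, 0 <= d p q.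
Implicit Types F G : P -> C.

Definition BL F := exists2 K, 0 <= K & (forall p, D p -> `|F p| <= K) /\
 (forall p q, D p -> D q -> `|F p - F q| <= K * d p q).

Lemma BL_eq F G : BL F -> (forall p, D p -> F p = G p) -> BL G.
Proof.
move=> [K K0 [b l]] E; exists K => //; split=> [p Dp|p q Dp Dq]; rewrite -!E//; [exact: b|exact: l].
Qed.
Lemma BLc c : BL (fun=> c).
Proof. by exists `|c| => //; split=> // p q _ _; rewrite subrr normr0 mulr_ge0. Qed.
Lemma BLD F G : BL F -> BL G -> BL (fun p => F p + G p).
Proof.
move=> [K K0 [b l]] [M M0 [b' l']]; exists (K + M); first exact: addr_ge0.
split=> [p Dp|p q Dp Dq].
 by rewrite (le_trans (ler_normD _ _))// lerD ?b ?b'.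
rewrite opprD addrACA (le_trans (ler_normD _ _))// mulrDl lerD ?l ?l'//.
Qed.
Lemma BLN F : BL F -> BL (fun p => - F p).
Proof.
move=> [K K0 [b l]]; exists K => //; split=> [p Dp|p q Dp Dq]; first by rewrite normrN b.
by rewrite -opprD normrN l.
Qed.
Lemma BLB F G : BL F -> BL G -> BL (fun p => F p - G p).
Proof. by move=> hF hG; apply: BLD => //; apply: BLN. Qed.
Lemma distM (a b a' b' : C) : `|a * b - a' * b'| <= `|a| * `|b - b'| + `|a - a'| * `|b'|.
Proof.
have -> : a * b - a' * b' = a * (b - b') + (a - a') * b' by ring.
by rewrite (le_trans (ler_normD _ _))// !normrM.
Qed.
Lemma BLM F G : BL F -> BL G -> BL (fun p => F p * G p).
Proof.
move=> [K K0 [b l]] [M M0 [b' l']]; have KM : 0 <= K * M by exact: mulr_ge0.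
exists (2%:R * (K * M)); first by rewrite mulr_ge0.
split=> [p Dp|p q Dp Dq].
 by rewrite normrM (le_trans (ler_pM _ _ (b p Dp) (b' p Dp)))// ler_peMl// ler1n.
apply: le_trans (distM _ _ _ _) _; rewrite mulrDl mul1r mulrDl.
apply: lerD; first by rewrite -mulrA; apply: ler_pM; rewrite ?b ?l'.
by rewrite mulrAC; apply: ler_pM; rewrite ?b' ?l.
Qed.
Lemma BLX F n : BL F -> BL (fun p => F p ^+ n).
Proof.
move=> hF; elim: n => [|n IH]; first exact: (BLc 1).
by apply: (@BL_eq (fun p => F p * F p ^+ n)) => [|p _]; [exact: BLM|rewrite exprS].
Qed.
Lemma BLconj F : BL F -> BL (fun p => (F p)^*).
Proof.
move=> [K K0 [b l]]; exists K => //; split=> [p Dp|p q Dp Dq]; first by rewrite norm_conjC b.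
by rewrite -rmorphB norm_conjC l.
Qed.
Lemma BLnorm F : BL F -> BL (fun p => `|F p|).
Proof.
move=> [K K0 [b l]]; exists K => //; split=> [p Dp|p q Dp Dq]; first by rewrite normr_id b.
by apply: le_trans (ler_dist_dist _ _) _; exact: l.
Qed.
Lemma BLV F m : 0 < m -> (forall p, D p -> m <= `|F p|) -> BL F -> BL (fun p => (F p)^-1).
Proof.
move=> m0 hm [K K0 [b l]].
have V p : D p -> `|(F p)^-1| <= m^-1.
 by move=> Dp; rewrite normfV lef_pV2 ?posrE// ?hm// (lt_le_trans m0)// hm.
have nz p : D p -> F p != 0 by move=> Dp; rewrite -normr_gt0 (lt_le_trans m0)// hm.
have Vm : 0 <= m^-1 by rewrite invr_ge0 ltW.
have KV : 0 <= K * m^-1 * m^-1 by rewrite !mulr_ge0.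
exists (m^-1 + K * m^-1 * m^-1); first exact: addr_ge0.
split=> [p Dp|p q Dp Dq]; first by rewrite (le_trans (V p Dp))// lerDl.
have -> : (F p)^-1 - (F q)^-1 = - (F p - F q) * ((F p)^-1 * (F q)^-1).
 by field; rewrite !nz.
rewrite normrM normrN normrM (le_trans (y := K * d p q * (m^-1 * m^-1)))//.
 by apply: ler_pM; rewrite ?mulr_ge0// ?l// ler_pM ?V.
rewrite mulrDl (le_trans (y := K * m^-1 * m^-1 * d p q))//; last by rewrite lerDr mulr_ge0.
by rewrite -!mulrA [d p q * _]mulrC -!mulrA.
Qed.

End BoundedLipschitz.

Lemma BL_comp (C : numClosedFieldType) (P Q : Type) (D : P -> Prop) (D' : Q -> Prop)
 (d : P -> P -> C) (d' : Q -> Q -> C) (phi : Q -> P) (M : C) F :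
 0 <= M -> (forall q, D' q -> D (phi q)) -> (forall p q, 0 <= d' p q) ->
 (forall p q, D' p -> D' q -> d (phi p) (phi q) <= M * d' p q) ->
 BL D d F -> BL D' d' (fun q => F (phi q)).
Proof.
move=> M0 hD d0 hd [K K0 [b l]].
exists (K + K * M); first by rewrite addr_ge0// mulr_ge0.
split=> [q Dq|p q Dp Dq].
 by rewrite (le_trans (b _ (hD _ Dq)))// lerDl mulr_ge0.
apply: le_trans (l _ _ (hD _ Dp) (hD _ Dq)) _; rewrite mulrDl.
rewrite (le_trans (y := K * M * d' p q))//; last by rewrite lerDr mulr_ge0.
by rewrite -mulrA ler_wpM2l// hd.
Qed.

Definition n1 (C : numClosedFieldType) n (x : 'rV[C]_n) : C := \sum_i `|x ord0 i|.

Section OneNorm.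
Variables (C : numClosedFieldType) (n : nat).
Implicit Types x y : 'rV[C]_n.
Lemma n1_ge0 x : 0 <= n1 x. Proof. exact: sumr_ge0. Qed.
Lemma n1D x y : n1 (x + y) <= n1 x + n1 y.
Proof. by rewrite /n1 -big_split; apply: ler_sum => i _; rewrite mxE ler_normD. Qed.
Lemma n1N x : n1 (- x) = n1 x.
Proof. by apply: eq_bigr => i _; rewrite mxE normrN. Qed.
Lemma n1C x y : n1 (x - y) = n1 (y - x). Proof. by rewrite -n1N opprB. Qed.
Lemma n1_triangle y x z : n1 (x - z) <= n1 (x - y) + n1 (y - z).
Proof. by have := n1D (x - y) (y - z); rewrite addrA subrK. Qed.
Lemma n1_coord x i : `|x ord0 i| <= n1 x.
Proof. by rewrite /n1 (bigD1 i)//= lerDl sumr_ge0. Qed.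
Lemma n1_eq0 x : n1 x = 0 -> x = 0.
Proof.
move=> x0; apply/rowP => i; rewrite mxE; apply/eqP; rewrite -normr_le0 -x0; exact: n1_coord.
Qed.
End OneNorm.

Section Complete.
Variable R : realType.
Local Notation C := (Cplx R).

Lemma pow2_gt (x : R) : exists n, x < 2%:R ^+ n.
Proof.
exists (Num.bound `|x|); apply: le_lt_trans (ler_norm x) _.
apply: lt_le_trans (archi_boundP (normr_ge0 x)) _.
by rewrite -natrX ler_nat ltnW// ltn_expl.
Qed.
Lemma geo_le (a b K : C) : a \is Num.real -> b \is Num.real -> K \is Num.real ->
 (forall n, a <= b + K / 2%:R ^+ n) -> a <= b.
Proof.
move=> /RRe_real <- /RRe_real <- /RRe_real <-; move: (complex.Re a) (complex.Re b) (complex.Re K) => {a b K} a b K H.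
rewrite lecR; apply/ler_addgt0Pr => e e0; have [n hn] := pow2_gt (`|K| / e).
have := H n; rewrite -(rmorph_nat (real_complex R)) -rmorphXn -fmorphV -rmorphM -rmorphD lecR => h.
apply: le_trans h _; rewrite lerD2l ler_pdivrMr ?exprn_gt0//.
apply: le_trans (ler_norm K) _; rewrite -ler_pdivrMl// mulrC; exact: ltW.
Qed.
Lemma geo_complete_real (a : nat -> R) (M : R) : 0 <= M ->
 (forall n, `|a n - a n.+1| <= M / 2%:R ^+ n) ->
 exists l, forall n, `|a n - l| <= 2%:R * M / 2%:R ^+ n.
Proof.
move=> M0 H; pose g n := 2%:R * M / 2%:R ^+ n.
have gS n : g n.+1 = M / 2%:R ^+ n by rewrite /g exprS invfM mulrACA divff ?mul1r// pnatr_eq0.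
have gD n : g n = M / 2%:R ^+ n + M / 2%:R ^+ n by rewrite /g; ring.
have g0 n : 0 <= g n by rewrite /g divr_ge0 ?mulr_ge0 ?exprn_ge0.
have up m n : (m <= n)%N -> a m - g m <= a n - g n.
 elim: n => [|n IH]; first by rewrite leqn0 => /eqP ->.
 rewrite leq_eqVlt => /orP[/eqP -> //|]; rewrite ltnS => /IH h; apply: le_trans h _.
 by have := H n; rewrite ler_norml gS gD => /andP[h1 h2]; lra.
have dn m n : (m <= n)%N -> a n + g n <= a m + g m.
 elim: n => [|n IH]; first by rewrite leqn0 => /eqP ->.
 rewrite leq_eqVlt => /orP[/eqP -> //|]; rewrite ltnS => /IH h; apply: le_trans _ h.
 by have := H n; rewrite ler_norml gS gD => /andP[h1 h2]; lra.
have ub m n : a n - g n <= a m + g m.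
 have h1 := up _ _ (leq_maxl n m); have h2 := dn _ _ (leq_maxr n m); have := g0 (maxn n m); lra.
pose E := range (fun n => a n - g n).
have hs : has_sup E by split; [exists (a 0%N - g 0%N), 0%N|exists (a 0%N + g 0%N) => _ [n _ <-]; exact: ub].
exists (sup E) => n; rewrite ler_norml -/(g n).
have h1 : a n - g n <= sup E by apply: ub_le_sup; [case: hs|exists n].
have h2 : sup E <= a n + g n by apply: ge_sup; [case: hs|move=> _ [m _ <-]; exact: ub].
by apply/andP; split; lra.
Qed.
Lemma geo_complete n (x : nat -> 'rV[C]_n) (M : C) : 0 <= M ->
 (forall k, n1 (x k - x k.+1) <= M / 2%:R ^+ k) ->
 exists l K, 0 <= K /\ forall k, n1 (x k - l) <= K / 2%:R ^+ k.
Proof.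
move=> M0 H; have [m mE] : exists m : R, M = m%:C%C by exists (complex.Re M); rewrite RRe_real// ger0_real.
have m0 : 0 <= m by rewrite -lecR -mE.
have two k : (2%:R ^+ k : C) = (2%:R ^+ k)%:C%C by rewrite rmorphXn rmorph_nat.
have Mk k : M / 2%:R ^+ k = (m / 2%:R ^+ k)%:C%C by rewrite mE two rmorphM fmorphV.
have part (g : {additive C -> R}) : (forall z, `|g z|%:C%C <= `|z|) ->
 exists l : 'I_n -> R, forall i k, `|g (x k ord0 i) - l i| <= 2%:R * m / 2%:R ^+ k.
 move=> gn; have h (i : 'I_n) : exists l, forall k, `|g (x k ord0 i) - l| <= 2%:R * m / 2%:R ^+ k.
 apply: geo_complete_real => // k; rewrite -lecR -Mk -raddfB; apply: le_trans (gn _) _.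
 by apply: le_trans (H k); have := n1_coord (x k - x k.+1) i; rewrite !mxE.
 have [l hl] := choice h; by exists l.
have [lr hr] := part (@complex.Re R) (@normc_ge_Re R).
have [|li hi] := part (@complex.Im R).
 by move=> z; have := normc_ge_Re (z * 'i%C); rewrite ReiNIm normrN normrM normCi mulr1.
exists (\row_i (lr i +i* li i)%C), (\sum_(i < n) (2%:R * m + 2%:R * m)%:C%C); split.
 by apply: sumr_ge0 => i _; rewrite lecR addr_ge0// mulr_ge0.
move=> k; rewrite /n1 mulr_suml; apply: ler_sum => i _; rewrite !mxE two -fmorphV -rmorphM.
rewrite [X in `|X|]complexE; apply: le_trans (ler_normD _ _) _; rewrite normrM normCi mul1r.
have nR (r : R) : `|r%:C%C : C| = `|r|%:C%C by rewrite normc_def /= expr0n addr0 sqrtr_sqr.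
rewrite !nR mulrDl rmorphD lerD ?lecR//; last by have := hi i k; case: (x k ord0 i).
by have := hr i k; case: (x k ord0 i).
Qed.
Lemma banach n (y : 'rV[C]_n) (s : C) (T : 'rV[C]_n -> 'rV[C]_n) : 0 <= s ->
 (forall x, n1 (x - y) <= s -> n1 (T x - y) <= s) ->
 (forall x x', n1 (x - y) <= s -> n1 (x' - y) <= s -> n1 (T x - T x') <= n1 (x - x') / 2%:R) ->
 exists2 x, n1 (x - y) <= s & T x = x.
Proof.
move=> s0 hT hc; pose x k := iter k T y.
have xs k : n1 (x k - y) <= s.
 elim: k => [|k IH]; last exact: hT.
 by rewrite subrr /n1 big1// => i _; rewrite mxE normr0.
pose M := n1 (x 0%N - x 1%N).
have step k : n1 (x k - x k.+1) <= M / 2%:R ^+ k.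
 elim: k => [|k IH]; first by rewrite expr0 divr1.
 apply: le_trans (hc _ _ (xs k) (xs k.+1)) _; rewrite exprSr invfM mulrA ler_wpM2r ?invr_ge0//.
have [l [K [K0 hl]]] := geo_complete (n1_ge0 _) step.
have rK : K \is Num.real by exact: ger0_real.
have rn (z : 'rV[C]_n) : n1 z \is Num.real by apply: ger0_real; exact: n1_ge0.
have ls : n1 (l - y) <= s.
 apply: (@geo_le _ _ K) => //; first exact: ger0_real.
 move=> k; apply: le_trans (n1_triangle (x k) _ _) _; rewrite addrC lerD//.
 by rewrite n1C hl.
exists l => //; apply/eqP; rewrite -subr_eq0; apply/eqP/n1_eq0/eqP; rewrite eq_le n1_ge0 andbT.
apply: (@geo_le _ _ (K + K)) => //; first exact: realD.
move=> k; rewrite add0r mulrDl; apply: le_trans (n1_triangle (x k.+1) _ _) _.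
apply: lerD.
 apply: le_trans (hc _ _ ls (xs k)) _; rewrite ler_pdivrMr// n1C.
 by apply: le_trans (hl k) _; rewrite ler_peMr ?ler1n// divr_ge0// exprn_ge0.
apply: le_trans (hl _) _; rewrite ler_wpM2l// lef_pV2 ?posrE ?exprn_gt0// ler_eXn2l ?ltr1n//.
Qed.
Lemma banach1 (s : C) (T : C -> C) : 0 <= s ->
 (forall u, `|u| <= s -> `|T u| <= s) ->
 (forall u v, `|u| <= s -> `|v| <= s -> `|T u - T v| <= `|u - v| / 2%:R) ->
 exists2 u, `|u| <= s & T u = u.
Proof.
move=> s0 hT hc; have n11 (x : 'rV[C]_1) : n1 x = `|x ord0 ord0| by rewrite /n1 big_ord1.
have [|x xs|x x' xs xs'|x xs hx] := @banach 1 0 s (fun x => \row_i T (x ord0 ord0)) => //.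
- by rewrite n11 !mxE subr0; apply: hT; move: xs; rewrite n11 !mxE subr0.
- rewrite !n11 !mxE; apply: hc; first by move: xs; rewrite n11 !mxE subr0.
 by move: xs'; rewrite n11 !mxE subr0.
exists (x ord0 ord0); first by move: xs; rewrite n11 !mxE subr0.
by rewrite -{2}hx mxE.
Qed.

(** The weighted circle action and its gauge. *)
Definition w4 (i : 'I_4) : nat := wt [:: 2; 4; 6; 15]%N i.
Definition act (p : C) (x : 'rV[C]_4) : 'rV[C]_4 := \row_i (p ^+ w4 i * x ord0 i).
Definition sq (x : 'rV[C]_4) : C := \sum_i `|x ord0 i| ^+ 2.

Lemma gauge_exists (x : 'rV[C]_4) : x != 0 -> exists2 p : C, 0 < p & sq (act p x) = 1.
Proof.
move=> x0; have [j xj] : exists j, x ord0 j != 0.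
 apply/existsP; rewrite -negb_forall; apply: contra x0 => /forallP H.
 by apply/eqP/rowP => i; rewrite mxE; exact/eqP.
pose a i : R := complex.Re (`|x ord0 i| ^+ 2).
have aE i : (a i)%:C%C = `|x ord0 i| ^+ 2 by rewrite RRe_real// ger0_real// exprn_ge0.
have a0 i : 0 <= a i by rewrite -lecR aE exprn_ge0.
have aj : 0 < a j by rewrite -ltcR aE exprn_gt0// normr_gt0.
have w0 i : (0 < w4 i * 2)%N by case: (ord4E i) => ->; rewrite /w4 /wt nth4.
pose q : {poly R} := \sum_i (a i)%:P * 'X^(w4 i * 2) - 1%:P.
have qE r : q.[r] = \sum_i a i * r ^+ (w4 i * 2) - 1.
 by rewrite /q hornerD hornerN hornerC horner_sum; congr (_ - _); apply: eq_bigr => i _; rewrite hornerM hornerC hornerXn.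
pose M := 1 + (a j)^-1.
have M1 : 1 <= M by rewrite lerDl invr_ge0 ltW.
have q0 : q.[0] = -1.
 by rewrite qE big1 ?add0r// => i _; rewrite expr0n eqn0Ngt w0 mulr0.
have [||r /andP[r0 _] /rootP rq] := @poly_ivt _ q 0 M; first exact: le_trans M1.
 rewrite q0 lerN10 /= qE (bigD1 j)//= -addrA addrC -addrA.
 have h1 : 1 <= a j * M ^+ (w4 j * 2).
 apply: (@le_trans _ _ (a j * M)).
 by rewrite mulrDr mulfV ?gt_eqF// mulr1 lerDr ltW.
 by rewrite ler_wpM2l// -{1}[M]expr1 ler_weXn2l.
 have h2 : 0 <= \sum_(i < 4 | i != j) a i * M ^+ (w4 i * 2).
 by apply: sumr_ge0 => i _; rewrite mulr_ge0// exprn_ge0// (le_trans _ M1).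
 lra.
have r1 : 0 < r.
 rewrite lt_neqAle r0 andbT; apply/eqP => r00; move: rq; rewrite -r00 q0 => /eqP.
 by rewrite oppr_eq0 oner_eq0.
exists r%:C%C; first by rewrite ltcR.
have := rq; rewrite qE => /eqP; rewrite subr_eq0 => /eqP /(congr1 (real_complex R)).
rewrite rmorph_sum rmorph1 => <-; apply: eq_bigr => i _.
rewrite mxE normrM exprMn -aE rmorphM rmorphXn mulrC; congr (_ * _).
by rewrite normrX -exprM ger0_norm// lecR.
Qed.

End Complete.

End Ta.
Import Ta.

(** * The weighted gauge *)

Module Tb.
Section Gauge.
Variable R : realType.
Local Notation C := (Cplx R).
Implicit Types x y : 'rV[C]_4.

Lemma w4_bounds i : (2 <= w4 i <= 15)%N.
Proof. by case: (ord4E i) => ->; rewrite /w4 /wt nth4. Qed.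
Lemma sq_act (p : C) x : 0 <= p -> sq (act p x) = \sum_i p ^+ (w4 i * 2) * `|x ord0 i| ^+ 2.
Proof.
move=> p0; apply: eq_bigr => i _; rewrite mxE normrM exprMn normrX -exprM.
by rewrite ger0_norm.
Qed.
Lemma act_act (p q : C) x : act p (act q x) = act (p * q) x.
Proof. by apply/rowP => i; rewrite !mxE mulrA exprMn. Qed.
Lemma act1 x : act 1 x = x. Proof. by apply/rowP => i; rewrite mxE expr1n mul1r. Qed.
Lemma gauge_lip (p q : C) x y : 0 < q -> q <= p -> sq (act p x) = 1 -> sq (act q y) = 1 ->
 p - q <= p * \sum_i q ^+ (w4 i * 2) * `| `|x ord0 i| ^+ 2 - `|y ord0 i| ^+ 2|.
Proof.
move=> q0 qp; have p0 : 0 <= p by apply: le_trans qp; exact: ltW.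
rewrite !sq_act// ?(ltW q0)// => hx hy.
rewrite -[leLHS]mulr1 -[X in _ * X <= _]hx.
have E (r : C) i : r ^+ (w4 i * 2) = r * r ^+ (w4 i * 2).-1.
 by rewrite -exprS prednK// muln_gt0 andbT; have /andP[h _] := w4_bounds i; exact: leq_trans h.
apply: (@le_trans _ _ (p * \sum_i (p ^+ (w4 i * 2) - q ^+ (w4 i * 2)) * `|x ord0 i| ^+ 2)).
 rewrite !mulr_sumr; apply: ler_sum => i _; rewrite !E -subr_ge0.
 set P := p ^+ _; set Q := q ^+ _; set X := `|x ord0 i| ^+ 2.
 have -> : p * ((p * P - q * Q) * X) - (p - q) * (p * P * X) = p * q * X * (P - Q) by ring.
 rewrite !mulr_ge0 ?exprn_ge0 ?(ltW q0)// subr_ge0 lerXn2r ?nnegrE// ltW//.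
rewrite ler_wpM2l//; apply: (@le_trans _ _ (\sum_i q ^+ (w4 i * 2) * (`|y ord0 i| ^+ 2 - `|x ord0 i| ^+ 2))).
 rewrite (eq_bigr (fun i => p ^+ (w4 i * 2) * `|x ord0 i| ^+ 2 - q ^+ (w4 i * 2) * `|x ord0 i| ^+ 2)).
 rewrite sumrB hx -{1}hy -sumrB; apply: ler_sum => i _; by rewrite mulrBr.
 by move=> i _; rewrite mulrBl.
apply: ler_sum => i _; rewrite ler_wpM2l ?exprn_ge0 ?(ltW q0)// distrC.
by apply: real_ler_norm; rewrite realB// realX// normr_real.
Qed.

Definition nu x : C := xget 0 [set p : C | 0 < p /\ sq (act p x) = 1].
Definition lam x : C := (nu x)^-1.
Definition th x := act (nu x) x.

Lemma nuP x : x != 0 -> 0 < nu x /\ sq (act (nu x) x) = 1.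
Proof.
move=> x0; rewrite /nu; case: xgetP => [p -> //|h]; have [p p0 hp] := gauge_exists x0.
by case: (h p).
Qed.
Lemma nu_uniq x p : x != 0 -> 0 < p -> sq (act p x) = 1 -> nu x = p.
Proof.
move=> x0 p0 hp; have [n0 hn] := nuP x0.
have le q r : 0 < q -> 0 < r -> sq (act q x) = 1 -> sq (act r x) = 1 -> q <= r -> r <= q.
 move=> q0 r0 hq hr qr; have := gauge_lip q0 qr hr hq; rewrite big1 ?mulr0 ?subr_le0//.
 by move=> i _; rewrite subrr normr0 mulr0.
have /orP[h|h] := real_leVge (gtr0_real n0) (gtr0_real p0).
 by apply/eqP; rewrite eq_le h (le (nu x) p).
by apply/eqP; rewrite eq_le h (le p (nu x)).
Qed.
Lemma nu0 : nu 0 = 0.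
Proof.
rewrite /nu; case: xgetP => // p _ [p0]; rewrite /sq big1 => [/esym/eqP|i _]; first by rewrite oner_eq0.
by rewrite !mxE mulr0 normr0 expr0n.
Qed.
Lemma act_neq0 p x : p != 0 -> x != 0 -> act p x != 0.
Proof.
move=> p0; apply: contra => /eqP h; apply/eqP/rowP => i; have := congr1 (fun v : 'rV[C]_4 => v ord0 i) h.
by rewrite !mxE => /eqP; rewrite mulf_eq0 (negbTE (expf_neq0 _ p0)) => /eqP.
Qed.
Lemma nu_act m x : 0 < m -> x != 0 -> nu (act m x) = nu x / m.
Proof.
move=> m0 x0; have [n0 hn] := nuP x0; apply: nu_uniq; first by rewrite act_neq0// gt_eqF.
 exact: divr_gt0.
by rewrite act_act divfK ?gt_eqF.
Qed.
Lemma lam_gt0 x : x != 0 -> 0 < lam x. Proof. by move=> /nuP[h _]; rewrite invr_gt0. Qed.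
Lemma lam_act m x : 0 < m -> x != 0 -> lam (act m x) = m * lam x.
Proof. by move=> m0 x0; rewrite /lam nu_act// invfM invrK mulrC. Qed.
Lemma lam_th x : x != 0 -> act (lam x) (th x) = x.
Proof. by move=> x0; rewrite act_act mulVf ?act1// gt_eqF//; case: (nuP x0). Qed.
Lemma sq_th x : x != 0 -> sq (th x) = 1. Proof. by case/nuP. Qed.
Lemma th_act m x : 0 < m -> x != 0 -> th (act m x) = th x.
Proof. by move=> m0 x0; rewrite /th nu_act// act_act divfK// gt_eqF. Qed.

Definition annulus x := 2%:R^-1 <= sq x /\ sq x <= 2%:R.

Lemma sq0 : sq (0 : 'rV[C]_4) = 0.
Proof. by rewrite /sq big1// => i _; rewrite mxE normr0 expr0n. Qed.
Lemma sq_neq0 x : 0 < sq x -> x != 0.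
Proof. by move=> h; apply/eqP => x0; rewrite x0 sq0 ltxx in h. Qed.
Lemma annulus_neq0 x : annulus x -> x != 0.
Proof. by case=> h _; apply: sq_neq0; apply: lt_le_trans h; rewrite invr_gt0 ltr0n. Qed.
Lemma coord_le_sq x i : `|x ord0 i| ^+ 2 <= sq x.
Proof. by rewrite /sq (bigD1 i)//= lerDl sumr_ge0// => j _; rewrite exprn_ge0. Qed.
Lemma sphere_annulus x : sq x = 1 -> annulus x.
Proof. by move=> h; rewrite /annulus h invf_le1 ?ltr0n// !ler1n. Qed.
Lemma sphere_coord x i : sq x = 1 -> `|x ord0 i| <= 1.
Proof.
move=> h; have := coord_le_sq x i; rewrite h -[X in _ <= X](expr1n _ 2).
by rewrite ler_pXn2r ?nnegrE.
Qed.
Lemma annulus_coord x i : annulus x -> `|x ord0 i| <= 2%:R.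
Proof.
move=> [_ h]; have := le_trans (coord_le_sq x i) h => h2.
have : `|x ord0 i| ^+ 2 <= 2%:R ^+ 2 by apply: le_trans h2 _; rewrite expr2 ler_peMl ?ler1n.
by rewrite ler_pXn2r ?nnegrE.
Qed.
Lemma nu_sphere x : sq x = 1 -> nu x = 1.
Proof.
by move=> h; apply: nu_uniq; rewrite ?act1// ?ltr01//; apply: sq_neq0; rewrite h ltr01.
Qed.
Lemma nu_annulus x : annulus x -> 2%:R^-1 <= nu x /\ nu x <= 2%:R.
Proof.
move=> Ax; have [p0] := nuP (annulus_neq0 Ax); move: (nu x) p0 => p p0; rewrite (sq_act _ (ltW p0)) => hp.
have [lo up] := Ax; have rp := gtr0_real p0.
have two0 : (0 : C) < 2%:R by rewrite ltr0n.
have w2 i : (4 <= w4 i * 2)%N by have /andP[h _] := w4_bounds i; lia.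
split; rewrite real_leNgt ?gtr0_real ?invr_gt0//; apply/negP => h.
- have p1 : p <= 1 by rewrite ltW// (lt_trans h)// invf_lt1// ltr1n.
 have : 1 <= p ^+ 4 * sq x.
 rewrite -hp /sq mulr_sumr; apply: ler_sum => i _; rewrite ler_wpM2r ?exprn_ge0//.
 by apply: ler_wiXn2l => //; rewrite ltW.
 apply/negP; rewrite -real_ltNge ?realM ?realX ?real1//; last first.
 by apply: ger0_real; apply: sumr_ge0 => i _; rewrite exprn_ge0.
 have : p ^+ 4 * sq x <= (2%:R^-1) ^+ 4 * 2%:R.
 apply: ler_pM => //; first by rewrite exprn_ge0// ltW.
 by apply: sumr_ge0 => i _; rewrite exprn_ge0.
 by rewrite lerXn2r ?nnegrE ?invr_ge0 ?(ltW two0) ?(ltW p0) ?(ltW h).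
 move=> /le_lt_trans; apply; rewrite exprSr -mulrA mulVf ?gt_eqF// mulr1 exprn_ilt1 ?invr_ge0 ?ltW//.
 by rewrite invf_lt1// ltr1n.
- have p1 : 1 <= p by rewrite ltW// (lt_trans _ h)// ltr1n.
 have : p ^+ 4 * sq x <= 1.
 rewrite -hp /sq mulr_sumr; apply: ler_sum => i _; rewrite ler_wpM2r ?exprn_ge0//.
 by apply: ler_weXn2l.
 apply/negP; rewrite -real_ltNge ?realM ?realX ?real1//; last first.
 by apply: ger0_real; apply: sumr_ge0 => i _; rewrite exprn_ge0.
 apply: (@lt_le_trans _ _ (2%:R ^+ 4 * 2%:R^-1)).
 by rewrite exprSr mulfK ?gt_eqF// -natrX ltr1n.
 by apply: ler_pM; rewrite ?exprn_ge0 ?invr_ge0 ?(ltW two0)// lerXn2r ?nnegrE ?(ltW two0) ?(ltW p0) ?(ltW h).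
Qed.

Local Notation dn := (fun x y : 'rV[C]_4 => n1 (x - y)).
Let dn0 x y : 0 <= dn x y. Proof. exact: n1_ge0. Qed.
Lemma BL_coord i : BL annulus dn (fun x => x ord0 i).
Proof.
exists 2%:R; rewrite ?ler0n//; split=> [x Ax|x y _ _]; first exact: annulus_coord.
have := n1_coord (x - y) i; rewrite !mxE => h; apply: le_trans h _.
by rewrite ler_peMl ?ler1n// n1_ge0.
Qed.
Lemma BL_nu : BL annulus dn nu.
Proof.
have [k k1 kw] : exists2 k : C, 1 <= k & forall i, 2%:R ^+ (w4 i * 2) <= k.
 have e0 j : 0 <= 2%:R ^+ (w4 j * 2) :> C by rewrite exprn_ge0// ler0n.
 exists (1 + \sum_j 2%:R ^+ (w4 j * 2)) => [|i].
 by rewrite lerDl; apply: sumr_ge0 => j _; exact: e0.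
 rewrite (bigD1 i)//= addrCA lerDl addr_ge0 ?ler01//.
 by apply: sumr_ge0 => j _; exact: e0.
pose K : C := 2%:R * (k * 4%:R).
have K2 : 2%:R <= K by rewrite ler_peMr ?ler0n// mulr_ege1// ler1n.
exists K; first by apply: le_trans K2; rewrite ler0n.
split=> [x Ax|].
 have [lo up] := nu_annulus Ax; have [p0 _] := nuP (annulus_neq0 Ax).
 by rewrite gtr0_norm// (le_trans up).
suff H x y : annulus x -> annulus y -> nu y <= nu x -> nu x - nu y <= K * n1 (x - y).
 move=> x y Ax Ay; have [p0 _] := nuP (annulus_neq0 Ax); have [q0 _] := nuP (annulus_neq0 Ay).
 have /orP[h|h] := real_leVge (gtr0_real p0) (gtr0_real q0).
 by rewrite distrC ger0_norm ?subr_ge0// n1C H.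
 by rewrite ger0_norm ?subr_ge0// H.
move=> Ax Ay yx; have [p0 hp] := nuP (annulus_neq0 Ax); have [q0 hq] := nuP (annulus_neq0 Ay).
have [_ p2] := nu_annulus Ax; have [_ q2] := nu_annulus Ay.
apply: le_trans (gauge_lip q0 yx hp hq) _; rewrite /K -mulrA.
apply: ler_pM => //; rewrite ?(ltW p0)//.
 by apply: sumr_ge0 => i _; rewrite mulr_ge0// exprn_ge0// ltW.
rewrite /n1 -mulrA 2!mulr_sumr; apply: ler_sum => i _.
apply: ler_pM; rewrite ?exprn_ge0 ?(ltW q0)//.
 by apply: le_trans (kw i); rewrite lerXn2r ?nnegrE ?(ltW q0)// ler0n.
rewrite subr_sqr normrM mulrC !mxE; apply: ler_pM => //; last exact: ler_dist_dist.
rewrite ger0_norm ?addr_ge0// (_ : 4%:R = 2%:R + 2%:R :> C); last by rewrite -natrD.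
by rewrite lerD// annulus_coord.
Qed.
Lemma BL_lam : BL annulus dn lam.
Proof.
apply: (BLV dn0 (m := 2%:R^-1)); rewrite ?invr_gt0 ?ltr0n//; last exact: BL_nu.
move=> x Ax; have [lo up] := nu_annulus Ax; have [p0 _] := nuP (annulus_neq0 Ax).
by rewrite gtr0_norm.
Qed.
Lemma BL_th i : BL annulus dn (fun x => th x ord0 i).
Proof.
apply: (@BL_eq _ _ _ _ (fun x => nu x ^+ w4 i * x ord0 i)) => [|x _]; last by rewrite mxE.
exact: (BLM (BLX dn0 _ BL_nu) (BL_coord i)).
Qed.
Lemma near_sphere x v : sq x = 1 -> n1 v <= 6%:R^-1 -> annulus (x + v).
Proof.
move=> hx hv; have v1 : n1 v <= 1 by rewrite (le_trans hv)// invf_le1 ?ltr0n// ler1n.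
have : `|sq (x + v) - sq x| <= 3%:R * n1 v.
 rewrite /sq -sumrB /n1 mulr_sumr; apply: le_trans (ler_norm_sum _ _ _) _; apply: ler_sum => i _.
 rewrite subr_sqr normrM mulrC !mxE; apply: ler_pM => //.
 rewrite ger0_norm ?addr_ge0// (_ : 3%:R = 1 + 1 + 1 :> C); last by ring.
 rewrite addrAC lerD// ?sphere_coord//; apply: le_trans (ler_normD _ _) _.
 by apply: lerD; [exact: sphere_coord|exact: le_trans (n1_coord v i) v1].
 by apply: le_trans (ler_dist_dist _ _) _; rewrite addrAC subrr add0r.
move=> h; have {}h : `|sq (x + v) - sq x| <= 2%:R^-1.
 apply: le_trans h _; apply: le_trans (ler_wpM2l (ler0n _ 3) hv) _.
 by rewrite (_ : 3%:R / 6%:R = 2%:R^-1 :> C)//; field.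
have rs (z : 'rV[C]_4) : sq z \is Num.real by apply: ger0_real; apply: sumr_ge0 => i _; rewrite exprn_ge0.
move: h; rewrite hx real_ler_norml ?realB ?real1// => /andP[h1 h2]; split.
 by rewrite -(lerD2r (-1)) (le_trans _ h1)// (_ : 2%:R^-1 - 1 = - 2%:R^-1 :> C)//; field.
rewrite -(lerD2r (-1)) (le_trans h2)// (_ : 2%:R - 1 = 1 :> C); last by ring.
by rewrite invf_le1 ?ltr0n// ler1n.
Qed.

End Gauge.

(** The partial derivatives of the special member have no common zero on the unit sphere. *)
Lemma gradient_bound (R : realFieldType) (h a b c e g : R) : 2%:R * h = 1 ->
 0 <= a -> 0 <= b -> 0 <= c -> 0 <= e ->
 a ^+ 2 + b ^+ 2 + c ^+ 2 + e ^+ 2 = 1 -> b ^+ 7 - 15%:R * a ^+ 14 <= g -> 15%:R * a ^+ 14 - b ^+ 7 <= g ->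
 [\/ h ^+ 13 <= g, h ^+ 13 <= 7%:R * (a * b ^+ 6), h ^+ 13 <= 5%:R * c ^+ 4 | h ^+ 13 <= 2%:R * e].
Proof.
move=> h2 a0 b0 c0 e0 s g1 g2.
have h0 : 0 <= h by lra.
have h1 : h <= 1 by lra.
have up (x y : R) k : 0 <= y -> y <= x -> y ^+ k <= x ^+ k.
 by move=> y0 yx; rewrite lerXn2r ?nnegrE// (le_trans y0).
have hk k : 0 <= h ^+ k by exact: exprn_ge0.
have dn k l : (l <= k)%N -> h ^+ k <= h ^+ l by move=> lk; apply: ler_wiXn2l.
have half k : h ^+ k = 2%:R * h ^+ k.+1 by rewrite exprS mulrA h2 mul1r.
have [he|he] := lerP h e; first by apply: Or44; have := dn 13%N 0%N isT; rewrite expr0; lra.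
have [hc|hc] := lerP h c.
 by apply: Or43; have := up c h 4%N h0 hc; have := dn 13%N 4%N isT; have := hk 4%N; lra.
have [hb|hb] := lerP h b.
 have [ha|ha] := lerP (h ^+ 2) a.
 apply: Or42; have h6 := up b h 6%N h0 hb.
 have : h ^+ 2 * h ^+ 6 <= a * b ^+ 6 by apply: ler_pM.
 by rewrite -exprD; have := dn 13%N 8%N isT; have := hk 8%N; lra.
 apply: Or41; have h7 := up b h 7%N h0 hb.
 have := up (h ^+ 2) a 14%N a0 (ltW ha); rewrite -exprM.
 have := dn 28%N 12%N isT; have := dn 12%N 11%N isT; have := dn 13%N 11%N isT.
 by have := half 7%N; have := half 8%N; have := half 9%N; have := half 10%N; have := hk 11%N; lra.
have [ha|ha] := lerP h a; last first.
 exfalso; have sqb (x : R) : 0 <= x -> x < h -> x ^+ 2 < h ^+ 2.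
 by move=> x0 xh; rewrite ltrXn2r// nnegrE.
 have := sqb _ a0 ha; have := sqb _ b0 hb; have := sqb _ c0 hc; have := sqb _ e0 he.
 by have := half 0%N; have := half 1%N; rewrite expr0 expr1; lra.
have [hb4|hb4] := lerP (h ^+ 2) b.
 apply: Or42; have h6 := up b (h ^+ 2) 6%N (hk 2%N) hb4.
 have : h * h ^+ 2 ^+ 6 <= a * b ^+ 6 by apply: ler_pM; rewrite ?exprn_ge0.
 by rewrite -exprM -exprS; have := hk 13%N; lra.
apply: Or41; have h14 := up a h 14%N h0 ha.
have := up (h ^+ 2) b 7%N b0 (ltW hb4); rewrite -exprM.
by have := half 13%N; have := hk 14%N; rewrite (_ : 2 * 7 = 14)%N//; lra.
Qed.

End Tb.
Import Tb.

(** * The family and its gradient *)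

Module Tc.
Lemma f_family_eval (C : comNzRingType) (t : C) (v : 'I_4 -> C) : meval v (f_family t) =
 v (o4 2) ^+ 5 + t * (v (o4 1) ^+ 6 * v (o4 2)) + v (o4 1) ^+ 7 * v (o4 0) + v (o4 0) ^+ 15 + v (o4 3) ^+ 2.
Proof.
have X k n : meval v (mpolyX C (mnm1 k) ^+ n) = v k ^+ n by rewrite rmorphXn /= mevalXU.
by rewrite /f_family !mevalD mevalZ !X 2!mevalM !X !mevalXU.
Qed.

Section Family.
Variable R : realType.
Local Notation C := (Cplx R).
Implicit Types x y : 'rV[C]_4.
Local Notation "x ` k" := (x ord0 (o4 k)) (at level 2, k at level 2, format "x ` k").

Definition phi x := x`1 ^+ 6 * x`2.
Definition fE (t : C) x := x`2 ^+ 5 + t * phi x + x`1 ^+ 7 * x`0 + x`0 ^+ 15 + x`3 ^+ 2.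

Lemma fE_meval t x : meval (fun i => x ord0 i) (f_family t) = fE t x.
Proof. exact: f_family_eval. Qed.
Lemma fE_act t p x : fE t (act p x) = p ^+ 30 * fE t x.
Proof. by rewrite /fE /phi !mxE /w4 /wt !nth4 //=; ring. Qed.
Lemma fE_t t x : fE t x = fE 0 x + t * phi x.
Proof. by rewrite /fE; ring. Qed.

Definition grad x (i : 'I_4) : C := nth 0 [:: x`1 ^+ 7 + 15%:R * x`0 ^+ 14;
 7%:R * (x`0 * x`1 ^+ 6); 5%:R * x`2 ^+ 4; 2%:R * x`3] i.
Definition gsq x : C := \sum_i grad x i * (grad x i)^*.
Definition dir x : 'rV[C]_4 := \row_i ((grad x i)^* / gsq x).

Lemma gsq_bound : exists2 m : C, 0 < m & forall x, sq x = 1 -> m <= gsq x.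
Proof.
have [h h2] : exists h : R, 2%:R * h = 1 by exists 2%:R^-1; rewrite mulfV ?pnatr_eq0.
have h0 : 0 < h by rewrite -(pmulr_rgt0 _ (ltr0n _ 2 : 0 < 2%:R :> R)) h2 ltr01.
exists ((h ^+ 13) ^+ 2)%:C%C; first by rewrite ltcR !exprn_gt0.
move=> x; rewrite /sq big4 /=.
pose a k : R := complex.Re `|x`k|.
have aE k : `|x`k| = (a k)%:C%C by rewrite RRe_real// normr_real.
have a0 k : 0 <= a k by rewrite -lecR -aE normr_ge0.
rewrite !aE -!rmorphXn -!rmorphD -(rmorph1 (real_complex R)) => /complexI; rewrite !addrA => hs.
pose g : R := complex.Re `|grad x (o4 0)|.
have gE : `|grad x (o4 0)| = g%:C%C by rewrite RRe_real// normr_real.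
have natM k (r : R) : (k%:R * r)%:C%C = k%:R * r%:C%C :> C.
 by rewrite !mulr_natl; exact: (rmorphMn (real_complex R)).
have nX k n : `|x`k ^+ n| = (a k ^+ n)%:C%C by rewrite normrX aE rmorphXn.
have n15 : `|15%:R * x`0 ^+ 14| = (15%:R * a 0%N ^+ 14)%:C%C.
 by rewrite normrM nX normr_nat natM.
have le i : `|grad x i| ^+ 2 <= gsq x.
 rewrite /gsq (bigD1 i)//= -normCK lerDl; apply: sumr_ge0 => j _.
 by rewrite -normCK exprn_ge0.
have fin i r : `|grad x i| = r%:C%C -> h ^+ 13 <= r -> ((h ^+ 13) ^+ 2)%:C%C <= gsq x.
 move=> E hr; apply: le_trans (le i); rewrite E -rmorphXn lecR lerXn2r ?nnegrE ?exprn_ge0 ?(ltW h0)//.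
 by apply: le_trans hr; rewrite exprn_ge0// ltW.
have g1 : a 1%N ^+ 7 - 15%:R * a 0%N ^+ 14 <= g.
 rewrite -lecR rmorphB /= -gE -nX -n15 /grad nth4//= lerBlDr.
 by have := ler_normB (x`1 ^+ 7 + 15%:R * x`0 ^+ 14) (15%:R * x`0 ^+ 14); rewrite addrK.
have g2 : 15%:R * a 0%N ^+ 14 - a 1%N ^+ 7 <= g.
 rewrite -lecR rmorphB /= -gE -nX -n15 /grad nth4//= lerBlDr.
 by have := ler_normB (x`1 ^+ 7 + 15%:R * x`0 ^+ 14) (x`1 ^+ 7); rewrite addrAC subrr add0r.
case: (gradient_bound h2 (a0 0%N) (a0 1%N) (a0 2%N) (a0 3%N) hs g1 g2) => H.
- exact: (fin _ _ gE H).
- apply: (fin (o4 1) _ _ H); rewrite /grad nth4//= normrM normrM nX aE normr_nat.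
 by rewrite natM; congr (_ * _); exact/esym/(rmorphM (real_complex R)).
- apply: (fin (o4 2) _ _ H); rewrite /grad nth4//= normrM nX normr_nat.
 by rewrite natM.
- apply: (fin (o4 3) _ _ H); rewrite /grad nth4//= normrM aE normr_nat.
 by rewrite natM.
Qed.

Local Notation dn := (fun x y : 'rV[C]_4 => n1 (x - y)).
Let dn0 x y : 0 <= dn x y. Proof. exact: n1_ge0. Qed.
Definition sphere x := sq x = 1.

Lemma BL_sphere F : BL (@annulus R) dn F -> BL (@sphere) dn F.
Proof.
move=> [K K0 [b l]]; exists K => //; split=> [x /sphere_annulus/b//|x y /sphere_annulus hx /sphere_annulus hy].
exact: l.
Qed.

Ltac bl := repeat first
 [ apply: (BLD dn0) | apply: (BLM dn0) | apply: (BLX dn0) | apply: (BLc _ dn0) | assumption ].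

Lemma BL_grad i : BL (@sphere) dn (fun x => grad x i).
Proof.
have hc j : BL (@sphere) dn (fun x => x ord0 j) by exact: (BL_sphere (@BL_coord R j)).
have X j n : BL (@sphere) dn (fun x => x ord0 j ^+ n) := @BLX C _ sphere dn dn0 _ n (hc j).
have Z (c : C) F : BL (@sphere) dn F -> BL (@sphere) dn (fun x => c * F x).
 by move=> hF; apply: (@BLM C _ sphere dn (fun=> c)) => //; exact: (BLc _ dn0).
case: (ord4E i) => ->; rewrite /grad.
- apply: (@BL_eq _ _ _ _ (fun x => x`1 ^+ 7 + 15%:R * x`0 ^+ 14)) => [|x _]; last by rewrite nth4.
 by apply: (@BLD C _ sphere dn (fun x => x`1 ^+ 7)); [exact: X|apply: Z; exact: X].
- apply: (@BL_eq _ _ _ _ (fun x => 7%:R * (x`0 * x`1 ^+ 6))) => [|x _]; last by rewrite nth4.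
 by apply: Z; apply: (@BLM C _ sphere dn (fun x => x`0)); [exact: hc|exact: X].
- apply: (@BL_eq _ _ _ _ (fun x => 5%:R * x`2 ^+ 4)) => [|x _]; last by rewrite nth4.
 by apply: Z; exact: X.
- apply: (@BL_eq _ _ _ _ (fun x => 2%:R * x`3)) => [|x _]; last by rewrite nth4.
 by apply: Z; exact: hc.
Qed.
Lemma BL_dir i : BL (@sphere) dn (fun x => dir x ord0 i).
Proof.
have cj j : BL (@sphere) dn (fun x => (grad x j)^*) := @BLconj C _ sphere dn _ (BL_grad j).
have [m m0 hm] := gsq_bound.
have hg : BL (@sphere) dn gsq.
 have t j : BL (@sphere) dn (fun x => grad x j * (grad x j)^*) :=
 @BLM C _ sphere dn _ _ (BL_grad j) (cj j).
 apply: (@BL_eq _ _ _ _ (fun x => grad x (o4 0) * (grad x (o4 0))^* + (grad x (o4 1) * (grad x (o4 1))^* +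
 (grad x (o4 2) * (grad x (o4 2))^* + grad x (o4 3) * (grad x (o4 3))^*)))) => [|x _]; last by rewrite /gsq big4.
 by do 3!(apply: (@BLD C _ sphere dn (fun x => grad x _ * (grad x _)^*)); first exact: t); exact: t.
apply: (@BL_eq _ _ _ _ (fun x => (grad x i)^* * (gsq x)^-1)) => [|x _]; last by rewrite mxE.
apply: (@BLM C _ sphere dn (fun x => (grad x i)^*)); first exact: cj.
apply: (@BLV C _ sphere dn dn0 gsq m) => // x hx.
apply: le_trans (hm _ hx) _; rewrite ger0_norm//; exact: le_trans (ltW m0) (hm _ hx).
Qed.
Lemma grad_dir x : sq x = 1 -> \sum_i grad x i * dir x ord0 i = 1.
Proof.
move=> hx; have [m m0 hm] := gsq_bound.
rewrite (eq_bigr (fun i => grad x i * (grad x i)^* / gsq x)) => [|i _]; last by rewrite mxE mulrA.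
by rewrite -mulr_suml -/(gsq x) mulfV// gt_eqF// (lt_le_trans m0)// hm.
Qed.

End Family.

(** Second order expansions in the variable u with bounded Lipschitz remainder. *)
Section Jets.
Variables (C : numClosedFieldType) (P : Type) (D : P -> Prop) (d : P -> P -> C).
Hypothesis d0 : forall p q, 0 <= d p q.
Variable u : P -> C.
Hypothesis uB : BL D d u.
Implicit Types F G : P -> C.

Definition jet F F0 F1 := [/\ BL D d F0, BL D d F1 &
 exists2 B, BL D d B & forall p, F p = F0 p + u p * F1 p + u p ^+ 2 * B p].

Let M F G : BL D d F -> BL D d G -> BL D d (fun p => F p * G p). Proof. exact: BLM. Qed.
Let A F G : BL D d F -> BL D d G -> BL D d (fun p => F p + G p). Proof. exact: BLD. Qed.
Lemma jetD F F0 F1 G G0 G1 : jet F F0 F1 -> jet G G0 G1 ->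
 jet (fun p => F p + G p) (fun p => F0 p + G0 p) (fun p => F1 p + G1 p).
Proof.
move=> [a b [B hB E]] [a' b' [B' hB' E']]; split; [exact: A|exact: A|].
by exists (fun p => B p + B' p) => [|p]; [exact: A|rewrite E E'; ring].
Qed.
Lemma jetM F F0 F1 G G0 G1 : jet F F0 F1 -> jet G G0 G1 ->
 jet (fun p => F p * G p) (fun p => F0 p * G0 p) (fun p => F0 p * G1 p + F1 p * G0 p).
Proof.
move=> [a b [B hB E]] [a' b' [B' hB' E']]; split; [exact: M|by apply: A; exact: M|].
exists (fun p => F1 p * G1 p + F0 p * B' p + B p * G0 p + u p * (F1 p * B' p + B p * G1 p) +
 u p * (u p * (B p * B' p))) => [|p]; last by rewrite E E'; ring.
by do ![exact: M|exact: uB|apply: A|apply: (M uB)|assumption].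
Qed.
Lemma jetX F F0 F1 n : jet F F0 F1 ->
 jet (fun p => F p ^+ n.+1) (fun p => F0 p ^+ n.+1) (fun p => n.+1%:R * (F0 p ^+ n * F1 p)).
Proof.
move=> h; elim: n => [|n [a b [B hB E]]].
 case: h => a b [B hB E]; split.
 - by apply: (BL_eq a) => p _; rewrite expr1.
 - by apply: (BL_eq b) => p _; rewrite expr0 !mul1r.
 - by exists B => // p; rewrite !expr1 expr0 !mul1r.
have [a' b' [B' hB' E']] := jetM h (And3 a b (ex_intro2 _ _ B hB E)).
split.
- by apply: (BL_eq a') => p _; rewrite [RHS]exprS.
- apply: (BL_eq b') => p _; rewrite exprS -[n.+2%:R]natr1 mulrDl mul1r; congr (_ + _).
 by move: (n.+1%:R) => k; ring.
 by ring.
- exists B' => // p; rewrite [LHS]exprS E' [F0 p ^+ n.+2]exprS; congr (_ + _ * _ + _).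
 rewrite -[n.+2%:R]natr1; move: (n.+1%:R) => k; first [ring|rewrite exprS; ring].
Qed.

End Jets.

End Tc.
Import Tc.

(** * The fixed point equation *)

Module Td.
Section Equation.
Variable R : realType.
Local Notation C := (Cplx R).
Local Notation V := 'rV[C]_4.
Local Notation P := (C * V * C)%type.
Local Notation sph := (@sphere R).

(** The largest of the positive numbers c and z, as an algebraic expression. *)
Definition cmax (c z : C) := (c + z + `|z - c|) / 2%:R.
Definition chi (c z : C) := c / cmax c `|z|.
Definition shift (x : V) (u : C) : V := x + u *: dir x.
Definition scale (c : C) (x : V) (u : C) := 1 + chi c (fE 0 x) * (lam (shift x u) - 1).
Definition step (c t : C) (x : V) (u : C) := u - fE t (shift x u) + fE 0 x * scale c x u ^+ 30.

Lemma cmax_ge (c z : C) : 0 < c -> 0 <= z -> c <= cmax c z /\ z <= cmax c z.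
Proof.
move=> c0 z0; have rz : z - c \is Num.real by rewrite realB ?ger0_real// ltW.
have h1 := real_ler_norm rz.
have h2 : c - z <= `|z - c| by rewrite distrC real_ler_norm// -opprB rpredN.
split; rewrite -subr_ge0.
 rewrite (_ : _ - c = (`|z - c| - (c - z)) / 2%:R); last by rewrite /cmax; field.
 by rewrite divr_ge0 ?subr_ge0 ?ler0n.
rewrite (_ : _ - z = (`|z - c| - (z - c)) / 2%:R); last by rewrite /cmax; field.
by rewrite divr_ge0 ?subr_ge0 ?ler0n.
Qed.

Section Domain.
Variable r1 : C.
Hypotheses (r1_gt0 : 0 < r1) (r1_le1 : r1 <= 1).
Hypothesis r1_ann : forall x u, sph x -> `|u| <= r1 -> n1 (u *: dir x) <= 6%:R^-1.

Definition dom (p : P) := [/\ `|p.1.1| <= 1, sph p.1.2 & `|p.2| <= r1].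
Definition dd (p q : P) := `|p.1.1 - q.1.1| + n1 (p.1.2 - q.1.2) + `|p.2 - q.2|.
Lemma dd_ge0 p q : 0 <= dd p q. Proof. by rewrite /dd !addr_ge0// n1_ge0. Qed.

Let dd0 := dd_ge0.

Lemma BL_u : BL dom dd (fun p => p.2).
Proof.
exists 1 => //; split=> [p [_ _ h]|p q _ _]; first exact: le_trans h _.
by rewrite mul1r /dd lerDr addr_ge0// n1_ge0.
Qed.
Lemma BL_point F : BL sph (fun x y : V => n1 (x - y)) F -> BL dom dd (fun p => F p.1.2).
Proof.
move=> h; apply: (@BL_comp C V P sph dom (fun x y : V => n1 (x - y)) dd (fun p => p.1.2) 1 F ler01) => //.
- by move=> q [].
- by move=> p q _ _; rewrite mul1r /dd addrAC lerDr addr_ge0.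
Qed.
Lemma BL_shift_coord i : BL dom dd (fun p => shift p.1.2 p.2 ord0 i).
Proof.
apply: (@BL_eq _ _ _ _ (fun p : P => p.1.2 ord0 i + p.2 * dir p.1.2 ord0 i)) => [|p _]; last by rewrite !mxE.
apply: BLD; first exact: (BL_point (BL_sphere (@BL_coord R i))).
exact: (BLM BL_u (BL_point (@BL_dir R i))).
Qed.
Lemma shift_annulus p : dom p -> annulus (shift p.1.2 p.2).
Proof. by move=> [_ hx hu]; apply: near_sphere => //; exact: r1_ann. Qed.
Lemma BL_shift F : BL (@annulus R) (fun x y : V => n1 (x - y)) F -> BL dom dd (fun p => F (shift p.1.2 p.2)).
Proof.
move=> h; have H (i : 'I_4) : exists K : C, 0 <= K /\
 forall p q, dom p -> dom q -> `|shift p.1.2 p.2 ord0 i - shift q.1.2 q.2 ord0 i| <= K * dd p q.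
 by have [K K0 [_ l]] := BL_shift_coord i; exists K.
have [K KE] := choice H.
apply: (@BL_comp C V P (@annulus R) dom (fun x y : V => n1 (x - y)) dd (fun p => shift p.1.2 p.2) (\sum_i K i) F) => //.
- by apply: sumr_ge0 => i _; case: (KE i).
- exact: shift_annulus.
- move=> p q Dp Dq; rewrite /n1 mulr_suml; apply: ler_sum => i _; have [_ l] := KE i.
 by have := l p q Dp Dq; rewrite !mxE.
Qed.
Lemma f_jet : exists2 B, BL dom dd B & forall p, dom p ->
 fE 0 (shift p.1.2 p.2) = fE 0 p.1.2 + p.2 + p.2 ^+ 2 * B p.
Proof.
have J i : jet dom dd (fun p => p.2) (fun p : P => shift p.1.2 p.2 ord0 i) (fun p => p.1.2 ord0 i) (fun p => dir p.1.2 ord0 i).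
 split; [exact: (BL_point (BL_sphere (@BL_coord R i)))|exact: (BL_point (@BL_dir R i))|].
 by exists (fun=> 0) => [|p]; [exact: (BLc _ dd0)|rewrite !mxE mulr0 addr0].
have X i n := jetX BL_u n (J i).
have [_ _ [B hB E]] := jetD (jetD (jetD (X (o4 2) 4%N) (jetM BL_u (X (o4 1) 6%N) (J (o4 0)))) (X (o4 0) 14%N)) (X (o4 3) 1%N).
exists B => // p [_ hx _]; rewrite /fE !mul0r !addr0 E.
have g1 := grad_dir hx; rewrite big4 /grad !nth4 //= in g1.
congr (_ + _ + _); rewrite -[RHS]mulr1; congr (_ * _); rewrite -[RHS]g1; ring.
Qed.
Lemma f0_BL : BL dom dd (fun p => fE 0 p.1.2).
Proof.
have c i : BL dom dd (fun p : P => p.1.2 ord0 i) := BL_point (BL_sphere (@BL_coord R i)).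
apply: (@BL_eq _ _ _ _ (fun p : P => p.1.2 ord0 (o4 2) ^+ 5 + p.1.2 ord0 (o4 1) ^+ 7 * p.1.2 ord0 (o4 0) +
 p.1.2 ord0 (o4 0) ^+ 15 + p.1.2 ord0 (o4 3) ^+ 2)) => [|p _]; last by rewrite /fE mul0r addr0.
exact: (BLD (BLD (BLD (BLX dd0 _ (c _)) (BLM (BLX dd0 _ (c _)) (c _))) (BLX dd0 _ (c _))) (BLX dd0 _ (c _))).
Qed.
Lemma phi_BL : BL dom dd (fun p => phi (shift p.1.2 p.2)).
Proof. exact: (BLM (BLX dd0 _ (BL_shift_coord (o4 1))) (BL_shift_coord (o4 2))). Qed.
Lemma lam_BL : BL dom dd (fun p => lam (shift p.1.2 p.2) - 1).
Proof. exact: (BLB (BL_shift (@BL_lam R)) (BLc _ dd0 1)). Qed.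
Lemma lam_small : exists2 K, 0 <= K & forall p, dom p -> `|lam (shift p.1.2 p.2) - 1| <= K * `|p.2|.
Proof.
have [K K0 [_ l]] := lam_BL; exists K => // p [a b c].
have Dq : dom (p.1.1, p.1.2, 0) by split=> //=; rewrite normr0 ltW.
have := l p _ (And3 a b c) Dq.
rewrite /= /shift scale0r addr0 {2}/lam (nu_sphere b) invr1 subrr subr0 /dd /= !subrr normr0 add0r subr0.
by rewrite (_ : n1 0 = 0) ?add0r// /n1 big1// => i _; rewrite mxE normr0.
Qed.
Lemma chi_BL c : 0 < c -> BL dom dd (fun p => chi c (fE 0 p.1.2)).
Proof.
move=> c0; have n := BLnorm f0_BL.
have m : BL dom dd (fun p => cmax c `|fE 0 p.1.2|).
 apply: (BLM _ (BLc _ dd0 2%:R^-1)); apply: BLD; first exact: (BLD (BLc _ dd0 c) n).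
 exact: (BLnorm (BLB n (BLc _ dd0 c))).
apply: (BLM (BLc _ dd0 c)); apply: (BLV dd0 c0 _ m) => p _.
by have [h _] := cmax_ge c0 (normr_ge0 (fE 0 p.1.2)); rewrite gtr0_norm// (lt_le_trans c0).
Qed.
Lemma psi_le c z : 0 < c -> `|z * chi c z| <= c.
Proof.
move=> c0; have [h1 h2] := cmax_ge c0 (normr_ge0 z).
have m0 : 0 < cmax c `|z| by exact: lt_le_trans h1.
rewrite /chi mulrCA normrM gtr0_norm// -[leRHS]mulr1 ler_wpM2l ?(ltW c0)//.
by rewrite normrM normfV (gtr0_norm m0) ler_pdivrMr// mul1r.
Qed.
Lemma combine (a1 a2 a3 a4 a5 a6 a7 a8 b1 b2 b3 b4 : C) : `|a1 - a2| <= b1 -> `|a3 - a4| <= b2 ->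
 `|a5 - a6| <= b3 -> `|a7 - a8| <= b4 ->
 `|- a1 - a3 + 30%:R * a5 + a7 - (- a2 - a4 + 30%:R * a6 + a8)| <= b1 + b2 + 30%:R * b3 + b4.
Proof.
move=> e1 e2 e3 e4.
have -> : - a1 - a3 + 30%:R * a5 + a7 - (- a2 - a4 + 30%:R * a6 + a8) =
 - (a1 - a2) - (a3 - a4) + 30%:R * (a5 - a6) + (a7 - a8) by ring.
apply: le_trans (ler_normD _ _) _; apply: lerD => //.
apply: le_trans (ler_normD _ _) _; apply: lerD; last by rewrite normrM normr_nat ler_wpM2l.
by apply: le_trans (ler_normB _ _) _; apply: lerD => //; rewrite normrN.
Qed.
Lemma step_estimate (r c Dd KB KP Kl Ks Kp KO u u' B B' t t' f f' psi psi' l l' O O' : C) :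
 0 <= r -> r <= 1 -> 0 <= Dd -> 0 <= Ks -> 0 <= KO -> 0 <= Kl -> `|u| <= r -> `|u'| <= r -> `|t| <= r -> `|u - u'| <= Dd ->
 `|l| <= Ks * r -> `|l'| <= Ks * r -> `|l - l'| <= Kl * Dd ->
 `|B'| <= KB -> `|B - B'| <= KB * Dd -> `|f'| <= KP -> `|f - f'| <= KP * Dd ->
 `|psi| <= c -> `|psi - psi'| <= Kp * Dd -> `|O'| <= KO -> `|O - O'| <= KO * Dd ->
 `|- (u ^+ 2 * B) - t * f + 30%:R * (psi * l) + l ^+ 2 * O -
 (- (u' ^+ 2 * B') - t' * f' + 30%:R * (psi' * l') + l' ^+ 2 * O')| <=
 3%:R * (r * KB) * Dd + (r * KP * Dd + KP * `|t - t'|) +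
 30%:R * (c * Kl * Dd + Ks * Kp * r * Dd) + r * ((2%:R * (Ks * Kl) + Ks * Ks) * KO) * Dd.
Proof.
move=> r0 r11 Dd0 Ks0 KO0 Kl0 up uq tp udist lr lr' ldist hB1 hB2 hf1 hf2 hp1 hp2 hO1 hO2.
 have sqd (a b s e : C) : `|a| <= s -> `|b| <= s -> `|a - b| <= e -> `|a ^+ 2 - b ^+ 2| <= e * (s + s).
 move=> ha hb hab; rewrite subr_sqr normrM; apply: ler_pM => //.
 by apply: le_trans (ler_normD _ _) _; exact: lerD.
 have e1 : `|u ^+ 2 * B - u' ^+ 2 * B'| <= 3%:R * (r * KB) * Dd.
 apply: le_trans (distM _ _ _ _) _.
 rewrite (_ : 3%:R * (r * KB) * Dd = r * (KB * Dd) + Dd * (r + r) * KB); last by ring.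
 apply: lerD; apply: ler_pM => //; first 1 last.
 - exact: sqd.
 rewrite normrX expr2 -[X in _ <= X]mulr1; apply: ler_pM => //; exact: le_trans up r11.
 have e2 : `|t * f - t' * f'| <= r * KP * Dd + KP * `|t - t'|.
 apply: le_trans (distM _ _ _ _) _; rewrite -mulrA [KP * `|_|]mulrC.
 by apply: lerD; apply: ler_pM.
 have e3 : `|psi * l - psi' * l'| <=
 c * Kl * Dd + Ks * Kp * r * Dd.
 apply: le_trans (distM _ _ _ _) _.
 rewrite (_ : Ks * Kp * r * Dd = (Kp * Dd) * (Ks * r)); last by ring.
 by rewrite -mulrA; apply: lerD; apply: ler_pM.
 have e4 : `|l ^+ 2 * O - l' ^+ 2 * O'| <=
 r * ((2%:R * (Ks * Kl) + Ks * Ks) * KO) * Dd.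
 apply: le_trans (distM _ _ _ _) _.
 rewrite (_ : r * _ * Dd = (Ks * Ks * r) * (KO * Dd) + (Kl * Dd) * (Ks * r + Ks * r) * KO); last by ring.
 apply: lerD; apply: ler_pM => //; first 1 last.
 - exact: sqd.
 apply: (@le_trans _ _ ((Ks * r) * (Ks * r))).
 by rewrite normrX expr2; apply: ler_pM.
 rewrite (_ : Ks * r * (Ks * r) = (Ks * Ks * r) * r); last by ring.
 by rewrite ler_piMr// !mulr_ge0.
exact: combine e1 e2 e3 e4.
Qed.

(** The iteration step contracts with an arbitrarily small constant. *)
Lemma step_small (kap rho : C) : 0 < kap -> 0 < rho -> exists c r K,
 [/\ 0 < c, [/\ 0 < r, r <= r1 & r <= rho], 0 <= K,
 forall p q : P, dom p -> dom q -> `|p.1.1| <= r -> `|q.1.1| <= r -> `|p.2| <= r -> `|q.2| <= r ->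
 `|step c p.1.1 p.1.2 p.2 - step c q.1.1 q.1.2 q.2| <= kap * dd p q + K * `|p.1.1 - q.1.1| &
 forall t x, `|t| <= 1 -> sph x -> `|step c t x 0| <= K * `|t|].
Proof.
move=> k0 rho0; have [B [KB KB0 [bB lB]] EB] := f_jet; have [KP KP0 [bP lP]] := phi_BL.
have [Kl Kl0 [bl ll]] := lam_BL; have [Ks Ks0 hs] := lam_small.
pose c := kap / (60%:R * (Kl + 1)).
have Kl1 : 0 < Kl + 1 by rewrite ltr_wpDl.
have c0 : 0 < c by rewrite divr_gt0// mulr_gt0// ltr0n.
have cK : 30%:R * (c * Kl) <= kap / 2%:R.
 apply: (@le_trans _ _ (30%:R * (c * (Kl + 1)))).
 by rewrite ler_wpM2l ?ler0n// ler_wpM2l ?(ltW c0)// lerDl.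
 by rewrite /c le_eqVlt; apply/orP; left; apply/eqP; field; rewrite gt_eqF.
have chB := chi_BL c0; have psB := BLM f0_BL chB.
have [W [KW KW0 [bW lW]] EW] : exists2 W, BL dom dd W & forall p, dom p ->
 (1 + chi c (fE 0 p.1.2) * (lam (shift p.1.2 p.2) - 1)) ^+ 30 =
 1 + 30%:R * (chi c (fE 0 p.1.2) * (lam (shift p.1.2 p.2) - 1)) + (lam (shift p.1.2 p.2) - 1) ^+ 2 * W p.
 have yB := BLM chB lam_BL.
 have J : jet dom dd (fun p : P => chi c (fE 0 p.1.2) * (lam (shift p.1.2 p.2) - 1))
 (fun p : P => 1 + chi c (fE 0 p.1.2) * (lam (shift p.1.2 p.2) - 1)) (fun=> 1) (fun=> 1).
 split; [exact: (BLc _ dd0)|exact: (BLc _ dd0)|exists (fun=> 0) => [|p]; first exact: (BLc _ dd0)].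
 by rewrite mulr1 mulr0 addr0.
 have [_ _ [W hW E]] := jetX yB 29 J.
 exists (fun p => chi c (fE 0 p.1.2) ^+ 2 * W p) => [|p _]; first exact: (BLM (BLX dd0 _ chB) hW).
 by rewrite E !expr1n !mulr1; ring.
have [KO KO0 [bO lO]] := BLM f0_BL (ex_intro2 _ _ KW KW0 (conj bW lW) : BL dom dd W).
have [Kp Kp0 [bp lp]] := psB.
pose M := 3%:R * KB + KP + 30%:R * (Ks * Kp) + (2%:R * (Ks * Kl) + Ks * Ks) * KO.
have M0 : 0 <= M by rewrite !addr_ge0// !mulr_ge0// ?addr_ge0 ?mulr_ge0.
pose Z := 1 + rho + kap + 2%:R * M.
have M20 : 0 <= 2%:R * M by rewrite mulr_ge0.
have Z1 : 1 <= Z by rewrite /Z -!addrA lerDl !addr_ge0// ltW.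
have Z0 : 0 < Z by exact: lt_le_trans Z1.
have Zr : rho <= Z by rewrite /Z addrAC [1 + rho]addrC -!addrA lerDl !addr_ge0// ltW.
have Zk : kap <= Z by rewrite /Z addrAC addrC lerDl !addr_ge0// ltW.
have ZM : 2%:R * M <= Z by rewrite /Z lerDr !addr_ge0// ltW.
pose r := r1 * (rho / Z) * (kap / Z).
have a0 : 0 < rho / Z by exact: divr_gt0.
have a1 : rho / Z <= 1 by rewrite ler_pdivrMr// mul1r.
have b0 : 0 < kap / Z by exact: divr_gt0.
have b1 : kap / Z <= 1 by rewrite ler_pdivrMr// mul1r.
have r0 : 0 < r by rewrite /r mulr_gt0// mulr_gt0.
have rr1 : r <= r1.
 by rewrite /r -mulrA ler_piMr ?(ltW r1_gt0)// mulr_ile1// ltW.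
have rrho : r <= rho.
 apply: (@le_trans _ _ (rho / Z)); last by rewrite ler_pdivrMr// ler_peMr// ltW.
 rewrite -[leRHS]mulr1; apply: ler_pM => //; [|exact: ltW|].
 by rewrite mulr_ge0 ?(ltW a0) ?(ltW r1_gt0).
 by rewrite ler_piMl ?(ltW a0).
have rM : r * M <= kap / 2%:R.
 apply: (@le_trans _ _ (kap / Z * M)).
 by rewrite ler_wpM2r// /r ler_piMl ?(ltW b0)// mulr_ile1 ?(ltW a0) ?(ltW r1_gt0).
 rewrite mulrAC ler_pdivrMr// mulrAC ler_pdivlMr ?ltr0n// -mulrA ler_wpM2l ?(ltW k0)// mulrC//.
have r11 : r <= 1 by exact: le_trans r1_le1.
exists c, r, KP; split=> //.
 move=> p q Dp Dq tp tq up uq; set Dd := dd p q.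
 have Dd0 : 0 <= Dd by exact: dd0.
 have stepE z : dom z -> step c z.1.1 z.1.2 z.2 = - (z.2 ^+ 2 * B z) - z.1.1 * phi (shift z.1.2 z.2) +
 30%:R * ((fE 0 z.1.2 * chi c (fE 0 z.1.2)) * (lam (shift z.1.2 z.2) - 1)) +
 (lam (shift z.1.2 z.2) - 1) ^+ 2 * (fE 0 z.1.2 * W z).
 by move=> Dz; rewrite /step /scale EW// fE_t EB//; ring.
 have udist : `|p.2 - q.2| <= Dd by rewrite /Dd /dd lerDr addr_ge0// n1_ge0.
 have lr : `|lam (shift p.1.2 p.2) - 1| <= Ks * r.
 by apply: le_trans (hs _ Dp) _; exact: ler_wpM2l.
 have lr' : `|lam (shift q.1.2 q.2) - 1| <= Ks * r.
 by apply: le_trans (hs _ Dq) _; exact: ler_wpM2l.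
 rewrite (stepE p Dp) (stepE q Dq).
 have est := (@step_estimate r c Dd KB KP Kl Ks Kp KO p.2 q.2 (B p) (B q) p.1.1 q.1.1 _ _ _ _ _ _ _ _ (ltW r0) r11 Dd0 Ks0 KO0 Kl0 up uq tp udist lr lr' (ll p q Dp Dq)
 (bB q Dq) (lB p q Dp Dq) (bP q Dq) (lP p q Dp Dq) (psi_le (fE 0 p.1.2) c0) (lp p q Dp Dq)
 (bO q Dq) (lO p q Dp Dq)).
 apply: le_trans (est) _ => {est}.
 rewrite (_ : _ + _ + _ + _ = (30%:R * (c * Kl) + r * M) * Dd + KP * `|p.1.1 - q.1.1|); last by rewrite /M; ring.
 by rewrite lerD2r ler_wpM2r// (le_trans (lerD cK rM))// -splitr.
move=> t x ht hx; have D0 : dom (t, x, 0) by split=> //=; rewrite normr0 ltW.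
rewrite /step /scale /shift scale0r addr0 {1}/lam (nu_sphere hx) invr1 subrr mulr0 addr0 expr1n mulr1 fE_t.
rewrite (_ : 0 - _ + _ = - (t * phi x)); last by ring.
rewrite normrN normrM mulrC ler_wpM2r//.
by have := bP _ D0; rewrite /= /shift scale0r addr0.
Qed.

End Domain.
End Equation.

End Td.
Import Td.

(** * Its solutions *)

Module Te.
Section Conjugacy.
Variable R : realType.
Local Notation C := (Cplx R).
Local Notation V := 'rV[C]_4.
Local Notation sph := (@sphere R).
Local Notation ann := (@annulus R).
Local Notation dn := (fun x y : V => n1 (x - y)).

Lemma actD (p : C) (x y : V) : act p (x + y) = act p x + act p y.
Proof. by apply/rowP => i; rewrite !mxE mulrDr. Qed.
Lemma act0l (x : V) : act 0 x = 0.
Proof.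
apply/rowP => i; rewrite !mxE; have /andP[h _] := w4_bounds i.
by rewrite expr0n eqn0Ngt (leq_trans _ h)// mul0r.
Qed.
Lemma th_sphere (x : V) : sph x -> th x = x.
Proof. by move=> h; rewrite /th (nu_sphere h) act1. Qed.
Lemma lam_sphere (x : V) : sph x -> lam x = 1.
Proof. by move=> h; rewrite /lam (nu_sphere h) invr1. Qed.
Lemma sphere_neq0 (x : V) : sph x -> x != 0.
Proof. by move=> h; apply: sq_neq0; rewrite h ltr01. Qed.
Lemma lam_annulus (x : V) : ann x -> 2%:R^-1 <= lam x /\ lam x <= 2%:R.
Proof.
move=> h; have [a b] := nu_annulus h; have [p0 _] := nuP (annulus_neq0 h).
have t0 : (0 : C) < 2%:R by rewrite ltr0n.
by rewrite /lam; split; rewrite ?lef_pV2 ?posrE// -[2%:R]invrK lef_pV2 ?posrE ?invr_gt0.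
Qed.
Lemma th_sph (x : V) : x != 0 -> sph (th x).
Proof. exact: sq_th. Qed.
Lemma th_lipschitz : exists2 K : C, 0 <= K & forall x y : V, ann x -> ann y -> n1 (th x - th y) <= K * n1 (x - y).
Proof.
have Ht (i : 'I_4) : exists K : C, 0 <= K /\ forall x y, ann x -> ann y -> `|th x ord0 i - th y ord0 i| <= K * n1 (x - y).
 by have [K K0 [_ l]] := @BL_th R i; exists K.
have [Kt KtP] := choice Ht; exists (\sum_i Kt i); first by apply: sumr_ge0 => i _; case: (KtP i).
move=> x y hx hy; rewrite {1}/n1 mulr_suml; apply: ler_sum => i _; have [_ l] := KtP i.
by have := l x y hx hy; rewrite !mxE.
Qed.
Lemma cancel6 (k D : C) : k != 0 -> D != 0 -> k * (6%:R * (k * D))^-1 * D = 6%:R^-1.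
Proof. by move=> k0 D0; rewrite !invfM mulrCA (mulrA k) mulfV// mul1r -mulrA mulVf// mulr1. Qed.
Lemma sum_bound (a b X T : C) : 0 <= a -> 0 <= b -> 0 <= X -> 0 <= T -> a * X + b * T <= (a + b) * (T + X).
Proof.
move=> a0 b0 X0 T0; rewrite -subr_ge0 (_ : _ - _ = a * T + b * X); last by ring.
by rewrite addr_ge0// mulr_ge0.
Qed.

(** What the fixed points of the iteration step provide. *)
Record solution := Solution {
 sc : C; sr : C; tau : C; sK : C; sk : C; u : C -> V -> C;
 sc_gt0 : 0 < sc; tau_gt0 : 0 < tau; sK_ge0 : 0 <= sK; sk_ge0 : 0 <= sk; sr_ge0 : 0 <= sr;
 u_small : forall t x, `|t| <= tau -> sph x -> `|u t x| <= sr;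
 u_fix : forall t x, `|t| <= tau -> sph x -> step sc t x (u t x) = u t x;
 u_lip : forall t t' x x', `|t| <= tau -> `|t'| <= tau -> sph x -> sph x' ->
 `|u t x - u t' x'| <= sk * n1 (x - x') + sK * `|t - t'|;
 sr_ann : forall x v, sph x -> `|v| <= sr -> n1 (v *: dir x) <= 6%:R^-1;
 sr_act : forall x v m, sph x -> `|v| <= sr -> 0 < m -> m <= 2%:R -> n1 (act m (v *: dir x)) <= 6%:R^-1;
 U_lip : forall t x x', `|t| <= tau -> ann x -> ann x' ->
 n1 (act (lam x) (u t (th x) *: dir (th x)) - act (lam x') (u t (th x') *: dir (th x'))) <= n1 (x - x') / 2%:R;
 scale_BL : exists2 K, 0 <= K & forall t t' x x', `|t| <= tau -> `|t'| <= tau -> sph x -> sph x' ->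
 `|scale sc x (u t x) - scale sc x' (u t' x')| <= K * (`|t - t'| + n1 (x - x')) }.

Lemma solution_exists : inhabited solution.
Proof.
have n0 (x y : V) : 0 <= dn x y by exact: n1_ge0.
have Hd (i : 'I_4) : exists K : C, 0 <= K /\ forall x, sph x -> `|dir x ord0 i| <= K.
 by have [K K0 [b _]] := @BL_dir R i; exists K.
have [Kd KdP] := choice Hd.
have [K2 K20 th_lip] := th_lipschitz.
have ths x : ann x -> sph (th x) by move=> h; apply: sq_th; exact: annulus_neq0.
have Hb (i : 'I_4) : exists K : C, 0 <= K /\ (forall x, ann x -> `|lam x ^+ w4 i * dir (th x) ord0 i| <= K) /\
 forall x y, ann x -> ann y -> `|lam x ^+ w4 i * dir (th x) ord0 i - lam y ^+ w4 i * dir (th y) ord0 i| <= K * n1 (x - y).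
 have h : BL ann dn (fun x => dir (th x) ord0 i).
 exact: (@BL_comp C V V sph ann dn dn (@th R) K2 _ K20 ths n0 th_lip (@BL_dir R i)).
 by have [K K0 H] := BLM (BLX n0 (w4 i) (@BL_lam R)) h; exists K.
have [Kb KbP] := choice Hb.
pose K1 := \sum_i Kb i.
have K10 : 0 <= K1 by apply: sumr_ge0 => i _; case: (KbP i).
pose kk : C := 1 + \sum_i 2%:R ^+ w4 i.
have p2 i : 0 <= 2%:R ^+ w4 i :> C by rewrite exprn_ge0.
have kk1 : 1 <= kk by rewrite lerDl sumr_ge0.
have kw i : 2%:R ^+ w4 i <= kk.
 by rewrite /kk (bigD1 i)//= addrCA lerDl addr_ge0// sumr_ge0.
pose D := 1 + \sum_i Kd i.
have D1 : 1 <= D by rewrite lerDl sumr_ge0// => i _; case: (KdP i).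
have n6 : (0 : C) < 6%:R by rewrite ltr0n.
pose r1 := (6%:R * (kk * D))^-1.
have kD : 1 <= kk * D by rewrite mulr_ege1.
have kD0 : 0 < kk * D by exact: lt_le_trans kD.
have r10 : 0 < r1 by rewrite invr_gt0 mulr_gt0.
have r00 : 0 < 6%:R * (kk * D) by rewrite mulr_gt0.
have r11 : r1 <= 1 by rewrite /r1 (invf_le1 r00) mulr_ege1// ler1n.
have act_small x v m : sph x -> `|v| <= r1 -> 0 <= m -> m <= 2%:R -> n1 (act m (v *: dir x)) <= 6%:R^-1.
 move=> hx hv m0 m2; apply: (@le_trans _ _ (\sum_i kk * (r1 * Kd i))).
 apply: ler_sum => i _; have [_ b] := KdP i.
 have -> : act m (v *: dir x) ord0 i = m ^+ w4 i * (v * dir x ord0 i) by rewrite !mxE.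
 have e1 : `|m ^+ w4 i| <= kk by rewrite normrX ger0_norm// (le_trans _ (kw i))// lerXn2r ?nnegrE.
 have e2 : `|v| * `|dir x ord0 i| <= r1 * Kd i by apply: ler_pM => //; exact: b.
 rewrite normrM [`|v * _|]normrM.
 exact: (ler_pM (normr_ge0 _) (mulr_ge0 (normr_ge0 _) (normr_ge0 _)) e1 e2).
 have kk0 : 0 < kk by exact: lt_le_trans kk1.
 have D0 : 0 < D by exact: lt_le_trans D1.
 have e3 : kk * r1 * (\sum_i Kd i) <= kk * r1 * D.
 by apply: ler_wpM2l; [rewrite mulr_ge0 ?ltW|rewrite /D lerDr].
 rewrite -mulr_sumr -mulr_sumr mulrA; apply: le_trans e3 _.
 by rewrite /r1 cancel6// gt_eqF.
have ann_small x v : sph x -> `|v| <= r1 -> n1 (v *: dir x) <= 6%:R^-1.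
 by move=> hx hv; rewrite -[v *: _]act1 act_small// ler1n.
pose kap := (16%:R * ((1 + K1) * (1 + K2)))^-1; pose rho := (16%:R * (1 + K1))^-1.
have a1 : 1 <= 1 + K1 by rewrite lerDl.
have a2 : 1 <= 1 + K2 by rewrite lerDl.
have a12 : 0 < 1 + K1 by exact: lt_le_trans a1.
have a22 : 0 < 1 + K2 by exact: lt_le_trans a2.
have n16 : (0 : C) < 16%:R by rewrite ltr0n.
have kap0 : 0 < kap by rewrite invr_gt0 !mulr_gt0.
have rho0 : 0 < rho by rewrite invr_gt0 mulr_gt0.
have kap2 : kap <= 2%:R^-1.
 rewrite lef_pV2 ?posrE ?mulr_gt0 ?ltr0n// (@le_trans _ _ (16%:R * 1))//; first by rewrite mulr1 ler_nat.
 by rewrite ler_wpM2l ?(ltW n16)// mulr_ege1.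
have [c [r [K [c0 [r0 rr1 rrho] K0 L N0]]]] := step_small r10 r11 ann_small kap0 rho0.
pose tau0 := r / (2%:R * (K + 1)).
have K11 : 0 < K + 1 by rewrite ltr_wpDl.
have tau00 : 0 < tau0 by rewrite divr_gt0// mulr_gt0// ltr0n.
have Kt0 : K * tau0 <= r / 2%:R.
 rewrite /tau0 mulrA ler_pdivrMr ?mulr_gt0 ?ltr0n// [X in _ <= X](_ : _ = (K + 1) * r); last by field.
 by rewrite ler_wpM2r ?(ltW r0)// lerDl.
have tr : tau0 <= r.
 rewrite /tau0 ler_pdivrMr ?mulr_gt0 ?ltr0n// ler_peMr ?(ltW r0)// mulr_ege1 ?ler1n// lerDr//.
have small t x v : `|t| <= tau0 -> sph x -> `|v| <= r -> dom r1 (t, x, v).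
 move=> ht hx hv; split=> //=; last exact: le_trans rr1.
 exact: le_trans (le_trans ht tr) (le_trans rr1 r11).
have n10 : n1 (0 : V) = 0 by rewrite /n1 big1// => i _; rewrite mxE normr0.
have fixp t x : `|t| <= tau0 -> sph x -> exists v, `|v| <= r /\ step c t x v = v.
 move=> ht hx; have tt1 := le_trans ht tr.
 have lip v v' : `|v| <= r -> `|v'| <= r -> `|step c t x v - step c t x v'| <= `|v - v'| / 2%:R.
 move=> hv hv'.
 have h : `|step c t x v - step c t x v'| <= kap * dd (t, x, v) (t, x, v') + K * `|t - t| :=
 L (t, x, v) (t, x, v') (small _ _ _ ht hx hv) (small _ _ _ ht hx hv') tt1 tt1 hv hv'.
 have E0 : dd (t, x, v) (t, x, v') = `|v - v'| by rewrite /dd /= !subrr normr0 n10 !add0r.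
 move: h; move: (step c t x v) (step c t x v') => a b; rewrite E0 (subrr t) normr0 mulr0 addr0 => h.
 by apply: le_trans h _; rewrite mulrC ler_wpM2l.
 have [|||v hv E] := @banach1 R r (step c t x); [exact: ltW| |exact: lip|by exists v].
 move=> v hv; have z0 : `|0 : C| <= r by rewrite normr0 ltW.
 have h1 := lip v 0 hv z0; have h2 := N0 t x (le_trans tt1 (le_trans rr1 r11)) hx.
 move: h1 h2; move: (step c t x v) (step c t x 0) => a b; rewrite subr0 => h1 h2.
 have e1 : `|v| / 2%:R <= r / 2%:R by rewrite ler_wpM2r// invr_ge0.
 have e2 : K * `|t| <= r / 2%:R := le_trans (ler_wpM2l K0 ht) Kt0.
 rewrite -[a](subrK b) [r]splitr; apply: le_trans (ler_normD _ _) _.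
 by apply: lerD; [exact: le_trans h1 e1|exact: le_trans h2 e2].
have [uu uP] : exists uu : C -> V -> C, forall t x, `|t| <= tau0 -> sph x ->
 `|uu t x| <= r /\ step c t x (uu t x) = uu t x.
 exists (fun t x => xget 0 [set v | `|v| <= r /\ step c t x v = v]) => t x ht hx.
 by case: xgetP => [v -> //|h]; have [v hv] := fixp t x ht hx; case: (h v).
have ul t t' x x' : `|t| <= tau0 -> `|t'| <= tau0 -> sph x -> sph x' ->
 `|uu t x - uu t' x'| <= (2%:R * kap) * n1 (x - x') + (2%:R * (kap + K)) * `|t - t'|.
 move=> ht ht' hx hx'; have [b e] := uP t x ht hx; have [b' e'] := uP t' x' ht' hx'.
 have h0 : `|step c t x (uu t x) - step c t' x' (uu t' x')| <=
 kap * (`|t - t'| + n1 (x - x') + `|uu t x - uu t' x'|) + K * `|t - t'| :=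
 L (t, x, uu t x) (t', x', uu t' x') (small _ _ _ ht hx b) (small _ _ _ ht' hx' b') (le_trans ht tr) (le_trans ht' tr) b b'.
 move: h0; rewrite e e'; set Dv := `|uu t x - _|; set Dt := `|t - t'|; set Dx := n1 _ => h.
 have Dv0 : 0 <= Dv by exact: normr_ge0.
 have h2 : kap * Dv <= Dv / 2%:R by rewrite mulrC ler_wpM2l.
 have : Dv - kap * Dv <= kap * Dx + (kap + K) * Dt.
 by rewrite lerBlDr; apply: le_trans h _; rewrite le_eqVlt; apply/orP; left; apply/eqP; ring.
 have h3 : Dv / 2%:R <= Dv - kap * Dv by rewrite lerBrDr -lerBrDl (le_trans h2)// [X in _ <= X - _]splitr addrK.
 move=> /(le_trans h3); rewrite ler_pdivrMr ?ltr0n// => h4; apply: le_trans h4 _.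
 by rewrite le_eqVlt; apply/orP; left; apply/eqP; ring.
apply: inhabits; apply: (@Solution c r tau0 (2%:R * (kap + K)) (2%:R * kap) uu).
- exact: c0.
- exact: tau00.
- by rewrite mulr_ge0// addr_ge0// ltW.
- by rewrite mulr_ge0// ltW.
- exact: ltW.
- by move=> t x ht hx; have [h _] := uP t x ht hx; exact: h.
- by move=> t x ht hx; have [_ h] := uP t x ht hx; exact: h.
- exact: ul.
- by move=> x v hx hv; apply: ann_small => //; exact: le_trans rr1.
- by move=> x v m hx hv m0 m2; apply: act_small => //; [exact: le_trans rr1|exact: ltW].
- move=> t x x' ht hx hx'.
 have hu := ul t t _ _ ht ht (ths _ hx) (ths _ hx'); rewrite subrr normr0 mulr0 addr0 in hu.
 have [b _] := uP t _ ht (ths _ hx).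
 apply: (@le_trans _ _ (\sum_i (r * (Kb i * n1 (x - x')) + (2%:R * kap * (K2 * n1 (x - x'))) * Kb i))).
 apply: ler_sum => i _; have [q0 [q1 q2]] := KbP i.
 have -> : (act (lam x) (uu t (th x) *: dir (th x)) - act (lam x') (uu t (th x') *: dir (th x'))) ord0 i =
 uu t (th x) * (lam x ^+ w4 i * dir (th x) ord0 i) - uu t (th x') * (lam x' ^+ w4 i * dir (th x') ord0 i).
 by rewrite !mxE; congr (_ - _); rewrite mulrCA.
 apply: le_trans (distM _ _ _ _) _; apply: lerD; apply: ler_pM => //; [exact: q2| |exact: q1].
 by apply: le_trans hu _; rewrite ler_wpM2l ?th_lip// mulr_ge0// ltW.
 rewrite big_split -mulr_sumr -mulr_sumr -mulr_suml /= -/K1.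
 rewrite (_ : _ + _ = (r * K1 + 2%:R * (kap * (K1 * K2))) * n1 (x - x')); last by ring.
 rewrite mulrC ler_wpM2l ?n1_ge0//.
 have e1 : r * K1 <= 16%:R^-1.
 apply: (@le_trans _ _ (rho * (1 + K1))); first by apply: ler_pM => //; rewrite ?(ltW r0)// lerDr.
 by rewrite /rho invfM divfK// gt_eqF.
 have e2 : kap * (K1 * K2) <= 16%:R^-1.
 apply: (@le_trans _ _ (kap * ((1 + K1) * (1 + K2)))).
 by rewrite ler_wpM2l ?(ltW kap0)//; apply: ler_pM; rewrite ?lerDr.
 by rewrite /kap invfM divfK// mulf_neq0// gt_eqF.
 apply: le_trans (lerD e1 (ler_wpM2l (ler0n _ 2) e2)) _.
 rewrite (_ : _ + _ = 3%:R / 16%:R); last by field.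
 by rewrite ler_pdivrMr// mulrC ler_pdivlMr ?ltr0n// -natrM ler_nat.
- have lB : BL (dom r1) (@dd R) (fun p => lam (shift p.1.2 p.2) - 1).
 exact: (lam_BL r11 ann_small).
 have cB : BL (dom r1) (@dd R) (fun p => chi c (fE 0 p.1.2)).
 exact: (chi_BL r1 c0).
 have sB : BL (dom r1) (@dd R) (fun p => scale c p.1.2 p.2).
 by apply: (BL_eq (BLD (BLc _ (@dd_ge0 R) 1) (BLM cB lB))) => p _.
 have [M M0 [_ l]] := sB; exists (M * (1 + (2%:R * kap + 2%:R * (kap + K)))).
 by rewrite mulr_ge0// addr_ge0// addr_ge0// mulr_ge0// ?addr_ge0// ltW.
 move=> t t' x x' ht ht' hx hx'; have [b _] := uP t x ht hx; have [b' _] := uP t' x' ht' hx'.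
 apply: le_trans (l _ _ (small _ _ _ ht hx b) (small _ _ _ ht' hx' b')) _.
 rewrite -mulrA ler_wpM2l// /dd /= mulrDl mul1r lerD2l.
 apply: le_trans (ul t t' x x' ht ht' hx hx') _.
 have k0 := ltW kap0.
 by apply: sum_bound; rewrite ?n1_ge0// mulr_ge0// addr_ge0.
Qed.

End Conjugacy.

End Te.
Import Te.

(** * The trivialization *)

Module Tf.
Section Gauge.
Variable R : realType.
Local Notation C := (Cplx R).
Local Notation V := 'rV[C]_4.
Local Notation sph := (@sphere R).
Local Notation ann := (@annulus R).

Lemma lam0 : lam (0 : V) = 0. Proof. by rewrite /lam nu0 invr0. Qed.
Lemma act0r (p : C) : act p (0 : V) = 0.
Proof. by apply/rowP => i; rewrite !mxE mulr0. Qed.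
Lemma fE00 (v : C) : fE v (0 : V) = 0.
Proof. by have := fE_act v 0 (0 : V); rewrite act0l expr0n mul0r. Qed.
Lemma fix_eq (a b c : C) : a - b + c = a -> b = c.
Proof. by move=> h; have -> : c = (a - b + c) - a + b; [ring|rewrite h subrr add0r]. Qed.
Lemma mix_bounds (X l : C) : 0 <= X -> X <= 1 -> 2%:R^-1 <= l -> l <= 2%:R ->
 2%:R^-1 <= 1 + X * (l - 1) /\ 1 + X * (l - 1) <= 2%:R.
Proof.
move=> X0 X1 l1 l2; split; rewrite -subr_ge0.
 rewrite (_ : _ - _ = (1 - X) / 2%:R + X * (l - 2%:R^-1)); last by field.
 by apply: addr_ge0; [rewrite divr_ge0 ?subr_ge0 ?ler0n|rewrite mulr_ge0 ?subr_ge0].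
rewrite (_ : _ - _ = (1 - X) + X * (2%:R - l)); last by ring.
by rewrite addr_ge0// ?mulr_ge0 ?subr_ge0.
Qed.
Lemma cmax_id (c z : C) : z <= c -> cmax c z = c.
Proof. by move=> h; rewrite /cmax distrC ger0_norm ?subr_ge0//; field. Qed.
Lemma half_le (a b : C) : a <= b + a / 2%:R -> a <= 2%:R * b.
Proof.
move=> h; rewrite -subr_ge0 (_ : _ - _ = 2%:R * (b + a / 2%:R - a)); last by field.
by rewrite mulr_ge0// subr_ge0.
Qed.
Lemma sub_fix (y a b : V) : y - a - (y - b) = - (a - b).
Proof. by rewrite [- (y - b)]opprB addrC addrA subrK opprB. Qed.
Lemma diff_fix (X U X' U' y y' : V) : X + U = y -> X' + U' = y' -> X - X' = (y - y') - (U - U').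
Proof.
by move=> <- <-; apply/rowP => i; rewrite !mxE; ring.
Qed.
Lemma coef_cancel (l g n : C) : g != 0 -> n != 0 -> l / g * n^-1 * (n * 1 * g) = l.
Proof. by move=> g0 n0; rewrite mulr1 mulrA divfK// divfK. Qed.
Lemma three_le (a b c : C) : 0 <= a -> 0 <= b -> 0 <= c -> a <= 4%:R^-1 -> b <= 2%:R -> c <= 2%:R -> a * b * c <= 1.
Proof.
move=> a0 b0 c0 h1 h2 h3; have := ler_pM (mulr_ge0 a0 b0) c0 (ler_pM a0 b0 h1 h2) h3.
by rewrite (_ : 4%:R^-1 * 2%:R * 2%:R = 1); last by field.
Qed.
Lemma pow_le (a b : C) n : (0 < n)%N -> 0 <= a -> 0 <= b -> a ^+ n <= b ^+ n -> a <= b.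
Proof. by move=> n0 a0 b0; rewrite ler_pXn2r. Qed.
Lemma pow_anti (m : C) a b : (a <= b)%N -> 0 <= m -> m <= 1 -> m ^+ b <= m ^+ a.
Proof. by move=> ab m0 m1; rewrite -(subnK ab) exprD ler_piMl ?exprn_ge0 ?exprn_ile1. Qed.
Lemma sq_lam (x : V) : x != 0 -> sq x = \sum_i lam x ^+ (w4 i * 2) * `|th x ord0 i| ^+ 2.
Proof. by move=> x0; rewrite -{1}(lam_th x0) sq_act// ltW// lam_gt0. Qed.
Lemma sq_le1 (x : V) : x != 0 -> (sq x <= 1) = (lam x <= 1).
Proof.
move=> x0; have l0 := lam_gt0 x0; have hs : sq (th x) = 1 by exact: th_sph.
have w0 i : (1 <= w4 i * 2)%N by have /andP[h _] := w4_bounds i; lia.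
apply/idP/idP => h.
 rewrite real_leNgt ?real1 ?gtr0_real//; apply/negP => l1.
 have q : lam x * sq (th x) <= sq x.
 rewrite (sq_lam x0) /sq mulr_sumr; apply: ler_sum => i _; rewrite ler_wpM2r ?exprn_ge0//.
 by rewrite -[X in X <= _]expr1 ler_weXn2l// ltW.
 by rewrite hs mulr1 in q; have := lt_le_trans l1 (le_trans q h); rewrite ltxx.
apply: (@le_trans _ _ (sq (th x))); last by rewrite hs.
rewrite (sq_lam x0) /sq; apply: ler_sum => i _.
by apply: ler_piMl; [exact: exprn_ge0|rewrite exprn_ile1 ?(ltW l0)].
Qed.
Lemma lam_le (x : V) (m : C) : x != 0 -> 0 < m -> m <= 1 -> sq x < m ^+ 30 -> lam x <= m.
Proof.
move=> x0 m0 m1 hx; have l0 := lam_gt0 x0; have hs : sq (th x) = 1 by exact: th_sph.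
rewrite real_leNgt ?gtr0_real//; apply/negP => ml.
have q : m ^+ 30 * sq (th x) <= sq x.
 rewrite (sq_lam x0) /sq mulr_sumr; apply: ler_sum => i _; rewrite ler_wpM2r ?exprn_ge0//.
 apply: (@le_trans _ _ (m ^+ (w4 i * 2))).
 by apply: pow_anti => //; [have /andP[_ h] := w4_bounds i; lia|exact: ltW].
 by rewrite lerXn2r ?nnegrE ?(ltW m0) ?(ltW l0) ?(ltW ml).
by rewrite hs mulr1 in q; have := lt_le_trans hx q; rewrite ltxx.
Qed.
Lemma ball_ann (y x : V) : sph y -> n1 (x - y) <= 6%:R^-1 -> ann x.
Proof. by move=> hy hx; have -> : x = y + (x - y); [rewrite addrC subrK|exact: near_sphere]. Qed.

End Gauge.

Section Trivialization.
Variable R : realType.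
Local Notation C := (Cplx R).
Local Notation V := 'rV[C]_4.
Local Notation sph := (@sphere R).
Local Notation ann := (@annulus R).
Variable s : solution R.
Local Notation ta := (tau s).
Implicit Types (t : C) (x y : V).

Definition H0 t x : V := shift x (u s t x).
Definition gs t x : C := scale (sc s) x (u s t x).
(** The homeomorphism is the homogeneous extension of a map on the unit sphere,
 for the action with the weights of the family. *)
Definition hh t x : V := act (lam x / gs t (th x)) (H0 t (th x)).
Definition UU t x : V := act (lam x) (u s t (th x) *: dir (th x)).
(** The point near y which the contraction x |-> y - UU t x fixes. *)
Definition XX t y : V := xget 0 [set x | n1 (x - y) <= 6%:R^-1 /\ x + UU t x = y].
Definition kk t y : V := act (lam y * (lam (XX t (th y)) * gs t (th (XX t (th y))))) (th (XX t (th y))).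

Lemma H0_ann t x : `|t| <= ta -> sph x -> ann (H0 t x).
Proof. by move=> ht hx; rewrite /H0 /shift; apply: near_sphere => //; exact: (sr_ann hx (u_small ht hx)). Qed.
Lemma f_H0 t x : `|t| <= ta -> sph x -> fE t (H0 t x) = fE 0 x * gs t x ^+ 30.
Proof.
move=> ht hx; have E : u s t x - fE t (H0 t x) + fE 0 x * gs t x ^+ 30 = u s t x := u_fix ht hx.
exact: fix_eq E.
Qed.
Lemma gs_bounds t x : `|t| <= ta -> sph x -> 2%:R^-1 <= gs t x /\ gs t x <= 2%:R.
Proof.
move=> ht hx; have [l1 l2] := lam_annulus (H0_ann ht hx).
have [c1 c2] := cmax_ge (sc_gt0 s) (normr_ge0 (fE 0 x)).
have m0 : 0 < cmax (sc s) `|fE 0 x| by exact: lt_le_trans (sc_gt0 s) c1.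
have X0 : 0 <= chi (sc s) (fE 0 x) by rewrite /chi divr_ge0// ltW// sc_gt0.
have X1 : chi (sc s) (fE 0 x) <= 1 by rewrite /chi ler_pdivrMr// mul1r.
exact: (mix_bounds X0 X1 l1 l2).
Qed.
Lemma gs_gt0 t x : `|t| <= ta -> sph x -> 0 < gs t x.
Proof. by move=> ht hx; have [h _] := gs_bounds ht hx; apply: lt_le_trans h; rewrite invr_gt0 ltr0n. Qed.
Lemma H0_neq0 t x : `|t| <= ta -> sph x -> H0 t x != 0.
Proof. by move=> ht hx; exact: annulus_neq0 (H0_ann ht hx). Qed.
Lemma hh0 t : hh t 0 = 0. Proof. by rewrite /hh lam0 mul0r act0l. Qed.
Lemma kk0 t : kk t 0 = 0. Proof. by rewrite /kk lam0 mul0r act0l. Qed.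
Lemma hh_f t x : `|t| <= ta -> fE t (hh t x) = fE 0 x.
Proof.
move=> ht; have [->|x0] := eqVneq x 0; first by rewrite hh0 !fE00.
have hs := th_sph x0; have g0 : gs t (th x) != 0 by rewrite gt_eqF// gs_gt0.
rewrite /hh fE_act (f_H0 ht hs) -[X in _ = fE 0 X](lam_th x0) fE_act expr_div_n.
by rewrite [fE 0 _ * _]mulrC mulrA divfK// expf_neq0.
Qed.
Lemma hh_pos t x : `|t| <= ta -> x != 0 -> 0 < lam x / gs t (th x).
Proof. by move=> ht x0; apply: divr_gt0; [exact: lam_gt0|exact: (gs_gt0 ht (th_sph x0))]. Qed.
Lemma lam_hh t x : `|t| <= ta -> x != 0 -> lam (hh t x) = lam x / gs t (th x) * lam (H0 t (th x)).
Proof. by move=> ht x0; rewrite /hh (lam_act (hh_pos ht x0) (H0_neq0 ht (th_sph x0))). Qed.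
Lemma th_hh t x : `|t| <= ta -> x != 0 -> th (hh t x) = th (H0 t (th x)).
Proof. by move=> ht x0; rewrite /hh (th_act (hh_pos ht x0) (H0_neq0 ht (th_sph x0))). Qed.
Lemma UU_small t x : `|t| <= ta -> ann x -> n1 (UU t x) <= 6%:R^-1.
Proof.
move=> ht hx; have x0 := annulus_neq0 hx; have [_ l2] := lam_annulus hx.
exact: (sr_act (th_sph x0) (u_small ht (th_sph x0)) (lam_gt0 x0) l2).
Qed.
Lemma UU_lip t x x' : `|t| <= ta -> ann x -> ann x' -> n1 (UU t x - UU t x') <= n1 (x - x') / 2%:R.
Proof. by move=> ht hx hx'; exact: (U_lip ht hx hx'). Qed.
Lemma XXP t y : `|t| <= ta -> sph y -> n1 (XX t y - y) <= 6%:R^-1 /\ XX t y + UU t (XX t y) = y.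
Proof.
move=> ht hy; rewrite /XX; case: xgetP => [x -> //|nx].
have [|||x hx xE] := @banach R 4 y 6%:R^-1 (fun x => y - UU t x).
- by rewrite invr_ge0 ler0n.
- move=> x hx /=; have -> : y - UU t x - y = - UU t x by rewrite addrAC subrr add0r.
 by rewrite n1N; apply: UU_small => //; exact: ball_ann hy hx.
- move=> x x' hx hx' /=; rewrite sub_fix n1N.
 exact: (UU_lip ht (ball_ann hy hx) (ball_ann hy hx')).
have {}xE : y - UU t x = x := xE.
by case: (nx x); split=> //; rewrite -{1}xE subrK.
Qed.
Lemma XX_ann t y : `|t| <= ta -> sph y -> ann (XX t y).
Proof. by move=> ht hy; have [b _] := XXP ht hy; exact: ball_ann hy b. Qed.
Lemma XX_lip t y y' : `|t| <= ta -> sph y -> sph y' -> n1 (XX t y - XX t y') <= 2%:R * n1 (y - y').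
Proof.
move=> ht hy hy'; have [_ e] := XXP ht hy; have [_ e'] := XXP ht hy'.
have L := UU_lip ht (XX_ann ht hy) (XX_ann ht hy').
apply: half_le; rewrite {1}(diff_fix e e'); apply: le_trans (n1D _ _) _.
by rewrite n1N lerD2l.
Qed.
Lemma XX_uniq t y x : `|t| <= ta -> sph y -> ann x -> x + UU t x = y -> XX t y = x.
Proof.
move=> ht hy hx e; have [_ e'] := XXP ht hy; have L := UU_lip ht (XX_ann ht hy) hx.
have E := diff_fix e' e; rewrite subrr sub0r in E.
have h : n1 (XX t y - x) <= 2%:R * 0 by apply: half_le; rewrite add0r {1}E n1N.
rewrite mulr0 in h; apply/eqP; rewrite -subr_eq0; apply/eqP/n1_eq0/le_anti.
by rewrite h n1_ge0.
Qed.
Lemma UU_act t x m : sph x -> 0 < m -> act m x + UU t (act m x) = act m (H0 t x).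
Proof.
move=> hx m0; have x0 := sphere_neq0 hx.
by rewrite /UU (lam_act m0 x0) (th_act m0 x0) (th_sphere hx) (lam_sphere hx) mulr1 -actD.
Qed.
Lemma hhK t x : `|t| <= ta -> kk t (hh t x) = x.
Proof.
move=> ht; have [->|x0] := eqVneq x 0; first by rewrite hh0 kk0.
rewrite /kk (th_hh ht x0) (lam_hh ht x0).
move: (th x) (th_sph x0) (lam_th x0) => q hs lx.
have HA := H0_ann ht hs; have Hn := annulus_neq0 HA; have q0 := sphere_neq0 hs.
have [n0 hn] := nuP Hn; have [_ n2] := nu_annulus HA.
have hn' : sph (th (H0 t q)) := hn.
have E : act (nu (H0 t q)) q + UU t (act (nu (H0 t q)) q) = th (H0 t q) := UU_act t hs n0.
have A : ann (act (nu (H0 t q)) q).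
 apply: (ball_ann hn').
 have -> : act (nu (H0 t q)) q - th (H0 t q) = - UU t (act (nu (H0 t q)) q).
 by rewrite -E opprD addrA subrr add0r.
 rewrite n1N /UU (lam_act n0 q0) (th_act n0 q0) (th_sphere hs) (lam_sphere hs) mulr1.
 exact: (sr_act hs (u_small ht hs) n0 n2).
rewrite (XX_uniq ht hn' A E) (lam_act n0 q0) (th_act n0 q0) (th_sphere hs) (lam_sphere hs).
rewrite -[RHS]lx; congr (act _ q).
have g0 : gs t q != 0 by rewrite gt_eqF// gs_gt0.
have m0 : nu (H0 t q) != 0 by rewrite gt_eqF.
exact: (coef_cancel (lam x) g0 m0).
Qed.
Lemma kkK t y : `|t| <= ta -> hh t (kk t y) = y.
Proof.
move=> ht; have [->|y0] := eqVneq y 0; first by rewrite kk0 hh0.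
have hy := th_sph y0; have [b e] := XXP ht hy; rewrite /kk.
move: (XX t (th y)) b e => x b e.
have xA := ball_ann hy b; have x0 := annulus_neq0 xA; have hs := th_sph x0; have q0 := sphere_neq0 hs.
have g0 := gs_gt0 ht hs.
have p0 : 0 < lam y * (lam x * gs t (th x)).
 by apply: mulr_gt0; [exact: lam_gt0|apply: mulr_gt0; [exact: lam_gt0|]].
rewrite /hh (lam_act p0 q0) (th_act p0 q0) (th_sphere hs) (lam_sphere hs).
have -> : lam y * (lam x * gs t (th x)) * 1 / gs t (th x) = lam y * lam x.
 by rewrite mulr1 mulrA mulfK// gt_eqF.
by rewrite -act_act -(UU_act t hs (lam_gt0 x0)) (lam_th x0) e (lam_th y0).
Qed.
Lemma tube_hh t x : `|t| <= ta -> `|fE 0 x| <= sc s * 4%:R^-1 ^+ 30 -> (sq x <= 1) = (sq (hh t x) <= 1).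
Proof.
move=> ht; have [->|x0] := eqVneq x 0; first by rewrite hh0.
have hs := th_sph x0; have l0 := lam_gt0 x0; have g0 := gs_gt0 ht hs.
have hn : hh t x != 0 by apply: contra_neq x0 => h; rewrite -(hhK x ht) h kk0.
have c0 := sc_gt0 s; have cn : sc s != 0 by rewrite gt_eqF.
rewrite (sq_le1 x0) (sq_le1 hn) (lam_hh ht x0) -{1}(lam_th x0) fE_act normrM normrX (gtr0_norm l0) => hf.
have L0 := lam_gt0 (H0_neq0 ht hs).
have [hc|hc] := real_leP (normr_real (fE 0 (th x))) (gtr0_real c0).
 have m1 : cmax (sc s) `|fE 0 (th x)| = sc s.
 exact: cmax_id.
 have -> : gs t (th x) = lam (H0 t (th x)).
 by rewrite /gs /scale /chi m1 divff// mul1r addrC subrK.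
 by rewrite divfK// gt_eqF.
have i4 : 0 <= 4%:R^-1 :> C by rewrite invr_ge0 ler0n.
have l4 : lam x <= 4%:R^-1.
 apply: (@pow_le _ _ _ 30) => //; first exact: ltW.
 rewrite -(ler_pM2l c0) [X in X <= _]mulrC; apply: le_trans hf.
 by rewrite ler_wpM2l ?exprn_ge0 ?(ltW l0) ?(ltW hc).
have [l1 l2] := lam_annulus (H0_ann ht hs); have [g1 g2] := gs_bounds ht hs.
have q1 : 4%:R^-1 <= 1 :> C by rewrite invf_le1 ?ler1n ?ltr0n.
have g3 : (gs t (th x))^-1 <= 2%:R by rewrite -[2%:R]invrK lef_pV2 ?posrE ?invr_gt0 ?ltr0n.
have gi : 0 <= (gs t (th x))^-1 by rewrite invr_ge0 ltW.
by rewrite (le_trans l4 q1) (three_le (ltW l0) gi (ltW L0) l4 g3 l2).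
Qed.

End Trivialization.

End Tf.
Import Tf.

(** * Continuity of homogeneous maps *)

Module Tg.
Section Continuity.
Variable R : realType.
Local Notation C := (Cplx R).
Local Notation V := 'rV[C]_4.
Local Notation sph := (@sphere R).
Local Notation ann := (@annulus R).
Local Notation dn := (fun x y : V => n1 (x - y)).

Lemma below2 (a b : C) : 0 < a -> 0 < b -> exists2 d, 0 < d & d <= a /\ d <= b.
Proof.
move=> a0 b0; have ab : 0 < a + b by rewrite addr_gt0.
exists (a * b / (a + b)); first by rewrite divr_gt0// mulr_gt0.
split; rewrite ler_pdivrMr//; first by rewrite ler_wpM2l ?(ltW a0)// lerDr ltW.
by rewrite mulrC ler_wpM2l ?(ltW b0)// lerDl ltW.
Qed.
Lemma small_num (e : C) : 0 < e -> exists2 m, 0 < m & 4%:R * m <= 1 /\ 32%:R * m < e.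
Proof.
move=> e0; have [||m m0 [h1 h2]] := @below2 (1 / 4%:R) (e / 64%:R).
- by rewrite divr_gt0// ltr0n.
- by rewrite divr_gt0// ltr0n.
exists m => //; split; first by rewrite mulrC -ler_pdivlMr ?ltr0n.
apply: (@lt_le_trans _ _ (64%:R * m)); first by rewrite ltr_pM2r// ltr_nat.
by rewrite mulrC -ler_pdivlMr ?ltr0n.
Qed.
Lemma pow_self (x : C) n : (0 < n)%N -> 0 <= x -> x <= 1 -> x ^+ n <= x.
Proof. by case: n => // n _ x0 x1; rewrite exprS ler_piMr// exprn_ile1. Qed.
Lemma n1_0 : n1 (0 : V) = 0.
Proof. by rewrite /n1 big1// => i _; rewrite mxE normr0. Qed.
Lemma sq_n1 (x : V) : n1 x <= 1 -> sq x <= n1 x.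
Proof.
move=> h; apply: ler_sum => i _; apply: pow_self => //.
exact: le_trans (n1_coord x i) h.
Qed.
Lemma lip_bound (K L a b c : C) : 0 <= K -> 0 <= L -> 0 <= a -> 0 <= b -> c <= L * b ->
 K * (a + c) <= (2%:R + K * (1 + L)) * (a + b).
Proof.
move=> K0 L0 a0 b0 h; apply: (@le_trans _ _ (K * (a + L * b))); first by rewrite ler_wpM2l// lerD2l.
rewrite -subr_ge0 (_ : _ - _ = 2%:R * (a + b) + (K * b + K * L * a)); last by ring.
by rewrite !addr_ge0 ?mulr_ge0 ?addr_ge0.
Qed.
Lemma lip_bound2 (r k K L a b c : C) : 0 <= r -> 0 <= k -> 0 <= K -> 0 <= L -> 0 <= a -> 0 <= b -> c <= L * b ->
 k * c + K * a <= (r + k * L + K) * (a + b).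
Proof.
move=> r0 k0 K0 L0 a0 b0 h; apply: (@le_trans _ _ (k * (L * b) + K * a)); first by rewrite lerD2r ler_wpM2l.
rewrite -subr_ge0 (_ : _ - _ = r * (a + b) + (k * L * a + K * b)); last by ring.
by rewrite !addr_ge0 ?mulr_ge0 ?addr_ge0.
Qed.
Lemma le_sixth (M d : C) : 0 <= M -> 0 <= d -> d <= 1 / (6%:R * (M + 1)) -> M * d <= 6%:R^-1.
Proof.
move=> M0 d0; have M1 : 0 < M + 1 by rewrite ltr_wpDl.
rewrite ler_pdivlMr ?mulr_gt0 ?ltr0n// => h.
rewrite -[6%:R^-1]mul1r ler_pdivlMr ?ltr0n//; apply: le_trans h.
by rewrite -subr_ge0 (_ : _ - _ = 6%:R * d); [rewrite mulr_ge0|ring].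
Qed.
Lemma cont_joint (f : C * V -> V) (p : C * V) :
 (forall e, 0 < e -> exists2 d, 0 < d & forall t x, `|p.1 - t| < d -> n1 (p.2 - x) < d -> n1 (f p - f (t, x)) < e) ->
 {for p, continuous f}.
Proof.
move=> H; apply/cvg_ballP => e e0; have [d d0 hd] := H e e0.
have d5 : 0 < d / 5%:R by rewrite divr_gt0// ltr0n.
exists (ball p.1 (d / 5%:R), ball p.2 (d / 5%:R)); first by split; exact: nbhsx_ballx.
move=> [t x] [/= q1 [_ q2]]; split=> // i j.
have p1 : `|p.1 - t| < d / 5%:R by move: q1; rewrite -ball_normE.
have p2 k : `|p.2 ord0 k - x ord0 k| < d / 5%:R by have := q2 ord0 k; rewrite -ball_normE.
have dd : d / 5%:R <= d by rewrite ler_pdivrMr ?ltr0n// ler_peMr ?ler1n// ltW.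
have h : n1 (f p - f (t, x)) < e.
 apply: hd; first exact: lt_le_trans dd.
 apply: (@le_lt_trans _ _ (\sum_(k < 4) d / 5%:R)).
 by apply: ler_sum => k _; rewrite !mxE; apply: ltW.
 by rewrite sumr_const card_ord -[_ *+ 4]mulr_natr -subr_gt0 (_ : _ - _ = d / 5%:R)//; field.
rewrite -ball_normE /= (ord1 i); apply: le_lt_trans h.
by have := n1_coord (f p - f (t, x)) j; rewrite !mxE.
Qed.
Lemma cont_pt (f : V -> V) (y : V) :
 (forall e, 0 < e -> exists2 d, 0 < d & forall x, n1 (y - x) < d -> n1 (f y - f x) < e) ->
 {for y, continuous f}.
Proof.
move=> H; have h : {for ((0 : C), y), continuous (fun p : C * V => f p.2)}.
 apply: cont_joint => e e0; have [d d0 hd] := H e e0; exists d => // t x _; exact: hd.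
have g : {for y, continuous (fun x : V => ((0 : C), x))}.
 move=> A [[B1 B2] /= [h1 h2] hB]; apply: filterS h2 => x Bx; apply: hB; split=> //=.
 exact: (@nbhs_singleton C 0 B1 h1).
by move=> A hA; exact: (g _ (h _ hA)).
Qed.

Variable s : solution R.
Local Notation ta := (tau s).
Local Notation H0 := (@H0 R s).
Local Notation gs := (@gs R s).
Local Notation hh := (@hh R s).
Local Notation XX := (@XX R s).
Local Notation kk := (@kk R s).

Definition dQ (p q : C * V) : C := `|p.1 - q.1| + n1 (p.2 - q.2).
Definition DQ (p : C * V) := `|p.1| <= ta /\ ann p.2.

Lemma dQ_ge0 (p q : C * V) : 0 <= dQ p q. Proof. by rewrite /dQ addr_ge0// n1_ge0. Qed.

(** A homogeneous map which is Lipschitz on the annulus is continuous, the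
 origin included, because all the weights are positive. *)
Lemma cone (F : C -> V -> V) (t : C) (x : V) : (forall t', F t' 0 = 0) ->
 (forall t' m x, `|t'| <= ta -> 0 < m -> x != 0 -> F t' (act m x) = act m (F t' x)) ->
 (forall t' x i, `|t'| <= ta -> x != 0 -> `|F t' x ord0 i| <= (4%:R * lam x) ^+ w4 i * 2%:R) ->
 (forall i, BL DQ dQ (fun p => F p.1 p.2 ord0 i)) -> `|t| < ta ->
 forall e, 0 < e -> exists2 d, 0 < d &
 forall t' x', `|t - t'| < d -> n1 (x - x') < d -> n1 (F t x - F t' x') < e.
Proof.
move=> F0 Fh Fb FL tt e e0; have st : 0 < ta - `|t| by rewrite subr_gt0.
have ts d t' : d <= ta - `|t| -> `|t - t'| < d -> `|t'| <= ta.
 move=> hd h; have -> : t' = t - (t - t') by rewrite opprB addrC subrK.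
 apply: le_trans (ler_normB _ _) _; rewrite addrC -lerBrDr; exact: le_trans (ltW h) hd.
have [->|x0] := eqVneq x 0.
 have [m m0 [m4 m32]] := small_num e0.
 have m1 : m <= 1 by apply: le_trans m4; rewrite ler_peMl ?ler1n// ltW.
 have [d d0 [d1 d2]] := below2 st (exprn_gt0 30 m0).
 exists d => // t' x' ht' hx'; have T := ts _ _ d1 ht'.
 rewrite F0 sub0r n1N; rewrite sub0r n1N in hx'.
 have [->|x'0] := eqVneq x' 0; first by rewrite F0 n1_0.
 have hm : n1 x' < m ^+ 30 by exact: lt_le_trans d2.
 have h1 : n1 x' <= 1 by apply: le_trans (ltW hm) _; rewrite exprn_ile1 ?(ltW m0).
 have lm : lam x' <= m by apply: lam_le => //; exact: le_lt_trans (sq_n1 h1) hm.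
 apply: le_lt_trans m32; apply: (@le_trans _ _ (\sum_(i < 4) 8%:R * m)).
 apply: ler_sum => i _; apply: le_trans (Fb _ _ i T x'0) _.
 have l0 := lam_gt0 x'0; have h4 : 4%:R * lam x' <= 4%:R * m by rewrite ler_wpM2l.
 rewrite (_ : 8%:R * m = 4%:R * m * 2%:R); last by ring.
 have h5 : (4%:R * lam x') ^+ w4 i <= 4%:R * lam x'.
 apply: pow_self; first by have /andP[h _] := w4_bounds i; exact: leq_trans h.
 by rewrite mulr_ge0// ltW.
 exact: le_trans h4 m4.
 by rewrite ler_wpM2r// (le_trans h5 h4).
 by rewrite sumr_const card_ord -[_ *+ 4]mulr_natr le_eqVlt; apply/orP; left; apply/eqP; ring.
have [n0 hn] := nuP x0; have l0 := lam_gt0 x0; have nn : nu x != 0 by rewrite gt_eqF.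
have [M M0 actM] : exists2 M : C, 0 <= M & forall v : V, n1 (act (nu x) v) <= M * n1 v.
 exists (\sum_i nu x ^+ w4 i); first by apply: sumr_ge0 => i _; rewrite exprn_ge0 ?(ltW n0).
 move=> v; rewrite {1}/n1 mulr_suml; apply: ler_sum => i _.
 by rewrite mxE normrM normrX (gtr0_norm n0) ler_wpM2l ?exprn_ge0 ?(ltW n0)// n1_coord.
have HK (i : 'I_4) : exists K : C, 0 <= K /\ forall p q, DQ p -> DQ q ->
 `|F p.1 p.2 ord0 i - F q.1 q.2 ord0 i| <= K * dQ p q.
 by have [K K0 [_ l]] := FL i; exists K.
have [K KP] := choice HK.
have [A A0 AE] : exists2 A : C, 0 <= A & forall z, A * z = \sum_i lam x ^+ w4 i * K i * z.
 exists (\sum_i lam x ^+ w4 i * K i) => [|z]; last by rewrite mulr_suml.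
 by apply: sumr_ge0 => i _; rewrite mulr_ge0 ?exprn_ge0 ?(ltW l0)//; case: (KP i).
have A1 : 0 < (A + 1) * (1 + M) by apply: mulr_gt0; [exact: ltr_wpDl A0 ltr01|exact: ltr_wpDr M0 ltr01].
have M1 : 0 < M + 1 by exact: ltr_wpDl M0 ltr01.
have B1 : 0 < 1 / (6%:R * (M + 1)) by rewrite divr_gt0// mulr_gt0 ?ltr0n.
have [d2 d20 [d2a d2b]] := below2 st B1.
have [d d0 [da db]] := below2 d20 (divr_gt0 e0 A1).
exists d => // t' x' ht' hx'; have T := ts _ _ (le_trans da d2a) ht'.
have xE y : act (lam x) (act (nu x) y) = y by rewrite act_act /lam mulVf// act1.
have Fx z y : `|z| <= ta -> F z y = act (lam x) (F z (act (nu x) y)).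
 move=> hz; have [->|y0] := eqVneq y 0; first by rewrite act0r !F0 act0r.
 by rewrite -(Fh _ _ _ hz l0 (act_neq0 nn y0)) xE.
have q1 : ann (act (nu x) x) := sphere_annulus hn.
have Md : M * d <= 6%:R^-1 by apply: le_sixth => //; [exact: ltW|exact: le_trans da d2b].
have q2 : ann (act (nu x) x').
 have -> : act (nu x) x' = act (nu x) x + act (nu x) (x' - x) by rewrite -actD addrC subrK.
 apply: near_sphere => //; apply: le_trans (actM _) _; apply: le_trans Md; rewrite ler_wpM2l//.
 by rewrite -n1N opprB ltW.
rewrite (Fx t x (ltW tt)) (Fx t' x' T); apply: (@le_lt_trans _ _ (A * ((1 + M) * d))).
 rewrite AE; apply: ler_sum => i _; have [K0 kl] := KP i.
 have -> : (act (lam x) (F t (act (nu x) x)) - act (lam x) (F t' (act (nu x) x'))) ord0 i =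
 lam x ^+ w4 i * (F t (act (nu x) x) ord0 i - F t' (act (nu x) x') ord0 i) by rewrite !mxE mulrBr.
 rewrite normrM normrX (gtr0_norm l0) -mulrA ler_wpM2l ?exprn_ge0 ?(ltW l0)//.
 apply: le_trans (kl (t, act (nu x) x) (t', act (nu x) x') (conj (ltW tt) q1) (conj T q2)) _.
 rewrite ler_wpM2l// /dQ /= mulrDl mul1r lerD ?(ltW ht')//.
 have -> : act (nu x) x - act (nu x) x' = act (nu x) (x - x') by apply/rowP => j; rewrite !mxE mulrBr.
 by apply: le_trans (actM _) _; rewrite ler_wpM2l// ltW.
rewrite ler_pdivlMr// in db; apply: lt_le_trans db.
rewrite -subr_gt0 (_ : _ - _ = (1 + M) * d); last by ring.
by apply: mulr_gt0 => //; exact: ltr_wpDr M0 ltr01.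
Qed.
Lemma BL_ann F : BL ann dn F -> BL DQ dQ (fun p => F p.2).
Proof.
move=> h; have hD q : DQ q -> ann q.2 by case.
have hL (p q : C * V) : DQ p -> DQ q -> n1 (p.2 - q.2) <= 1 * dQ p q by move=> _ _; rewrite mul1r /dQ lerDr.
exact: (@BL_comp C V (C * V)%type ann DQ dn dQ (fun p => p.2) 1 F ler01 hD dQ_ge0 hL h).
Qed.
Lemma BL_sph F : BL sph dn F -> BL ann dn (fun x => F (th x)).
Proof.
move=> h; have [L L0 tl] := th_lipschitz R.
have ths (x : V) : ann x -> sph (th x) by move=> hx; exact: th_sph (annulus_neq0 hx).
have n0 (x y : V) : 0 <= dn x y by exact: n1_ge0.
exact: (@BL_comp C V V sph ann dn dn (@th R) L F L0 ths n0 tl h).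
Qed.
Lemma BL_gs : BL DQ dQ (fun p => gs p.1 (th p.2)).
Proof.
have [K K0 l] := scale_BL s; have [L L0 tl] := th_lipschitz R.
have W0 : 0 <= K * (1 + L) by rewrite mulr_ge0// addr_ge0.
exists (2%:R + K * (1 + L)); first by rewrite addr_ge0.
split=> [p [pt pa]|p q [pt pa] [qt qa]]; have hs := th_sph (annulus_neq0 pa).
 have [a b] := gs_bounds pt hs; rewrite gtr0_norm ?(gs_gt0 pt hs)//.
 by apply: le_trans b _; rewrite lerDl.
have hs' := th_sph (annulus_neq0 qa).
apply: le_trans (l _ _ _ _ pt qt hs hs') _.
by apply: lip_bound => //; [exact: n1_ge0|exact: tl].
Qed.
Lemma BL_uth : BL DQ dQ (fun p => u s p.1 (th p.2)).
Proof.
have [L L0 tl] := th_lipschitz R.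
have W0 : 0 <= sk s * L by rewrite mulr_ge0// sk_ge0.
exists (sr s + sk s * L + sK s); first by rewrite !addr_ge0 ?sr_ge0 ?sK_ge0.
split=> [p [pt pa]|p q [pt pa] [qt qa]]; have hs := th_sph (annulus_neq0 pa).
 by apply: le_trans (u_small pt hs) _; rewrite -addrA lerDl addr_ge0 ?sK_ge0.
have hs' := th_sph (annulus_neq0 qa).
apply: le_trans (u_lip pt qt hs hs') _.
by apply: lip_bound2; rewrite ?sr_ge0 ?sk_ge0 ?sK_ge0 ?n1_ge0//; exact: tl.
Qed.
Lemma BL_H0 i : BL DQ dQ (fun p => H0 p.1 (th p.2) ord0 i).
Proof.
apply: (BL_eq (BLD (BL_ann (@BL_th R i)) (BLM BL_uth (BL_ann (BL_sph (@BL_dir R i)))))) => p _ /=.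
by rewrite /Tf.H0 /shift [RHS]mxE; congr (_ + _); rewrite [RHS]mxE.
Qed.
Lemma BL_hh i : BL DQ dQ (fun p => hh p.1 p.2 ord0 i).
Proof.
have h2 : 0 < 2%:R^-1 :> C by rewrite invr_gt0 ltr0n.
have hm (p : C * V) : DQ p -> 2%:R^-1 <= `|gs p.1 (th p.2)|.
 move=> [pt pa]; have hs := th_sph (annulus_neq0 pa); have [a _] := gs_bounds pt hs.
 by rewrite gtr0_norm ?(gs_gt0 pt hs).
have gi := BLV dQ_ge0 h2 hm BL_gs.
apply: (BL_eq (BLM (BLX dQ_ge0 (w4 i) (BLM (BL_ann (@BL_lam R)) gi)) (BL_H0 i))) => p _ /=.
by rewrite /Tf.hh [RHS]mxE.
Qed.
Lemma hh_bound t x i : `|t| <= ta -> x != 0 -> `|hh t x ord0 i| <= (4%:R * lam x) ^+ w4 i * 2%:R.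
Proof.
move=> ht x0; have hs := th_sph x0; have l0 := lam_gt0 x0; have [g1 g2] := gs_bounds ht hs.
have g0 := gs_gt0 ht hs; rewrite /Tf.hh mxE normrM; apply: ler_pM => //; last exact: annulus_coord (H0_ann ht hs).
have p1 : 0 <= 4%:R * lam x by rewrite mulr_ge0 ?ltW.
have p2 := hh_pos ht x0; have p3 := ltW p2.
have le4 : lam x / gs t (th x) <= 4%:R * lam x.
 rewrite mulrC ler_wpM2r ?(ltW l0)//; apply: (@le_trans _ _ 2%:R); last by rewrite ler_nat.
 by rewrite -[2%:R]invrK lef_pV2 ?posrE ?invr_gt0 ?ltr0n.
by rewrite normrX (gtr0_norm p2) lerXn2r ?nnegrE.
Qed.
Lemma hh_act t m x : 0 < m -> x != 0 -> hh t (act m x) = act m (hh t x).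
Proof. by move=> m0 x0; rewrite /Tf.hh (lam_act m0 x0) (th_act m0 x0) act_act mulrA. Qed.
Lemma hh_cont t x : `|t| < ta -> {for (t, x), continuous (fun p : C * V => hh p.1 p.2)}.
Proof.
move=> tt; apply: cont_joint; apply: (cone x _ _ _ BL_hh tt).
- exact: hh0.
- by move=> t' m y _; exact: hh_act.
- exact: hh_bound.
Qed.
Lemma hh_cont_pt t x : `|t| < ta -> {for x, continuous (hh t)}.
Proof.
move=> tt; apply: cont_pt => e e0.
have [|||d d0 hd] := @cone hh t x _ _ _ BL_hh tt e e0.
- exact: hh0.
- by move=> t' m y _; exact: hh_act.
- exact: hh_bound.
by exists d => // y; apply: (hd t); rewrite subrr normr0.
Qed.

Section Inverse.
Variable t : C.

Lemma BL_XX F : `|t| <= ta -> BL DQ dQ F -> BL DQ dQ (fun q => F (t, XX t (th q.2))).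
Proof.
move=> ht h; have [L L0 tl] := th_lipschitz R.
have L2 : 0 <= 2%:R * L by rewrite mulr_ge0.
have hD (q : C * V) : DQ q -> DQ (t, XX t (th q.2)).
 by move=> [_ qa]; split=> //=; exact: XX_ann ht (th_sph (annulus_neq0 qa)).
have hL (p q : C * V) : DQ p -> DQ q -> dQ (t, XX t (th p.2)) (t, XX t (th q.2)) <= 2%:R * L * dQ p q.
 move=> [_ pa] [_ qa]; rewrite {1}/dQ /= subrr normr0 add0r -mulrA.
 apply: le_trans (XX_lip ht (th_sph (annulus_neq0 pa)) (th_sph (annulus_neq0 qa))) _.
 rewrite ler_wpM2l//; apply: le_trans (tl _ _ pa qa) _; rewrite ler_wpM2l// /dQ lerDr//.
exact: (@BL_comp C (C * V)%type (C * V)%type DQ DQ dQ dQ (fun q => (t, XX t (th q.2))) _ F L2 hD dQ_ge0 hL h).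
Qed.
Lemma BL_kk i : `|t| <= ta -> BL DQ dQ (fun q => kk t q.2 ord0 i).
Proof.
move=> ht.
apply: (BL_eq (BLM (BLX dQ_ge0 (w4 i) (BLM (BL_ann (@BL_lam R)) (BLM (BL_XX ht (BL_ann (@BL_lam R))) (BL_XX ht BL_gs))))
 (BL_XX ht (BL_ann (@BL_th R i))))) => q _ /=.
by rewrite /Tf.kk [RHS]mxE.
Qed.
Lemma kk_bound y i : `|t| <= ta -> y != 0 -> `|kk t y ord0 i| <= (4%:R * lam y) ^+ w4 i * 2%:R.
Proof.
move=> ht y0; have hy := th_sph y0; have XA := XX_ann ht hy; have X0 := annulus_neq0 XA.
have hs := th_sph X0; have [g1 g2] := gs_bounds ht hs; have g0 := gs_gt0 ht hs.
have [l1 l2] := lam_annulus XA; have l0 := lam_gt0 X0; have ly := lam_gt0 y0.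
have p0 : 0 <= lam y * (lam (XX t (th y)) * gs t (th (XX t (th y)))) by rewrite !mulr_ge0// ltW.
rewrite /Tf.kk mxE normrM; apply: ler_pM => //; last exact: annulus_coord (sphere_annulus hs).
have p1 : 0 <= 4%:R * lam y by rewrite mulr_ge0 ?ltW.
have le4 : lam y * (lam (XX t (th y)) * gs t (th (XX t (th y)))) <= 4%:R * lam y.
 rewrite mulrC ler_wpM2r ?(ltW ly)// (_ : 4%:R = 2%:R * 2%:R); last by rewrite -natrM.
 by apply: ler_pM => //; exact: ltW.
by rewrite normrX (ger0_norm p0) lerXn2r ?nnegrE.
Qed.
Lemma kk_act m y : 0 < m -> y != 0 -> kk t (act m y) = act m (kk t y).
Proof. by move=> m0 y0; rewrite /Tf.kk (lam_act m0 y0) (th_act m0 y0) act_act -[m * lam y * _]mulrA. Qed.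
Lemma kk_cont y : `|t| < ta -> {for y, continuous (kk t)}.
Proof.
move=> tt; have ht := ltW tt; apply: cont_pt => e e0.
have [|||d d0 hd] := @cone (fun _ => kk t) t y _ _ _ (fun i => BL_kk i ht) tt e e0.
- by move=> _; exact: kk0.
- by move=> _ m x _; exact: kk_act.
- by move=> _ x i _; exact: kk_bound.
by exists d => // x; apply: (hd t); rewrite subrr normr0.
Qed.

End Inverse.
End Continuity.

End Tg.
Import Tg.

(** * The family is topologically trivial *)

Module Th.
Lemma f_family_square_trivial (R : realType) :
 top_right_trivial (fun (t : Cplx R) (x : 'rV[Cplx R]_4) => meval (fun i => x ord0 i) (f_family t ^+ 2)).
Proof.
have [s] := solution_exists R.
have gE (t : Cplx R) (x : 'rV[Cplx R]_4) : meval (fun i => x ord0 i) (f_family t ^+ 2) = fE t x ^+ 2.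
 by rewrite expr2 mevalM fE_meval -expr2.
have [b [b0 bE]] : exists b : Cplx R, 0 < b /\ b = sc s * 4%:R^-1 ^+ 30.
 by exists (sc s * 4%:R^-1 ^+ 30); split=> //; apply: mulr_gt0; [exact: sc_gt0|apply: exprn_gt0; rewrite invr_gt0 ltr0n].
have tubeE (t : Cplx R) (x : 'rV[Cplx R]_4) :
 tube (fun x : 'rV[Cplx R]_4 => meval (fun i => x ord0 i) (f_family t ^+ 2)) 1 (b ^+ 2) x <->
 sq x <= 1 /\ `|fE t x| <= b.
 have e1 : (`|meval (fun i => x ord0 i) (f_family t ^+ 2)| <= b ^+ 2) = (`|fE t x| <= b).
 by rewrite gE normrX ler_pXn2r ?nnegrE ?(ltW b0).
 have e2 : (\sum_i `|x ord0 i| ^+ 2 <= (1 : Cplx R) ^+ 2) = (sq x <= 1) by rewrite expr1n.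
 split=> [[h1 h2]|[h1 h2]].
 by split; [rewrite -e2; exact: h1|rewrite -e1; exact: h2].
 by move: h1 h2; rewrite -e1 -e2 => h1 h2; exact: (conj h1 h2).
exists (tau s), 1, (b ^+ 2); split; [exact: tau_gt0|exact: ltr01|exact: exprn_gt0|].
exists (fun t x => hh s t x); split.
 by apply: continuous_in_subspaceT => -[t x] /set_mem [tt _]; exact: (@hh_cont R s t x tt).
move=> t tt; have ht := ltW tt; split; last first.
 move=> x _; have E := hh_f x ht.
 exact: (etrans (gE t (hh s t x)) (etrans (congr1 (fun z => z ^+ 2) E) (esym (gE 0 x)))).
have in_hh (x : 'rV[Cplx R]_4) : sq x <= 1 -> `|fE 0 x| <= b -> sq (hh s t x) <= 1 /\ `|fE t (hh s t x)| <= b.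
 move=> h1 h2; have h3 : `|fE 0 x| <= sc s * 4%:R^-1 ^+ 30 by rewrite -bE.
 by split; [rewrite -(tube_hh ht h3)|rewrite (hh_f x ht)].
have in_kk (y : 'rV[Cplx R]_4) : sq y <= 1 -> `|fE t y| <= b -> sq (kk s t y) <= 1 /\ `|fE 0 (kk s t y)| <= b.
 move=> h1 h2; have h3 : `|fE 0 (kk s t y)| <= b by rewrite -(hh_f _ ht) (kkK y ht).
 have h4 : `|fE 0 (kk s t y)| <= sc s * 4%:R^-1 ^+ 30 by rewrite -bE.
 by split; [rewrite (tube_hh ht h4) (kkK y ht)|].
split.
- split.
 + move=> x hx; have [h1 h2] := (tubeE 0 x).1 hx; exact: ((tubeE t _).2 (in_hh x h1 h2)).
 + move=> x y _ _ E; have E' : hh s t x = hh s t y := E.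
 by have := congr1 (kk s t) E'; rewrite (hhK x ht) (hhK y ht).
 + move=> y hy; have [h1 h2] := (tubeE t y).1 hy; exists (kk s t y); last exact: (kkK y ht).
 exact: ((tubeE 0 _).2 (in_kk y h1 h2)).
- by apply: continuous_in_subspaceT => x _; exact: (@hh_cont_pt R s t x tt).
- exists (kk s t); last by move=> x _; exact: (hhK x ht).
 by apply: continuous_in_subspaceT => y _; exact: (@kk_cont R s t y tt).
Qed.

End Th.
Import Th.

Unset Implicit Arguments.
Set Strict Implicit.
Set Printing Implicit Defensive.

Theorem mainTheorem5 (R : realType) :
 let C := Cplx R in
 let f : C -> {mpoly C[4]} := fun t => f_family t in
 top_right_trivial (fun (t : C) (x : 'rV[C]_4) =>
 meval (fun i => x ord0 i) (f t ^+ 2)) /\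
 ~ (exists2 tau : C, 0 < tau &
 forall (t : C) (k : 'I_4), `|t| < tau ->
 Le_number (germ_of_mpoly (f t ^+ 2)) k =
 Le_number (germ_of_mpoly (f 0 ^+ 2)) k).
Proof.
by move=> C f; split; [exact: f_family_square_trivial|exact: (@Le_numbers_vary C)].
Qed.
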